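(* Let $f\in L^2(\mathbb{R},d\mu)$, where $d\mu(x)=(2\pi)^{-1/2}e^{-x^2/2}\,dx$, let $\eta$ be a standard normal random variable, and let $k_0=\inf\{k\ge1: E(H_k(\eta)f(\eta))\ne0\}$ be the Hermite rank of $f$, assumed finite. Let $G=\{G(x),x\in\mathbb{R}_+\}$, $G(0)=0$, be a mean zero Gaussian process with stationary increments, with increments variance $\sigma^2$, satisfying: (i) $\sigma^2(h)$ is regularly varying at zero of index $\beta$ for some $1\le\beta\le 2$; (ii) $\lim_{h\to0}h^2/\sigma^2(h)=0$ and $\lim_{h\to0}\sigma^2(h)/h=0$; (iii) there is a constant $C$ such that $\frac{|\sigma^2(s+h)+\sigma^2(s-h)-2\sigma^2(s)|}{h^2}\le C\frac{\sigma^2(s)}{s^2}$ for all $s>0$ and $0<h\le s/8$; (iv) $\sigma^2(s)$ has a second derivative at each $s\ne0$. Assume that $\left(\frac{d^2}{ds^2}\sigma^2(s)\right)^{k_0}$ is locally integrable and that $h=o\left(\left(h^2/\sigma^2(h)\right)^{k_0}\right)$ as $h\downarrow0$. Then for all $0\le a\le b<\infty$, $$\lim_{h\downarrow0}\frac{\int_a^bf\left(\frac{G(x+h)-G(x)}{\sigma(h)}\right)dx-(b-a)Ef(\eta)}{(h/\sigma(h))^{k_0}}=\frac{E(H_{k_0}(\eta)f(\eta))}{\sqrt{k_0!}}\,:(G')^{k_0}:(I_{[a,b]})$$ in $L^2$.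
   Context: The increments variance $\sigma^2$ is defined by $E(G(x)-G(y))^2=\sigma^2(x-y)=\sigma^2(|x-y|)$; it is regarded as an even function on $\mathbb{R}$, $\sigma^2\not\equiv0$, and $\sigma=\sqrt{\sigma^2}$. Regularly varying at zero of index $\beta$ means $\sigma^2(\lambda h)/\sigma^2(h)\to\lambda^\beta$ as $h\downarrow0$ for every $\lambda>0$. The condition $\sigma^2(h)/h\to0$ implies that $G$ has a version with continuous sample paths; this version is used. Set $\rho(s)=\frac12\frac{d^2}{ds^2}\sigma^2(s)$, $s\ne0$. $\{H_k\}_{k\ge0}$ are the Hermite polynomials normalized to be orthonormal in $L^2(\mathbb{R},d\mu)$ (with positive leading coefficient). For a mean zero Gaussian random variable $X$ with variance $\sigma_X^2$, the $k$-th Wick power is $:X^k:=\sum_{j=0}^{[k/2]}(-1)^j\binom{k}{2j}E(X^{2j})X^{k-2j}=\sqrt{k!}\,\sigma_X^kH_k(X/\sigma_X)$. $\mathcal{B}_0(\mathbb{R}_+)$ is the set of bounded Lebesgue measurable functions on $\mathbb{R}_+$ with compact support. Generalized derivative $G'$: for elementary $g=\sum_{i=1}^n g_iI_{(a_i,b_i]}$ set $G'(g)=\sum_i g_i(G(b_i)-G(a_i))$. When $\rho$ is locally integrable one has $E(G'(g)G'(\tilde g))=\int\int\rho(t-s)g(s)\tilde g(t)\,ds\,dt$ for elementary $g,\tilde g$, and $G'$ extends by isometry (as $L^2$ limits) to the closure of the elementary functions in the norm $(\int\int\rho(t-s)g(s)g(t)\,ds\,dt)^{1/2}$, which contains $\mathcal{B}_0(\mathbb{R}_+)$.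 Wick power chaos: let $f_\delta$, $\delta\in(0,1]$, be a continuous approximate identity (continuous, nonnegative, symmetric, supported in $[-\delta,\delta]$, $\int f_\delta=1$), and $f_{x,\delta}(s)=f_\delta(s-x)$ (restricted to $s\in\mathbb{R}_+$). When $\rho^k$ is locally integrable, $k\ge1$, $:(G')^k:(g)=\lim_{\delta\to0}\int :(G'(f_{x,\delta}))^k:\,g(x)\,dx$, a limit in $L^2$, for $g\in\mathcal{B}_0(\mathbb{R}_+)$; it satisfies $E(:(G')^k:(g))^2=k!\int\int\rho^k(x-y)g(x)g(y)\,dx\,dy$. *)

(* Defs.v *)
From mathcomp Require Import all_boot all_order all_algebra.
From mathcomp Require Import all_classical all_reals all_analysis.

Set Implicit Arguments.
Unset Strict Implicit.
Unset Printing Implicit Defensive.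

Import Order.TTheory GRing.Theory Num.Theory.
Import numFieldNormedType.Exports.

Local Open Scope classical_set_scope.
Local Open Scope ring_scope.

(* A process or function indexed by the half-line [0, +oo[ is encoded as a
   function on the whole of [R] of which only the values at nonnegative
   arguments are ever used. *)

Section gaussian_processes.
Context {R : realType} {d : measure_display} {T : measurableType d}.
Variable P : probability T R.

(* The degenerate case is separate because [normal_prob m 0] is by convention
   the uniform law on [0, 1], not a Dirac mass. *)
Definition centered_gaussian (X : T -> R) : Prop :=
  measurable_fun setT X /\
  exists2 s : R, 0 <= s & forall A : set R, measurable A ->
    P (X @^-1` A) = if s == 0 then \d_(0 : R) A else normal_prob 0 s A.

Definition centered_gaussian_process (G : R -> T -> R) : Prop :=
  forall (n : nat) (t c : 'I_n -> R), (forall i, 0 <= t i) ->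
    centered_gaussian (fun w => \sum_(i < n) c i * G (t i) w).

Definition stationary_increments (G : R -> T -> R) : Prop :=
  forall (n : nat) (t : 'I_n -> R) (A : 'I_n -> set R) (h : R),
    (forall i, 0 <= t i) -> (forall i, measurable (A i)) -> 0 <= h ->
    P [set w | forall i, A i (G (t i + h) w - G h w)] =
    P [set w | forall i, A i (G (t i) w - G 0 w)].

Definition increments_variance (G : R -> T -> R) (sigma2 : R -> R) : Prop :=
  forall x y : R, 0 <= x -> 0 <= y ->
    'E_P[(fun w => (G x w - G y w) ^+ 2)%R]%E = (sigma2 (x - y))%:E /\
    sigma2 (x - y) = sigma2 `|x - y|.

Definition continuous_paths (G : R -> T -> R) : Prop :=
  forall w, {within `[0, +oo[, continuous (fun x => G x w)}.

Definition cvg_L2 {I : Type} (F : set_system I) (X : I -> T -> R)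
    (Y : T -> R) : Prop :=
  Lnorm P 2%:E (fun w => (X i w - Y w)%:E) @[i --> F] --> (0 : \bar R).

Definition standard_normal (eta : T -> R) : Prop :=
  measurable_fun setT eta /\
  forall A : set R, measurable A -> P (eta @^-1` A) = normal_prob 0 1 A.

Definition wick_power (X : T -> R) (k : nat) (w : T) : R :=
  \sum_(j < k./2.+1) (-1) ^+ j * 'C(k, j.*2)%:R *
    fine 'E_P[(fun w' => X w' ^+ j.*2)%R]%E * X w ^+ (k - j.*2).

End gaussian_processes.

Section regular_variation.
Context {R : realType}.

Definition regularly_varying0 (beta : R) (s : R -> R) : Prop :=
  forall lambda : R, 0 < lambda ->
    s (lambda * h) / s h @[h --> 0^'+] --> lambda `^ beta.

End regular_variation.

Section hermite.
Context {R : realType}.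

Definition orthonormal_hermite (H : nat -> {poly R}) : Prop :=
  [/\ forall k, size (H k) = k.+1,
      forall k, 0 < lead_coef (H k) &
      forall i j, \int[normal_prob 0 1]_x ((H i).[x] * (H j).[x])
                  = (i == j)%:R].

Definition hermite_coef {d : measure_display} {T : measurableType d}
    (Q : probability T R) (eta : T -> R) (H : nat -> {poly R}) (f : R -> R)
    (k : nat) : R :=
  fine 'E_Q[(fun w => (H k).[eta w] * f (eta w))%R]%E.

Definition hermite_rank {d : measure_display} {T : measurableType d}
    (Q : probability T R) (eta : T -> R) (H : nat -> {poly R}) (f : R -> R)
    (k0 : nat) : Prop :=
  [/\ (1 <= k0)%N, hermite_coef Q eta H f k0 != 0 &
      forall k, (1 <= k < k0)%N -> hermite_coef Q eta H f k = 0].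

End hermite.

Section generalized_derivative.
Context {R : realType} {d : measure_display} {T : measurableType d}.
Variables (P : probability T R) (G : R -> T -> R) (sigma2 : R -> R).

Local Notation mu := (@lebesgue_measure R).
Local Notation half_line := (`[(0 : R), +oo[%classic : set R).

(* Meaningful for [s != 0]; the value at [0] does not affect any integral. *)
Definition rho (s : R) : R := 2^-1 * derive1n 2 sigma2 s.

Definition bounded_compact_support (g : R -> R) : Prop :=
  measurable_fun half_line g /\
  exists M : R, forall s, 0 <= s -> `|g s| <= M /\ (M < s -> g s = 0).

(* The list of triples [(c, a, b)] stands for the sum of the [c * 1_(a, b]]. *)
Definition elementary (e : seq (R * R * R)) : Prop :=
  forall p, p \in e -> 0 <= p.1.2 /\ p.1.2 <= p.2.

Definition elementary_fun (e : seq (R * R * R)) (s : R) : R :=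
  \sum_(p <- e) p.1.1 * \1_(`]p.1.2, p.2]) s.

Definition elementary_derivative (e : seq (R * R * R)) (w : T) : R :=
  \sum_(p <- e) p.1.1 * (G p.2 w - G p.1.2 w).

Definition rho_form (g : R -> R) : R :=
  \int[mu]_(t in half_line) \int[mu]_(s in half_line)
    (rho (t - s) * g s * g t).

(* [Y] is a version of [G'(g)].  The isometric extension is only needed, and
   its double integrals are only guaranteed to converge, on bounded functions
   with compact support. *)
Definition is_gen_derivative (g : R -> R) (Y : T -> R) : Prop :=
  [/\ bounded_compact_support g,
      Y \in Lfun P 2%:E &
      exists e : nat -> seq (R * R * R),
        [/\ forall n, elementary (e n),
            Num.sqrt (rho_form (fun s => g s - elementary_fun (e n) s))
              @[n --> \oo] --> (0 : R) &
            cvg_L2 P \oo (fun n => elementary_derivative (e n)) Y]].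

Definition approximate_identity (f : R -> R -> R) : Prop :=
  forall delta : R, 0 < delta <= 1 ->
    [/\ continuous (f delta),
        forall s, 0 <= f delta s,
        forall s, f delta (- s) = f delta s,
        forall s, delta < `|s| -> f delta s = 0 &
        \int[mu]_s (f delta s) = 1].

(* [V delta x] is [G'(f_{x,delta})].  As each [G'(f_{x,delta})] is only
   defined almost surely, the pathwise integral over [x] of its Wick power
   makes sense for a version that is jointly measurable in [(x, w)]. *)
Definition is_smoothed_derivative (f : R -> R -> R) (V : R -> R -> T -> R)
    : Prop :=
  forall delta : R, 0 < delta <= 1 ->
    measurable_fun (half_line `*` [set: T])
      (fun p : R * T => V delta p.1 p.2) /\
    forall x, 0 <= x ->
      is_gen_derivative (fun s => f delta (s - x)) (V delta x).

Definition is_wick_chaos (k : nat) (g : R -> R) (Z : T -> R) : Prop :=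
  Z \in Lfun P 2%:E /\
  forall (f : R -> R -> R) (V : R -> R -> T -> R),
    approximate_identity f -> is_smoothed_derivative f V ->
    cvg_L2 P (0 : R)^'+
      (fun delta w =>
         \int[mu]_(x in half_line) (wick_power P (V delta x) k w * g x)) Z.

(* [:(G')^k:(g)].  The limit is unique up to almost sure equality, so any
   choice will do; the default value is for when there is no limit. *)
Definition wick_chaos (k : nat) (g : R -> R) : T -> R :=
  xget (cst 0) [set Z | is_wick_chaos k g Z].

End generalized_derivative.

(* Main.v *)
(* Write [f = E f + c He_k0 + q] with [q] orthogonal to the Hermite polynomials of degree
   at most [k0].  Since Wick powers are homogeneous, the [He_k0] part of the integral is
   [(h / sigma(h))^k0] times the integral of [:U(x)^k0:] with [U(x) = (G(x+h) - G(x)) / h],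
   which is [G'] smoothed by the kernel [h^-1 1_]0,h]].  The covariances of two smoothings
   of [G'] tend to [rho(y - x)] in [L^k0] of the square as the kernels shrink, and
   [E :X^k: :Y^k: = k! (E XY)^k] for jointly Gaussian variables, so increment quotients
   have the same limit [:(G')^k0:] as continuous approximate identities.  The [q] part is
   negligible: two standard Gaussian variables with correlation [t] satisfy
   [|E q(X) q(Y)| <= |t|^(k0+1) ||q||^2], and the correlation of normalized increments is
   [h^2 / sigma^2(h)] times a covariance converging to [rho(y - x)], so one power more
   than the normalization is available and dominated convergence applies.  Condition
   (iii) and the continuity at [0] make [rho] the second derivative of [sigma^2 / 2] in
   the integrated sense on the whole line, which gives the covariance of [G']. *)
Require Import Defs.
From HB Require Import structures.
From mathcomp Require Import all_boot all_order all_algebra.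
From mathcomp Require Import all_classical all_reals all_analysis.
From mathcomp Require Import measurable_realfun normal_distribution.
From mathcomp Require Import ring lra zify.
Set Implicit Arguments.
Unset Strict Implicit.
Unset Printing Implicit Defensive.
Import Order.TTheory GRing.Theory Num.Theory.
Import numFieldNormedType.Exports.
Local Open Scope classical_set_scope.
Local Open Scope ring_scope.
(** * Hermite polynomials *)

(** Gaussian variables enter mostly through their moments: Gaussianity is stated as a property of
    moments, which survives $L^2$ limits, and integration by parts on mixed moments gives every
    Hermite identity. The remainder estimate for a general square-integrable [q] is proved for
    polynomials and carried over by their density in the Gaussian $L^2$ space, which rests on
    exponential moments. The chaos is chosen by [xget] among the variables that are the limit along
    every smoothing. If no jointly measurable smoothed derivative existed, that condition would be
    vacuous and the choice arbitrary, so one has to be constructed; continuity of the paths supplies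
    it. Integrability of [r^(k+1)] does not give that of [r^(k+2)]. The spare power in the remainder
    is therefore capped at 1, the bound obeyed by every correlation, and dominated convergence is
    applied to the capped quantity. The half-line cuts off the kernels near 0. The error lives in
    strips of width [delta], on which the translation invariance of the covariance keeps it of order
    [delta]. *)

Fixpoint he_rec {R : realFieldType} (v : R) (k : nat) : {poly R} :=
  if k is m.+1 then 'X * he_rec v m -
    (if m is p.+1 then (m%:R * v) *: he_rec v p else 0) else 1.

(* Hermite polynomial of variance [v]; locked because rewriting with the
   evaluation lemmas would otherwise unfold the recursion. *)
HB.lock Definition he {R : realFieldType} (v : R) (k : nat) := he_rec v k.

Section hermite_algebra.
Context {R : realFieldType}.
Implicit Types (v c w a : R) (p q : {poly R}).

(** The moments of the standard normal law, [(n-1)!!] for even [n] and 0 for odd [n], in the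
    recursive form that integration by parts produces. *)
Fixpoint gmom (n : nat) : R :=
  if n is m.+1 then (if m is p.+1 then m%:R * gmom p else 0) else 1.

Lemma gmomSS n : gmom n.+2 = n.+1%:R * gmom n.
Proof. by []. Qed.

Lemma gmom0 : gmom 0 = 1. Proof. by []. Qed.

Lemma gmom_odd n : odd n -> gmom n = 0.
Proof.
elim/ltn_ind: n => -[|[|n]] IH // on; rewrite gmomSS IH ?mulr0//.
by move: on; rewrite /= negbK.
Qed.

Lemma he0 v : he v 0 = 1. Proof. by rewrite he.unlock. Qed.
Lemma he1 v : he v 1 = 'X. Proof. by rewrite he.unlock /= subr0 mulr1. Qed.
Lemma heSS v k : he v k.+2 = 'X * he v k.+1 - (k.+1%:R * v) *: he v k.
Proof. by rewrite he.unlock. Qed.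

Arguments gmom : simpl never.

(** Appell property: differentiating the three-term recurrence returns the recurrence one degree
    lower. It is what turns integration by parts into orthogonality. *)
Lemma deriv_he v k : (he v k.+1)^`() = k.+1%:R *: he v k.
Proof.
elim/ltn_ind: k => -[|[|k]] IH.
- by rewrite he1 derivX he0 scale1r.
- rewrite heSS he1 he0 derivB derivM derivX derivZ derivC /= scaler0 subr0.
  by rewrite mul1r mulr1 scaler_nat mulr2n.
- rewrite (heSS _ k.+1) derivB derivM derivX derivZ IH// IH// mul1r heSS.
  rewrite -!mul_polyC !(rmorphM, rmorph_nat)/=; ring.
Qed.

(** Every term of the recurrence is homogeneous when the argument has weight 1 and the variance
    weight 2. *)
Lemma he_scale v a k x : (he (a ^+ 2 * v) k).[a * x] = a ^+ k * (he v k).[x].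
Proof.
elim/ltn_ind: k => -[|[|k]] IH.
- by rewrite !he0 !hornerE.
- by rewrite !he1 !hornerE.
- by rewrite !heSS !(hornerD, hornerN, hornerM, hornerX, hornerZ) !IH// !exprS; ring.
Qed.

(** The bridge to [wick_power]: [gmom (2j) * v^j] is the moment of order [2j] of a centered Gaussian
    variable of variance [v]. *)
Lemma horner_he v k x : (he v k).[x] =
  \sum_(j < k./2.+1) (-1) ^+ j * 'C(k, j.*2)%:R * (gmom j.*2 * v ^+ j)
    * x ^+ (k - j.*2).
Proof.
pose F k j := (-1) ^+ j * 'C(k, j.*2)%:R * (gmom j.*2 * v ^+ j) * x ^+ (k - j.*2).
(* The range is loosened to any [N >= k/2], the extra binomials being 0, so that both terms of the
   recurrence become sums over a common range. *)
suff E N : (k./2 <= N)%N -> (he v k).[x] = \sum_(j < N.+1) F k j by exact: E.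
have F0 k' j : (k' < j.*2)%N -> F k' j = 0.
  by move=> kj; rewrite /F bin_small// mulr0 !mul0r.
elim/ltn_ind: k N => -[|[|k]] IH N kN.
- rewrite he0 hornerC big_ord_recl/= big1 ?addr0; first by rewrite /F bin0 subn0 gmom0; ring.
  by move=> i _; rewrite F0//.
- rewrite he1 hornerX big_ord_recl/= big1 ?addr0; first by rewrite /F bin0 subn0 gmom0; ring.
  by move=> i _; rewrite F0// /bump/= doubleS.
- rewrite heSS !hornerE (IH k.+1 _ N)//; last first.
    by apply: leq_trans kN; rewrite half_leq.
  rewrite (IH k _ N)//; last by apply: leq_trans kN; rewrite half_leq// leqW.
  rewrite !big_distrr/=.
  case: N kN => [//|N] kN.
  rewrite [in LHS]big_ord_recl [X in _ - X]big_ord_recr/= [in RHS]big_ord_recl/=.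
  rewrite (F0 k N.+1) ?mulr0 ?addr0; last first.
    by move: kN; rewrite /=; lia.
  rewrite -addrA; congr (_ + _).
    by rewrite /F double0 !bin0 !subn0 gmom0 !exprS; ring.
  rewrite -sumrB; apply: eq_bigr => i _; rewrite /bump/= add1n /F doubleS.
  have [ki|ki] := leqP i.*2.+1 k.
    have -> : (k.+2 - i.*2.+2 = k - i.*2)%N by lia.
    have -> : (k - i.*2 = (k.+1 - i.*2.+2).+1)%N by lia.
    rewrite (binS k.+1) natrD gmomSS !exprS.
    have /(congr1 (fun n => n%:R : R)) := mul_bin_diag k.+1 i.*2.
    rewrite /= !natrM; move: (k.+1%:R) (i.*2.+1%:R) => K J E; ring: E.
  rewrite (@bin_small k.+1); last by lia.
  have [ki'|ki'|ke] := ltngtP k i.*2; last 2 first.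
  - by lia.
  - rewrite -ke !binn !subnn gmomSS exprS [v ^+ _.+1]exprS; ring.
  by rewrite (@bin_small k) ?(@bin_small k.+2)//; ring.
Qed.

Lemma monic_size_he v k : size (he v k) = k.+1 /\ lead_coef (he v k) = 1.
Proof.
elim/ltn_ind: k => -[|[|k]] IH.
- by rewrite he0 size_poly1 lead_coef1.
- by rewrite he1 size_polyX lead_coefX.
- have [s1 l1] := IH k.+1 (ltnSn _); have [s0 _] := IH k (leqW (ltnSn _)).
  have sX : size ('X * he v k.+1) = k.+3.
    by rewrite mulrC size_mulX ?s1// -size_poly_gt0 s1.
  have lt : (size (- ((k.+1%:R * v) *: he v k)) < size ('X * he v k.+1)%R)%N.
    by rewrite size_polyN sX (leq_ltn_trans (size_scale_leq _ _))// s0.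
  rewrite heSS; split; first by rewrite size_polyDl.
  by rewrite lead_coefDl// lead_coefM lead_coefX l1 mul1r.
Qed.

Lemma size_he v k : size (he v k) = k.+1.
Proof. exact: (monic_size_he v k).1. Qed.

Lemma lead_coef_he v k : lead_coef (he v k) = 1.
Proof. exact: (monic_size_he v k).2. Qed.

Lemma poly_eq_horner p q : (forall x, p.[x] = q.[x]) -> p = q.
Proof.
move=> pq; apply/eqP; rewrite -subr_eq0; apply/eqP.
apply: (@roots_geq_poly_eq0 _ _ [seq i%:R | i <- iota 0 (size (p - q))]).
- by apply/allP => _ /mapP[i _ ->]; rewrite rootE !hornerE pq subrr.
- rewrite map_inj_uniq ?iota_uniq// => i j /eqP.
  by rewrite eqr_nat => /eqP.
- by rewrite size_map size_iota.
Qed.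

(* [m a b] is the mixed moment [E X^a Y^b]; the hypothesis says that every
   [t X + Y] has the moments of a Gaussian variable. *)
Lemma mixed_moment_rec (m : nat -> nat -> R) v c w :
  (forall n t, \sum_(b < n.+1) 'C(n, b)%:R * m b (n - b)%N * t ^+ b =
               gmom n * (v * t ^+ 2 + 2 * c * t + w) ^+ n./2) ->
  forall a b : nat, m a.+1 b = a%:R * v * m a.-1 b + b%:R * c * m a b.-1.
Proof.
move=> mE.
pose q : {poly R} := v *: 'X^2 + (2 * c) *: 'X + w%:P.
pose P n : {poly R} := \poly_(b < n.+1) ('C(n, b)%:R * m b (n - b)%N).
have PE n : P n = gmom n *: q ^+ n./2.
  apply: poly_eq_horner => t; rewrite horner_poly mE.
  by rewrite hornerZ horner_exp /q !(hornerD, hornerZ, hornerXn, hornerX, hornerC).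
have dq : q^`() = 2 *: (v *: 'X + c%:P).
  rewrite /q !derivD !derivZ derivXn derivX derivC addr0 /= -!mul_polyC.
  rewrite !rmorphM /= expr1 !polyC_natr; ring.
(* [P n] generates the mixed moments of degree [n] and is a power of the variance [q] of [t X + Y].
   Since [q' = 2 (v t + c)], differentiating lowers the degree by 2; comparing coefficients of [t^a]
   is the recursion up to binomial factors. *)
have dP n : (P n.+2)^`() =
    (n.+2%:R * n.+1%:R) *: ((v *: 'X + c%:P) * P n).
  rewrite !PE derivZ deriv_exp dq /= gmomSS.
  have [on|en] := boolP (odd n).
    by rewrite gmom_odd// mulr0 !scale0r mulr0 scaler0.
  have -> : n.+2%:R = (n./2.+1)%:R * 2 :> R.
    by rewrite -natrM; congr (_%:R); rewrite -[in LHS](odd_double_half n) (negbTE en); lia.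
  rewrite -mulr_natr -!mul_polyC !(rmorphM, rmorph_nat)/=; ring.
move=> a b.
(* In total degree 1 there is nothing to differentiate: the first moment vanishes because
   [P 1 = 0]. *)
case abn : (a + b)%N => [|n].
  have [-> ->] : a = 0%N /\ b = 0%N by lia.
  rewrite !mul0r addr0; have /(congr1 (fun p => p`_1)) := PE 1%N.
  by rewrite coef_poly /= mul1r (@gmom_odd 1)// scale0r coef0.
have cd : 'C(n.+1, a)%:R != 0 :> R.
  by rewrite pnatr_eq0 -lt0n bin_gt0; lia.
have /(congr1 (fun p => p`_a)) E5 := dP n.
move: E5; rewrite coef_deriv coefZ (mulrDl (v *: 'X)) coefD -(scalerAl v 'X) (coefZ v) coefXM coefCM.
rewrite /P !coef_poly ifT; last by lia.
have -> : (n.+2 - a.+1 = b)%N by lia.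
rewrite -[X in X = _]mulr_natr => E5.
have /(congr1 (fun n => n%:R : R)) := mul_bin_diag n.+2 a.
rewrite /= !natrM => E1.
have E2 : n.+1%:R * ((a > 0)%:R * 'C(n, a.-1)%:R) = a%:R * 'C(n.+1, a)%:R :> R.
  case: a {abn cd E1 E5} => [|a]; first by rewrite !mul0r mulr0.
  by rewrite mul1r -!natrM (mul_bin_diag n.+1 a).
have E3 : n.+1%:R * 'C(n, a)%:R = b%:R * 'C(n.+1, a)%:R :> R.
  by rewrite -!natrM (mul_bin_down n.+1 a); congr ((_ * _)%:R); lia.
have n2 : n.+2%:R != 0 :> R by rewrite pnatr_eq0.
have E4 : (if (a < n.+1)%N then 'C(n, a)%:R * m a (n - a)%N else 0) =
    'C(n, a)%:R * m a b.-1.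
  have [an|an] := ltnP a n.+1; first by congr (_ * m _ _); lia.
  by rewrite bin_small ?mul0r.
have E6 : (if a == 0%N then 0 else
    if (a.-1 < n.+1)%N then 'C(n, a.-1)%:R * m a.-1 (n - a.-1)%N else 0) =
    (a > 0)%:R * ('C(n, a.-1)%:R * m a.-1 b).
  case: a abn {cd E1 E2 E3 E4 E5} => [|a] abn; first by rewrite mul0r.
  by rewrite /= mul1r ifT; [congr (_ * m _ _); lia|lia].
rewrite E4 E6 in E5; apply: (mulfI cd); apply: (mulfI n2).
rewrite mulrA E1.
rewrite (_ : _ * m a.+1 b = 'C(n.+2, a.+1)%:R * m a.+1 b * a.+1%:R); last by ring.
rewrite E5.
move: n.+2%:R n.+1%:R (m a.+1 b) (m a.-1 b) (m a b.-1) 'C(n, a.-1)%:R 'C(n, a)%:R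
  'C(n.+1, a)%:R ((a > 0)%N%:R : R) E2 E3 => N M x y z k1 k2 k3 k4 E2 E3.
transitivity (N * (v * y * (M * (k4 * k1)) + c * z * (M * k2))); first by ring.
by rewrite E2 E3; ring.
Qed.

(* [L p q] stands for [E p(X) q(Y)], where [X] and [Y] are jointly Gaussian with
   variances [v], [w] and covariance [c]. *)
Lemma he_orthogonal (L : {poly R} -> {poly R} -> R) v c w :
  (forall a p q r, L (a *: p + q) r = a * L p r + L q r) ->
  (forall a p q r, L r (a *: p + q) = a * L r p + L r q) ->
  L 1 1 = 1 ->
  (forall n t, \sum_(b < n.+1) 'C(n, b)%:R * L 'X^b 'X^(n - b) * t ^+ b =
               gmom n * (v * t ^+ 2 + 2 * c * t + w) ^+ n./2) ->
  forall k l, L (he v k) (he w l) = (k == l)%:R * k`!%:R * c ^+ k.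
Proof.
move=> Ll Lr L11 Lm.
have rec := mixed_moment_rec (m := fun i j : nat => L 'X^i 'X^j) Lm.
(* [rec] only removes a factor [X]. Without one, the moments are those of [Y] alone, read off from
   the hypothesis at [t = 0]. *)
have rec0 b : L 'X^0 'X^(b.+1) = b%:R * w * L 'X^0 'X^(b.-1).
  have L0 n : L 'X^0 'X^n = gmom n * w ^+ n./2.
    have := Lm n 0; rewrite big_ord_recl big1 => [|i _]; last first.
      by rewrite expr0n mulr0.
    by rewrite bin0 subn0 expr0 mul1r mulr1 expr0n !mulr0 !add0r addr0 => ->.
  case: b => [|b]; first by rewrite !mul0r L0 gmom_odd// mul0r.
  by rewrite !L0 gmomSS /= exprS; ring.
have L0l p : L 0 p = 0.
  by have := Ll 1 0 0 p; rewrite scaler0 addr0 mul1r; lra.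
have L0r p : L p 0 = 0.
  by have := Lr 1 0 0 p; rewrite scaler0 addr0 mul1r; lra.
have suml (F : nat -> R) (P : nat -> {poly R}) n q :
    L (\sum_(i < n) F i *: P i) q = \sum_(i < n) F i * L (P i) q.
  elim: n => [|n IH]; first by rewrite !big_ord0.
  by rewrite !big_ord_recr/= addrC Ll IH addrC.
have sumr (F : nat -> R) (P : nat -> {poly R}) n q :
    L q (\sum_(i < n) F i *: P i) = \sum_(i < n) F i * L q (P i).
  elim: n => [|n IH]; first by rewrite !big_ord0.
  by rewrite !big_ord_recr/= addrC Lr IH addrC.
have pE (p : {poly R}) : p = \sum_(i < size p) p`_i *: 'X^i.
  by rewrite -{1}[p]coefK poly_def.
have Lder p q :
    L p^`() q = \sum_(i < size p) p`_i * (i%:R * L 'X^(i.-1) q).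
  rewrite {1}(pE p) raddf_sum /=.
  under eq_bigr do rewrite derivZ derivXn -scaler_nat scalerA.
  by rewrite (suml (fun i => p`_i * i%:R) (fun i => 'X^(i.-1))); apply: eq_bigr => i _; rewrite mulrA.
have Rder p q : L p q^`() = \sum_(i < size q) q`_i * (i%:R * L p 'X^(i.-1)).
  rewrite {1}(pE q) raddf_sum /=.
  under eq_bigr do rewrite derivZ derivXn -scaler_nat scalerA.
  by rewrite (sumr (fun i => q`_i * i%:R) (fun i => 'X^(i.-1))); apply: eq_bigr => i _; rewrite mulrA.
have Lp p q : L p q = \sum_(i < size p) p`_i * L 'X^i q.
  by rewrite {1}(pE p) (suml (fun i => p`_i) (fun i => 'X^i)).
have Lq p q : L p q = \sum_(i < size q) q`_i * L p 'X^i.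
  by rewrite {1}(pE q) (sumr (fun i => q`_i) (fun i => 'X^i)).
(* Gaussian integration by parts, [E X p(X) q(Y) = v E p'(X) q(Y) + c E p(X) q'(Y)]. *)
have LX p q : L ('X * p) q = v * L p^`() q + c * L p q^`().
  have -> : L ('X * p) q = \sum_(i < size p) p`_i * L 'X^(i.+1) q.
    rewrite {1}(pE p) mulr_sumr; under eq_bigr do rewrite -scalerAr -exprS.
    by rewrite (suml (fun i => p`_i) (fun i => 'X^(i.+1))).
  rewrite Lder// (Lp p q^`()) !mulr_sumr -big_split/=; apply: eq_bigr => i _.
  rewrite Rder Lq [L 'X^(i.-1) q]Lq !mulr_sumr -big_split/=.
  by apply: eq_bigr => j _; rewrite rec; ring.
have RX q : L 1 ('X * q) = w * L 1 q^`().
  have -> : L 1 ('X * q) = \sum_(i < size q) q`_i * L 1 'X^(i.+1).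
    rewrite {1}(pE q) mulr_sumr; under eq_bigr do rewrite -scalerAr -exprS.
    by rewrite (sumr (fun i => q`_i) (fun i => 'X^(i.+1))).
  rewrite Rder mulr_sumr; apply: eq_bigr => i _.
  by rewrite -[1](expr0 'X) rec0; ring.
have LZ a p q : L (a *: p) q = a * L p q.
  by rewrite -[a *: p]addr0 Ll L0l addr0.
have RZ a p q : L p (a *: q) = a * L p q.
  by rewrite -[a *: q]addr0 Lr L0r addr0.
have LB p q r : L (p - q) r = L p r - L q r.
  by rewrite addrC -scaleN1r Ll mulN1r addrC.
have RB p q r : L r (p - q) = L r p - L r q.
  by rewrite addrC -scaleN1r Lr mulN1r addrC.
(* The subtracted term of the three-term recurrence is exactly the [v]-part of the integration by
   parts, so only the covariance part survives and both degrees drop by one. *)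
have step k l : L (he v k.+1) (he w l) = c * l%:R * L (he v k) (he w l.-1).
  have dl : (he w l)^`() = l%:R *: he w l.-1.
    by case: l => [|l]; rewrite ?deriv_he// he0 derivC scale0r.
  case: k => [|k].
    by rewrite he1 -['X]mulr1 LX he0 derivC L0l mulr0 add0r dl RZ mulrA.
  rewrite heSS LB LX LZ deriv_he LZ dl RZ; ring.
have step0 l : L (he v 0) (he w l.+1) = 0.
  rewrite he0; case: l => [|l].
    by rewrite he1 -['X]mulr1 RX derivC L0r mulr0.
  by rewrite heSS RB RX RZ deriv_he RZ; ring.
elim=> [|k IH] [|l].
- by rewrite !he0 L11 !mulr1.
- by rewrite step0 !mul0r.
- by rewrite step mulr0 !mul0r.
- rewrite step /= IH eqSS factS natrM exprS.
  by case: eqP => [->|_]; rewrite ?(mul0r, mulr0)//; ring.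
Qed.

Lemma poly_expansion (H : nat -> {poly R}) :
  (forall k, size (H k) = k.+1) ->
  forall n p, (size p <= n)%N -> exists a : nat -> R, p = \sum_(i < n) a i *: H i.
Proof.
move=> sH; elim=> [|n IH] p sp.
  exists (fun=> 0); rewrite big_ord0; apply/eqP.
  by rewrite -size_poly_leq0.
have lH : lead_coef (H n) != 0 by rewrite lead_coef_eq0 -size_poly_gt0 sH.
pose b := p`_n / lead_coef (H n).
have [|a aE] := IH (p - b *: H n).
  apply/leq_sizeP => j; rewrite leq_eqVlt coefB coefZ => /predU1P[<-|nj].
    have <- : lead_coef (H n) = (H n)`_n by rewrite lead_coefE sH.
    by rewrite divfK// subrr.
  by rewrite !nth_default ?mulr0 ?subrr ?sH//; apply: leq_trans nj.
exists (fun i => if (i < n)%N then a i else b).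
rewrite big_ord_recr/= ltnn -[LHS](subrK (b *: H n)) aE; congr (_ + _).
by apply: eq_bigr => i _; rewrite ltn_ord.
Qed.

(** Uniqueness in Gram-Schmidt: [H k - l he k] has degree below [k], hence is a combination of lower
    [he j]; by induction these are proportional to [H j], to which [H k] is orthogonal. *)
Lemma orthonormal_he (L : {poly R} -> {poly R} -> R) v (H : nat -> {poly R}) :
  (forall a p q r, L (a *: p + q) r = a * L p r + L q r) ->
  (forall a p q r, L r (a *: p + q) = a * L r p + L r q) ->
  (forall k l, L (he v k) (he v l) = (k == l)%:R * k`!%:R) ->
  (forall k, size (H k) = k.+1) ->
  (forall k l, L (H k) (H l) = (k == l)%:R) ->
  forall k, H k = lead_coef (H k) *: he v k /\ lead_coef (H k) ^+ 2 * k`!%:R = 1.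
Proof.
move=> Ll Lr Lh sH LH.
have L0l p : L 0 p = 0.
  by have := Ll 1 0 0 p; rewrite scaler0 addr0 mul1r; lra.
have LZ a p q : L (a *: p) q = a * L p q.
  by rewrite -[a *: p]addr0 Ll L0l addr0.
have L0r p : L p 0 = 0.
  by have := Lr 1 0 0 p; rewrite scaler0 addr0 mul1r; lra.
have RZ a p q : L p (a *: q) = a * L p q.
  by rewrite -[a *: q]addr0 Lr L0r addr0.
have suml (F : nat -> R) (P : nat -> {poly R}) n q :
    L (\sum_(i < n) F i *: P i) q = \sum_(i < n) F i * L (P i) q.
  elim: n => [|n IH]; first by rewrite !big_ord0.
  by rewrite !big_ord_recr/= addrC Ll IH addrC.
have kf (k : nat) : k`!%:R != 0 :> R by rewrite pnatr_eq0 -lt0n fact_gt0.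
elim/ltn_ind=> k IH.
set l := lead_coef (H k).
have [|a aE] := @poly_expansion (he v) (size_he v) k (H k - l *: he v k).
  apply/leq_sizeP => j; rewrite leq_eqVlt coefB coefZ => /predU1P[<-|nj].
    have -> : (he v k)`_k = 1 by rewrite -(lead_coef_he v k) lead_coefE size_he.
    by rewrite mulr1 /l lead_coefE sH subrr.
  by rewrite !nth_default ?mulr0 ?subrr ?sH ?size_he.
have HE : H k = l *: he v k + \sum_(i < k) a i *: he v i.
  by rewrite -aE addrC subrK.
have a0 (j : 'I_k) : a j = 0.
  have [Hj lj] := IH j (ltn_ord j).
  have : L (H k) (H j) = 0 by rewrite LH gtn_eqF.
  rewrite {1}HE Hj RZ Ll Lh gtn_eqF// mul0r mulr0 add0r suml.
  rewrite (bigD1 j)//= big1 => [|i ij].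
    rewrite Lh eqxx mul1r addr0 => /eqP; rewrite !mulf_eq0 (negbTE (kf j)) orbF.
    case/orP => /eqP// l0; move: lj; rewrite l0 expr0n mul0r => /eqP.
    by rewrite eq_sym oner_eq0.
  by rewrite Lh (_ : _ == _ :> nat = false) ?mul0r ?mulr0//; exact: negbTE ij.
have Hk : H k = l *: he v k.
  by rewrite HE big1 ?addr0// => i _; rewrite a0 scale0r.
split => //; have := LH k k; rewrite Hk LZ RZ Lh !eqxx mul1r => lk; rewrite -[RHS]lk; ring.
Qed.
End hermite_algebra.

(** * Square-integrable functions *)

Section square_integrable.
Context {R : realType} d {T : measurableType d}.
Variable m : {measure set T -> \bar R}.
Implicit Types X Y : T -> R.

Local Notation mint X := (m.-integrable [set: T] (EFin \o X)).

Definition sqint X := measurable_fun [set: T] X /\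
  m.-integrable [set: T] (EFin \o (fun w => X w ^+ 2)).

Lemma le_integrableT X Y : measurable_fun [set: T] X ->
  (forall w, `|X w| <= `|Y w|) -> mint Y -> mint X.
Proof.
move=> mX XY; apply: le_integrable => //; first exact/measurable_EFinP.
by move=> w _ /=; rewrite lee_fin.
Qed.

Lemma mintD X Y : mint X -> mint Y -> mint (fun w => X w + Y w).
Proof. by move=> iX iY; apply: (integrableD measurableT iX iY). Qed.

Lemma mintB X Y : mint X -> mint Y -> mint (fun w => X w - Y w).
Proof. by move=> iX iY; apply: (integrableB measurableT iX iY). Qed.

Lemma mintZ (k : R) X : mint X -> mint (fun w => k * X w).
Proof. by move=> iX; apply: (integrableZl measurableT k iX). Qed.

Lemma mint_sum (I : Type) (s : seq I) (F : I -> T -> R) :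
  (forall i, mint (F i)) -> mint (fun w => \sum_(i <- s) F i w).
Proof.
move=> iF; elim: s => [|i s IH].
  under [X in _.-integrable _ (_ \o X)]eq_fun do rewrite big_nil.
  exact: integrable0.
under [X in _.-integrable _ (_ \o X)]eq_fun do rewrite big_cons.
exact: mintD.
Qed.

Lemma Rint_sum (I : Type) (s : seq I) (F : I -> T -> R) :
  (forall i, mint (F i)) ->
  \int[m]_w (\sum_(i <- s) F i w) = \sum_(i <- s) \int[m]_w F i w.
Proof.
move=> iF; elim: s => [|i s IH].
  rewrite big_nil; under eq_Rintegral do rewrite big_nil.
  by rewrite /Rintegral integral0.
rewrite big_cons; under eq_Rintegral do rewrite big_cons.
by rewrite RintegralD ?IH//; exact: mint_sum.
Qed.

Lemma sqint_measurable X : sqint X -> measurable_fun [set: T] X.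
Proof. by case. Qed.

Lemma sqintM X Y : sqint X -> sqint Y -> mint (fun w => X w * Y w).
Proof.
move=> [mX iX] [mY iY]; apply: le_integrableT (mintD iX iY).
  exact: measurable_funM.
move=> w; rewrite [X in _ <= X]ger0_norm ?addr_ge0 ?sqr_ge0// ler_norml.
by apply/andP; split; nra.
Qed.

Lemma sqintD X Y : sqint X -> sqint Y -> sqint (fun w => X w + Y w).
Proof.
move=> sX sY; have [mX iX] := sX; have [mY iY] := sY.
split; first exact: measurable_funD.
have := mintD (mintD iX iY) (mintZ 2 (sqintM sX sY)).
by apply: eq_integrable => // w _ /=; congr EFin; ring.
Qed.

Lemma sqintZ (k : R) X : sqint X -> sqint (fun w => k * X w).
Proof.
move=> [mX iX]; split; first exact: measurable_funM.
by have := mintZ (k ^+ 2) iX; apply: eq_integrable => // w _ /=; rewrite exprMn.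
Qed.

Lemma sqintN X : sqint X -> sqint (fun w => - X w).
Proof.
move=> /(sqintZ (-1)); congr sqint.
by apply/funext => w; rewrite mulN1r.
Qed.

Lemma sqintB X Y : sqint X -> sqint Y -> sqint (fun w => X w - Y w).
Proof. by move=> sX /sqintN; exact: sqintD. Qed.

Lemma sqint0 : sqint (fun=> 0).
Proof.
split=> //; under [X in _.-integrable _ (_ \o X)]eq_fun do rewrite expr0n.
exact: integrable0.
Qed.

Lemma sqint_sum (I : Type) (s : seq I) (F : I -> T -> R) :
  (forall i, sqint (F i)) -> sqint (fun w => \sum_(i <- s) F i w).
Proof.
move=> iF; elim: s => [|i s IH].
  by under eq_fun do rewrite big_nil; exact: sqint0.
by under eq_fun do rewrite big_cons; exact: sqintD.
Qed.

Lemma sqint_le X Y : measurable_fun [set: T] X -> (forall w, `|X w| <= `|Y w|) ->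
  sqint Y -> sqint X.
Proof.
move=> mX XY [mY iY]; split=> //; apply: le_integrableT iY.
  exact: measurable_funX.
by move=> w; rewrite !normrX lerXn2r ?nnegrE.
Qed.

Definition norm2 X := Num.sqrt (\int[m]_w (X w ^+ 2)).

Lemma norm2_ge0 X : 0 <= norm2 X. Proof. exact: sqrtr_ge0. Qed.

Lemma Rint_sqr_ge0 X : 0 <= \int[m]_w (X w ^+ 2).
Proof. by apply: Rintegral_ge0 => w _; exact: sqr_ge0. Qed.

Lemma norm2_sqr X : norm2 X ^+ 2 = \int[m]_w (X w ^+ 2).
Proof. by rewrite sqr_sqrtr// Rint_sqr_ge0. Qed.

Lemma Rint_sqrD X Y : sqint X -> sqint Y ->
  \int[m]_w ((X w + Y w) ^+ 2) = \int[m]_w (X w ^+ 2) +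
    2 * \int[m]_w (X w * Y w) + \int[m]_w (Y w ^+ 2).
Proof.
move=> sX sY; have iXY := sqintM sX sY.
transitivity (\int[m]_w (X w ^+ 2 + 2 * (X w * Y w) + Y w ^+ 2)).
  by apply: eq_Rintegral => w _; ring.
rewrite RintegralD//; [|exact: mintD sX.2 (mintZ 2 iXY)|exact: sY.2].
rewrite RintegralD//; [|exact: sX.2|exact: mintZ].
by rewrite RintegralZl.
Qed.

(** [t -> ||X + t Y||^2] is a nonnegative quadratic; it is evaluated at its minimum. If [||Y|| = 0]
    it is affine, and a nonzero slope would let it take the value -1. *)
Lemma cauchy_schwarz X Y : sqint X -> sqint Y ->
  `|\int[m]_w (X w * Y w)| <= norm2 X * norm2 Y.
Proof.
move=> sX sY; set c := \int[m]_w _.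
have q t : 0 <= norm2 X ^+ 2 + 2 * t * c + t ^+ 2 * norm2 Y ^+ 2.
  have := Rint_sqr_ge0 (fun w => X w + t * Y w).
  rewrite Rint_sqrD//; last exact: sqintZ.
  have -> : \int[m]_w (X w * (t * Y w)) = t * c.
    rewrite -RintegralZl//; last exact: sqintM.
    by apply: eq_Rintegral => w _; rewrite mulrCA.
  have -> : \int[m]_w ((t * Y w) ^+ 2) = t ^+ 2 * norm2 Y ^+ 2.
    rewrite norm2_sqr -RintegralZl//; last exact: sY.2.
    by apply: eq_Rintegral => w _; rewrite exprMn.
  by rewrite (norm2_sqr X) mulrA.
rewrite -ler_sqr ?nnegrE ?mulr_ge0 ?norm2_ge0// real_normK ?num_real// exprMn.
have [Y0|Y0] := eqVneq (norm2 Y) 0.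
  rewrite Y0 expr0n mulr0; have [->|c0] := eqVneq c 0; first by rewrite expr0n.
  have := q (- (norm2 X ^+ 2 + 1) / (2 * c)).
  rewrite Y0 expr0n mulr0 addr0 (_ : _ + _ = -1) ?ler0N1//.
  by field.
have Yp : 0 < norm2 Y ^+ 2 by rewrite exprn_even_gt0.
have := q (- c / norm2 Y ^+ 2); rewrite -(ler_pM2r Yp) mul0r.
rewrite (_ : _ * _ = norm2 X ^+ 2 * norm2 Y ^+ 2 - c ^+ 2) ?subr_ge0//.
by field; rewrite Y0.
Qed.

Lemma norm2D X Y : sqint X -> sqint Y ->
  norm2 (fun w => X w + Y w) <= norm2 X + norm2 Y.
Proof.
move=> sX sY; rewrite -ler_sqr ?nnegrE ?addr_ge0 ?norm2_ge0//.
rewrite norm2_sqr Rint_sqrD// sqrrD !norm2_sqr lerD2r lerD2l -[leRHS]mulr_natl ler_pM2l//.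
exact: le_trans (ler_norm _) (cauchy_schwarz sX sY).
Qed.

Lemma norm2Z (k : R) X : sqint X -> norm2 (fun w => k * X w) = `|k| * norm2 X.
Proof.
move=> sX; rewrite /norm2.
under eq_Rintegral do rewrite exprMn.
by rewrite RintegralZl//; [rewrite sqrtrM ?sqr_ge0// sqrtr_sqr|exact: sX.2].
Qed.

Lemma norm2N X : norm2 (fun w => - X w) = norm2 X.
Proof. by congr Num.sqrt; apply: eq_Rintegral => w _; rewrite sqrrN. Qed.

Lemma norm2BC X Y : norm2 (fun w => X w - Y w) = norm2 (fun w => Y w - X w).
Proof. by rewrite -norm2N; congr norm2; apply/funext => w; rewrite opprB. Qed.

Lemma norm2B X Y Z : sqint X -> sqint Y -> sqint Z ->
  norm2 (fun w => X w - Z w) <= norm2 (fun w => X w - Y w) + norm2 (fun w => Y w - Z w).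
Proof.
move=> sX sY sZ; apply: le_trans (norm2D (sqintB sX sY) (sqintB sY sZ)).
by rewrite (_ : (fun w => _) = (fun w => X w - Z w))//; apply/funext => w; rewrite addrA subrK.
Qed.

Lemma norm2_cvg I (F : set_system I) {FF : ProperFilter F} (X : I -> T -> R) Y :
  (\forall i \near F, sqint (X i)) -> sqint Y ->
  norm2 (fun w => X i w - Y w) @[i --> F] --> 0 ->
  norm2 (X i) @[i --> F] --> norm2 Y.
Proof.
move=> sX sY XY; apply/cvgrPdist_le => e e0.
move/cvgrPdist_le : XY => /(_ _ e0) XY.
near=> i.
have si : sqint (X i) by near: i.
have : `|0 - norm2 (fun w => X i w - Y w)| <= e by near: i.
rewrite sub0r normrN ger0_norm ?norm2_ge0// => le; apply: le_trans le.
have h1 : norm2 (X i) <= norm2 (fun w => X i w - Y w) + norm2 Y.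
  apply: le_trans (norm2D (sqintB si sY) sY).
  by rewrite (_ : (fun w => _) = X i)//; apply/funext => w; rewrite subrK.
have h2 : norm2 Y <= norm2 (fun w => X i w - Y w) + norm2 (X i).
  rewrite norm2BC; apply: le_trans (norm2D (sqintB sY si) si).
  by rewrite (_ : (fun w => _) = Y)//; apply/funext => w; rewrite subrK.
by rewrite ler_norml; apply/andP; split; lra.
Unshelve. all: by end_near. Qed.

(** Write [X1 X2 - Y1 Y2 = (X1 - Y1) X2 + Y1 (X2 - Y2)]; the norm of [X2] stays bounded because it
    converges. *)
Lemma Rint_mul_cvg I (F : set_system I) {FF : ProperFilter F} (X1 X2 : I -> T -> R) Y1 Y2 :
  (\forall i \near F, sqint (X1 i)) -> (\forall i \near F, sqint (X2 i)) ->
  sqint Y1 -> sqint Y2 ->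
  norm2 (fun w => X1 i w - Y1 w) @[i --> F] --> 0 ->
  norm2 (fun w => X2 i w - Y2 w) @[i --> F] --> 0 ->
  \int[m]_w (X1 i w * X2 i w) @[i --> F] --> \int[m]_w (Y1 w * Y2 w).
Proof.
move=> s1 s2 t1 t2 c1 c2; apply/subr_cvg0.
pose B i := norm2 (fun w => X1 i w - Y1 w) * norm2 (X2 i) +
  norm2 Y1 * norm2 (fun w => X2 i w - Y2 w).
have B0 : B i @[i --> F] --> 0.
  rewrite [X in _ --> X](_ : 0 = 0 * norm2 Y2 + norm2 Y1 * 0); last by rewrite mul0r mulr0 addr0.
  apply: cvgD; apply: cvgM => //; [exact: (norm2_cvg s2 t2 c2)|exact: cvg_cst].
apply: norm_cvg0; apply: (squeeze_cvgr _ (cvg_cst 0) B0).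
near=> i; rewrite normr_ge0 /=.
have u1 : sqint (X1 i) by near: i.
have u2 : sqint (X2 i) by near: i.
rewrite -RintegralB ?sqintM//.
have -> : \int[m]_w (X1 i w * X2 i w - Y1 w * Y2 w) =
    \int[m]_w ((X1 i w - Y1 w) * X2 i w + Y1 w * (X2 i w - Y2 w)).
  by apply: eq_Rintegral => w _; ring.
rewrite RintegralD//; [|exact: sqintM (sqintB _ _) _|exact: sqintM _ (sqintB _ _)].
by apply: le_trans (ler_normD _ _) (lerD _ _); apply: cauchy_schwarz => //; exact: sqintB.
Unshelve. all: by end_near. Qed.

End square_integrable.

(** * Almost everywhere convergence from summable bounds *)

Section ae_limits.
Context {R : realType} d {T : measurableType d}.
Variable m : {measure set T -> \bar R}.
Local Notation mint X := (m.-integrable [set: T] (EFin \o X)).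

(** By monotone convergence the sum of the series has a finite integral, so it is finite almost
    everywhere. *)
Lemma ae_cvg_series (f : nat -> T -> R) (b : nat -> R) :
  (forall n, mint (f n)) -> (forall n w, 0 <= f n w) ->
  (forall n, \int[m]_w f n w <= b n) -> cvgn (series b) ->
  {ae m, forall w, cvgn (series (f ^~ w))}.
Proof.
move=> fi f0 fb cb.
have mf n : measurable_fun [set: T] (fun w => (f n w)%:E).
  exact: measurable_int (fi n).
have f0' n w : [set: T] w -> (0 <= (f n w)%:E)%E by rewrite lee_fin.
have b0 n : 0 <= b n.
  by apply: le_trans (fb n); apply: Rintegral_ge0 => w _.
have fin : (\int[m]_w (\sum_(n <oo) (f n w)%:E) < +oo)%E.
  rewrite integral_nneseries//.
  have iE n : (\int[m]_w (f n w)%:E = (\int[m]_w f n w)%:E)%E.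
    by rewrite /Rintegral fineK//; exact: integrable_fin_num (fi n).
  apply: (@le_lt_trans _ _ (limn (series b))%:E); last exact: ltry.
  under eq_eseriesr do rewrite iE.
  apply: lime_le.
    by apply: is_cvg_nneseries => n _ _; rewrite lee_fin Rintegral_ge0.
  apply: nearW => n; rewrite sumEFin lee_fin.
  apply: (@le_trans _ _ (series b n)); first by apply: ler_sum => i _.
  apply: nondecreasing_cvgn_le => //.
  exact: nondecreasing_series.
have int : m.-integrable [set: T] (fun w => \sum_(n <oo) (f n w)%:E)%E.
  apply/integrableP; split.
    by apply: (ge0_emeasurable_sum (P := xpredT)) => //= k x _ _; rewrite lee_fin.
  rewrite (eq_integral (fun w => \sum_(n <oo) (f n w)%:E)%E)// => w _.
  by rewrite gee0_abs// nneseries_ge0// => n _ _; rewrite lee_fin.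
apply: filterS (integrable_ae measurableT int) => w /(_ I) finw.
apply: nondecreasing_is_cvgn; first exact: nondecreasing_series.
exists (fine (\sum_(n <oo) (f n w)%:E)%E) => _ [n _ <-].
rewrite -lee_fin fineK// -sumEFin.
by apply: nneseries_lim_ge => i _ _; rewrite lee_fin.
Qed.

Lemma cvgn_series_geometric_half : cvgn (series (fun n => 2^-1 ^+ n : R)).
Proof.
have := @is_cvg_geometric_series R 1 2^-1.
rewrite ger0_norm// invf_lt1// ltr1n => /(_ isT).
by congr (cvgn (series _)); apply/funext => n; rewrite /geometric /= mul1r.
Qed.

Lemma ae_cvg_sqr (X : nat -> T -> R) (Y : T -> R) :
  (forall n, sqint m (fun w => X n w - Y w)) ->
  (forall n, \int[m]_w ((X n w - Y w) ^+ 2) <= 2^-1 ^+ n) ->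
  {ae m, forall w, X n w @[n --> \oo] --> Y w}.
Proof.
move=> sX bX.
have := ae_cvg_series (fun n => (sX n).2) (fun n w => sqr_ge0 _) bX
  cvgn_series_geometric_half.
apply: filterS => w /cvg_series_cvg_0 c; apply/subr_cvg0.
apply/norm_cvg0P.
have -> : (fun n => `|X n w - Y w|) = Num.sqrt \o (fun n => (X n w - Y w) ^+ 2).
  by apply/funext => n /=; rewrite sqrtr_sqr.
by rewrite -(sqrtr0 R); apply: continuous_cvg => //; exact: sqrt_continuous.
Qed.
End ae_limits.

Section finite.
Context {R : realType} d {T : measurableType d}.
Variable m : {finite_measure set T -> \bar R}.
Local Notation mint X := (m.-integrable [set: T] (EFin \o X)).

Lemma mint_cst (k : R) : mint (fun=> k).
Proof. exact: finite_measure_integrable_cst. Qed.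

Lemma sqint_cst (k : R) : sqint m (fun=> k).
Proof. by split => //; exact: mint_cst. Qed.

Lemma sqint_mint X : sqint m X -> mint X.
Proof.
by move=> sX; have := sqintM sX (sqint_cst 1); apply: eq_integrable => // w _ /=; rewrite mulr1.
Qed.

Lemma Rint_abs_le_norm2 X : sqint m X ->
  \int[m]_w `|X w| <= norm2 m X * Num.sqrt (fine (m setT)).
Proof.
move=> [mX iX].
have sX : sqint m (fun w => `|X w|).
  by apply: (@sqint_le _ _ _ _ _ X) => //; [exact: measurableT_comp|move=> w; rewrite normr_id].
have := cauchy_schwarz sX (sqint_cst 1).
under eq_Rintegral do rewrite mulr1.
rewrite ger0_norm ?Rintegral_ge0//; congr (_ <= _ * _).
  by congr Num.sqrt; apply: eq_Rintegral => w _; rewrite real_normK ?num_real.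
congr Num.sqrt; under eq_Rintegral do rewrite expr1n.
by rewrite Rintegral_cst// mul1r.
Qed.

(** An upper limit, so that the result is measurable without any convergence hypothesis. Applied
    pointwise with a parameter, it later yields a version that is jointly measurable in the
    parameter and in [w]. *)
Definition limfun (X : nat -> T -> R) (w : T) : R :=
  fine (limn_esup (fun n => (X n w)%:E)).

Lemma limfunE (X : nat -> T -> R) w l : X n w @[n --> \oo] --> l -> limfun X w = l.
Proof.
move=> c; rewrite /limfun.
have c' : (X n w)%:E @[n --> \oo] --> l%:E.
  by apply: cvg_EFin => //; exact: nearW.
by have [_ ->] := cvg_limn_einf_sup c'.
Qed.

Lemma measurable_limfun (X : nat -> T -> R) :
  (forall n, measurable_fun [set: T] (X n)) -> measurable_fun [set: T] (limfun X).
Proof.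
move=> mX; apply: measurableT_comp => //.
by apply: measurable_fun_limn_esup => n; exact/measurable_EFinP.
Qed.

(** Fatou's lemma: only an upper bound on the integral of the limit is claimed, so no dominating
    function is needed. *)
Lemma fatou_bound (f : nat -> T -> R) (g : T -> R) (B : R) :
  (forall n, mint (f n)) -> (forall n w, 0 <= f n w) -> (forall w, 0 <= g w) ->
  measurable_fun [set: T] g ->
  (forall n, \int[m]_w f n w <= B) ->
  {ae m, forall w, f n w @[n --> \oo] --> g w} ->
  mint g /\ \int[m]_w g w <= B.
Proof.
move=> fi f0 g0 mg fB fg.
have mf n : measurable_fun [set: T] (fun w => (f n w)%:E).
  exact: measurable_int (fi n).
have mg' : measurable_fun [set: T] (fun w => (g w)%:E) by exact/measurable_EFinP.
have le : (\int[m]_w (g w)%:E <= B%:E)%E.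
  apply: (@le_trans _ _ (\int[m]_w limn_einf (fun n => (f n w)%:E))%E).
    apply: ae_ge0_le_integral => //.
    - by move=> w _; rewrite lee_fin.
    - move=> w _; rewrite limn_einf_lim; apply: lime_ge; first exact: is_cvg_einfs.
      by apply: nearW => n; apply: le_ereal_inf_tmp => _ [k _ <-]; rewrite lee_fin.
    - rewrite (_ : (fun w => _) = (fun w => - limn_esup (fun n => - (f n w)%:E))%E).
        apply: measurableT_comp => //.
        by apply: measurable_fun_limn_esup => n; exact: measurableT_comp.
      apply/funext => w; rewrite -limn_einfN; congr limn_einf.
      by apply/funext => n /=; rewrite opprK.
    apply: filterS fg => w c _.
    have c' : (f n w)%:E @[n --> \oo] --> (g w)%:E.
      by apply: cvg_EFin => //; exact: nearW.
    by have [-> _] := cvg_limn_einf_sup c'.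
  apply: le_trans (fatou _ _ _ _) _ => //.
    by move=> n w _; rewrite lee_fin.
  rewrite limn_einf_lim; apply: lime_le; first exact: is_cvg_einfs.
  apply: nearW => n; apply: (@le_trans _ _ (\int[m]_w (f n w)%:E)%E).
    by apply: ereal_inf_lbound; exists n => //=.
  rewrite -[leLHS]fineK ?lee_fin; first exact: fB.
  exact: integrable_fin_num (fi n).
have ig : mint g.
  apply/integrableP; split=> //.
  rewrite (eq_integral (fun w => (g w)%:E)) => [|w _]; last by rewrite gee0_abs ?lee_fin.
  exact: le_lt_trans le (ltry _).
split=> //; rewrite -lee_fin /Rintegral fineK//; exact: integrable_fin_num ig.
Qed.

(** Completeness with an explicit limit and an explicit rate. The distance to the limit is bounded
    by applying Fatou to [(X n - X (n+k))^2] as [k] grows, these being at most [(2 * 2^-n)^2] by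
    telescoping. *)
Lemma fast_cauchy (X : nat -> T -> R) :
  (forall n, sqint m (X n)) ->
  (forall n, norm2 m (fun w => X n.+1 w - X n w) <= 2^-1 ^+ n) ->
  sqint m (limfun X) /\
  (forall n, norm2 m (fun w => X n w - limfun X w) <= 2 * 2^-1 ^+ n).
Proof.
move=> sX bX.
have nX n k : norm2 m (fun w => X n w - X (n + k)%N w) <= 2 * 2^-1 ^+ n.
  suff : norm2 m (fun w => X n w - X (n + k)%N w) <=
      2 * 2^-1 ^+ n - 2 * 2^-1 ^+ (n + k).
    by move=> /le_trans; apply; rewrite gerBl mulr_ge0// exprn_ge0.
  elim: k => [|k IH].
    rewrite addn0 subrr /norm2 (_ : Rintegral _ _ _ = 0) ?sqrtr0//.
    under eq_Rintegral do rewrite subrr expr0n.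
    by rewrite /Rintegral integral0.
  apply: le_trans (norm2B (sX n) (sX (n + k)%N) (sX _)) _.
  have := bX (n + k)%N; rewrite norm2BC addnS exprS; lra.
(* On a finite measure the $L^1$ norms of the successive differences are bounded by a geometric
   sequence, so the telescoping series converges absolutely almost everywhere. *)
have ae : {ae m, forall w, X n w @[n --> \oo] --> limfun X w}.
  pose K := Num.sqrt (fine (m [set: T])).
  have := @ae_cvg_series _ _ _ m (fun n w => `|X n.+1 w - X n w|)
    (fun n => 2^-1 ^+ n * K) (fun n => integrable_norm (sqint_mint (sqintB (sX _) (sX _))))
    (fun n w => normr_ge0 _).
  have h1 n : \int[m]_w `|X n.+1 w - X n w| <= 2^-1 ^+ n * K.
    apply: le_trans (Rint_abs_le_norm2 (sqintB (sX _) (sX _))) _.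
    by rewrite ler_wpM2r ?sqrtr_ge0.
  have h2 : cvgn (series (fun n => 2^-1 ^+ n * K)).
    have := @is_cvg_geometric_series R K 2^-1.
    rewrite ger0_norm// invf_lt1// ltr1n => /(_ isT).
    by congr (cvgn (series _)); apply/funext => n; rewrite /geometric /= mulrC.
  move=> /(_ h1 h2); apply: filterS => w /normed_cvg c.
  have {}c : cvgn (fun n => X n w).
    have -> : (fun n => X n w) = (fun n => X 0%N w + series (fun n => X n.+1 w - X n w) n).
      by apply/funext => n; rewrite seriesEnat /= telescope_sumr// subrKC.
    by apply: is_cvgD => //; exact: is_cvg_cst.
  by rewrite (limfunE c).
have mL : measurable_fun [set: T] (limfun X) by apply: measurable_limfun => n; exact: (sX n).1.
have key n : mint (fun w => (X n w - limfun X w) ^+ 2) /\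
    \int[m]_w ((X n w - limfun X w) ^+ 2) <= (2 * 2^-1 ^+ n) ^+ 2.
  apply: (@fatou_bound (fun k w => (X n w - X (n + k)%N w) ^+ 2)).
  - by move=> k; exact: (sqintB (sX _) (sX _)).2.
  - by move=> k w; exact: sqr_ge0.
  - by move=> w; exact: sqr_ge0.
  - by apply: measurable_funX; apply: measurable_funB => //; exact: (sX n).1.
  - by move=> k; rewrite -norm2_sqr lerXn2r ?nnegrE ?norm2_ge0 ?mulr_ge0 ?exprn_ge0.
  - apply: filterS ae => w c.
    apply: (@continuous_cvg _ _ _ _ _ _ (fun x : R => x ^+ 2)); first exact: exprn_continuous.
    apply: cvgB; first exact: cvg_cst.
    rewrite (_ : (fun k => _) = (fun k => X (k + n)%N w)); first by rewrite (cvg_shiftn n (fun j => X j w)).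
    by apply/funext => k; rewrite addnC.
have sD n : sqint m (fun w => X n w - limfun X w).
  by split; [apply: measurable_funB => //; exact: (sX n).1|exact: (key n).1].
split.
  have := sqintB (sX 0%N) (sD 0%N); congr sqint.
  by apply/funext => w; ring.
move=> n; rewrite -ler_sqr ?nnegrE ?norm2_ge0 ?mulr_ge0 ?exprn_ge0// norm2_sqr.
exact: (key n).2.
Qed.
End finite.

Section L2_convergence.
Context {R : realType} d {T : measurableType d}.
Variable P : probability T R.

Lemma Lfun2P (X : T -> R) : X \in Lfun P 2%:E <-> sqint P X.
Proof.
split=> [XL|[mX iX]].
  split; last exact: Lfun2_integrable_sqr.
  by move: XL; rewrite inE => /andP[/[!inE]].
rewrite inE; apply/andP; split; rewrite inE//= /finite_norm unlock.
apply: poweR_lty; move/integrableP : iX => [_]; apply: le_lt_trans.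
rewrite le_eqVlt; apply/orP; left; apply/eqP; apply: eq_integral => w _ /=.
by rewrite powR_mulrn// -normrX.
Qed.

Lemma Lnorm2E (X : T -> R) : sqint P X ->
  Lnorm P 2%:E (fun w => (X w)%:E) = (norm2 P X)%:E.
Proof.
move=> [mX iX]; rewrite unlock /norm2.
rewrite (eq_integral (fun w => (X w ^+ 2)%:E)); last first.
  by move=> w _ /=; rewrite powR_mulrn// real_normK// num_real.
rewrite -[X in (X `^ _)%E]fineK; last exact: integrable_fin_num iX.
by rewrite poweR_EFin powR12_sqrt// Rint_sqr_ge0.
Qed.

(** Square integrability is only required eventually, because along [0^'+] nothing is known for
    large values of the parameter. *)
Lemma cvg_L2P I (F : set_system I) {FF : Filter F} (X : I -> T -> R) Y :
  (\forall i \near F, sqint P (fun w => X i w - Y w)) ->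
  cvg_L2 P F X Y <-> norm2 P (fun w => X i w - Y w) @[i --> F] --> 0.
Proof.
move=> sX; rewrite /cvg_L2.
have E : \forall i \near F, Lnorm P 2%:E (fun w => (X i w - Y w)%:E) =
    (norm2 P (fun w => X i w - Y w))%:E.
  by apply: filterS sX => i; exact: Lnorm2E.
split=> c.
- have : fine (Lnorm P 2%:E (fun w => (X i w - Y w)%:E)) @[i --> F] --> 0.
    exact: fine_cvg c.
  apply: cvg_trans; apply: near_eq_cvg.
  by apply: filterS E => i ->.
- have : (norm2 P (fun w => X i w - Y w))%:E @[i --> F] --> 0%:E.
    by apply: cvg_EFin => //; exact: nearW.
  apply: cvg_trans; apply: near_eq_cvg.
  by apply: filterS E => i ->.
Qed.
End L2_convergence.

(** * Laws of random variables *)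

Section dominated.
Context {R : realType} d {T : measurableType d}.
Variable m : {measure set T -> \bar R}.
Local Notation mint X := (m.-integrable [set: T] (EFin \o X)).

Lemma Rint_dominated (f : nat -> T -> R) (g h : T -> R) :
  (forall n, measurable_fun [set: T] (f n)) -> measurable_fun [set: T] g ->
  {ae m, forall w, f n w @[n --> \oo] --> g w} -> mint h ->
  (forall n w, `|f n w| <= h w) ->
  mint g /\ \int[m]_w f n w @[n --> \oo] --> \int[m]_w g w.
Proof.
move=> mf mg fg ih fh.
have fg' : {ae m, forall w, [set: T] w -> (f n w)%:E @[n --> \oo] --> (g w)%:E}.
  by apply: filterS fg => w c _; apply: cvg_EFin => //; exact: nearW.
have dom : {ae m, forall w n, [set: T] w -> (`|(f n w)%:E| <= (h w)%:E)%E}.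
  by apply: nearW => w n _; rewrite lee_fin.
have mf' n : measurable_fun [set: T] (EFin \o f n) by exact/measurable_EFinP.
have mg' : measurable_fun [set: T] (EFin \o g) by exact/measurable_EFinP.
have [ig _ c] := dominated_convergence measurableT mf' mg' fg' ih dom.
by split=> //; apply: fine_cvg; rewrite fineK//; exact: integrable_fin_num ig.
Qed.

Lemma norm2_dominated (X : nat -> T -> R) (Y g : T -> R) :
  (forall n, measurable_fun [set: T] (X n)) -> measurable_fun [set: T] Y ->
  {ae m, forall w, X n w @[n --> \oo] --> Y w} -> sqint m g ->
  (forall n w, `|X n w - Y w| <= `|g w|) ->
  norm2 m (fun w => X n w - Y w) @[n --> \oo] --> 0.
Proof.
move=> mX mY XY sg Xg.
have h1 n : measurable_fun [set: T] (fun w => (X n w - Y w) ^+ 2).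
  by apply: measurable_funX; exact: measurable_funB.
have h3 : {ae m, forall w, (X n w - Y w) ^+ 2 @[n --> \oo] --> (0 : R)}.
  apply: filterS XY => w c.
  rewrite (_ : 0 = (Y w - Y w) ^+ 2); last by rewrite subrr expr0n.
  apply: (@continuous_cvg _ _ _ _ _ _ (fun x : R => x ^+ 2)); first exact: exprn_continuous.
  by apply: cvgB => //; exact: cvg_cst.
have h5 n w : `|(X n w - Y w) ^+ 2| <= g w ^+ 2.
  by rewrite normrX -(real_normK (num_real (g w))) lerXn2r ?nnegrE.
have [_] := Rint_dominated h1 (@measurable_cst _ _ _ _ setT (0 : R)) h3 sg.2 h5.
move=> c; rewrite /norm2 -(sqrtr0 R).
apply: (@continuous_cvg _ _ _ _ _ _ (@Num.sqrt R)); first exact: sqrt_continuous.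
rewrite (_ : 0 = \int[m]_w (0 : R))//.
by rewrite /Rintegral integral0.
Qed.
End dominated.

Section law.
Context {R : realType} d {T : measurableType d} (P : {measure set T -> \bar R}).
Variables (nu : {measure set (measurableTypeR R) -> \bar R}) (X : T -> R).
Hypothesis mX : measurable_fun [set: T] X.
Hypothesis lX : forall A : set R, measurable A -> P (X @^-1` A) = nu A.

Let X' : T -> measurableTypeR R := X.

Let mX' : measurable_fun [set: T] X'. Proof. exact: mX. Qed.

Let PX : {measure set (measurableTypeR R) -> \bar R} :=
  measure_function_pushforward__canonical__measure_function_Measure P mX'.

Let ge0_law (f : R -> \bar R) : measurable_fun [set: R] f -> (forall x, 0 <= f x)%E ->
  (\int[P]_w f (X w) = \int[nu]_x f x)%E.
Proof.
move=> mf f0.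
have := @ge0_integral_pushforward _ _ _ _ _ X' mX' P setT f measurableT mf (fun y _ => f0 y).
rewrite preimage_setT => <-.
by apply: (@eq_measure_integral _ _ _ setT nu PX f) => A mA _; rewrite -lX.
Qed.

Lemma law_mint (f : R -> R) : measurable_fun [set: R] f ->
  P.-integrable [set: T] (EFin \o (f \o X)) <-> nu.-integrable [set: R] (EFin \o f).
Proof.
move=> mf.
have E : (\int[P]_w `|(f (X w))%:E| = \int[nu]_x `|(f x)%:E|)%E.
  rewrite (@ge0_law (fun x => `|(f x)%:E|)%E)//.
  by apply: measurableT_comp => //; exact/measurable_EFinP.
split=> /integrableP[_ h]; apply/integrableP; split.
- exact/measurable_EFinP.
- by rewrite -E.
- by apply/measurable_EFinP; exact: measurableT_comp.
- by rewrite E.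
Qed.

Lemma law_Rint (f : R -> R) : measurable_fun [set: R] f ->
  \int[P]_w f (X w) = \int[nu]_x f x.
Proof.
move=> mf; rewrite /Rintegral; congr fine.
rewrite integralE [RHS]integralE; congr (_ - _)%E.
- rewrite (eq_integral (fun w => (Num.max (f (X w)) 0)%:E)); last first.
    by move=> x _; rewrite funeposE EFin_max.
  rewrite (@ge0_law (fun x => (Num.max (f x) 0)%:E)).
  + by apply: eq_integral => x _; rewrite funeposE EFin_max.
  + by apply/measurable_EFinP; exact: measurable_funrpos.
  + by move=> x; rewrite lee_fin le_max lexx orbT.
- rewrite (eq_integral (fun w => (Num.max (- f (X w)) 0)%:E)); last first.
    by move=> x _; rewrite funenegE EFin_max.
  rewrite (@ge0_law (fun x => (Num.max (- f x) 0)%:E)).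
  + by apply: eq_integral => x _; rewrite funenegE EFin_max.
  + by apply/measurable_EFinP; exact: measurable_funrneg.
  + by move=> x; rewrite lee_fin le_max lexx orbT.
Qed.

Lemma law_sqint (f : R -> R) : measurable_fun [set: R] f ->
  sqint P (f \o X) <-> sqint nu f.
Proof.
move=> mf; have mf2 : measurable_fun [set: R] (fun x => f x ^+ 2) by exact: measurable_funX.
split=> -[_ i]; split=> //.
- exact/(law_mint mf2).
- exact: measurableT_comp.
- exact/(law_mint mf2).
Qed.
End law.

(** * Integration against a measure given by a density *)

Section density_measure.
Context {R : realType} d {T : measurableType d}.
Variables (mu nu : {measure set T -> \bar R}) (p : T -> R).
Hypotheses (p0 : forall x, 0 <= p x) (mp : measurable_fun [set: T] p).
Hypothesis nuE : forall A, measurable A -> nu A = (\int[mu]_(x in A) (p x)%:E)%E.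

Import HBNNSimple.

Let nnsfun_density (f : {nnsfun T >-> R}) :
  (\int[nu]_x (f x)%:E = \int[mu]_x (f x * p x)%:E)%E.
Proof.
under [LHS]eq_integral do rewrite fimfunE -fsumEFin//.
rewrite ge0_integral_fsum//; last 2 first.
  - by move=> r; exact/measurable_EFinP/measurableT_comp.
  - by move=> n x _; rewrite EFinM nnfun_muleindic_ge0.
under [RHS]eq_integral do rewrite fimfunE mulr_fsuml//= -fsumEFin//.
rewrite ge0_integral_fsum//; last 2 first.
  - move=> r; apply/measurable_EFinP; apply: measurable_funM => //.
    exact/measurableT_comp.
  - by move=> n x _; rewrite EFinM mule_ge0 ?lee_fin// -lee_fin EFinM nnfun_muleindic_ge0.
apply: eq_fsbigr => r _.
rewrite integralZl_indic_nnsfun// integral_indic// setIT nuE//.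
rewrite [RHS](eq_integral (fun x => (r%:E * (\1_(f @^-1` [set r]) x * p x)%:E)%E)); last first.
  by move=> x _; rewrite -EFinM mulrA.
have [r0|r0] := leP 0 r.
  rewrite ge0_integralZl//; last 2 first.
    - by apply/measurable_EFinP; apply: measurable_funM.
    - by move=> x _; rewrite lee_fin mulr_ge0.
  congr (_ * _)%E; rewrite integral_mkcond; apply: eq_integral => x _.
  by rewrite patchE indicE; case: ifPn => _; rewrite ?mul1r ?mul0r.
have -> : f @^-1` [set r] = set0.
  by apply/seteqP; split => // x /= fx; move: r0; rewrite -fx ltNge fun_ge0.
rewrite integral_set0 mule0; symmetry; apply: integral0_eq => x _.
by rewrite indic0 mul0r mule0.
Qed.

Lemma ge0_integral_density (f : T -> R) : measurable_fun [set: T] f ->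
  (forall x, 0 <= f x) ->
  (\int[nu]_x (f x)%:E = \int[mu]_x (f x * p x)%:E)%E.
Proof.
move=> mf f0; have mf' : measurable_fun [set: T] (EFin \o f) by exact/measurable_EFinP.
pose g := nnsfun_approx measurableT mf'.
have gf x : (g n x)%:E @[n --> \oo] --> (f x)%:E.
  by apply: cvg_nnsfun_approx => // y _; rewrite lee_fin.
have ndg x : {homo (fun n => g n x) : a b / (a <= b)%N >-> a <= b}.
  by move=> a b ab; have /lefP := nd_nnsfun_approx measurableT mf' ab; exact.
have c1 : (\int[nu]_x (g n x)%:E)%E @[n --> \oo] --> (\int[nu]_x (f x)%:E)%E.
  rewrite (eq_integral (fun x => limn (fun n => (g n x)%:E))); last first.
    by move=> x _; apply/esym/cvg_lim.
  apply: cvg_monotone_convergence => //.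
  - by move=> n; exact/measurable_EFinP.
  - by move=> n x _; rewrite lee_fin.
  - by move=> x _ a b ab; rewrite lee_fin ndg.
have c2 : (\int[mu]_x (g n x * p x)%:E)%E @[n --> \oo] --> (\int[mu]_x (f x * p x)%:E)%E.
  rewrite (eq_integral (fun x => limn (fun n => (g n x * p x)%:E))); last first.
    move=> x _; apply/esym/cvg_lim => //; under eq_fun do rewrite EFinM.
    by rewrite EFinM; apply: cvgeZr.
  apply: cvg_monotone_convergence => //.
  - by move=> n; apply/measurable_EFinP/measurable_funM.
  - by move=> n x _; rewrite lee_fin mulr_ge0.
  - by move=> x _ a b ab; rewrite lee_fin ler_wpM2r// ndg.
move: c1; under eq_fun do rewrite nnsfun_density.
by move=> c1; exact: cvg_unique c1 c2.
Qed.

Lemma mint_density (f : T -> R) : measurable_fun [set: T] f ->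
  nu.-integrable [set: T] (EFin \o f) <->
  mu.-integrable [set: T] (EFin \o (fun x => f x * p x)).
Proof.
move=> mf.
have E : (\int[nu]_x `|(f x)%:E| = \int[mu]_x `|(f x * p x)%:E|)%E.
  have := @ge0_integral_density (fun x => `|f x|); rewrite /= => -> //.
    by apply: eq_integral => x _ /=; rewrite normrM (ger0_norm (p0 x)).
  exact: measurableT_comp.
split=> /integrableP[_ h]; apply/integrableP; split.
- by apply/measurable_EFinP; exact: measurable_funM.
- by rewrite -E.
- exact/measurable_EFinP.
- by rewrite E.
Qed.

Lemma Rint_density (f : T -> R) : measurable_fun [set: T] f ->
  \int[nu]_x f x = \int[mu]_x (f x * p x).
Proof.
move=> mf; rewrite /Rintegral; congr fine.
rewrite integralE [RHS]integralE; congr (_ - _)%E.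
- have := @ge0_integral_density (fun x => Num.max (f x) 0).
  move=> /(_ (measurable_funrpos mf)) h.
  rewrite (eq_integral (fun x => (Num.max (f x) 0)%:E)); last first.
    by move=> x _; rewrite /= funeposE EFin_max.
  rewrite h; last by move=> x; rewrite le_max lexx orbT.
  by apply: eq_integral => x _; rewrite /= funeposE -EFin_max maxr_pMl// mul0r.
- have := @ge0_integral_density (fun x => Num.max (- f x) 0).
  move=> /(_ (measurable_funrneg mf)) h.
  rewrite (eq_integral (fun x => (Num.max (- f x) 0)%:E)); last first.
    by move=> x _; rewrite /= funenegE EFin_max.
  rewrite h; last by move=> x; rewrite le_max lexx orbT.
  by apply: eq_integral => x _; rewrite /= funenegE -EFinN -EFin_max maxr_pMl// mul0r mulNr.
Qed.
End density_measure.

(** * Moments of the normal law by integration by parts *)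

Section normal_moments.
Context {R : realType}.
Implicit Types s t x : R.
Local Notation mu := (@lebesgue_measure R).

Lemma exprn_le_expR n x : 0 <= x -> x ^+ n <= n`!%:R * expR x.
Proof.
case: n => [|n] x0; first by rewrite expr0 fact0 mul1r -(expR0 R) ler_expR.
have := expR_ge1Dxn n x0.
have f0 : 0 < n.+1`!%:R :> R by rewrite ltr0n fact_gt0.
move=> h; rewrite -ler_pdivrMl// mulrC; apply: le_trans h.
by rewrite lerDr.
Qed.

Lemma normr_exprn_le_expR n x : `|x ^+ n| <= n`!%:R * (expR x + expR (- x)).
Proof.
rewrite normrX; apply: le_trans (exprn_le_expR n (normr_ge0 x)) _.
rewrite ler_wpM2l//; case: (ger0P x) => _.
  by rewrite lerDl expR_ge0.
by rewrite lerDr expR_ge0.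
Qed.

Lemma normal_pdfE' m s x : s != 0 ->
  normal_pdf m s x = normal_peak s * expR (- (x - m) ^+ 2 / (s ^+ 2 *+ 2)).
Proof. by move=> s0; rewrite normal_pdfE. Qed.

(** Completing the square: exponential tilting of a normal density is a translation of it. All
    exponential moments, and then all powers, are integrable as a consequence. *)
Lemma expR_normal_pdf s t x : s != 0 ->
  expR (t * x) * normal_pdf 0 s x =
  expR (t ^+ 2 * s ^+ 2 / 2) * normal_pdf (s ^+ 2 * t) s x.
Proof.
move=> s0; rewrite !normal_pdfE'// mulrCA [RHS]mulrCA -!expRD; congr (_ * expR _).
by field.
Qed.

Section normal.
Variable s : R.
Hypothesis s0 : s != 0.
Let nu : probability (measurableTypeR R) R := normal_prob 0 s.
Let pdf := normal_pdf 0 s.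

Lemma normal_mint (f : R -> R) : measurable_fun [set: R] f ->
  nu.-integrable [set: R] (EFin \o f) <->
  mu.-integrable [set: R] (EFin \o (fun x => f x * pdf x)).
Proof.
by move=> mf; apply: (@mint_density _ _ _ mu nu pdf (normal_pdf_ge0 0 s) (measurable_normal_pdf 0 s)).
Qed.

Lemma normal_Rint (f : R -> R) : measurable_fun [set: R] f ->
  \int[nu]_x f x = \int[mu]_x (f x * pdf x).
Proof.
by move=> mf; apply: (@Rint_density _ _ _ mu nu pdf (normal_pdf_ge0 0 s) (measurable_normal_pdf 0 s)).
Qed.

Lemma normal_mint_expR t : nu.-integrable [set: R] (EFin \o (fun x => expR (t * x))).
Proof.
apply/normal_mint.
  by apply: measurableT_comp => //; exact: measurable_funM.
have := mintZ (expR (t ^+ 2 * s ^+ 2 / 2)) (integrable_normal_pdf (s ^+ 2 * t) s).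
by apply: eq_integrable => // x _ /=; rewrite expR_normal_pdf.
Qed.

Lemma normal_mint_exprn n : nu.-integrable [set: R] (EFin \o (fun x => x ^+ n)).
Proof.
have h := mintZ n`!%:R (mintD (normal_mint_expR 1) (normal_mint_expR (-1))).
apply: le_integrableT h.
  exact: measurable_funX.
move=> x; rewrite mul1r mulN1r; apply: le_trans (normr_exprn_le_expR _ _) _.
exact: ler_norm.
Qed.

(** [F n] is an antiderivative of [f n], because the normal density satisfies [s^2 pdf' = - x pdf].
    That [f n] has integral 0 over the line is the moment recursion. *)
Let F n x := - s ^+ 2 * (x ^+ n * pdf x).
Let f n x := (x ^+ n.+1 - n%:R * s ^+ 2 * x ^+ n.-1) * pdf x.

Let derF n x : is_derive x 1 (F n) (f n x).
Proof.
pose k := - (s ^+ 2 *+ 2)^-1.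
pose c := - s ^+ 2 * normal_peak s.
have FE : F n = (fun y => c * (y ^+ n * expR (k * y ^+ 2))).
  apply/funext => y; rewrite /F /pdf normal_pdfE' // subr0 /c.
  by rewrite (_ : - y ^+ 2 / (s ^+ 2 *+ 2) = k * y ^+ 2); [ring|rewrite /k !mulNr mulrC].
have d1 j : is_derive x 1 (fun y : R => y ^+ j) (j%:R * x ^+ j.-1).
  apply: DeriveDef; first exact: exprn_derivable.
  by rewrite exp_derive /GRing.scale /= mulr1.
have d2 : is_derive x 1 (fun y => k * y ^+ 2) (k * (2 * x)).
  by apply: (is_derive_eq (is_deriveZ k (d1 2%N))).
have d3 := @is_derive1_comp _ expR (fun y => k * y ^+ 2) x _ _ (is_derive_expR (k * x ^+ 2)) d2.
have d4 := is_deriveZ c (is_deriveM (d1 n) d3).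
rewrite FE; apply: (is_derive_eq d4).
rewrite /f /pdf normal_pdfE' // subr0.
rewrite (_ : - x ^+ 2 / (s ^+ 2 *+ 2) = k * x ^+ 2); last by rewrite /k !mulNr mulrC.
rewrite /GRing.scale /= /c; set e := expR _; set p := normal_peak s.
case: n {d1 d4 FE} => [|n]; rewrite /= /k ?mul0r ?expr0 ?expr1; first by field.
by rewrite !exprS; field.
Qed.

Let cf n : continuous (f n).
Proof.
move=> x; apply: cvgM; last by apply: continuous_normal_pdf.
apply: cvgB; first exact: exprn_continuous.
apply: cvgM; first exact: cvg_cst.
exact: exprn_continuous.
Qed.

Let cF n : continuous (F n).
Proof.
by move=> x; apply: differentiable_continuous; apply/derivable1_diffP; have [] := derF n x.
Qed.

Let mf n : measurable_fun [set: R] (f n).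
Proof. exact: continuous_measurable_fun. Qed.

Let intf n : mu.-integrable [set: R] (EFin \o f n).
Proof.
apply/(@normal_mint (fun x => x ^+ n.+1 - n%:R * s ^+ 2 * x ^+ n.-1)).
  by apply: measurable_funB; [|apply: measurable_funM]; try exact: measurable_funX.
apply: mintB; first exact: normal_mint_exprn.
by apply: mintZ; exact: normal_mint_exprn.
Qed.

(** The factor [|x|] is absorbed into the power, and a power is at most a multiple of
    [exp x + exp (- x)]; tilted by either exponential, the density stays bounded. *)
Let F_le n x : 0 < `|x| -> `|F n x| <=
   s ^+ 2 * n.+1`!%:R * (2 * (expR (s ^+ 2 / 2) * normal_peak s)) / `|x|.
Proof.
move=> x0; rewrite ler_pdivlMr// /F normrM normrN -mulrA.
rewrite (ger0_norm (sqr_ge0 s)) -mulrA ler_wpM2l ?sqr_ge0//.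
rewrite normrM [X in _ * X * _]ger0_norm ?normal_pdf_ge0// mulrAC -normrM -exprSr.
have p0 := normal_pdf_ge0 0 s x.
apply: (le_trans (ler_wpM2r p0 (normr_exprn_le_expR _ _))).
rewrite -mulrA ler_wpM2l// mulrDl mulr_natl mulr2n.
have h t : t ^+ 2 = 1 -> expR (t * x) * pdf x <= expR (s ^+ 2 / 2) * normal_peak s.
  move=> t1; rewrite expR_normal_pdf// t1 mul1r ler_wpM2l ?expR_ge0//.
  exact: normal_pdf_ub.
apply: lerD; first by have := h 1; rewrite mul1r expr1n; exact.
by have := h (-1); rewrite mulN1r sqrrN expr1n; exact.
Qed.

(** Over [[- N.+1, N.+1]] the integral is a difference of boundary values of [F n], of order [1/N]
    by [F_le]. *)
Let Rint_f n : \int[mu]_x f n x = 0.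
Proof.
pose I N : set R := `[- N.+1%:R, N.+1%:R]%classic.
have mI N : measurable (I N) by exact: measurable_itv.
have mind N : measurable_fun [set: R] (\1_(I N) : R -> R) by exact: measurable_indic.
have h1 N : \int[mu]_x (f n x * \1_(I N) x) = F n N.+1%:R - F n (- N.+1%:R).
  have lt : - N.+1%:R < N.+1%:R :> R by rewrite -subr_gt0 opprK -natrD ltr0n.
  have h := @continuous_FTC2 R (f n) (F n) _ _ lt (continuous_subspaceT (@cf n)).
  have hd : derivable_oo_LRcontinuous (F n) (- N.+1%:R) N.+1%:R.
    split.
    + by move=> y _; have [] := derF n y.
    + by apply: cvg_at_right_filter; exact: cF.
    + by apply: cvg_at_left_filter; exact: cF.
  have he : {in `]- N.+1%:R, N.+1%:R[, (F n)^`()%classic =1 f n}.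
    by move=> y _; rewrite derive1E; have [_ ->] := derF n y.
  have {h hd he} h := h hd he.
  rewrite -EFinB in h; rewrite /Rintegral -[RHS]/(fine (_)%:E) -h; congr fine.
  rewrite [RHS]integral_mkcond; apply: eq_integral => x _.
  by rewrite patchE indicE; case: ifPn => _; rewrite ?mulr1 ?mulr0.
have [_ c] : mu.-integrable [set: R] (EFin \o f n) /\
    \int[mu]_x (f n x * \1_(I N) x) @[N --> \oo] --> \int[mu]_x f n x.
  apply: (@Rint_dominated _ _ _ mu _ _ (fun x => `|f n x|)) => //.
  - by move=> N; apply: measurable_funM; [exact: mf|exact: mind].
  - exact: mf.
  - apply: nearW => x; apply: cvg_near_cst.
    near=> N; rewrite indicE mem_set ?mulr1// /I /= in_itv/= -ler_norml.
    apply: (@le_trans _ _ N%:R); last by rewrite ler_nat.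
    by near: N; exact: nbhs_infty_ger.
  - exact: integrable_norm.
  - by move=> N x; rewrite normrM indicE; case: (_ \in _); rewrite ?normr1 ?mulr1// normr0 mulr0.
have {}c : (F n N.+1%:R - F n (- N.+1%:R)) @[N --> \oo] --> \int[mu]_x f n x.
  by apply: cvg_trans c; apply: near_eq_cvg; apply: nearW => N; rewrite h1.
apply: (cvg_unique _ c) => //.
pose K := s ^+ 2 * n.+1`!%:R * (2 * (expR (s ^+ 2 / 2) * normal_peak s)).
have cK : 2 * K * N.+1%:R^-1 @[N --> \oo] --> (0 : R).
  rewrite -[X in _ --> X](mulr0 (2 * K)); apply: cvgM; first exact: cvg_cst.
  exact: cvg_harmonic.
apply: norm_cvg0; apply: (squeeze_cvgr _ (cvg_cst 0) cK).
apply: nearW => N; rewrite normr_ge0 /=.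
have N0 : 0 < `|N.+1%:R : R| by rewrite normr_gt0.
apply: le_trans (ler_normB _ _) _.
have N1 : `|N.+1%:R| = N.+1%:R :> R by rewrite ger0_norm.
have N2 : `|- N.+1%:R| = N.+1%:R :> R by rewrite normrN.
have b1 := F_le n N0; rewrite N1 in b1.
have N0' : 0 < `|- N.+1%:R : R| by rewrite N2 -N1.
have b2 := F_le n N0'; rewrite N2 in b2.
by rewrite -mulrA mulr_natl mulr2n; apply: lerD.
Unshelve. all: by end_near. Qed.

Lemma normal_moment n : \int[nu]_x (x ^+ n) = gmom n * s ^+ n.
Proof.
have rec k : \int[nu]_x (x ^+ k.+1) = k%:R * s ^+ 2 * \int[nu]_x (x ^+ k.-1).
  apply/eqP; rewrite -subr_eq0 -RintegralZl//; last exact: normal_mint_exprn.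
  rewrite -RintegralB//; last 2 first.
  - exact: normal_mint_exprn.
  - by apply: mintZ; exact: normal_mint_exprn.
  rewrite normal_Rint; first by rewrite Rint_f.
  by apply: measurable_funB; [|apply: measurable_funM]; try exact: measurable_funX.
elim/ltn_ind: n => -[|[|n]] IH.
- under eq_Rintegral do rewrite expr0.
  rewrite Rintegral_cst// mul1r gmom0 mul1r expr0 -[RHS]/(fine 1%E); congr fine.
  exact: probability_setT.
- by rewrite rec !mul0r.
- by rewrite rec IH// gmomSS !exprS; ring.
Qed.
End normal.
End normal_moments.

(** * Density of the polynomials in the Gaussian space *)

Section polynomial_density.
Context {R : realType}.
Variable nu : probability (measurableTypeR R) R.
Hypothesis expint : forall t : R, nu.-integrable [set: R] (EFin \o (fun x => expR (t * x))).
Implicit Types (s phi : R -> R) (p : {poly R}).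

Local Notation mint X := (nu.-integrable [set: R] (EFin \o X)).

Lemma measurable_horner p : measurable_fun [set: R] (horner p).
Proof. by apply: continuous_measurable_fun; exact: continuous_horner. Qed.

Lemma mint_horner_expR p t : mint (fun x => p.[x] * expR (t * x)).
Proof.
have mono n : mint (fun x => x ^+ n * expR (t * x)).
  have h := mintZ n`!%:R (mintD (expint (t + 1)) (expint (t - 1))).
  apply: le_integrableT h.
    apply: measurable_funM; first exact: measurable_funX.
    by apply: measurableT_comp => //; exact: measurable_funM.
  move=> x; rewrite normrM (ger0_norm (expR_ge0 _)).
  apply: le_trans (ler_wpM2r (expR_ge0 _) (normr_exprn_le_expR _ _)) _.
  rewrite -mulrA (_ : (expR x + expR (- x)) * expR (t * x) = expR ((t + 1) * x) + expR ((t - 1) * x)).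
    exact: ler_norm.
  by rewrite mulrDl -!expRD; congr (expR _ + expR _); ring.
have := @mint_sum _ _ _ nu _ (index_enum _) (fun (i : 'I_(size p)) x => p`_i * (x ^+ i * expR (t * x))).
move=> /(_ (fun i => mintZ _ (mono _))); apply: eq_integrable => // x _ /=.
by rewrite horner_coef mulr_suml; congr EFin; apply: eq_bigr => i _; rewrite mulrA.
Qed.

Lemma mint_horner p : mint (horner p).
Proof.
by have := mint_horner_expR p 0; apply: eq_integrable => // x _ /=; rewrite mul0r expR0 mulr1.
Qed.

Lemma sqint_horner p : sqint nu (horner p).
Proof.
split; first exact: measurable_horner.
by have := mint_horner (p ^+ 2); apply: eq_integrable => // x _ /=; rewrite horner_exp.
Qed.

Definition polyapprox s := sqint nu s /\
  forall e, 0 < e -> exists p, norm2 nu (fun x => s x - p.[x]) <= e.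

(** Bounded functions whose multiplication preserves the closure of the polynomials. They form an
    algebra closed under bounded pointwise limits; once it contains the indicators of all Borel
    sets, applying these to the polynomial 1 brings every simple function into the closure. *)
Definition multiplier phi := [/\ measurable_fun [set: R] phi,
  exists M, forall x, `|phi x| <= M &
  forall s, polyapprox s -> polyapprox (fun x => phi x * s x)].

Lemma polyapprox_horner p : polyapprox (horner p).
Proof.
split; first exact: sqint_horner.
move=> e e0; exists p; rewrite /norm2 (_ : Rintegral _ _ _ = 0) ?sqrtr0 ?ltW//.
by under eq_Rintegral do rewrite subrr expr0n; rewrite /Rintegral integral0.
Qed.

Lemma polyapprox_closed s : sqint nu s ->
  (forall e, 0 < e -> exists2 s', polyapprox s' & norm2 nu (fun x => s x - s' x) <= e) ->
  polyapprox s.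
Proof.
move=> ss h; split=> // e e0; have e2 : 0 < e / 2 by rewrite divr_gt0.
have [s' [ss' /(_ _ e2)[p hp]] hs'] := h _ e2; exists p.
by apply: le_trans (norm2B ss ss' (sqint_horner p)) _; lra.
Qed.

Lemma polyapproxD s1 s2 : polyapprox s1 -> polyapprox s2 -> polyapprox (fun x => s1 x + s2 x).
Proof.
move=> [i1 h1] [i2 h2]; split=> [|e e0]; first exact: sqintD.
have e2 : 0 < e / 2 by rewrite divr_gt0.
have [p1 hp1] := h1 _ e2; have [p2 hp2] := h2 _ e2; exists (p1 + p2).
have := norm2D (sqintB i1 (sqint_horner p1)) (sqintB i2 (sqint_horner p2)).
rewrite (_ : (fun w => _) = (fun x => s1 x + s2 x - (p1 + p2).[x])); last first.
  by apply/funext => x; rewrite hornerD; ring.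
by move=> /le_trans; apply; lra.
Qed.

Lemma polyapproxZ k s : polyapprox s -> polyapprox (fun x => k * s x).
Proof.
move=> [i h]; split=> [|e e0]; first exact: sqintZ.
have k0 : 0 < `|k| + 1 by rewrite ltr_pwDr.
have [p hp] := h (e / (`|k| + 1)) (divr_gt0 e0 k0); exists (k *: p).
rewrite (_ : (fun w => _) = (fun x => k * (s x - p.[x]))); last first.
  by apply/funext => x; rewrite hornerZ; ring.
rewrite norm2Z; last exact: sqintB i (sqint_horner p).
apply: le_trans (ler_wpM2l (normr_ge0 k) hp) _.
by rewrite mulrCA ger_pMr// ler_pdivrMr// mul1r lerDl.
Qed.

Lemma sqintMb phi s (M : R) : measurable_fun [set: R] phi ->
  (forall x, `|phi x| <= M) -> sqint nu s -> sqint nu (fun x => phi x * s x).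
Proof.
move=> mphi phiM ss; apply: (@sqint_le _ _ _ nu _ (fun x => M * s x)); last exact: sqintZ.
  by apply: measurable_funM => //; exact: ss.1.
move=> x; rewrite !normrM ler_wpM2r//; exact: le_trans (phiM x) (ler_norm _).
Qed.

(** Multiplication by a bounded function is continuous in norm, so it suffices to test it on
    polynomials. [M + 1] replaces [M] to have a positive divisor. *)
Lemma multiplier_poly phi M : measurable_fun [set: R] phi ->
  (forall x, `|phi x| <= M) ->
  (forall p, polyapprox (fun x => phi x * p.[x])) -> multiplier phi.
Proof.
move=> mphi phiM h; split=> //; first by exists M.
move=> s [ss hs]; apply: polyapprox_closed; first exact: sqintMb phiM ss.
move=> e e0; have M0 : 0 < M + 1 by rewrite ltr_wpDl// (le_trans _ (phiM 0)).
have [p hp] := hs (e / (M + 1)) (divr_gt0 e0 M0); exists (fun x => phi x * p.[x]) => //.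
have sB := sqintB ss (sqint_horner p).
rewrite (_ : (fun w => _) = (fun x => phi x * (s x - p.[x]))); last first.
  by apply/funext => x; ring.
apply: (@le_trans _ _ (norm2 nu (fun x => (M + 1) * (s x - p.[x])))).
  rewrite /norm2 ler_wsqrtr//; apply: le_Rintegral => //.
  - exact: (sqintMb mphi phiM sB).2.
  - exact: (sqintZ _ sB).2.
  - move=> x _; rewrite -real_normK ?num_real// -[leRHS]real_normK ?num_real//.
    rewrite lerXn2r ?nnegrE// !normrM ler_wpM2r// (ger0_norm (ltW M0)).
    by apply: le_trans (phiM x) _; rewrite lerDl.
rewrite norm2Z// (ger0_norm (ltW M0)).
by apply: le_trans (ler_wpM2l (ltW M0) hp) _; rewrite mulrCA divff ?mulr1// gt_eqF.
Qed.

(** Dominated convergence with dominating function [2 M |s|]. *)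
Lemma multiplier_lim (phi_ : nat -> R -> R) phi (M : R) :
  (forall n, multiplier (phi_ n)) -> (forall n x, `|phi_ n x| <= M) ->
  (forall x, phi_ n x @[n --> \oo] --> phi x) -> multiplier phi.
Proof.
move=> mn nM c.
have mphi : measurable_fun [set: R] phi.
  by apply: (@measurable_fun_cvg _ _ _ _ phi_) => // n; have [] := mn n.
have phiM x : `|phi x| <= M.
  have cx : `|phi_ n x| @[n --> \oo] --> `|phi x| by apply: cvg_norm.
  rewrite -(cvg_lim _ cx)//; apply: limr_le; first by apply/cvg_ex; exists `|phi x|.
  exact: nearW.
split=> //; first by exists M.
move=> s sV; have [ss _] := sV; apply: polyapprox_closed; first exact: sqintMb phiM ss.
move=> e e0.
have : norm2 nu (fun x => phi_ n x * s x - phi x * s x) @[n --> \oo] --> 0.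
  apply: (@norm2_dominated _ _ _ nu _ _ (fun x => 2 * M * s x)).
  - by move=> n; apply: measurable_funM; [have [] := mn n|exact: ss.1].
  - by apply: measurable_funM; [exact: mphi|exact: ss.1].
  - by apply: nearW => x; apply: cvgM; [exact: c|exact: cvg_cst].
  - exact: sqintZ.
  - move=> n x; rewrite -mulrBl !normrM ler_wpM2r//.
    apply: le_trans (ler_normB _ _) _.
    have := nM n x; have := phiM x; have := normr_ge0 (phi x); have := ler_norm M; rewrite normr_nat; lra.
move=> /cvgrPdist_le /(_ _ e0)[n _ /(_ n (leqnn _))].
rewrite sub0r normrN ger0_norm ?norm2_ge0// norm2BC => h.
by exists (fun x => phi_ n x * s x) => //; have [_ _] := mn n; exact.
Qed.

Lemma multiplier_cst k : multiplier (fun=> k).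
Proof.
apply: (@multiplier_poly _ `|k|) => // p.
by apply: polyapproxZ; exact: polyapprox_horner.
Qed.

Lemma multiplierD phi psi : multiplier phi -> multiplier psi ->
  multiplier (fun x => phi x + psi x).
Proof.
move=> [m1 [M1 b1] h1] [m2 [M2 b2] h2]; split.
- exact: measurable_funD.
- by exists (M1 + M2) => x; apply: le_trans (ler_normD _ _) (lerD _ _).
- move=> s sV; have := polyapproxD (h1 _ sV) (h2 _ sV).
  by congr polyapprox; apply/funext => x; ring.
Qed.

Lemma multiplierM phi psi : multiplier phi -> multiplier psi ->
  multiplier (fun x => phi x * psi x).
Proof.
move=> [m1 [M1 b1] h1] [m2 [M2 b2] h2]; split.
- exact: measurable_funM.
- by exists (M1 * M2) => x; rewrite normrM ler_pM.
- move=> s sV; have := h1 _ (h2 _ sV).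
  by congr polyapprox; apply/funext => x; ring.
Qed.

Lemma multiplierZ k phi : multiplier phi -> multiplier (fun x => k * phi x).
Proof. exact/multiplierM/multiplier_cst. Qed.

Lemma multiplierB phi psi : multiplier phi -> multiplier psi ->
  multiplier (fun x => phi x - psi x).
Proof.
move=> h1 h2; have := multiplierD h1 (multiplierZ (-1) h2).
by congr multiplier; apply/funext => x; rewrite mulN1r.
Qed.

Lemma multiplierX phi n : multiplier phi -> multiplier (fun x => phi x ^+ n).
Proof.
move=> h; elim: n => [|n IH]; first exact: multiplier_cst.
by under eq_fun do rewrite exprS; exact: multiplierM.
Qed.

(* The iteration [r <- r + (y^2 - r^2) / 2] increases from 0 to [|y|]. *)
Lemma multiplier_norm phi : multiplier phi -> (forall x, `|phi x| <= 1) ->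
  multiplier (fun x => `|phi x|).
Proof.
move=> mphi phi1.
pose r := fix r n x := if n is n'.+1 then r n' x + 2^-1 * (phi x ^+ 2 - r n' x ^+ 2) else 0.
have bnd n x : 0 <= r n x <= `|phi x| /\ `|phi x| - r n x <= `|phi x| * (1 - `|phi x| / 2) ^+ n.
  elim: n => [|n [/andP[r0 r1] r2]] /=.
    by rewrite lexx normr_ge0 subr0 expr0 mulr1.
  have y1 := phi1 x; have y0 := normr_ge0 (phi x).
  rewrite -(real_normK (num_real (phi x))).
  set y := `|phi x| in y1 y0 r0 r1 r2 *; set q := r n x in r0 r1 r2 *.
  set z := (1 - y / 2) ^+ n in r2 *.
  (* The error is multiplied by [1 - (y + q) / 2], which lies between 0 and [1 - y / 2] since
     [0 <= q <= y <= 1]; this keeps it nonnegative and makes it decay geometrically where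
     [y > 0]. *)
  have E : y - (q + 2^-1 * (y ^+ 2 - q ^+ 2)) = (y - q) * (1 - (y + q) / 2) by field.
  have h1 : 0 <= y - (q + 2^-1 * (y ^+ 2 - q ^+ 2)) by rewrite E mulr_ge0//; lra.
  split; first by apply/andP; split; [nra|lra].
  rewrite E exprSr mulrA -/z.
  apply: (@le_trans _ _ ((y - q) * (1 - y / 2))).
    by apply: ler_wpM2l; lra.
  by apply: ler_wpM2r => //; lra.
apply: (@multiplier_lim r _ 1).
- elim=> [|n IH]; first exact: multiplier_cst.
  apply: multiplierD => //; apply: multiplierZ; apply: multiplierB; exact: multiplierX.
- move=> n x; have [/andP[h0 h1] _] := bnd n x.
  by rewrite ger0_norm// (le_trans h1).
- move=> x; apply/cvgrPdist_le => e e0.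
  have [y0|y0] := eqVneq (phi x) 0.
    apply: nearW => n; have [/andP[h0 h1] _] := bnd n x.
    by rewrite y0 normr0 in h1 *; rewrite sub0r normrN ger0_norm// (le_trans h1)// ltW.
  have yp : 0 < `|phi x| by rewrite normr_gt0.
  have /cvgrPdist_le /(_ _ e0) : `|phi x| * (1 - `|phi x| / 2) ^+ n @[n --> \oo] --> (0 : R).
    rewrite -[X in _ --> X](mulr0 `|phi x|); apply: cvgM; first exact: cvg_cst.
    have h : 0 <= 1 - `|phi x| / 2 by have := phi1 x; lra.
    by apply: cvg_expr; rewrite ger0_norm//; lra.
  apply: filterS => n; have [/andP[h0 h1] h2] := bnd n x.
  rewrite sub0r normrN ger0_norm => [h|]; last first.
    by rewrite mulr_ge0// exprn_ge0//; have := phi1 x; lra.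
  by rewrite ger0_norm ?subr_ge0//; apply: le_trans h2 h.
Qed.

(** With [y] the positive part of [phi], which takes values in [[0, 1]], the functions
    [1 - (1 - y)^n] increase to the indicator of [phi > 0]. *)
Lemma multiplier_gt0 phi : multiplier phi -> (forall x, `|phi x| <= 1) ->
  multiplier (fun x => (0 < phi x)%R%:R).
Proof.
move=> mphi phi1; pose y x := 2^-1 * (`|phi x| + phi x).
have my : multiplier y.
  by apply: multiplierZ; apply: multiplierD => //; exact: multiplier_norm.
have y01 x : 0 <= y x <= 1.
  have := phi1 x; rewrite /y; case: (ger0P (phi x)) => ? ?; apply/andP; split; lra.
apply: (@multiplier_lim (fun n x => 1 - (1 - y x) ^+ n) _ 1).
- move=> n; apply: multiplierB; first exact: multiplier_cst.
  by apply: multiplierX; apply: multiplierB => //; exact: multiplier_cst.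
- move=> n x; have /andP[h0 h1] := y01 x.
  have h2 : 0 <= (1 - y x) ^+ n by rewrite exprn_ge0// subr_ge0.
  have h3 : (1 - y x) ^+ n <= 1 by rewrite exprn_ile1// ?subr_ge0// lerBlDr lerDl.
  by rewrite ger0_norm; lra.
- move=> x; case: ltP => h.
    rewrite -[X in _ --> X](subr0 1); apply: cvgB; first exact: cvg_cst.
    apply: cvg_expr; have /andP[h0 h1] := y01 x.
    rewrite ger0_norm ?subr_ge0// ltrBlDr ltrDl /y gtr0_norm//; lra.
  apply: cvg_near_cst; apply: nearW => n.
  by rewrite /y ler0_norm// addNr mulr0 subr0 expr1n subrr.
Qed.

Let sin_poly t u (N : nat) : {poly R} := \sum_(n < N)
  ((odd n)%:R * (-1) ^+ n.-1./2 / n`!%:R) *: (t *: ('X - u%:P)) ^+ n.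

Let sin_polyE t u N x : (sin_poly t u N).[x] = series (sin_coeff (t * (x - u))) N.
Proof.
rewrite /sin_poly horner_sum seriesEord; apply: eq_bigr => n _.
rewrite hornerZ horner_exp hornerZ !hornerE /sin_coeff /=; ring.
Qed.

(** Absolute values turn the Taylor sum into one for [exp |t (x - u)|]. The bound does not depend on
    [N], so it can serve as a dominating function. *)
Let sin_poly_le t u N x : `|(sin_poly t u N).[x]| <=
  expR (`|t| * `|u|) * (expR (t * x) + expR (- t * x)).
Proof.
rewrite sin_polyE; apply: (@le_trans _ _ (expR `|t * (x - u)|)).
  apply: (@le_trans _ _ (series (exp_coeff `|t * (x - u)|) N)).
    rewrite !seriesEord; apply: le_trans (ler_norm_sum _ _ _) _.
    apply: ler_sum => i _; rewrite /sin_coeff /exp_coeff /= normrM normrM normrX.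
    rewrite [X in _ * X <= _]ger0_norm ?invr_ge0// ler_wpM2r ?invr_ge0//.
    rewrite -[leRHS]mul1r ler_wpM2r// normrM normrX normrN1 expr1n mulr1.
    by case: (odd i); rewrite ?normr1 ?normr0.
  apply: nondecreasing_cvgn_le; last exact: is_cvg_series_exp_coeff.
  by apply: nondecreasing_series => n _ _; exact: exp_coeff_ge0.
apply: (@le_trans _ _ (expR (`|t| * `|u| + `|t * x|))).
  rewrite ler_expR mulrBr; apply: le_trans (ler_normB _ _) _.
  by rewrite (normrM t u) addrC.
rewrite expRD ler_wpM2l ?expR_ge0//; case: (ger0P (t * x)) => _.
  by rewrite lerDl expR_ge0.
by rewrite mulNr lerDr expR_ge0.
Qed.

(** The Taylor polynomials of the sine, multiplied by [p], converge in norm to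
    [sin (t (x - u)) p(x)]. This is where exponential moments are decisive: they make the dominating
    function square integrable. *)
Lemma multiplier_sin t u : multiplier (fun x => sin (t * (x - u))).
Proof.
have msin : measurable_fun [set: R] (fun x => sin (t * (x - u))).
  apply: continuous_measurable_fun => x.
  apply: (@continuous_comp _ _ _ (fun x => t * (x - u)) sin); last exact: continuous_sin.
  by apply: cvgM; [exact: cvg_cst|apply: cvgB; [exact: cvg_id|exact: cvg_cst]].
apply: (@multiplier_poly _ 1) => //; first by move=> x; exact: sin_max.
move=> p; apply: polyapprox_closed.
  by apply: (@sqintMb _ _ 1) => //; [move=> x; exact: sin_max|exact: sqint_horner].
move=> e e0; pose c := expR (`|t| * `|u|).
have : norm2 nu (fun x => (sin_poly t u n).[x] * p.[x] - sin (t * (x - u)) * p.[x])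
    @[n --> \oo] --> 0.
  apply: (@norm2_dominated _ _ _ nu _ _ (fun x => (c + 1) * (expR (t * x) + expR (- t * x) + 1) * p.[x])).
  - move=> n; apply: measurable_funM; exact: measurable_horner.
  - by apply: measurable_funM; [exact: msin|exact: measurable_horner].
  - apply: nearW => x; apply: cvgM; last exact: cvg_cst.
    under eq_fun do rewrite sin_polyE.
    by rewrite sin.unlock; exact: is_cvg_series_sin_coeff.
  - have E t' : sqint nu (fun x => p.[x] * expR (t' * x)).
      split.
        apply: measurable_funM; first exact: measurable_horner.
        by apply: measurableT_comp => //; exact: measurable_funM.
      have := mint_horner_expR (p ^+ 2) (2 * t').
      apply: eq_integrable => // x _ /=.
      by rewrite horner_exp exprMn -(expRM_natl 2) mulrA.
    have := sqintZ (c + 1) (sqintD (sqintD (E t) (E (- t))) (sqint_horner p)).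
    by congr sqint; apply/funext => x; ring.
  - move=> n x; rewrite -mulrBl !normrM ler_wpM2r//.
    apply: le_trans (ler_normB _ _) _.
    have := sin_poly_le t u n x; have := sin_max (t * (x - u)).
    have c0 : 0 <= c by exact: expR_ge0.
    have a0 := expR_ge0 (t * x); have b0 := expR_ge0 (- t * x).
    rewrite [`|c + 1|]ger0_norm; last by lra.
    rewrite [`|_ + 1|]ger0_norm; last by lra.
    rewrite -/c; nra.
move=> /cvgrPdist_le /(_ _ e0)[n _ /(_ n (leqnn _))].
rewrite sub0r normrN ger0_norm ?norm2_ge0// norm2BC => h.
exists (fun x => (sin_poly t u n).[x] * p.[x]) => //.
have := polyapprox_horner (sin_poly t u n * p); congr polyapprox.
by apply/funext => x; rewrite hornerM.
Qed.

(** At frequency [1 / (n+1)] the argument of the sine eventually lies in []-pi, pi[], so the sign of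
    the sine becomes that of [x - u]. *)
Lemma multiplier_ray u : multiplier \1_(`]u, +oo[%classic : set R).
Proof.
apply: (@multiplier_lim (fun n x => (0 < sin (n.+1%:R^-1 * (x - u)))%R%:R) _ 1).
- move=> n; apply: (@multiplier_gt0 (fun x => sin (n.+1%:R^-1 * (x - u)))).
    exact: multiplier_sin.
  by move=> x; exact: sin_max.
- by move=> n x; rewrite normr_nat lern1 leq_b1.
- move=> x; apply: cvg_near_cst.
  have pi0 := pi_gt0 R.
  have key (y : R) : 0 < y -> \forall n \near \oo, 0 < sin (n.+1%:R^-1 * y).
    move=> y0; near=> n; apply: sin_gt0_pi; apply/andP; split.
      by rewrite mulr_gt0.
    rewrite mulrC ltr_pdivrMr// -ltr_pdivrMl// mulrC.
    apply: (@lt_le_trans _ _ n%:R); last by rewrite ler_nat.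
    by near: n; exact: nbhs_infty_gtr.
  have [xu|xu|->] := ltgtP x u.
  + have := key (u - x); rewrite subr_gt0 => /(_ xu); apply: filterS => n h.
    rewrite -[x - u]opprB mulrN sinN indicE memNset/= ?in_itv/= ?andbT; last by rewrite ltNge (ltW xu).
    by rewrite ltNge oppr_le0 (ltW h).
  + have := key (x - u); rewrite subr_gt0 => /(_ xu); apply: filterS => n h.
    by rewrite h indicE mem_set//= in_itv/= xu.
  + by apply: nearW => n; rewrite subrr mulr0 sin0 ltxx indicE memNset//= in_itv/= ltxx.
Unshelve. all: by end_near. Qed.

(** The sets whose indicator is a multiplier form a sigma-algebra, and it contains the open rays,
    which generate the Borel sets. *)
Lemma multiplier_indic (B : set R) : measurable B -> multiplier (\1_B : R -> R).
Proof.
have -> : @measurable _ R = (@RGenOInfty.G R).-sigma.-measurable.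
  exact: RGenOInfty.measurableE.
apply: (@smallest_sub _ _ _ [set B | multiplier (\1_B : R -> R)]); last first.
  by move=> _ [u ->]; exact: multiplier_ray.
have mC (A : set R) : multiplier \1_A -> multiplier \1_(~` A).
  move=> mA; have := multiplierB (multiplier_cst 1) mA; congr multiplier.
  by apply/funext => x; rewrite indicC indicE; case: (x \in A); rewrite ?subrr ?subr0.
split.
- by have := multiplier_cst 0; congr multiplier; apply/funext => x; rewrite indic0.
- by move=> A /= mA; rewrite setTD; exact: mC.
- move=> A mA /=.
  (* Inclusion-exclusion in product form: the indicator of a finite union as an element of the
     algebra. *)
  pose psi n x := 1 - \prod_(i < n) (1 - \1_(A i) x) : R.
  apply: (@multiplier_lim psi _ 1).
  + move=> n; apply: multiplierB; first exact: multiplier_cst.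
    elim: n => [|n IH].
      by under eq_fun do rewrite big_ord0; exact: multiplier_cst.
    under eq_fun do rewrite big_ord_recr/=; apply: multiplierM => //.
    by apply: multiplierB; [exact: multiplier_cst|exact: mA].
  + move=> n x; have : 0 <= (\prod_(i < n) (1 - \1_(A i) x) : R) <= 1.
      elim/big_ind: _ => [|a b /andP[? ?] /andP[? ?]|i _]; first by rewrite ler01 lexx.
        by rewrite mulr_ge0//= mulr_ile1.
      by rewrite indicE; case: (_ \in _); rewrite ?subrr ?subr0 ?lexx ?ler01.
    by rewrite /psi; move: (\prod_(i < n) _) => q /andP[h0 h1]; rewrite ger0_norm; lra.
  + move=> x; apply: cvg_near_cst; rewrite indicE.
    case: (boolP (x \in \bigcup_k A k)) => [/set_mem[k _ Akx]|].
      near=> n; rewrite /psi.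
      have kn : (k < n)%N by near: n; exact: nbhs_infty_gt.
      by rewrite (bigD1 (Ordinal kn))//= indicE mem_set// subrr mul0r subr0.
    rewrite notin_setE => nA; apply: nearW => n; rewrite /psi big1 ?subrr// => i _.
    by rewrite indicE memNset ?subr0// => Ai; apply: nA; exists i.
Unshelve. all: by end_near. Qed.

Import HBNNSimple.

(** A nonnegative [s] is the limit in norm of simple functions below it, and a simple function is a
    multiplier applied to the polynomial 1. The general case splits into positive and negative
    parts. *)
Theorem polynomial_dense s : sqint nu s -> polyapprox s.
Proof.
suff pos s' : sqint nu s' -> (forall x, 0 <= s' x) -> polyapprox s'.
  move=> ss; pose sp x := Num.max (s x) 0; pose sn x := Num.max (- s x) 0.
  have ms := ss.1.
  have h1 : polyapprox sp.
    apply: pos; last by move=> x; rewrite le_max lexx orbT.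
    apply: sqint_le ss; first exact: measurable_funrpos.
    by move=> x; rewrite /sp ger0_norm ?le_max ?lexx ?orbT// ge_max ler_norm normr_ge0.
  have h2 : polyapprox sn.
    apply: pos; last by move=> x; rewrite le_max lexx orbT.
    apply: sqint_le ss; first exact: measurable_funrneg.
    by move=> x; rewrite /sn ger0_norm ?le_max ?lexx ?orbT// ge_max -normrN ler_norm normr_ge0.
  have := polyapproxD h1 (polyapproxZ (-1) h2); congr polyapprox.
  apply/funext => x; rewrite /sp /sn mulN1r.
  by case: (leP (s x) 0) => h; [rewrite max_l ?oppr_ge0// opprK add0r|rewrite max_r ?oppr_le0 ?ltW// subr0].
move=> ss s0; have ms := ss.1.
have ms' : measurable_fun [set: R] (EFin \o s') by exact/measurable_EFinP.
pose g := nnsfun_approx measurableT ms'.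
have gs x : (g n x)%:E @[n --> \oo] --> (s' x)%:E.
  by apply: cvg_nnsfun_approx => // y _; rewrite lee_fin.
have gs' x : g n x @[n --> \oo] --> s' x by have /fine_cvg := gs x.
have ndg x : nondecreasing_seq (fun n => g n x).
  by move=> a b ab; have /lefP := nd_nnsfun_approx measurableT ms' ab; exact.
have mg n : measurable_fun [set: R] (g n) by [].
have gle n x : g n x <= s' x.
  rewrite -(cvg_lim _ (gs' x))//; apply: nondecreasing_cvgn_le => //.
  by apply/cvg_ex; exists (s' x); exact: gs'.
apply: polyapprox_closed => // e e0.
have : norm2 nu (fun x => g n x - s' x) @[n --> \oo] --> 0.
  apply: (@norm2_dominated _ _ _ nu _ _ s') => //.
  - by apply: nearW => x; exact: gs'.
  - move=> n x; rewrite distrC ger0_norm ?subr_ge0//.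
    by rewrite (ger0_norm (s0 x)) gerBl.
move=> /cvgrPdist_le /(_ _ e0)[n _ /(_ n (leqnn _))].
rewrite sub0r normrN ger0_norm ?norm2_ge0// norm2BC => h.
exists (g n) => //.
have : multiplier (g n).
  rewrite (_ : (g n : R -> R) = (fun x => \sum_(y <- finmap.enum_fset (fset_set (range (g n)))) y * \1_(g n @^-1` [set y]) x)).
    elim: (finmap.enum_fset _) => [|y l IH].
      by under eq_fun do rewrite big_nil; exact: multiplier_cst.
    under eq_fun do rewrite big_cons; apply: multiplierD => //.
    by apply: multiplierZ; apply: multiplier_indic.
  by apply/funext => x; rewrite fimfunE fsbig_finite.
move=> [_ _ /(_ _ (polyapprox_horner 1))]; congr polyapprox.
by apply/funext => x; rewrite hornerC mulr1.
Qed.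
End polynomial_density.

(** * Random integrals *)

Section random_integral.
Context {R : realType} d1 d2 {S : measurableType d1} {T : measurableType d2}.
Variables (m : {finite_measure set S -> \bar R}) (P : probability T R).
Variable D : S * T -> R.
Hypothesis mD : measurable_fun [set: S * T] D.
Hypothesis iD : (m \x P)%E.-integrable [set: S * T] (EFin \o (fun z => D z ^+ 2)).

Definition rint w := \int[m]_x D (x, w).

Let mDw w : measurable_fun [set: S] (fun x => D (x, w)).
Proof. exact: (measurableT_comp mD (measurable_pair2 w)). Qed.

Lemma integrable_rint_weight (W : T -> R) : sqint P W ->
  (m \x P)%E.-integrable [set: S * T] (EFin \o (fun z => W z.2 * D z)).
Proof.
move=> [mW iW].
have mW' : measurable_fun [set: S * T] (fun z => W z.2) by exact: measurableT_comp.
have iW2 : (m \x P)%E.-integrable [set: S * T] (EFin \o (fun z => W z.2 ^+ 2)).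
  apply/integrable12ltyP.
    by apply/measurable_EFinP; exact: measurable_funX.
  rewrite (eq_integral (cst (\int[P]_w `|(W w ^+ 2)%:E|)%E)) => [|x _]//.
  rewrite integral_cst//; move/integrableP : iW => [_ iW].
  rewrite -[X in (X * _)%E]fineK ?ge0_fin_numE ?integral_ge0//.
  rewrite -[X in (_ * X)%E]fineK ?fin_num_measure//.
  by rewrite -EFinM ltry.
apply: le_integrableT (mintD iW2 iD).
  exact: measurable_funM.
move=> z; rewrite [leRHS]ger0_norm ?addr_ge0 ?sqr_ge0// ler_norml; apply/andP; split; nra.
Qed.

Let iD1 : (m \x P)%E.-integrable [set: S * T] (EFin \o D).
Proof.
have := integrable_rint_weight (sqint_cst P 1).
by apply: eq_integrable => // z _ /=; rewrite mul1r.
Qed.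

Lemma measurable_rint : measurable_fun [set: T] rint.
Proof.
by apply: measurableT_comp => //; exact: (measurable_fubini_G iD1).
Qed.

(** For fixed [w], Cauchy-Schwarz in [x] against the constant 1 bounds [rint w ^ 2] by the mass
    times the integral of [D^2]; then integrate in [w]. *)
Lemma sqint_rint : sqint P rint /\
  \int[P]_w (rint w ^+ 2) <= (fine (m setT) + 1) * \int[(m \x P)%E]_z (D z ^+ 2).
Proof.
(* The added 1 makes [M] positive, so that at the [w] where the integral of [D^2] is infinite the
   bound reads [+oo] instead of [0 * +oo]. *)
set M := fine (m setT) + 1.
have M0 : 0 < M by rewrite ltr_wpDl// fine_ge0.
have le w : ((rint w ^+ 2)%:E <= M%:E * \int[m]_x (D (x, w) ^+ 2)%:E)%E.
  have i0 : (0 <= \int[m]_x (D (x, w) ^+ 2)%:E)%E.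
    by apply: integral_ge0 => x _; rewrite lee_fin sqr_ge0.
  have [fin|] := ltP (\int[m]_x (D (x, w) ^+ 2)%:E)%E +oo%E; last first.
    by rewrite leye_eq => /eqP ->; rewrite gt0_muley ?lte_fin// leey.
  have sD : sqint m (fun x => D (x, w)).
    split; first exact: mDw.
    apply/integrableP; split; first by apply/measurable_EFinP; exact: measurable_funX.
    by under eq_integral do rewrite /= ger0_norm ?sqr_ge0//.
  rewrite -[X in (_ * X)%E]fineK ?ge0_fin_numE// -EFinM lee_fin.
  have := cauchy_schwarz sD (sqint_cst m 1).
  have -> : \int[m]_x (D (x, w) * 1) = rint w.
    by apply: eq_Rintegral => x _; rewrite mulr1.
  move=> h; have : rint w ^+ 2 <= (norm2 m (fun x => D (x, w)) * norm2 m (fun=> 1)) ^+ 2.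
    by rewrite -real_normK ?num_real// lerXn2r ?nnegrE ?mulr_ge0 ?norm2_ge0.
  rewrite exprMn !norm2_sqr; under [X in _ <= _ * X -> _]eq_Rintegral do rewrite expr1n.
  rewrite Rintegral_cst// mul1r => /le_trans; apply.
  rewrite mulrC ler_wpM2r ?Rint_sqr_ge0// /M lerDl ler01//.
have mG : measurable_fun [set: T] (fun w => \int[m]_x (D (x, w) ^+ 2)%:E)%E.
  exact: (measurable_fubini_G iD).
have mr2 : measurable_fun [set: T] (fun w => (rint w ^+ 2)%:E).
  by apply/measurable_EFinP; apply: measurable_funX; exact: measurable_rint.
have Efin := integrable_fin_num measurableT iD.
have key : (\int[P]_w (rint w ^+ 2)%:E <= (M * \int[(m \x P)%E]_z (D z ^+ 2))%:E)%E.
  apply: (@le_trans _ _ (\int[P]_w (M%:E * \int[m]_x (D (x, w) ^+ 2)%:E))%E).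
    apply: ge0_le_integral => //.
    - by move=> w _; rewrite lee_fin sqr_ge0.
    - by apply: emeasurable_funM.
  rewrite ge0_integralZl//; last 2 first.
  - by move=> w _; apply: integral_ge0 => x _; rewrite lee_fin sqr_ge0.
  - by rewrite lee_fin ltW.
  rewrite EFinM lee_wpmul2l ?lee_fin ?(ltW M0)//.
  by rewrite (integral21_prod_meas1 iD) /Rintegral fineK.
have sr : sqint P rint.
  split; first exact: measurable_rint.
  apply/integrableP; split=> //.
  under eq_integral do rewrite /= ger0_norm ?sqr_ge0//.
  exact: le_lt_trans key (ltry _).
split=> //; rewrite -lee_fin /Rintegral fineK//; exact: integrable_fin_num sr.2.
Qed.

(** Fubini, with a random weight [W] that is merely square integrable. Since [W] may itself be a
    random integral, two uses of the lemma give mixed second moments. *)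
Lemma Rint_rint_weight (W : T -> R) : sqint P W ->
  m.-integrable [set: S] (EFin \o (fun x => \int[P]_w (W w * D (x, w)))) /\
  \int[P]_w (W w * rint w) = \int[m]_x \int[P]_w (W w * D (x, w)).
Proof.
move=> sW; have iWD := integrable_rint_weight sW.
have ae1 := ae_integrable1 iWD; have ae2 := ae_integrable2 iWD.
have iF := integrable_fubini_F iWD.
have mF : measurable_fun [set: S] (fun x => \int[P]_w (W w * D (x, w))).
  by apply: measurableT_comp => //; exact: (measurable_fubini_F iWD).
(* The real inner integral differs from the extended one only at those [x] where the latter is not
   finite, a null set. *)
have E1 : ae_eq m setT (fubini_F P (EFin \o (fun z => W z.2 * D z)))
    (EFin \o (fun x => \int[P]_w (W w * D (x, w)))).
  apply: filterS ae1 => x ix _ /=; rewrite /fubini_F /Rintegral fineK//.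
  exact: integrable_fin_num ix.
have iR : m.-integrable [set: S] (EFin \o (fun x => \int[P]_w (W w * D (x, w)))).
  apply/integrableP; split; first exact/measurable_EFinP.
  move/integrableP : iF => [mF' iF]; apply: le_lt_trans iF.
  rewrite le_eqVlt; apply/orP; left; apply/eqP; apply: ae_eq_integral => //.
  - by apply: measurableT_comp => //; exact/measurable_EFinP.
  - exact: measurableT_comp.
  - by apply: filterS E1 => x /= h _; rewrite h.
split=> //; rewrite {2}/Rintegral.
rewrite (ae_eq_integral (fubini_F P (EFin \o (fun z => W z.2 * D z))))//; last 3 first.
- exact/measurable_EFinP.
- exact: (measurable_fubini_F iWD).
- by apply: filterS E1 => x /= h hx; rewrite h.
rewrite (integral12_prod_meas1 iWD) -(integral21_prod_meas1 iWD) /Rintegral; congr fine.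
apply: ae_eq_integral => //.
- by apply/measurable_EFinP; apply: measurable_funM; [exact: sW.1|exact: measurable_rint].
- exact: (measurable_fubini_G iWD).
have ae3 := ae_integrable2 iD1.
apply: filterS2 ae2 ae3 => w i1 i2 _; rewrite /fubini_G /=.
rewrite EFinM; under [RHS]eq_integral do rewrite EFinM.
by rewrite integralZl// /rint /Rintegral fineK//; exact: integrable_fin_num i2.
Qed.

End random_integral.

Section random_integral_sup.
Context {R : realType} d1 d2 {S : measurableType d1} {T : measurableType d2}.
Variables (m : {finite_measure set S -> \bar R}) (P : probability T R).

Lemma integrable_sqr_prod (D : S * T -> R) (M : R) :
  measurable_fun [set: S * T] D ->
  (forall x, sqint P (fun w => D (x, w))) ->
  (forall x, \int[P]_w (D (x, w) ^+ 2) <= M) ->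
  (m \x P)%E.-integrable [set: S * T] (EFin \o (fun z => D z ^+ 2)).
Proof.
move=> mD sD DM; apply/integrable12ltyP.
  by apply/measurable_EFinP; exact: measurable_funX.
apply: (@le_lt_trans _ _ (\int[m]_x (cst M%:E x))%E).
  apply: ge0_le_integral => //.
  - by move=> x _; exact: integral_ge0.
  - apply: (@measurable_fun_fubini_tonelli_F _ _ _ _ _ P (fun z => `|(D z ^+ 2)%:E|)%E) => //.
    by apply: measurableT_comp => //; apply/measurable_EFinP; exact: measurable_funX.
  - move=> x _; under eq_integral do rewrite /= ger0_norm ?sqr_ge0//.
    rewrite -[leLHS]fineK ?lee_fin; first exact: DM.
    exact: integrable_fin_num (sD x).2.
rewrite integral_cst// -[X in (_ * X)%E]fineK ?fin_num_measure//.
by rewrite -EFinM ltry.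
Qed.

(** [Rint_rint_weight] is used with [W] the random integral itself, then for each [x] with [W] the
    section of [D] at [x]. *)
Lemma Rint_rint2 (D : S * T -> R) (M : R) :
  measurable_fun [set: S * T] D ->
  (forall x, sqint P (fun w => D (x, w))) ->
  (forall x, \int[P]_w (D (x, w) ^+ 2) <= M) ->
  sqint P (rint m D) /\
  \int[P]_w (rint m D w ^+ 2) = \int[m]_x \int[m]_y \int[P]_w (D (x, w) * D (y, w)).
Proof.
move=> mD sD DM; have iD := integrable_sqr_prod mD sD DM.
have [sr _] := sqint_rint mD iD; split=> //.
under eq_Rintegral do rewrite expr2.
rewrite (Rint_rint_weight mD iD sr).2; apply: eq_Rintegral => x _.
under eq_Rintegral do rewrite mulrC.
by rewrite (Rint_rint_weight mD iD (sD x)).2.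
Qed.
End random_integral_sup.

(** * Jointly Gaussian variables *)

Section gaussian_moments.
Context {R : realType} d {T : measurableType d}.
Variable P : probability T R.
Local Notation mint X := (P.-integrable [set: T] (EFin \o X)).
Implicit Types X Y : T -> R.

Lemma Rint_prob_cst (k : R) : \int[P]_w k = k.
Proof.
rewrite Rintegral_cst// -[RHS]mulr1; congr (_ * _).
by rewrite -[RHS]/(fine 1%E); congr fine; exact: probability_setT.
Qed.

(** Gaussianity of a centered variable through its moments. This covers variance 0 without a special
    case, passes to $L^2$ limits, and is all that the Hermite identities use. *)
Definition gauss X := [/\ measurable_fun [set: T] X,
  forall n, mint (fun w => X w ^+ n) &
  forall n, \int[P]_w (X w ^+ n) = gmom n * (\int[P]_w (X w ^+ 2)) ^+ n./2].

Definition gauss2 X Y := forall a b : R, gauss (fun w => a * X w + b * Y w).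

Lemma gauss_sqint X : gauss X -> sqint P X.
Proof. by case=> mX iX _; split. Qed.

Lemma gauss2C X Y : gauss2 X Y -> gauss2 Y X.
Proof. by move=> h a b; have := h b a; congr gauss; apply/funext => w; rewrite addrC. Qed.

Lemma gauss2l X Y : gauss2 X Y -> gauss X.
Proof. by move=> /(_ 1 0); congr gauss; apply/funext => w; rewrite mul1r mul0r addr0. Qed.

Lemma gauss2r X Y : gauss2 X Y -> gauss Y.
Proof. by move=> /gauss2C /gauss2l. Qed.

Lemma gauss_moments (s : R) X : measurable_fun [set: T] X ->
  (forall n, mint (fun w => X w ^+ n)) ->
  (forall n, \int[P]_w (X w ^+ n) = gmom n * s ^+ n) ->
  gauss X /\ \int[P]_w (X w ^+ 2) = s ^+ 2.
Proof.
move=> mX iX XE; have X2 : \int[P]_w (X w ^+ 2) = s ^+ 2.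
  by rewrite XE gmomSS gmom0 !mul1r.
split=> //; split=> // n; rewrite XE X2; have [on|en] := boolP (odd n).
  by rewrite gmom_odd ?mul0r.
rewrite -exprM mul2n; congr (_ * _ ^+ _).
by rewrite -[LHS]odd_double_half (negbTE en).
Qed.

(** The law itself is kept only for unit variance, the case in which a function that is not a
    polynomial is composed with the variable. *)
Lemma centered_gaussian_gauss X : centered_gaussian P X ->
  gauss X /\ (\int[P]_w (X w ^+ 2) = 1 ->
    forall A : set R, measurable A -> P (X @^-1` A) = normal_prob 0 1 A).
Proof.
move=> [mX [s s0 lX]].
have mpow n : measurable_fun [set: R] (fun x : R => x ^+ n) by exact: measurable_funX.
have [z|nz] := eqVneq s 0.
  pose nu : {measure set (measurableTypeR R) -> \bar R} := \d_(0 : measurableTypeR R).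
  have l0 (A : set R) : measurable A -> P (X @^-1` A) = nu A.
    by move=> mA; rewrite lX// z eqxx.
  have inu n : nu.-integrable [set: R] (EFin \o (fun x => x ^+ n)).
    apply/integrableP; split; first by apply/measurable_EFinP; exact: mpow.
    rewrite integral_dirac//; last first.
      by apply: measurableT_comp => //; apply/measurable_EFinP; exact: mpow.
    by rewrite diracT mul1e ltry.
  have [] := @gauss_moments 0 X mX.
  - by move=> n; apply/(law_mint mX l0 (mpow n)).
  - move=> n; rewrite (law_Rint mX l0 (mpow n)) /Rintegral integral_dirac//; last first.
      by apply/measurable_EFinP; exact: mpow.
    rewrite diracT mul1e /=; case: n => [|n]; first by rewrite gmom0 mul1r.
    by rewrite expr0n /= mulr0.
  move=> gX X2; split=> //; rewrite X2 expr0n /= => /eqP.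
  by rewrite eq_sym oner_eq0.
have l1 (A : set R) : measurable A -> P (X @^-1` A) = normal_prob 0 s A.
  by move=> mA; rewrite lX// (negbTE nz).
have [] := @gauss_moments s X mX.
- by move=> n; apply/(law_mint mX l1 (mpow n)); exact: normal_mint_exprn.
- by move=> n; rewrite (law_Rint mX l1 (mpow n)) normal_moment.
move=> gX X2; split=> //; rewrite X2 => /eqP; rewrite sqrp_eq1// => /eqP s1 A mA.
by rewrite l1// s1.
Qed.

Lemma wick_power_he X k w : gauss X ->
  wick_power P X k w = (he (\int[P]_w (X w ^+ 2)) k).[X w].
Proof.
move=> [mX iX XE]; rewrite /wick_power horner_he; apply: eq_bigr => j _.
rewrite expectation.unlock -[X in _ * X * _]/(\int[P]_w' (X w' ^+ j.*2)) XE doubleK.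
by rewrite -!mulrA.
Qed.

Section mixed.
Variables X Y : T -> R.
Hypothesis gXY : gauss2 X Y.

Let mX : measurable_fun [set: T] X. Proof. by have [] := gauss2l gXY. Qed.
Let mY : measurable_fun [set: T] Y. Proof. by have [] := gauss2r gXY. Qed.

Lemma gauss2_mint i j : mint (fun w => X w ^+ i * Y w ^+ j).
Proof.
have [_ iX _] := gauss2l gXY; have [_ iY _] := gauss2r gXY.
apply: le_integrableT (mintD (iX (i * 2)%N) (iY (j * 2)%N)).
  by apply: measurable_funM; exact: measurable_funX.
move=> w; rewrite !exprM [leRHS]ger0_norm ?addr_ge0 ?sqr_ge0// ler_norml.
by apply/andP; split; nra.
Qed.

Lemma gauss2_mint_poly (p q : {poly R}) : mint (fun w => p.[X w] * q.[Y w]).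
Proof.
have h := @mint_sum _ _ _ P _ (index_enum _) (fun (i : 'I_(size p)) w =>
  \sum_(j < size q) (p`_i * q`_j) * (X w ^+ i * Y w ^+ j)).
have {}h := h (fun i => mint_sum _ (fun j => mintZ _ (gauss2_mint _ _))).
apply: eq_integrable h => // w _ /=; congr EFin.
rewrite !horner_coef mulr_suml; apply: eq_bigr => i _.
by rewrite mulr_sumr; apply: eq_bigr => j _; ring.
Qed.

(** The bilinear form [E p(X) q(Y)] satisfies the moment hypothesis of [he_orthogonal], because
    [t X + Y] is Gaussian with variance [v t^2 + 2 c t + u]. *)
Lemma he_gauss2 k l :
  \int[P]_w ((he (\int[P]_w (X w ^+ 2)) k).[X w] * (he (\int[P]_w (Y w ^+ 2)) l).[Y w])
  = (k == l)%:R * k`!%:R * (\int[P]_w (X w * Y w)) ^+ k.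
Proof.
set v := \int[P]_w (X w ^+ 2); set u := \int[P]_w (Y w ^+ 2).
set c := \int[P]_w (X w * Y w).
pose L p q := \int[P]_w (p.[X w] * q.[Y w]).
have iL := gauss2_mint_poly.
apply: (@he_orthogonal _ L v c u).
- move=> a p q r; rewrite /L -RintegralZl// -RintegralD//; last exact: mintZ.
  by apply: eq_Rintegral => w _; rewrite hornerD hornerZ; ring.
- move=> a p q r; rewrite /L -RintegralZl// -RintegralD//; last exact: mintZ.
  by apply: eq_Rintegral => w _; rewrite hornerD hornerZ; ring.
- rewrite /L; under eq_Rintegral do rewrite !hornerC mulr1.
  exact: Rint_prob_cst.
- move=> n t; have [_ _ /(_ n) gE] := gXY t 1.
  have <- : \int[P]_w ((t * X w + 1 * Y w) ^+ 2) = v * t ^+ 2 + 2 * c * t + u.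
    rewrite Rint_sqrD; last 2 first.
    - by apply: sqintZ; exact: gauss_sqint (gauss2l gXY).
    - by apply: sqintZ; exact: gauss_sqint (gauss2r gXY).
    have [_ iX _] := gauss2l gXY.
    rewrite (_ : \int[P]_w ((t * X w) ^+ 2) = t ^+ 2 * v); last first.
      by rewrite /v -RintegralZl//; apply: eq_Rintegral => w _; rewrite exprMn.
    rewrite (_ : \int[P]_w ((1 * Y w) ^+ 2) = u); last first.
      by apply: eq_Rintegral => w _; rewrite mul1r.
    rewrite (_ : \int[P]_w ((t * X w) * (1 * Y w)) = t * c); last first.
      rewrite /c -RintegralZl//; last by have := gauss2_mint 1 1.
      by apply: eq_Rintegral => w _; rewrite mul1r mulrA.
    ring.
  rewrite -gE.
  transitivity (\int[P]_w (\sum_(b < n.+1) ('C(n, b)%:R * t ^+ b) * (X w ^+ b * Y w ^+ (n - b)))).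
    rewrite Rint_sum => [|b]; last by apply: mintZ; exact: gauss2_mint.
    apply: eq_bigr => b _; rewrite RintegralZl//; last exact: gauss2_mint.
    rewrite mulrAC; congr (_ * _); apply: eq_Rintegral => w _.
    by rewrite !hornerXn.
  apply: eq_Rintegral => w _; rewrite mul1r addrC exprDn; apply: eq_bigr => b _.
  rewrite exprMn -mulr_natr; ring.
Qed.
End mixed.

(** Convergence in $L^2$ controls only second moments directly. The higher ones converge because,
    for Gaussian variables, all moments are bounded in terms of the variances, which stay bounded
    along the sequence. *)
Lemma gauss_lim (X : nat -> T -> R) Y : (forall n, gauss (X n)) -> sqint P Y ->
  norm2 P (fun w => X n w - Y w) @[n --> \oo] --> 0 -> gauss Y.
Proof.
move=> gX sY XY.
have [phi hphi] : {phi : nat -> nat | forall k, norm2 P (fun w => X (phi k) w - Y w) <= 2^-1 ^+ k}.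
  have /choice[phi h] : forall k, exists n, norm2 P (fun w => X n w - Y w) <= 2^-1 ^+ k.
    move=> k; have e0 : 0 < 2^-1 ^+ k :> R by rewrite exprn_gt0.
    move/cvgrPdist_le : XY => /(_ _ e0)[n _ /(_ n (leqnn _))].
    by rewrite sub0r normrN ger0_norm ?norm2_ge0//; exists n.
  by exists phi.
pose Z k := X (phi k).
have gZ k : gauss (Z k) by exact: gX.
have sZ k : sqint P (Z k) by exact: gauss_sqint.
have mZ k := sqint_measurable (sZ k); have mY := sqint_measurable sY.
have ZY : norm2 P (fun w => Z k w - Y w) @[k --> \oo] --> 0.
  apply: (squeeze_cvgr _ (cvg_cst 0) (@cvg_expr R 2^-1 _)).
    by apply: nearW => k; rewrite norm2_ge0 hphi.
  by rewrite ger0_norm// invf_lt1// ltr1n.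
have ae : {ae P, forall w, Z k w @[k --> \oo] --> Y w}.
  apply: ae_cvg_sqr => [k|k]; first exact: sqintB.
  rewrite -norm2_sqr; apply: (@le_trans _ _ ((2^-1 ^+ k) ^+ 2)).
    by rewrite lerXn2r ?nnegrE ?norm2_ge0 ?exprn_ge0//; exact: hphi.
  rewrite -exprM mulnC exprM expr2 exprMn ler_piMl ?exprn_ge0//.
  by rewrite exprn_ile1// invf_le1// ler1n.
pose v k := \int[P]_w (Z k w ^+ 2).
have vE k : v k = norm2 P (Z k) ^+ 2 by rewrite norm2_sqr.
have cZ : norm2 P (Z k) @[k --> \oo] --> norm2 P Y.
  by apply: norm2_cvg => //; exact: nearW.
have cv : v k @[k --> \oo] --> \int[P]_w (Y w ^+ 2).
  rewrite -norm2_sqr; under eq_fun do rewrite vE.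
  by apply: (@continuous_cvg _ _ _ _ _ _ (fun x : R => x ^+ 2)); first exact: exprn_continuous.
have [B B0 vB] : exists2 B, 0 <= B & forall k, v k <= B.
  have /cvg_seq_bounded [M [_ hM]] := cvgP _ cv.
  exists (`|M| + 1) => // k; have h : M < `|M| + 1 by rewrite ltr_pwDr// ler_norm.
  by apply: le_trans (ler_norm _) (hM _ h k _).
have v0 k : 0 <= v k by exact: Rint_sqr_ge0.
have g0 j : 0 <= gmom j.*2 :> R.
  by elim: j => [|j IH]; rewrite ?gmom0// doubleS gmomSS mulr_ge0.
have Zev k j : \int[P]_w (Z k w ^+ j.*2) <= gmom j.*2 * B ^+ j.
  by have [_ _ ->] := gZ k; rewrite doubleK -/(v k) ler_wpM2l// lerXn2r ?nnegrE.
(* Even powers are nonnegative, so Fatou along an almost surely convergent subsequence transfers the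
   uniform moment bound to the limit. *)
have evY j : mint (fun w => Y w ^+ j.*2).
  have [] := @fatou_bound _ _ _ P (fun k w => Z k w ^+ j.*2) (fun w => Y w ^+ j.*2) (gmom j.*2 * B ^+ j) => //.
  - by move=> k; have [_ + _] := gZ k; exact.
  - by move=> k w; rewrite exprn_even_ge0// odd_double.
  - by move=> w; rewrite exprn_even_ge0// odd_double.
  - exact: measurable_funX.
  - apply: filterS ae => w c.
    by apply: (@continuous_cvg _ _ _ _ _ _ (fun x : R => x ^+ j.*2)); first exact: exprn_continuous.
have iY n : mint (fun w => Y w ^+ n).
  apply: le_integrableT (mintD (mint_cst P 1) (evY n)); first exact: measurable_funX.
  move=> w; rewrite -muln2 exprM [leRHS]ger0_norm ?addr_ge0 ?sqr_ge0// ler_norml.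
  by apply/andP; split; nra.
have sqY n : sqint P (fun w => Y w ^+ n).
  split; first exact: measurable_funX.
  by have := iY (n * 2)%N; apply: eq_integrable => // w _ /=; rewrite exprM.
have sqZ k n : sqint P (fun w => Z k w ^+ n).
  split; first exact: measurable_funX.
  by have [_ /(_ (n * 2)%N) + _] := gZ k; apply: eq_integrable => // w _ /=; rewrite exprM.
have sqZY k n j : sqint P (fun w => Z k w ^+ n * Y w ^+ j) /\
    norm2 P (fun w => Z k w ^+ n * Y w ^+ j) ^+ 2 <=
      gmom (n * 2).*2 * B ^+ (n * 2) + \int[P]_w (Y w ^+ (j * 2).*2).
  have le w : (Z k w ^+ n * Y w ^+ j) ^+ 2 <= Z k w ^+ (n * 2).*2 + Y w ^+ (j * 2).*2.
    by rewrite -!muln2 !exprM exprMn; move: (Z k w ^+ n ^+ 2) (Y w ^+ j ^+ 2) => a b; nra.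
  have [_ iZ _] := gZ k.
  have i : mint (fun w => (Z k w ^+ n * Y w ^+ j) ^+ 2).
    apply: le_integrableT (mintD (iZ (n * 2).*2) (evY (j * 2)%N)).
      by apply: measurable_funX; apply: measurable_funM; exact: measurable_funX.
    by move=> w; rewrite ger0_norm ?sqr_ge0//; apply: le_trans (le w) (ler_norm _).
  split; first by split => //; apply: measurable_funM; exact: measurable_funX.
  rewrite norm2_sqr; apply: le_trans (le_Rintegral _ _ _ (fun w _ => le w)) _ => //.
    by apply: mintD => //; exact: evY.
  by rewrite RintegralD//; rewrite lerD2r; exact: Zev.
(* The weight [Y^j] makes the induction on [n] close, through [Z^(n+1) - Y^(n+1) = Z^n (Z - Y) +
   (Z^n - Y^n) Y]; the first part is small by Cauchy-Schwarz. *)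
have conv n j : \int[P]_w ((Z k w ^+ n - Y w ^+ n) * Y w ^+ j) @[k --> \oo] --> (0 : R).
  elim: n j => [|n IH] j.
    under eq_fun do under eq_Rintegral do rewrite !expr0 subrr mul0r.
    rewrite (_ : (fun=> _) = (fun=> 0)); first exact: cvg_cst.
    by apply/funext => k; rewrite Rint_prob_cst.
  pose K := Num.sqrt (gmom (n * 2).*2 * B ^+ (n * 2) + \int[P]_w (Y w ^+ (j * 2).*2)).
  have c1 : \int[P]_w ((Z k w ^+ n * Y w ^+ j) * (Z k w - Y w)) @[k --> \oo] --> (0 : R).
    apply: norm_cvg0.
    have cK : K * norm2 P (fun w => Z k w - Y w) @[k --> \oo] --> 0.
      by rewrite -[X in _ --> X](mulr0 K); apply: cvgM => //; exact: cvg_cst.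
    apply: (squeeze_cvgr _ (cvg_cst 0) cK); apply: nearW => k; rewrite normr_ge0/=.
    have [sk bk] := sqZY k n j.
    apply: le_trans (cauchy_schwarz sk (sqintB (sZ k) sY)) _.
    rewrite ler_wpM2r ?norm2_ge0// -[leLHS]ger0_norm ?norm2_ge0// -sqrtr_sqr.
    by rewrite ler_wsqrtr.
  have cc := cvgD c1 (IH j.+1); rewrite addr0 in cc.
  rewrite (_ : (fun k => _) = (fun k => \int[P]_w ((Z k w ^+ n * Y w ^+ j) * (Z k w - Y w)) +
      \int[P]_w ((Z k w ^+ n - Y w ^+ n) * Y w ^+ j.+1))); first exact: cc.
  apply/funext => k; rewrite -RintegralD//.
  - by apply: eq_Rintegral => w _; rewrite !exprS; ring.
  - exact: sqintM (sqZY k n j).1 (sqintB (sZ k) sY).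
  - exact: sqintM (sqintB (sqZ k n) (sqY n)) (sqY j.+1).
split=> // n.
have cn : \int[P]_w (Z k w ^+ n) @[k --> \oo] --> \int[P]_w (Y w ^+ n).
  apply/subr_cvg0; rewrite (_ : (fun k => _) = (fun k => \int[P]_w ((Z k w ^+ n - Y w ^+ n) * Y w ^+ 0))).
    exact: conv.
  apply/funext => k /=; rewrite -RintegralB//; last by have [_ + _] := gZ k; exact.
  by apply: eq_Rintegral => w _; rewrite expr0 mulr1.
have cn' : \int[P]_w (Z k w ^+ n) @[k --> \oo] --> gmom n * (\int[P]_w (Y w ^+ 2)) ^+ n./2.
  rewrite (_ : (fun k => _) = (fun k => gmom n * v k ^+ n./2)); last first.
    by apply/funext => k; have [_ _ ->] := gZ k.
  apply: cvgM; first exact: cvg_cst.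
  by apply: (@continuous_cvg _ _ _ _ _ _ (fun x : R => x ^+ n./2)); first exact: exprn_continuous.
exact: (cvg_unique _ cn cn').
Qed.

Lemma gauss2_lim (X1 X2 : nat -> T -> R) Y1 Y2 : (forall n, gauss2 (X1 n) (X2 n)) ->
  sqint P Y1 -> sqint P Y2 ->
  norm2 P (fun w => X1 n w - Y1 w) @[n --> \oo] --> 0 ->
  norm2 P (fun w => X2 n w - Y2 w) @[n --> \oo] --> 0 -> gauss2 Y1 Y2.
Proof.
move=> gX s1 s2 c1 c2 a b.
have sX1 n : sqint P (X1 n) by exact: gauss_sqint (gauss2l (gX n)).
have sX2 n : sqint P (X2 n) by exact: gauss_sqint (gauss2r (gX n)).
apply: (@gauss_lim (fun n w => a * X1 n w + b * X2 n w)).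
- by move=> n; exact: gX.
- by apply: sqintD; exact: sqintZ.
- have c : `|a| * norm2 P (fun w => X1 n w - Y1 w) + `|b| * norm2 P (fun w => X2 n w - Y2 w)
    @[n --> \oo] --> 0.
    rewrite [X in _ --> X](_ : 0 = `|a| * 0 + `|b| * 0); last by rewrite !mulr0 addr0.
    by apply: cvgD; apply: cvgM => //; exact: cvg_cst.
  apply: (squeeze_cvgr _ (cvg_cst 0) c); apply: nearW => n; rewrite norm2_ge0/=.
  rewrite -!norm2Z; try exact: sqintB.
  have := norm2D (sqintZ a (sqintB (sX1 n) s1)) (sqintZ b (sqintB (sX2 n) s2)).
  by congr (norm2 _ _ <= _); apply/funext => w; ring.
Qed.
End gaussian_moments.

(** * Hermite expansions in the Gaussian space and decay in the correlation *)

Section normal_hermite.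
Context {R : realType}.
Let nu : probability (measurableTypeR R) R := normal_prob 0 1.

Lemma normal_gauss2 : gauss2 nu (fun x => x) (fun x => x).
Proof.
move=> a b; have [] // := @gauss_moments R _ _ nu (a + b) (fun x : R => a * x + b * x).
- by apply: measurable_funD; exact: measurable_funM.
- move=> n; have := mintZ ((a + b) ^+ n) (normal_mint_exprn (oner_neq0 R) n).
  by apply: eq_integrable => // x _ /=; rewrite -mulrDl exprMn.
- move=> n; rewrite (_ : Rintegral _ _ _ = \int[nu]_x ((a + b) ^+ n * x ^+ n)); last first.
    by apply: eq_Rintegral => x _; rewrite -mulrDl exprMn.
  rewrite RintegralZl//; last exact: (normal_mint_exprn (oner_neq0 R) n).
  by rewrite normal_moment ?oner_neq0// expr1n mulr1 mulrC.
Qed.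

Lemma normal_variance : \int[nu]_x (x ^+ 2) = 1 :> R.
Proof. by rewrite normal_moment ?oner_neq0// gmomSS gmom0 expr1n !mulr1. Qed.

Lemma he_normal k l :
  \int[nu]_x ((he 1 k).[x] * (he 1 l).[x]) = (k == l)%:R * k`!%:R :> R.
Proof.
have h := he_gauss2 normal_gauss2 k l; rewrite normal_variance in h; by rewrite h expr1n mulr1.
Qed.

Lemma normal_expint (t : R) : nu.-integrable [set: R] (EFin \o (fun x => expR (t * x))).
Proof. exact: (normal_mint_expR (oner_neq0 R)). Qed.

Let sqp := sqint_horner normal_expint.

Lemma normal_mint_poly (p q : {poly R}) :
  nu.-integrable [set: R] (EFin \o (fun x => p.[x] * q.[x])).
Proof. exact: sqintM (sqp p) (sqp q). Qed.

(** Orthonormality fixes the polynomial up to sign, and the positive leading coefficient fixes the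
    sign. *)
Lemma orthonormal_hermiteE (H : nat -> {poly R}) k : orthonormal_hermite H ->
  H k = (Num.sqrt k`!%:R)^-1 *: he 1 k.
Proof.
move=> [sH lH oH].
pose L (p q : {poly R}) := \int[nu]_x (p.[x] * q.[x]).
have iL := normal_mint_poly.
have [|||||Hk lk] := @orthonormal_he _ L 1 H _ _ _ _ _ k.
- move=> a p q r; rewrite /L -RintegralZl// -RintegralD//; last exact: mintZ.
  by apply: eq_Rintegral => w _; rewrite hornerD hornerZ; ring.
- move=> a p q r; rewrite /L -RintegralZl// -RintegralD//; last exact: mintZ.
  by apply: eq_Rintegral => w _; rewrite hornerD hornerZ; ring.
- exact: he_normal.
- exact: sH.
- exact: oH.
rewrite Hk; congr (_ *: _).
have f0 : 0 < k`!%:R :> R by rewrite ltr0n fact_gt0.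
have l2 : lead_coef (H k) ^+ 2 = k`!%:R^-1.
  by apply: (mulIf (lt0r_neq0 f0)); rewrite lk mulVf// gt_eqF.
have := congr1 Num.sqrt l2; rewrite sqrtr_sqr gtr0_norm ?lH// => ->.
by rewrite sqrtrV// ltW.
Qed.

Lemma he_expansion (p : {poly R}) K :
  (forall j, (j < K)%N -> \int[nu]_x (p.[x] * (he 1 j).[x]) = 0) ->
  exists n (a : nat -> R), p = \sum_(i < n) a i *: he 1 i /\ forall j, (j < n)%N -> (j < K)%N -> a j = 0.
Proof.
move=> pK; have [a pE] := poly_expansion (size_he 1) (leqnn (size p)).
exists (size p), a; split=> // j jn jK.
have := pK j jK.
rewrite (_ : Rintegral _ _ _ = \int[nu]_x (\sum_(i < size p) a i * ((he 1 i).[x] * (he 1 j).[x]))); last first.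
  apply: eq_Rintegral => x _; rewrite {1}pE horner_sum mulr_suml.
  by apply: eq_bigr => i _; rewrite hornerZ mulrA.
rewrite Rint_sum => [|i]; last by apply: mintZ; exact: normal_mint_poly.
rewrite (bigD1 (Ordinal jn))//= big1 => [|i ij]; last first.
  rewrite RintegralZl//; last exact: normal_mint_poly.
  by rewrite he_normal (_ : _ == _ = false) ?mul0r ?mulr0//; apply/negbTE; apply: contra ij => /eqP ij; apply/eqP/val_inj.
rewrite RintegralZl//; last exact: normal_mint_poly.
rewrite he_normal eqxx mul1r addr0 => /eqP; rewrite mulf_eq0 => /orP[/eqP//|].
by rewrite pnatr_eq0 -leqn0 leqNgt fact_gt0.
Qed.

(** A polynomial [q] near [r] is made orthogonal to the first [K] Hermite polynomials by subtracting
    its projection on them. As [r] has no such projection, that of [q] is controlled by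
    [||r - q||]. *)
Lemma orthogonal_approx (r : R -> R) K : sqint nu r ->
  (forall j, (j < K)%N -> \int[nu]_x (r x * (he 1 j).[x]) = 0) ->
  exists2 p : nat -> {poly R},
    forall n j, (j < K)%N -> \int[nu]_x ((p n).[x] * (he 1 j).[x]) = 0 &
    norm2 nu (fun x => (p n).[x] - r x) @[n --> \oo] --> 0.
Proof.
move=> sr rK.
have [_ dense] := polynomial_dense normal_expint sr.
have fneq j : j`!%:R != 0 :> R by rewrite pnatr_eq0 -lt0n fact_gt0.
pose pr (q : {poly R}) j := \int[nu]_x (q.[x] * (he 1 j).[x]).
(* [S] bounds the norm of the projection operator, so the correction multiplies the approximation
   error by at most [1 + S]. *)
pose S := \sum_(j < K) norm2 nu (horner (he 1 j)) * j`!%:R^-1 * norm2 nu (horner (he 1 j)).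
have S0 : 0 <= S by apply: sumr_ge0 => j _; rewrite !mulr_ge0 ?norm2_ge0.
have key e : 0 < e -> exists2 p : {poly R},
    forall j, (j < K)%N -> \int[nu]_x (p.[x] * (he 1 j).[x]) = 0 &
    norm2 nu (fun x => p.[x] - r x) <= e.
  move=> e0; have S1 : 0 < 1 + S by rewrite ltr_pwDl.
  have [q hq] := dense (e / (1 + S)) (divr_gt0 e0 S1).
  exists (q - \sum_(j < K) (pr q j / j`!%:R) *: he 1 j).
    move=> j jK; rewrite (_ : Rintegral _ _ _ = \int[nu]_x (q.[x] * (he 1 j).[x] -
        \sum_(i < K) (pr q i / i`!%:R) * ((he 1 i).[x] * (he 1 j).[x]))); last first.
      apply: eq_Rintegral => x _; rewrite hornerD hornerN horner_sum mulrBl mulr_suml.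
      by congr (_ - _); apply: eq_bigr => i _; rewrite hornerZ mulrA.
    rewrite RintegralB//; last 2 first.
    - exact: normal_mint_poly.
    - by apply: mint_sum => i; apply: mintZ; exact: normal_mint_poly.
    rewrite Rint_sum => [|i]; last by apply: mintZ; exact: normal_mint_poly.
    rewrite (bigD1 (Ordinal jK))//= big1 => [|i ij]; last first.
      rewrite RintegralZl//; last exact: normal_mint_poly.
      by rewrite he_normal (_ : _ == _ = false) ?mul0r ?mulr0//; apply/negbTE; apply: contra ij => /eqP ij; apply/eqP/val_inj.
    rewrite RintegralZl//; last exact: normal_mint_poly.
    by rewrite he_normal eqxx mul1r addr0 divfK// subrr.
  have sB := sqintB sr (sqp q).
  have prE j : (j < K)%N -> `|pr q j| <= norm2 nu (fun x => r x - q.[x]) * norm2 nu (horner (he 1 j)).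
    move=> jK; have := cauchy_schwarz sB (sqp (he 1 j)).
    rewrite (_ : Rintegral _ _ _ = - pr q j) ?normrN//.
    rewrite -[RHS]add0r -(rK _ jK) -RintegralB//.
    - by apply: eq_Rintegral => x _; rewrite mulrBl.
    - exact: sqintM sr (sqp _).
    - exact: normal_mint_poly.
  have sumle : norm2 nu (fun x => \sum_(j < K) (pr q j / j`!%:R) * (he 1 j).[x]) <=
      norm2 nu (fun x => r x - q.[x]) * S.
    rewrite /S mulr_sumr.
    have : forall l : seq 'I_K, norm2 nu (fun x => \sum_(j <- l) (pr q j / j`!%:R) * (he 1 j).[x]) <=
      \sum_(j <- l) norm2 nu (fun x => r x - q.[x]) * (norm2 nu (horner (he 1 j)) / j`!%:R * norm2 nu (horner (he 1 j))).
      elim=> [|j l IH].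
        under eq_fun do rewrite big_nil; rewrite big_nil /norm2.
        by under eq_Rintegral do rewrite expr0n; rewrite /Rintegral integral0 sqrtr0.
      under eq_fun do rewrite big_cons; rewrite big_cons.
      apply: le_trans (norm2D _ _) _.
      - by apply: sqintZ; exact: sqp.
      - by apply: sqint_sum => i; apply: sqintZ; exact: sqp.
      apply: lerD => //; rewrite norm2Z; last exact: sqp.
      rewrite !mulrA ler_wpM2r ?norm2_ge0// normrM [X in _ * X <= _]ger0_norm ?invr_ge0//.
      by rewrite ler_wpM2r ?invr_ge0//; exact: prE.
    by move=> /(_ (index_enum _)).
  have -> : (fun x => (q - \sum_(j < K) (pr q j / j`!%:R) *: he 1 j).[x] - r x) =
      (fun x => - (r x - q.[x]) + - (\sum_(j < K) (pr q j / j`!%:R) * (he 1 j).[x])).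
    apply/funext => x; rewrite hornerD hornerN horner_sum.
    by under eq_bigr do rewrite hornerZ; ring.
  apply: le_trans (norm2D (sqintN sB) (sqintN _)) _.
    by apply: sqint_sum => i; apply: sqintZ; exact: sqp.
  rewrite !norm2N; apply: (@le_trans _ _ (norm2 nu (fun x => r x - q.[x]) * (1 + S))).
    by rewrite mulrDr mulr1 lerD2l.
  by rewrite -ler_pdivlMr.
have /choice[p hp] : forall n : nat, exists p : {poly R},
    (forall j, (j < K)%N -> \int[nu]_x (p.[x] * (he 1 j).[x]) = 0) /\
    norm2 nu (fun x => p.[x] - r x) <= n.+1%:R^-1.
  by move=> n; have [|p h1 h2] := key n.+1%:R^-1; [rewrite invr_gt0|exists p].
exists p; first by move=> n; exact: (hp n).1.
apply: (squeeze_cvgr _ (cvg_cst 0) cvg_harmonic).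
by apply: nearW => n; rewrite norm2_ge0 (hp n).2.
Qed.

Section pair.
Context d {T : measurableType d} (P : probability T R) (X Y : T -> R).
Hypotheses (gXY : gauss2 P X Y).
Hypotheses (X1 : \int[P]_w (X w ^+ 2) = 1) (Y1 : \int[P]_w (Y w ^+ 2) = 1).
Hypothesis lX : forall A : set R, measurable A -> P (X @^-1` A) = nu A.
Hypothesis lY : forall A : set R, measurable A -> P (Y @^-1` A) = nu A.

Let mX : measurable_fun [set: T] X. Proof. by have [] := gauss2l gXY. Qed.
Let mY : measurable_fun [set: T] Y. Proof. by have [] := gauss2r gXY. Qed.
Let c := \int[P]_w (X w * Y w).

Lemma correlation_le1 : `|c| <= 1.
Proof.
have := cauchy_schwarz (gauss_sqint (gauss2l gXY)) (gauss_sqint (gauss2r gXY)).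
by rewrite /norm2 X1 Y1 sqrtr1 mulr1.
Qed.

(** Diagonalization: with coefficients [a i], the two integrals are the sums of [a_i^2 i! c^i] and
    of [a_i^2 i!] over [i >= K], and [|c| <= 1] allows [|c|^i <= |c|^K]. *)
Lemma pair_poly_bound (p : {poly R}) K :
  (forall j, (j < K)%N -> \int[nu]_x (p.[x] * (he 1 j).[x]) = 0) ->
  `|\int[P]_w (p.[X w] * p.[Y w])| <= `|c| ^+ K * \int[nu]_x (p.[x] ^+ 2).
Proof.
move=> /he_expansion[n [a [pE a0]]].
have E1 : \int[nu]_x (p.[x] ^+ 2) = \sum_(i < n) a i ^+ 2 * i`!%:R.
  rewrite (_ : Rintegral _ _ _ = \int[nu]_x (\sum_(i < n) \sum_(j < n) (a i * a j) * ((he 1 i).[x] * (he 1 j).[x]))); last first.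
    apply: eq_Rintegral => x _; rewrite expr2 pE horner_sum mulr_suml; apply: eq_bigr => i _.
    by rewrite mulr_sumr; apply: eq_bigr => j _; rewrite !hornerZ; ring.
  rewrite Rint_sum => [|i]; last by apply: mint_sum => j; apply: mintZ; exact: normal_mint_poly.
  apply: eq_bigr => i _.
  rewrite Rint_sum => [|j]; last by apply: mintZ; exact: normal_mint_poly.
  rewrite (bigD1 i)//= big1 => [|j ji]; last first.
    rewrite RintegralZl//; last exact: normal_mint_poly.
    by rewrite he_normal (_ : _ == _ = false) ?mul0r ?mulr0//; apply/negbTE; apply: contra ji => /eqP ij; apply/eqP/val_inj.
  by rewrite RintegralZl ?he_normal ?eqxx ?mul1r ?addr0 ?expr2//; exact: normal_mint_poly.
have hg := he_gauss2 gXY; rewrite X1 Y1 -/c in hg.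
have iP := gauss2_mint_poly gXY.
have E2 : \int[P]_w (p.[X w] * p.[Y w]) = \sum_(i < n) a i ^+ 2 * i`!%:R * c ^+ i.
  rewrite (_ : Rintegral _ _ _ = \int[P]_w (\sum_(i < n) \sum_(j < n) (a i * a j) * ((he 1 i).[X w] * (he 1 j).[Y w]))); last first.
    apply: eq_Rintegral => x _; rewrite pE !horner_sum mulr_suml; apply: eq_bigr => i _.
    by rewrite mulr_sumr; apply: eq_bigr => j _; rewrite !hornerZ; ring.
  rewrite Rint_sum => [|i]; last by apply: mint_sum => j; apply: mintZ; exact: iP.
  apply: eq_bigr => i _.
  rewrite Rint_sum => [|j]; last by apply: mintZ; exact: iP.
  rewrite (bigD1 i)//= big1 => [|j ji]; last first.
    rewrite RintegralZl; [|by []|exact: iP].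
    by rewrite hg (_ : _ == _ = false) ?mul0r ?mulr0//; apply/negbTE; apply: contra ji => /eqP ij; apply/eqP/val_inj.
  rewrite RintegralZl; [|by []|exact: iP].
  by rewrite hg eqxx mul1r addr0 expr2 mulrA.
rewrite E1 E2 mulr_sumr; apply: le_trans (ler_norm_sum _ _ _) _.
apply: ler_sum => i _.
have [iK|iK] := ltnP i K; first by rewrite a0// expr0n !mul0r mulr0 normr0.
have nn : 0 <= a i ^+ 2 * i`!%:R by rewrite mulr_ge0// sqr_ge0.
rewrite normrM normrX mulrC (ger0_norm nn) ler_wpM2r//.
by rewrite -(subnKC iK) exprD ler_piMr ?exprn_ge0// exprn_ile1// correlation_le1.
Qed.

(** Both sides are continuous in [r] for the Gaussian norm, since composing with [X] or [Y]
    preserves that norm; hence the polynomial case extends by density. *)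
Lemma pair_bound (r : R -> R) K : sqint nu r ->
  (forall j, (j < K)%N -> \int[nu]_x (r x * (he 1 j).[x]) = 0) ->
  `|\int[P]_w (r (X w) * r (Y w))| <= `|c| ^+ K * \int[nu]_x (r x ^+ 2).
Proof.
move=> sr rK; have [p pK pr] := orthogonal_approx sr rK.
have mr := sr.1; have mp n := sqint_measurable (sqp (p n)).
have tX (f : R -> R) (mf : measurable_fun [set: R] f) : norm2 P (fun w => f (X w)) = norm2 nu f.
  by congr Num.sqrt; rewrite (law_Rint mX lX (f := fun x => f x ^+ 2))//; exact: measurable_funX.
have tY (f : R -> R) (mf : measurable_fun [set: R] f) : norm2 P (fun w => f (Y w)) = norm2 nu f.
  by congr Num.sqrt; rewrite (law_Rint mY lY (f := fun x => f x ^+ 2))//; exact: measurable_funX.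
have mB n : measurable_fun [set: R] (fun x => (p n).[x] - r x).
  by apply: measurable_funB; [exact: mp|exact: mr].
have c1 : `|\int[P]_w ((p n).[X w] * (p n).[Y w])| @[n --> \oo] --> `|\int[P]_w (r (X w) * r (Y w))|.
  apply: cvg_norm; apply: (Rint_mul_cvg (X1 := fun n w => (p n).[X w]) (X2 := fun n w => (p n).[Y w])).
  - by apply: nearW => n; apply/(law_sqint mX lX); [exact: mp|exact: sqp].
  - by apply: nearW => n; apply/(law_sqint mY lY); [exact: mp|exact: sqp].
  - by apply/(law_sqint mX lX).
  - by apply/(law_sqint mY lY).
  - by under eq_fun do rewrite (tX (fun x => (p _).[x] - r x))//.
  - by under eq_fun do rewrite (tY (fun x => (p _).[x] - r x))//.
have c2 : `|c| ^+ K * norm2 nu (horner (p n)) ^+ 2 @[n --> \oo] --> `|c| ^+ K * \int[nu]_x (r x ^+ 2).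
  rewrite -norm2_sqr; apply: cvgM; first exact: cvg_cst.
  apply: (@continuous_cvg _ _ _ _ _ _ (fun x : R => x ^+ 2)); first exact: exprn_continuous.
  by apply: norm2_cvg => //; apply: nearW => n; exact: sqp.
apply: (ler_cvg_to c1 c2); apply: nearW => n.
by rewrite norm2_sqr; apply: pair_poly_bound; exact: pK.
Qed.
End pair.
End normal_hermite.

(** * Translation and reflection of integrals *)

Section translation.
Context {R : realType}.
Local Notation mu := (@lebesgue_measure R).

Let mshift (a : R) : measurable_fun [set: R] (fun x : measurableTypeR R => (x + a : R)).
Proof. exact: measurable_funD. Qed.

Lemma lebesgue_measure_shift (a : R) (A : set R) : measurable A ->
  mu ((fun x : measurableTypeR R => x + a : R) @^-1` A) = mu A.
Proof.
move=> mA; pose phi : measurableTypeR R -> measurableTypeR R := fun x => x + a.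
have mphi : measurable_fun setT phi by exact: (mshift a).
pose nu : {measure set (measurableTypeR R) -> \bar R} :=
  measure_function_pushforward__canonical__measure_function_Measure mu mphi.
symmetry; apply: (@lebesgue_measure_unique R nu _ A mA) => _ [[x y] _ <-].
rewrite /= /nu /pushforward.
have -> : phi @^-1` `]x, y] = `]x - a, y - a]%classic.
  by apply/seteqP; split=> z /=; rewrite !in_itv/= ltrBlDr lerBrDr.
rewrite !lebesgue_measure_itv/= !lte_fin ltrD2r; case: ifPn => // _.
by rewrite -!EFinB; congr EFin; ring.
Qed.

Lemma Rint_shift (a : R) (f : R -> R) : measurable_fun [set: R] f ->
  \int[mu]_x f (x + a) = \int[mu]_x f x.
Proof.
move=> mf; exact: (@law_Rint R _ (measurableTypeR R) mu mu (fun x => x + a) (mshift a) (lebesgue_measure_shift a) f mf).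
Qed.

Lemma mint_shift (a : R) (f : R -> R) : measurable_fun [set: R] f ->
  mu.-integrable [set: R] (EFin \o (fun x => f (x + a))) <->
  mu.-integrable [set: R] (EFin \o f).
Proof.
move=> mf; exact: (@law_mint R _ (measurableTypeR R) mu mu (fun x => x + a) (mshift a) (lebesgue_measure_shift a) f mf).
Qed.

Let mopp : measurable_fun [set: R] (fun x : measurableTypeR R => (- x : R)).
Proof. exact: measurable_funN. Qed.

Lemma lebesgue_measure_opp (A : set R) : measurable A ->
  mu ((fun x : measurableTypeR R => - x : R) @^-1` A) = mu A.
Proof.
move=> mA; pose phi : measurableTypeR R -> measurableTypeR R := fun x => - x.
have mphi : measurable_fun setT phi by exact: mopp.
pose nu : {measure set (measurableTypeR R) -> \bar R} :=
  measure_function_pushforward__canonical__measure_function_Measure mu mphi.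
symmetry; apply: (@lebesgue_measure_unique R nu _ A mA) => _ [[x y] _ <-].
rewrite /= /nu /pushforward.
have -> : phi @^-1` `]x, y] = `[- y, - x[%classic.
  by apply/seteqP; split=> z /=; rewrite !in_itv/= ltrNr lerNl andbC.
rewrite !lebesgue_measure_itv/= !lte_fin ltrN2; case: ifPn => // _.
by rewrite -!EFinB; congr EFin; ring.
Qed.

Lemma Rint_opp (f : R -> R) : measurable_fun [set: R] f ->
  \int[mu]_x f (- x) = \int[mu]_x f x.
Proof.
move=> mf; exact: (@law_Rint R _ (measurableTypeR R) mu mu (fun x => - x) mopp lebesgue_measure_opp f mf).
Qed.

Lemma mint_opp (f : R -> R) : measurable_fun [set: R] f ->
  mu.-integrable [set: R] (EFin \o (fun x => f (- x))) <->
  mu.-integrable [set: R] (EFin \o f).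
Proof.
move=> mf; exact: (@law_mint R _ (measurableTypeR R) mu mu (fun x => - x) mopp lebesgue_measure_opp f mf).
Qed.
End translation.

Section Rint_fubini.
Context {R : realType} d1 d2 {S : measurableType d1} {T : measurableType d2}.
Variables (m1 : {sigma_finite_measure set S -> \bar R}) (m2 : {sigma_finite_measure set T -> \bar R}).
Variable F : S * T -> R.
Hypothesis iF : (m1 \x m2)%E.-integrable [set: S * T] (EFin \o F).

(** Fubini for real-valued integrals: passing through [fine] changes the inner integral only on the
    null set of [x] whose section is not integrable. *)
Lemma Rint_fubini1 :
  m1.-integrable [set: S] (EFin \o (fun x => \int[m2]_y F (x, y))) /\
  \int[m1]_x \int[m2]_y F (x, y) = \int[(m1 \x m2)%E]_z F z.
Proof.
have ae1 := ae_integrable1 iF; have iG := integrable_fubini_F iF.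
have mG : measurable_fun [set: S] (fun x => \int[m2]_y F (x, y)).
  by apply: measurableT_comp => //; exact: (measurable_fubini_F iF).
have E1 : ae_eq m1 setT (fubini_F m2 (EFin \o F)) (EFin \o (fun x => \int[m2]_y F (x, y))).
  apply: filterS ae1 => x ix _ /=; rewrite /fubini_F /Rintegral fineK//.
  exact: integrable_fin_num ix.
split.
  apply/integrableP; split; first exact/measurable_EFinP.
  move/integrableP : iG => [mG' iG]; apply: le_lt_trans iG.
  rewrite le_eqVlt; apply/orP; left; apply/eqP; apply: ae_eq_integral => //.
  - by apply: measurableT_comp => //; exact/measurable_EFinP.
  - exact: measurableT_comp.
  - by apply: filterS E1 => x /= h _; rewrite h.
rewrite /Rintegral -(integral12_prod_meas1 iF); congr fine; apply: ae_eq_integral => //.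
- exact/measurable_EFinP.
- exact: (measurable_fubini_F iF).
- by apply: filterS E1 => x /= h hx; rewrite h.
Qed.

Lemma Rint_fubini2 :
  m2.-integrable [set: T] (EFin \o (fun y => \int[m1]_x F (x, y))) /\
  \int[m2]_y \int[m1]_x F (x, y) = \int[(m1 \x m2)%E]_z F z.
Proof.
have ae1 := ae_integrable2 iF.
have iG : m2.-integrable [set: T] (fubini_G m1 (EFin \o F)).
  have mF := measurable_int _ iF.
  apply/integrableP; split; first exact: (measurable_fubini_G iF).
  apply: le_lt_trans ((integrable21ltyP m1 m2 mF).1 iF).
  apply: ge0_le_integral => //.
  - by apply: measurableT_comp => //; exact: (measurable_fubini_G iF).
  - apply: (@measurable_fun_fubini_tonelli_G _ _ _ _ _ m1 (fun z => `|(F z)%:E|%E)) => //.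
    exact: measurableT_comp.
  - move=> y _; apply: le_abse_integral => //.
    exact: measurableT_comp.

have mG : measurable_fun [set: T] (fun y => \int[m1]_x F (x, y)).
  by apply: measurableT_comp => //; exact: (measurable_fubini_G iF).
have E1 : ae_eq m2 setT (fubini_G m1 (EFin \o F)) (EFin \o (fun y => \int[m1]_x F (x, y))).
  apply: filterS ae1 => x ix _ /=; rewrite /fubini_G /Rintegral fineK//.
  exact: integrable_fin_num ix.
split.
  apply/integrableP; split; first exact/measurable_EFinP.
  move/integrableP : iG => [mG' iG]; apply: le_lt_trans iG.
  rewrite le_eqVlt; apply/orP; left; apply/eqP; apply: ae_eq_integral => //.
  - by apply: measurableT_comp => //; exact/measurable_EFinP.
  - exact: measurableT_comp.
  - by apply: filterS E1 => x /= h _; rewrite h.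
rewrite /Rintegral -(integral21_prod_meas1 iF); congr fine; apply: ae_eq_integral => //.
- exact/measurable_EFinP.
- exact: (measurable_fubini_G iF).
- by apply: filterS E1 => x /= h hx; rewrite h.
Qed.

End Rint_fubini.

(** * Regularity of the increments variance *)

Section restriction.
Context {R : realType} d {T : measurableType d}.
Variable m : {measure set T -> \bar R}.

Lemma restrict_indic (A : set T) (f : T -> R) : f \_ A = (fun x => \1_A x * f x).
Proof.
by apply/funext => x; rewrite patchE indicE; case: ifPn => _; rewrite ?mul1r ?mul0r.
Qed.

Lemma Rint_in (A : set T) (f : T -> R) :
  \int[m]_(x in A) f x = \int[m]_x (\1_A x * f x).
Proof. by rewrite Rintegral_mkcond restrict_indic. Qed.

Lemma mint_in (A : set T) (f : T -> R) : measurable A ->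
  m.-integrable A (EFin \o f) <->
  m.-integrable [set: T] (EFin \o (fun x => \1_A x * f x)).
Proof.
move=> mA; rewrite -restrict_indic -restrict_EFin.
by rewrite -(integrable_mkcond (EFin \o f) mA).
Qed.

Lemma normr_indic (A : set T) x : `|\1_A x : R| = \1_A x.
Proof. by rewrite indicE; case: (_ \in _); rewrite ?normr1 ?normr0. Qed.

Lemma indic_le1 (A : set T) x : \1_A x <= 1 :> R.
Proof. by rewrite indicE; case: (_ \in _). Qed.
End restriction.

Section lebesgue_line.
Context {R : realType}.
Local Notation mu := (@lebesgue_measure R).

Lemma Rint_dominated_line (f : nat -> R -> R) (g h : R -> R) :
  (forall n, measurable_fun [set: R] (f n)) -> measurable_fun [set: R] g ->
  (forall x, f n x @[n --> \oo] --> g x) -> mu.-integrable [set: R] (EFin \o h) ->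
  (forall n x, `|f n x| <= h x) ->
  mu.-integrable [set: R] (EFin \o g) /\
  \int[mu]_x f n x @[n --> \oo] --> \int[mu]_x g x.
Proof.
move=> mf mg fg ih fh; apply: (@Rint_dominated R _ (measurableTypeR R) mu f g h) => //.
exact: aeW.
Qed.

Lemma mint_itv_bounded (u v K : R) (F : R -> R) : measurable_fun [set: R] F ->
  (forall x, u <= x <= v -> `|F x| <= K) ->
  mu.-integrable [set: R] (EFin \o (fun x => \1_(`[u, v]%classic : set R) x * F x)).
Proof.
move=> mF FK; apply/(@mint_in R _ (measurableTypeR R) mu `[u, v]%classic F) => //.
apply: measurable_bounded_integrable => //.
- have h : (lebesgue_measure (`[u, v]%classic : set R) < +oo)%E.
    rewrite lebesgue_measure_itv/= lte_fin.
    by case: ifPn => _; rewrite -?EFinB ltry.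
  exact: h.
- exact: measurable_funTS.
- exists K; split; first exact: num_real.
  move=> M KM x /=; rewrite in_itv/= => xuv.
  by apply: le_trans (FK _ xuv) (ltW KM).
Qed.
End lebesgue_line.

(** * The second derivative of the increments variance away from 0 *)

Section second_derivative.
Context {R : realType}.
Local Notation mu := (@lebesgue_measure R).
Variable (S : R -> R) (C : R).
Let f : R -> R := derive1 S.
Let g : R -> R := derive1n 2 S.
Hypothesis S0 : S 0 = 0.
Hypothesis Sev : forall x, S (- x) = S x.
Hypothesis Sge0 : forall x, 0 <= S x.
Hypothesis dS : forall s : R, s != 0 ->
      derivable S s 1 /\ derivable (derive1 S) s 1.
Hypothesis S_o : S h / h @[h --> 0^'] --> (0 : R).
Hypothesis S_second : forall s h : R, 0 < s -> 0 < h -> h <= s / 8 ->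
      `|S (s + h) + S (s - h) - 2 * S s| / h ^+ 2 <= C * (S s / s ^+ 2).

(** A sequential form, suited to measurability of limits and to dominated convergence. *)
Lemma difference_quotient (F : R -> R) (s : R) (e : nat -> R) : derivable F s 1 ->
  (forall n, e n != 0) -> e n @[n --> \oo] --> 0 ->
  (e n)^-1 * (F (s + e n) - F s) @[n --> \oo] --> derive1 F s.
Proof.
move=> dF e0 ecv.
have h : h^-1 * (F (h + s) - F s) @[h --> 0^'] --> derive1 F s.
  have := dF; rewrite /derivable /derive1.
  under eq_fun do rewrite /= [_ *: 1]mulr1.
  by move=> hd; exact: hd.
have -> : (fun n => (e n)^-1 * (F (s + e n) - F s)) =
  (fun h => h^-1 * (F (h + s) - F s)) \o e.
  by apply/funext => n /=; rewrite [s + _]addrC.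
apply: (cvg_comp e (fun h => h^-1 * (F (h + s) - F s)) _ h).
move=> A [r /= r0 rA]; near=> n; apply: rA => /=; last exact: e0.
rewrite sub0r normrN; near: n.
by move/cvgr0_norm_lt : ecv; apply.
Unshelve. all: by end_near.
Qed.

Let harm_cvg : (n.+1%:R^-1 : R) @[n --> \oo] --> 0.
Proof. exact: cvg_harmonic. Qed.

Let gE : g = derive1 f. Proof. by rewrite /g derive1nS derive1n1. Qed.

Let measurable_off0 (F : R -> R) :
  (forall s, s != 0 -> {for s, continuous F}) -> measurable_fun [set: R] F.
Proof.
move=> cF; have o0 : open (~` [set (0 : R)]).
  by apply: closed_openC; exact: closed_eq.
rewrite -(setvU [set (0 : R)]); apply/measurable_funU.
- exact: open_measurable.
- exact: measurable_set1.
split; last exact: measurable_fun_set1.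
apply: open_continuous_measurable_fun => // s; rewrite inE => s0.
by apply: cF; apply/eqP.
Qed.

Lemma measurable_derive1_off0 : measurable_fun [set: R] f.
Proof.
apply: measurable_off0 => s /dS [_] dfs.
by apply: differentiable_continuous; apply/derivable1_diffP.
Qed.

Lemma measurable_derive2_off0 : measurable_fun [set: R] g.
Proof.
have o0 : open (~` [set (0 : R)]).
  by apply: closed_openC; exact: closed_eq.
rewrite -(setvU [set (0 : R)]); apply/measurable_funU.
- exact: open_measurable.
- exact: measurable_set1.
split; last exact: measurable_fun_set1.
apply: (@measurable_fun_cvg _ R R (~` [set 0]) (fun n s => (n.+1%:R^-1)^-1 * (f (s + n.+1%:R^-1) - f s)) g).
  move=> n; apply: measurable_funS (measurableT) _ _ => //.
  apply: measurable_funM => //; apply: measurable_funB; last exact: measurable_derive1_off0.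
  apply: measurableT_comp; first exact: measurable_derive1_off0.
  exact: measurable_funD.
move=> s /eqP/dS [_ dfs]; rewrite gE; exact: difference_quotient.
Qed.

Lemma continuous_off0 s : s != 0 -> {for s, continuous S}.
Proof.
by move=> /dS [dSs _]; apply: differentiable_continuous; apply/derivable1_diffP.
Qed.

(** The second derivative is not assumed continuous or locally bounded. Condition (iii) bounds
    second differences of step [e] by [K e^2], uniformly on compacts away from 0; adding [n] of them
    compares two first differences at distance [h], and dividing by [e] and letting [e] tend to 0
    gives a Lipschitz bound for the derivative. *)
Lemma derive1_lipschitz u v : 0 < u -> exists2 K, 0 <= K &
  forall x h, u <= x -> 0 < h -> x + h <= v -> `|f (x + h) - f x| <= K * h.
Proof.
move=> u0; have [vu|uv] := ltP v (u / 2).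
  by exists 0 => // x h ux h0 xhv; exfalso; lra.
have [c _ Sc] := @EVT_max R S (u / 2) (v + 1) ltac:(lra) ltac:(
  apply: continuous_in_subspaceT => x; rewrite inE/= in_itv/= => /andP[x1 _];
  apply: continuous_off0; lra).
have Cu : 0 <= `|C| * (S c / u ^+ 2).
  by apply: mulr_ge0 => //; apply: divr_ge0 => //; apply: sqr_ge0.
exists (`|C| * (S c / u ^+ 2)) => // x h ux h0 xhv.
pose K := `|C| * (S c / u ^+ 2).
pose e n : R := h / n.+1%:R.
have e0 n : 0 < e n by apply: divr_gt0.
have ecv : e n @[n --> \oo] --> 0.
  rewrite -(mulr0 h); apply: cvgMl_tmp; exact: harm_cvg.
have second s n : u <= s -> s <= v -> e n <= u / 8 ->
    `|S (s + e n) + S (s - e n) - 2 * S s| <= K * e n ^+ 2.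
  move=> us sv en; have s0 : 0 < s by lra.
  have := @S_second s (e n) s0 (e0 n) ltac:(lra).
  rewrite ler_pdivrMr ?exprn_gt0// => /le_trans; apply.
  rewrite ler_wpM2r ?sqr_ge0//.
  apply: le_trans (_ : `|C| * (S s / s ^+ 2) <= _).
    by rewrite ler_wpM2r ?ler_norm// divr_ge0// sqr_ge0.
  rewrite ler_wpM2l//; apply: ler_pM => //.
  - by rewrite invr_ge0 sqr_ge0.
  - by apply: Sc; rewrite in_itv/=; lra.
  - by rewrite lef_pV2 ?posrE ?exprn_gt0// lerXn2r ?nnegrE//; lra.
(* Forward differences on a grid of step [h / (n+1)]. Consecutive ones differ by a second
   difference, and [n+1] errors [K e^2] divided by [e] add up to [K h]. *)
pose del n (j : nat) := S (x + j.+1%:R * e n) - S (x + j%:R * e n).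
have tele n k : e n <= u / 8 -> (k <= n.+1)%N -> `|del n k - del n 0%N| <= k%:R * (K * e n ^+ 2).
  move=> en; elim: k => [|k IH] kn; first by rewrite subrr normr0 mul0r.
  have := IH (ltnW kn); set Kn := K * _ => IHk.
  have ke : k.+1%:R * e n <= h.
    by rewrite /e mulrCA ler_piMr ?(ltW h0)// ler_pdivrMr// mul1r ler_nat.
  have ek : 0 <= k.+1%:R * e n by rewrite mulr_ge0// ltW.
  have := @second (x + k.+1%:R * e n) n ltac:(lra) ltac:(lra) en.
  rewrite -/Kn.
  have -> : S (x + k.+1%:R * e n + e n) + S (x + k.+1%:R * e n - e n) - 2 * S (x + k.+1%:R * e n) =
     del n k.+1 - del n k.
    rewrite /del.
    have -> : x + k.+1%:R * e n + e n = x + k.+2%:R * e n by rewrite -[k.+2%:R]natr1; ring.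
    have -> : x + k.+1%:R * e n - e n = x + k%:R * e n by rewrite -[k.+1%:R]natr1; ring.
    ring.
  move=> h1; have -> : del n k.+1 - del n 0%N = (del n k.+1 - del n k) + (del n k - del n 0%N) by ring.
  by apply: le_trans (ler_normD _ _) _; rewrite -[k.+1%:R]natr1; lra.
have step n : e n <= u / 8 -> `|(e n)^-1 * (S (x + h + e n) - S (x + h)) -
    (e n)^-1 * (S (x + e n) - S x)| <= K * h.
  move=> en; have := tele n n.+1 en (leqnn _).
  have -> : del n n.+1 = S (x + h + e n) - S (x + h).
    have E : n.+1%:R * e n = h by rewrite /e mulrCA divff ?mulr1.
    rewrite /del E; congr (S _ - _).
    by rewrite -[n.+2%:R]natr1 mulrDl E; ring.
  have -> : del n 0%N = S (x + e n) - S x by rewrite /del mul1r mul0r addr0.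
  move=> hn; rewrite -mulrBr normrM gtr0_norm ?invr_gt0//.
  rewrite ler_pdivrMl//; apply: le_trans hn _.
  rewrite le_eqVlt; apply/orP; left; apply/eqP.
  rewrite /e; have : n.+1%:R != 0 :> R by rewrite pnatr_eq0.
  by move: (n.+1%:R : R) => N N0; field.
have cv : `|(e n)^-1 * (S (x + h + e n) - S (x + h)) - (e n)^-1 * (S (x + e n) - S x)|
    @[n --> \oo] --> `|f (x + h) - f x|.
  apply: cvg_norm; apply: cvgB; apply: difference_quotient;
    first [exact: ecv|by move=> n; rewrite gt_eqF|by apply: (dS _).1; lra].
apply: (ler_cvg_to cv (cvg_cst (K * h))).
have u8 : 0 < u / 8 by lra.
near=> n; apply: step; apply: ltW; near: n.
exact: (cvgr_lt (0 : R) ecv _ u8).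
Unshelve. all: by end_near.
Qed.

(** The Lipschitz bound dominates the difference quotients of [f], so their integrals converge to
    the integral of [g]. *)
Lemma ftc_pos u v : 0 < u -> u < v ->
  mu.-integrable [set: R] (EFin \o (fun x => \1_(`[u, v]) x * g x)) /\
  \int[mu]_x (\1_(`[u, v]) x * g x) = f v - f u.
Proof.
move=> u0 uv; have [K K0 lip] := derive1_lipschitz (v + 1) u0.
pose e n : R := n.+1%:R^-1.
have e0 n : 0 < e n by rewrite /e.
have e1 n : e n <= 1 by rewrite /e invf_le1// ler1n.
pose F n x := \1_(`[u, v]%classic : set R) x * ((e n)^-1 * (f (x + e n) - f x)).
have mF n : measurable_fun [set: R] (F n).
  apply: measurable_funM; first exact: measurable_indic.
  apply: measurable_funM => //; apply: measurable_funB; last exact: measurable_derive1_off0.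
  apply: measurableT_comp; first exact: measurable_derive1_off0.
  exact: measurable_funD.
have mG : measurable_fun [set: R] (fun x => \1_(`[u, v]%classic : set R) x * g x).
  by apply: measurable_funM; [exact: measurable_indic|exact: measurable_derive2_off0].
have FG x : F n x @[n --> \oo] --> \1_(`[u, v]%classic : set R) x * g x.
  rewrite /F indicE; case: (boolP (x \in _)) => /=; last first.
    by move=> _; rewrite mul0r; under eq_fun do rewrite mul0r; exact: cvg_cst.
  rewrite inE/= in_itv/= mul1r => /andP[ux xv].
  under eq_fun do rewrite mul1r.
  rewrite gE; apply: difference_quotient; [by apply: (dS _).2; lra| |exact: harm_cvg].
  by move=> n; rewrite gt_eqF.
have iK : mu.-integrable [set: R] (EFin \o (fun x => \1_(`[u, v]%classic : set R) x * K)).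
  apply: (@mint_itv_bounded R u v `|K| (fun=> K)) => // x _; exact: lexx.
have FK n x : `|F n x| <= \1_(`[u, v]%classic : set R) x * K.
  rewrite /F indicE; case: (boolP (x \in _)); rewrite ?mul1r ?mul0r ?normr0//.
  rewrite inE/= in_itv/= => /andP[ux xv].
  rewrite normrM gtr0_norm ?invr_gt0// ler_pdivrMl// mulrC.
  by apply: lip => //; have := e1 n; lra.
have [iG cG] := Rint_dominated_line mF mG FG iK FK.
split=> //.
apply: (cvg_unique _ cG) => //.
(* As [f] is continuous away from 0 and integrates to [S], the integrated quotient is a difference
   of difference quotients of [S] at the endpoints, which tend to [f v] and [f u]. *)
have E n : \int[mu]_x F n x = (e n)^-1 * (S (v + e n) - S v) - (e n)^-1 * (S (u + e n) - S u).
  have ftc t : 0 <= t -> mu.-integrable [set: R] (EFin \o (fun x => \1_(`[u, v]%classic : set R) x * f (x + t))) /\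
      \int[mu]_x (\1_(`[u, v]%classic : set R) x * f (x + t)) = S (v + t) - S (u + t).
    move=> t0.
    have cf : {within `[u, v], continuous (fun x => f (x + t))}.
      apply: continuous_in_subspaceT => x; rewrite inE/= in_itv/= => /andP[ux _].
      apply: (@continuous_comp _ _ _ (fun x => x + t) f).
        by apply: cvgD; [exact: cvg_id|exact: cvg_cst].
      by apply: differentiable_continuous; apply/derivable1_diffP; apply: (dS _).2; lra.
    have dS' x : u <= x -> is_derive x 1 (fun x => S (x + t)) (f (x + t)).
      move=> ux; have h1 : is_derive (x + t) 1 S (f (x + t)).
        by apply: DeriveDef; [apply: (dS _).1; lra|rewrite -derive1E].
      have h2 : is_derive x 1 (fun x : R => x + t) 1.
        have -> : (fun x : R => x + t) = id + cst t by [].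
        by rewrite -[X in is_derive _ _ _ X]addr0; apply: is_deriveD.
      have := @is_derive1_comp R S (fun x => x + t) x (f (x + t)) 1 h1 h2.
      by rewrite mulr1.
    split.
      apply/(@mint_in R _ (measurableTypeR R) mu `[u, v]%classic (fun x => f (x + t))) => //.
      by apply: continuous_compact_integrable => //; exact: segment_compact.
    rewrite -Rint_in /Rintegral (@continuous_FTC2 _ (fun x => f (x + t)) (fun x => S (x + t)))//.
    - have cS x : u <= x -> {for x, continuous (fun x => S (x + t))}.
        move=> ux; apply: differentiable_continuous; apply/derivable1_diffP.
        exact: (ex_derive (is_derive := dS' x ux)).
      split.
      + move=> x; rewrite in_itv/= => /andP[ux _].
        exact: (ex_derive (is_derive := dS' x (ltW ux))).
      + by apply: cvg_at_right_filter; apply: cS.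
      + by apply: cvg_at_left_filter; apply: cS; exact: ltW.
    - move=> x; rewrite in_itv/= => /andP[ux _]; rewrite derive1E.
      exact: (derive_val (is_derive := dS' x (ltW ux))).
  have [i1 v1] := ftc (e n) (ltW (e0 n)).
  have [i2 v2] := ftc 0 (lexx _).
  have {}v2 : \int[mu]_x (\1_(`[u, v]%classic : set R) x * f x) = S v - S u.
    by move: v2; rewrite !addr0 => <-; apply: eq_Rintegral => x _; rewrite addr0.
  have -> : (F n) = (fun x => (e n)^-1 * (\1_(`[u, v]%classic : set R) x * f (x + e n) -
     \1_(`[u, v]%classic : set R) x * f (x + 0))).
    by apply/funext => x; rewrite /F addr0; ring.
  rewrite RintegralZl//; last exact: mintB.
  rewrite RintegralB// v1; under [X in _ * (_ - X)]eq_Rintegral do rewrite addr0.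
  by rewrite v2; ring.
have -> : (fun n => \int[mu]_x F n x) = (fun n => (e n)^-1 * (S (v + e n) - S v) - (e n)^-1 * (S (u + e n) - S u)).
  exact/funext.
apply: cvgB; apply: difference_quotient; rewrite ?/e//.
- by apply: (dS _).1; lra.
- by apply: (dS _).1; lra.
Qed.
End second_derivative.

(** * Extension of the integrated second-derivative identity across 0 *)

Section derivative_at_zero.
Context {R : realType}.
Local Notation mu := (@lebesgue_measure R).
Variable (S : R -> R) (C : R).
Let f : R -> R := derive1 S.
Let g : R -> R := derive1n 2 S.
Hypothesis S0 : S 0 = 0.
Hypothesis Sev : forall x, S (- x) = S x.
Hypothesis Sge0 : forall x, 0 <= S x.
Hypothesis dS : forall s : R, s != 0 ->
      derivable S s 1 /\ derivable (derive1 S) s 1.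
Hypothesis S_o : S h / h @[h --> 0^'] --> (0 : R).
Hypothesis S_second : forall s h : R, 0 < s -> 0 < h -> h <= s / 8 ->
      `|S (s + h) + S (s - h) - 2 * S s| / h ^+ 2 <= C * (S s / s ^+ 2).

Let gE : g = derive1 f. Proof. by rewrite /g derive1nS derive1n1. Qed.

(** As [S 0 = 0], the assumption [S h / h -> 0] says that [S] is differentiable at 0 with derivative
    0. *)
Let dS0 : is_derive (0 : R) 1 S 0.
Proof.
have h : h^-1 *: ((S \o shift 0) (h *: 1) - S 0) @[h --> 0^'] --> (0 : R).
  have -> : (fun h : R => h^-1 *: ((S \o shift 0) (h *: 1) - S 0)) = (fun h => S h / h).
    by apply/funext => h; rewrite /= S0 subr0 addr0 [_ *: 1]mulr1 [_ *: _]mulrC.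
  exact: S_o.
apply: DeriveDef; first by apply/cvg_ex; exists 0.
exact: (cvg_lim (@norm_hausdorff _ _) h).
Qed.

Let f0 : f 0 = 0.
Proof. by rewrite /f derive1E; exact: (derive_val (is_derive := dS0)). Qed.

Lemma is_derive_all (x : R) : is_derive x 1 S (f x).
Proof.
have [->|x0] := eqVneq x 0; last by apply: DeriveDef; [exact: (dS x0).1|rewrite -derive1E].
by rewrite f0.
Qed.

Let reflect_derive (F : R -> R) (l x : R) : is_derive (- x) 1 F l ->
  derive1 (F \o (fun y => - y)) x = - l.
Proof.
move=> h2; have h1 : is_derive x 1 (fun y : R => - y) (-1).
  by apply: is_deriveN.
have h3 := @is_derive1_comp R F (fun y => - y) x l (-1) h2 h1.
by rewrite derive1E (derive_val (is_derive := h3)) mulrN1.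
Qed.

Lemma derive1_odd x : f (- x) = - f x.
Proof.
have := reflect_derive (is_derive_all (- x)).
have -> : S \o (fun y => - y) = S by apply/funext => y /=; rewrite Sev.
by rewrite -/f => ->; rewrite opprK.
Qed.

Lemma derive2_even x : g (- x) = g x.
Proof.
have [->|x0] := eqVneq x 0; first by rewrite oppr0.
have h : is_derive (- x) 1 f (g (- x)).
  by apply: DeriveDef; [apply: (dS _).2; rewrite oppr_eq0|rewrite gE -derive1E].
have := reflect_derive h.
have -> : f \o (fun y => - y) = (fun y => - f y) by apply/funext => y /=; rewrite derive1_odd.
have h' : is_derive x 1 f (g x).
  by apply: DeriveDef; [exact: (dS x0).2|rewrite gE -derive1E].
have h'' : is_derive x 1 (fun y => - f y) (- g x) by exact: is_deriveN.
have E1 : derive1 (fun y => - f y) x = - g x.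
  by rewrite derive1E; exact: (derive_val (is_derive := h'')).
by rewrite E1; move: (g x) (g (- x)) => p q pq; lra.
Qed.

Hypothesis g_int : forall M, mu.-integrable `[- M, M]%classic (EFin \o g).

Let mg := measurable_derive2_off0 dS.

Let mgi u v : measurable_fun [set: R] (fun x => \1_(`]u, v]%classic : set R) x * g x).
Proof. by apply: measurable_funM; [exact: measurable_indic|exact: mg]. Qed.

Let g_itv u v : mu.-integrable `]u, v]%classic (EFin \o g).
Proof.
apply: (@integrableS _ _ _ mu `[- Num.max `|u| `|v|, Num.max `|u| `|v|]%classic) => //.
move=> x /=; rewrite !in_itv/= => /andP[ux xv]; rewrite -ler_norml.
rewrite ler_norml; apply/andP; split.
  rewrite lerNl le_max; apply/orP; left.
  by have := ler_norm (- u); rewrite normrN; lra.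
by rewrite le_max (le_trans xv (ler_norm _)) orbT.
Qed.

Let J u v : R := \int[mu]_(x in `]u, v]) g x.

Let Jadd u v w : u <= v -> v <= w -> J u w = J u v + J v w.
Proof.
move=> uv vw; have := @Rintegral_itvB R g (BRight u) (BRight w) v (g_itv u w) uv vw.
by rewrite -/(J u w) -/(J u v) -/(J v w) => <-; ring.
Qed.

Let Jpos u v : 0 < u -> u < v -> J u v = f v - f u.
Proof.
move=> u0 uv; rewrite /J (Rintegral_itv_obnd_cbnd (g_itv u v)) Rint_in.
exact: (ftc_pos Sge0 dS S_second u0 uv).2.
Qed.

Let Jcvg v (e : nat -> R) : (forall n, 0 < e n) -> e n @[n --> \oo] --> 0 ->
  J (e n) v @[n --> \oo] --> J 0 v.
Proof.
move=> e0 ecv; rewrite /J Rint_in.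
under eq_fun do rewrite Rint_in.
apply: (@Rint_dominated_line R (fun n x => \1_(`]e n, v]%classic : set R) x * g x)
    _ (fun x => \1_(`]0, v]%classic : set R) x * `|g x|) _ _ _ _ _).2.
- by move=> n; exact: mgi.
- exact: mgi.
- move=> x; apply: cvg_near_cst; have [x0|x0] := ltP 0 x; near=> n; congr (_ * _).
    have ex : e n < x by near: n; exact: (cvgr_lt (0 : R) ecv _ x0).
    by rewrite !indicE; congr (nat_of_bool _)%:R; apply/idP/idP; rewrite !inE/= !in_itv/= x0 ex.
  by rewrite !indicE !memNset//= in_itv/= ltNge ?x0 ?(le_trans x0 (ltW (e0 n))).
- apply/(@mint_in R _ (measurableTypeR R) mu `]0, v]%classic (fun x => `|g x|)) => //.
  exact: (integrable_norm (g_itv 0 v)).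
- move=> n x; rewrite normrM normr_indic ler_wpM2r//.
  rewrite !indicE; case: (boolP (x \in `]e n, v]%classic)) => //.
  rewrite inE/= in_itv/= => /andP[ux xv].
  by rewrite mem_set//= in_itv/= xv andbT; exact: lt_trans (e0 n) ux.
Unshelve. all: by end_near.
Qed.

(** That [f] tends to 0 at 0 is not yet known. The mean value theorem gives points [xi n] tending to
    0 with [f (xi n) = S (e n) / e n], which tends to 0; integrability of [g] near 0 then lets the
    lower endpoint go to 0 along [xi n]. *)
Let J0 v : 0 < v -> J 0 v = f v.
Proof.
move=> v0; pose e n : R := v / n.+1%:R.
have e0 n : 0 < e n by apply: divr_gt0.
have xi_ex n : exists x : R, [/\ 0 < x, x < e n & f x = S (e n) / e n].
  have := @MVT R S f 0 (e n) (e0 n) (fun x _ => is_derive_all x).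
  case.
    apply: continuous_in_subspaceT => x _; apply: differentiable_continuous.
    by apply/derivable1_diffP; exact: (ex_derive (is_derive := is_derive_all x)).
  move=> x; rewrite in_itv/= => /andP[x0 xe]; rewrite S0 !subr0 => E.
  by exists x; split => //; rewrite E mulfK// gt_eqF.
have [xi xiP] := choice xi_ex.
have xi0 n : 0 < xi n by case: (xiP n).
have ecv : e n @[n --> \oo] --> 0.
  rewrite -(mulr0 v); apply: cvgMl_tmp.
  exact: cvg_harmonic.
have xicv : xi n @[n --> \oo] --> 0.
  apply: (@squeeze_cvgr _ _ _ _ (fun=> 0) e) => //; last exact: cvg_cst.
  by near=> n; case: (xiP n) => a b _; rewrite !ltW.
have h1 := Jcvg (v := v) xi0 xicv.
have h2 : J (xi n) v @[n --> \oo] --> f v - 0.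
  have -> : (fun n => J (xi n) v) = (fun n => f v - S (e n) / e n).
    apply/funext => n; have [a b c] := xiP n; rewrite Jpos//; first by rewrite c.
    apply: lt_le_trans b _; rewrite /e ler_pdivrMr// ler_peMr// ?(ltW v0)//.
    by rewrite ler1n.
  apply: cvgB; first exact: cvg_cst.
  apply: (cvg_comp e (fun h => S h / h) _ S_o).
  move=> A [r /= r0 rA]; near=> n; apply: rA => /=; last by rewrite gt_eqF.
  rewrite sub0r normrN; near: n.
  by move/cvgr0_norm_lt : ecv; apply.
by have := cvg_unique _ h1 h2; rewrite subr0; apply.
Unshelve. all: by end_near.
Qed.

(** Reflection, [g] being even; half-open intervals are matched by dropping an endpoint. *)
Let Jneg v : 0 < v -> J (- v) 0 = f v.
Proof.
move=> v0; rewrite -(J0 v0) /J (Rintegral_itv_obnd_cbnd (g_itv 0 v)).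
rewrite -(@Rintegral_itv_bndo_bndc R (BLeft 0) v); last first.
  apply: integrableS (g_int v) => //.
  by move=> x /=; rewrite !in_itv/= => /andP[x0 xv]; apply/andP; split; lra.
rewrite [LHS]Rint_in [RHS]Rint_in -[LHS]Rint_opp; last exact: mgi.
apply: eq_Rintegral => x _; rewrite derive2_even; congr (_ * _).
rewrite !indicE; congr (nat_of_bool _)%:R.
by apply/idP/idP; rewrite !inE/= !in_itv/= => /andP[? ?]; apply/andP; split; lra.
Qed.

Lemma derive1_ftc u v : u <= v -> \int[mu]_(x in `]u, v]) g x = f v - f u.
Proof.
have Jr w : 0 <= w -> J 0 w = f w.
  rewrite le_eqVlt => /orP[/eqP <-|]; last exact: J0.
  by rewrite /J set_itv_ge ?bnd_simp// Rintegral_set0 f0.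
have Jl w : 0 <= w -> J (- w) 0 = f w.
  rewrite le_eqVlt => /orP[/eqP <-|]; last exact: Jneg.
  by rewrite oppr0 /J set_itv_ge ?bnd_simp// Rintegral_set0 f0.
rewrite -/(J u v) => uv; have [u0|u0] := leP 0 u.
  by have := Jadd u0 uv; rewrite (Jr u)// (Jr v) ?(le_trans u0)// => ->; ring.
have := Jl (- u) ltac:(lra); rewrite opprK derive1_odd.
have [v0|v0] := leP 0 v.
  by move=> E; rewrite (Jadd (ltW u0) v0) E Jr//; ring.
have := Jl (- v) ltac:(lra); rewrite opprK derive1_odd.
by move=> E1 E2; have := Jadd uv (ltW v0); rewrite E1 E2 => ->; ring.
Qed.

(** Only 0 is at stake. From the right, [f y = f 1 - J y 1] converges because [g] is integrable up
    to 0; oddness of [f] gives the left side. *)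
Lemma continuous_derive1 : continuous f.
Proof.
move=> x; have [->|x0] := eqVneq x 0; last first.
  by apply: differentiable_continuous; apply/derivable1_diffP; exact: (dS x0).2.
have h : f y @[y --> 0^'+] --> f 0.
  apply/cvg_at_rightP => e [e0 ecv].
  have h1 := Jcvg (v := 1) e0 ecv.
  have -> : f 0 = f 1 - J 0 1 by rewrite J0 ?ltr01// f0; ring.
  have : f 1 - J (e n) 1 @[n --> \oo] --> f 1 - J 0 1 by apply: cvgB => //; exact: cvg_cst.
  apply: cvg_trans; apply: near_eq_cvg; near=> n.
  rewrite Jpos//; first by ring.
  by near: n; exact: (cvgr_lt (0 : R) ecv _ ltr01).
apply/left_right_continuousP; split=> //.
apply/cvg_at_leftNP; rewrite oppr0.
have -> : f \o -%R = (fun y => - f y) by apply/funext => y /=; rewrite derive1_odd.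
have h1 := cvgN h; have E : f 0 = - f 0 by rewrite f0 oppr0.
by rewrite [X in _ --> X]E; exact: h1.
Unshelve. all: by end_near.
Qed.
End derivative_at_zero.

(** * The covariance form *)

Section product_integrable.
Context {R : realType} d1 d2 {S : measurableType d1} {T : measurableType d2}.
Variables (m1 : {sigma_finite_measure set S -> \bar R}) (m2 : {sigma_finite_measure set T -> \bar R}).

Lemma mint_prod (F : S * T -> R) : measurable_fun [set: S * T] F ->
  (forall z, 0 <= F z) ->
  (forall x, m2.-integrable [set: T] (EFin \o (fun y => F (x, y)))) ->
  m1.-integrable [set: S] (EFin \o (fun x => \int[m2]_y F (x, y))) ->
  (m1 \x m2)%E.-integrable [set: S * T] (EFin \o F).
Proof.
move=> mF F0 iy ix; apply/integrable12ltyP; first exact/measurable_EFinP.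
rewrite (eq_integral (fun x => `|(\int[m2]_y F (x, y))%R%:E|%E)).
  by case/integrableP : ix.
move=> x _; have -> : (\int[m2]_y F (x, y))%R%:E = (\int[m2]_y (F (x, y))%:E)%E.
  by rewrite /Rintegral fineK//; exact: integrable_fin_num (iy x).
rewrite gee0_abs ?integral_ge0//=; last by move=> y _; rewrite lee_fin.
by apply: eq_integral => y _ /=; rewrite ger0_norm.
Qed.
End product_integrable.

Section quadratic_form.
Context {R : realType}.
Local Notation mu := (@lebesgue_measure R).
Local Notation mu2 := ((@lebesgue_measure R \x @lebesgue_measure R)%E).

Lemma Rint_reflect (y : R) (h : R -> R) : measurable_fun [set: R] h ->
  \int[mu]_x h (y - x) = \int[mu]_x h x.
Proof.
move=> mh; rewrite -[RHS](Rint_shift y)// -[RHS]Rint_opp.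
  by apply: eq_Rintegral => x _; rewrite addrC.
by apply: measurableT_comp => //; exact: measurable_funD.
Qed.

Lemma mint_reflect (y : R) (h : R -> R) : measurable_fun [set: R] h ->
  mu.-integrable [set: R] (EFin \o h) -> mu.-integrable [set: R] (EFin \o (fun x => h (y - x))).
Proof.
move=> mh ih; have m1 : measurable_fun [set: R] (fun x : R => h (x + y)).
  by apply: measurableT_comp => //; exact: measurable_funD.
have := (mint_opp m1).2 ((mint_shift y mh).2 ih).
by under eq_fun do rewrite /= addrC.
Qed.

Definition locint (psi : R -> R) := measurable_fun [set: R] psi /\
  forall M, mu.-integrable `[- M, M]%classic (EFin \o psi).

Lemma locint_cut psi (u v : R) : locint psi ->
  mu.-integrable [set: R] (EFin \o (fun x => \1_(`[u, v]%classic : set R) x * psi x)).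
Proof.
move=> [mpsi ipsi].
apply/(@mint_in R _ (measurableTypeR R) mu `[u, v]%classic psi) => //.
apply: (@integrableS _ _ _ mu `[- Num.max `|u| `|v|, Num.max `|u| `|v|]%classic) => //.
move=> x /=; rewrite !in_itv/= => /andP[ux xv].
have hu := ler_norm (- u); rewrite normrN in hu; have hv := ler_norm v.
by rewrite lerNl !le_max; apply/andP; split; apply/orP; [left|right]; lra.
Qed.

Lemma locint_norm psi : locint psi -> locint (fun x => `|psi x|).
Proof.
move=> [mpsi ipsi]; split; first exact: measurableT_comp.
by move=> M; exact: (integrable_norm (ipsi M)).
Qed.

Lemma locint_shift psi t : locint psi -> locint (fun x => psi (x + t)).
Proof.
move=> hp; have [mpsi _] := hp.
have m1 : measurable_fun [set: R] (fun x => psi (x + t)).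
  by apply: measurableT_comp => //; exact: measurable_funD.
split=> // M; apply/(@mint_in R _ (measurableTypeR R) mu `[- M, M]%classic (fun x => psi (x + t))) => //.
have h := locint_cut (- M + t) (M + t) hp.
have m2 : measurable_fun [set: R] (fun x => \1_(`[- M + t, M + t]%classic : set R) x * psi x).
  by apply: measurable_funM => //; exact: measurable_indic.
have := (mint_shift t m2).2 h.
apply: eq_integrable => // x _ /=; congr (_ * _)%:E.
by rewrite !indicE; congr (nat_of_bool _)%:R; apply/idP/idP; rewrite !inE/= !in_itv/= !lerD2r.
Qed.

Lemma measurable_diff : measurable_fun [set: R * R] (fun z : R * R => z.2 - z.1).
Proof. by apply: measurable_funB; [exact: measurable_snd|exact: measurable_fst]. Qed.

Section kernel.
Variable psi : R -> R.
Hypothesis lpsi : locint psi.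

Let mpsi : measurable_fun [set: R] psi. Proof. by case: lpsi. Qed.

Lemma measurable_form (g g' : R -> R) : measurable_fun [set: R] g -> measurable_fun [set: R] g' ->
  measurable_fun [set: R * R] (fun z => psi (z.2 - z.1) * g z.1 * g' z.2).
Proof.
move=> mg mg'; apply: measurable_funM; [apply: measurable_funM|].
- by apply: measurableT_comp => //; exact: measurable_diff.
- by apply: measurableT_comp => //; exact: measurable_fst.
- by apply: measurableT_comp => //; exact: measurable_snd.
Qed.

Let Psi L x := \1_(`[- L, L]%classic : set R) x * `|psi x|.

Let mPsi L : measurable_fun [set: R] (Psi L).
Proof. by apply: measurable_funM; [exact: measurable_indic|exact: measurableT_comp]. Qed.

Let iPsi L : mu.-integrable [set: R] (EFin \o Psi L).
Proof. exact: (locint_cut (- L) L (locint_norm lpsi)). Qed.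

(** For points of an interval of length [L] the difference stays in [[-L, L]], and shifting [y] by
    [x] factors the integral. The factor [l], independent of [L], is what makes thin strips
    cheap. *)
Lemma form_dominating u l L : 0 <= l ->
  mu2.-integrable [set: R * R]
    (EFin \o (fun z => \1_(`[u, u + l]%classic : set R) z.1 * Psi L (z.2 - z.1))) /\
  \int[mu2]_z (\1_(`[u, u + l]%classic : set R) z.1 * Psi L (z.2 - z.1)) =
  l * \int[mu]_x Psi L x.
Proof.
move=> l0; set F := fun z : R * R => _.
have mF : measurable_fun [set: R * R] F.
  apply: measurable_funM.
    by apply: measurableT_comp; [exact: measurable_indic|exact: measurable_fst].
  by apply: measurableT_comp => //; exact: measurable_diff.
have Psi0 x : 0 <= Psi L x by rewrite mulr_ge0// indicE ler0n.
have F0 z : 0 <= F z by rewrite mulr_ge0// indicE ler0n.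
have i1 := @mint_itv_bounded R u (u + l) 1 (fun=> 1) (measurable_cst _) (fun x _ => ltac:(by rewrite normr1)).
have iy x : mu.-integrable [set: R] (EFin \o (fun y => F (x, y))).
  rewrite /F /=; apply: (@mintZ R _ (measurableTypeR R) mu).
  exact: ((mint_shift (- x) (mPsi L)).2 (iPsi L)).
have iyE x : \int[mu]_y F (x, y) = \1_(`[u, u + l]%classic : set R) x * \int[mu]_y Psi L y.
  rewrite /F /= RintegralZl//; last exact: ((mint_shift (- x) (mPsi L)).2 (iPsi L)).
  by rewrite (Rint_shift (- x)).
have iF : mu2.-integrable [set: R * R] (EFin \o F).
  apply: mint_prod => //.
  have := @mintZ R _ (measurableTypeR R) mu (\int[mu]_y Psi L y) _ i1.
  by apply: eq_integrable => // x _ /=; rewrite iyE mulrC mulr1.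
split=> //; rewrite -(Rint_fubini1 iF).2.
under eq_Rintegral do rewrite iyE.
have -> : \int[mu]_x (\1_(`[u, u + l]%classic : set R) x * \int[mu]_y Psi L y) =
   \int[mu]_x (\int[mu]_y Psi L y * (\1_(`[u, u + l]%classic : set R) x * 1)).
  by apply: eq_Rintegral => x _; rewrite mulr1 mulrC.
rewrite RintegralZl// mulrC -Rint_in; congr (_ * _).
rewrite Rintegral_cst// mul1r.
have E := @lebesgue_measure_itv R `[u, u + l]%R.
move: E; rewrite /= lte_fin => E; rewrite [X in fine X]E.
case: ltP => h /=; last by lra.
ring.
Qed.

Lemma form_bound (g g' : R -> R) (A A' u L : R) : measurable_fun [set: R] g -> measurable_fun [set: R] g' ->
  0 <= L -> (forall x, `|g x| <= A) -> (forall x, `|g' x| <= A') ->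
  (forall x, ~~ (u <= x <= u + L) -> g x = 0) ->
  (forall x, ~~ (u <= x <= u + L) -> g' x = 0) ->
  mu2.-integrable [set: R * R] (EFin \o (fun z => psi (z.2 - z.1) * g z.1 * g' z.2)) /\
  \int[mu2]_z `|psi (z.2 - z.1) * g z.1 * g' z.2| <= A * A' * (L * \int[mu]_x Psi L x).
Proof.
move=> mg mg' L0 gA gA' g0 g0'; have [iD vD] := form_dominating u L L0.
have A0 : 0 <= A by apply: le_trans (normr_ge0 _) (gA 0).
have A0' : 0 <= A' by apply: le_trans (normr_ge0 _) (gA' 0).
have iD' := @mintZ R _ _ mu2 (A * A') _ iD.
have le z : `|psi (z.2 - z.1) * g z.1 * g' z.2| <=
    A * A' * (\1_(`[u, u + L]%classic : set R) z.1 * Psi L (z.2 - z.1)).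
  have [z1|z1] := boolP (u <= z.1 <= u + L); last first.
    by rewrite (g0 _ z1) mulr0 mul0r normr0 !mulr_ge0// indicE ler0n.
  have [z2|z2] := boolP (u <= z.2 <= u + L); last first.
    by rewrite (g0' _ z2) mulr0 normr0 !mulr_ge0// indicE ler0n.
  rewrite /Psi !indicE !mem_set /= ?in_itv//=; last by apply/andP; split; lra.
  rewrite !mul1r !normrM [X in X <= _](_ : _ = `|g z.1| * `|g' z.2| * `|psi (z.2 - z.1)|); last by ring.
  by rewrite ler_wpM2r// ler_pM.
have iF : mu2.-integrable [set: R * R] (EFin \o (fun z => psi (z.2 - z.1) * g z.1 * g' z.2)).
  apply: (@le_integrableT R _ _ mu2 _ _ _ _ iD'); first exact: measurable_form.
  by move=> z; apply: le_trans (le z) (ler_norm _).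
split=> //; rewrite -vD -RintegralZl//; apply: le_Rintegral => //.
  exact: (integrable_norm iF).
Qed.

Definition form (g g' : R -> R) := \int[mu2]_z (psi (z.2 - z.1) * g z.1 * g' z.2).

(** One constant bounds both the values and the support, so that a family of functions is uniformly
    dominated as soon as [M] is common. *)
Definition nice (M : R) (g : R -> R) := [/\ measurable_fun [set: R] g,
  forall x, `|g x| <= M & forall x, M < `|x| -> g x = 0].

Lemma nice_le M N g : M <= N -> nice M g -> nice N g.
Proof.
move=> MN [mg gM g0]; split=> // x; first exact: le_trans (gM x) MN.
by move=> Nx; apply: g0; exact: le_lt_trans Nx.
Qed.

Lemma nice_ge0 M g : nice M g -> 0 <= M.
Proof. by move=> [_ gM _]; exact: le_trans (normr_ge0 _) (gM 0). Qed.

Lemma form_mint M N g g' : nice M g -> nice N g' ->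
  mu2.-integrable [set: R * R] (EFin \o (fun z => psi (z.2 - z.1) * g z.1 * g' z.2)).
Proof.
move=> hg hg'; pose K := Num.max M N.
have [mg gM g0] : nice K g by apply: nice_le hg; rewrite le_max lexx.
have [mg' gM' g0'] : nice K g' by apply: nice_le hg'; rewrite le_max lexx orbT.
have K0 : 0 <= K by rewrite le_max (nice_ge0 hg).
apply: (form_bound (A := K) (A' := K) (u := - K) (L := 2 * K) _ _ _ _ _ _ _).1 => //.
- by rewrite mulr_ge0.
- move=> x xK; apply: g0; move: xK; apply: contraR; rewrite -leNgt ler_norml => /andP[? ?].
  by apply/andP; split; lra.
- move=> x xK; apply: g0'; move: xK; apply: contraR; rewrite -leNgt ler_norml => /andP[? ?].
  by apply/andP; split; lra.
Qed.

Lemma form_cvg M (g g' : nat -> R -> R) h h' : (forall n, nice M (g n)) -> (forall n, nice M (g' n)) ->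
  (forall x, g n x @[n --> \oo] --> h x) -> (forall x, g' n x @[n --> \oo] --> h' x) ->
  form (g n) (g' n) @[n --> \oo] --> form h h'.
Proof.
move=> ng ng' gh gh'; have M0 := nice_ge0 (ng 0%N).
have mgn n : measurable_fun [set: R] (g n) by case: (ng n).
have mgn' n : measurable_fun [set: R] (g' n) by case: (ng' n).
have mh : measurable_fun [set: R] h.
  by apply: (@measurable_fun_cvg _ R R setT g h) => // x _; exact: gh.
have mh' : measurable_fun [set: R] h'.
  by apply: (@measurable_fun_cvg _ R R setT g' h') => // x _; exact: gh'.
pose B := fun x : R => M * \1_(`[- M, M]%classic : set R) x.
have gB n x : `|g n x| <= B x.
  rewrite /B indicE; case: (boolP (x \in _)) => xM.
    by rewrite mulr1; case: (ng n).
  rewrite mulr0; have [_ _ ->] := ng n; rewrite ?normr0// ltNge; apply: contra xM.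
  by rewrite inE/= in_itv/= -ler_norml.
have gB' n x : `|g' n x| <= B x.
  rewrite /B indicE; case: (boolP (x \in _)) => xM.
    by rewrite mulr1; case: (ng' n).
  rewrite mulr0; have [_ _ ->] := ng' n; rewrite ?normr0// ltNge; apply: contra xM.
  by rewrite inE/= in_itv/= -ler_norml.
have nB : nice M B.
  split; first by apply: measurable_funM => //; exact: measurable_indic.
    by move=> x; rewrite normrM normr_indic ger0_norm// ler_piMr// indic_le1.
  move=> x xM; rewrite /B indicE memNset ?mulr0//= in_itv/= -ler_norml.
  by apply/negP; rewrite -ltNge.
have iB := integrable_norm (form_mint nB nB).
apply: (@Rint_dominated _ _ _ mu2 (fun n z => psi (z.2 - z.1) * g n z.1 * g' n z.2) _ _ _ _ _ iB _).2.
- by move=> n; exact: measurable_form.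
- exact: measurable_form.
- apply: aeW => z; apply: cvgM; last exact: gh'.
  by apply: cvgM; [exact: cvg_cst|exact: gh].
- move=> n z; rewrite /comp.
  have B0 x : `|B x| = B x by rewrite ger0_norm// mulr_ge0// indicE ler0n.
  rewrite (normrM _ (g' n z.2)) (normrM _ (g n z.1)) (normrM _ (B z.2)) (normrM _ (B z.1)) !B0.
  by apply: ler_pM => //; rewrite ?mulr_ge0//; apply: ler_wpM2l.
Qed.

Lemma formDl M g1 g2 g' (k : R) : nice M g1 -> nice M g2 -> nice M g' ->
  form (fun x => g1 x + k * g2 x) g' = form g1 g' + k * form g2 g'.
Proof.
move=> n1 n2 n'; rewrite /form -RintegralZl//; last exact: (form_mint n2 n').
rewrite -RintegralD//; first by apply: eq_Rintegral => z _; ring.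
- exact: (form_mint n1 n').
- by apply: mintZ; exact: (form_mint n2 n').
Qed.

Lemma formDr M g1 g2 g' (k : R) : nice M g1 -> nice M g2 -> nice M g' ->
  form g' (fun x => g1 x + k * g2 x) = form g' g1 + k * form g' g2.
Proof.
move=> n1 n2 n'; rewrite /form -RintegralZl//; last exact: (form_mint n' n2).
rewrite -RintegralD//; first by apply: eq_Rintegral => z _; ring.
- exact: (form_mint n' n1).
- by apply: mintZ; exact: (form_mint n' n2).
Qed.

Lemma form_iter M g g' : nice M g -> nice M g' ->
  form g g' = \int[mu]_y \int[mu]_x (psi (y - x) * g x * g' y).
Proof. by move=> ng ng'; rewrite /form -(Rint_fubini2 (form_mint ng ng')).2. Qed.

Lemma formC M g g' : (forall x, psi (- x) = psi x) -> nice M g -> nice M g' ->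
  form g g' = form g' g.
Proof.
move=> ev ng ng'; rewrite (form_iter ng ng') /form -(Rint_fubini1 (form_mint ng' ng)).2 /=.
apply: eq_Rintegral => x _; apply: eq_Rintegral => y _.
by rewrite -ev opprB mulrAC.
Qed.
End kernel.
End quadratic_form.

(** * Elementary functions and their pointwise limits *)

Section elementary_functions.
Context {R : realType}.
Local Notation mu := (@lebesgue_measure R).
Implicit Types e : seq (R * R * R).

Lemma elementary_cons p e : elementary (p :: e) -> (0 <= p.1.2 /\ p.1.2 <= p.2) /\ elementary e.
Proof.
move=> h; split; first by apply: h; rewrite mem_head.
by move=> q qe; apply: h; rewrite inE qe orbT.
Qed.

Definition escale (k : R) e := [seq (k * p.1.1, p.1.2, p.2) | p <- e].

Lemma elementary_cat k e1 e2 : elementary e1 -> elementary e2 -> elementary (e1 ++ escale k e2).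
Proof.
move=> h1 h2 p; rewrite mem_cat => /orP[|/mapP[q qe ->]]; first exact: h1.
exact: (h2 q qe).
Qed.

Lemma elementary_fun_cat k e1 e2 x :
  elementary_fun (e1 ++ escale k e2) x = elementary_fun e1 x + k * elementary_fun e2 x.
Proof.
rewrite /elementary_fun big_cat/= big_map mulr_sumr; congr (_ + _).
by apply: eq_bigr => p _; rewrite mulrA.
Qed.

Lemma elementary_fun_cons p e x :
  elementary_fun (p :: e) x = p.1.1 * \1_(`]p.1.2, p.2]%classic : set R) x + elementary_fun e x.
Proof. by rewrite /elementary_fun big_cons. Qed.

Lemma elementary_fun_neg e x : elementary e -> x <= 0 -> elementary_fun e x = 0.
Proof.
move=> he x0; rewrite /elementary_fun big_seq big1// => p /he[p0 _].
by rewrite indicE memNset ?mulr0//= in_itv/= => /andP[]; lra.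
Qed.

Lemma nice_itv (a b : R) : nice (Num.max 1 (Num.max `|a| `|b|)) (\1_(`]a, b]%classic : set R) : R -> R).
Proof.
split; first exact: measurable_indic.
  by move=> x; rewrite normr_indic le_max indic_le1.
move=> x; rewrite !gt_max => /andP[_ /andP[ax bx]].
rewrite indicE memNset//= in_itv/= => /andP[h1 h2].
have := ler_norm (- a); rewrite normrN => ha; have hb := ler_norm b.
have [x0|x0] := leP 0 x; [move: bx; rewrite (ger0_norm x0)|move: ax; rewrite (ltr0_norm x0)]; lra.
Qed.

Lemma niceD (M N k : R) (g g' : R -> R) : nice M g -> nice N g' ->
  nice (Num.max (Num.max M N) (M + `|k| * N)) (fun x => g x + k * g' x).
Proof.
move=> [mg gM g0] [mg' gM' g0']; split.
- by apply: measurable_funD => //; exact: measurable_funM.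
- move=> x; rewrite le_max; apply/orP; right; apply: le_trans (ler_normD _ _) _.
  by rewrite normrM lerD// ler_wpM2l.
- move=> x; rewrite !gt_max => /andP[/andP[Mx Nx] _].
  by rewrite g0// g0'// mulr0 addr0.
Qed.

Lemma nice_elementary e : exists M, nice M (elementary_fun e).
Proof.
elim: e => [|p e [M nM]].
  exists 0; split.
  - have -> : elementary_fun [::] = (fun=> 0 : R) by apply/funext => x; rewrite /elementary_fun big_nil.
    exact: measurable_cst.
  - by move=> x; rewrite /elementary_fun big_nil normr0.
  - by move=> x _; rewrite /elementary_fun big_nil.
have h := niceD p.1.1 nM (nice_itv p.1.2 p.2).
eexists; have -> : elementary_fun (p :: e) =
    (fun x => elementary_fun e x + p.1.1 * \1_(`]p.1.2, p.2]%classic : set R) x).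
  by apply/funext => x; rewrite elementary_fun_cons addrC.
exact: h.
Qed.

(** Pointwise limits of uniformly bounded elementary functions with a common bounded support. On
    them [form] is a limit of its values on elementary functions, hence inherits the positivity that
    comes from variances. *)
Definition approximable (g : R -> R) := exists (e : nat -> seq (R * R * R)) (M : R),
  [/\ forall n, elementary (e n), forall n, nice M (elementary_fun (e n)) &
      forall x, elementary_fun (e n) x @[n --> \oo] --> g x].

Lemma approximable_elementary e : elementary e -> approximable (elementary_fun e).
Proof.
by move=> he; have [M nM] := nice_elementary e; exists (fun=> e), M; split => // x; exact: cvg_cst.
Qed.

Lemma approximableD (k : R) (g g' : R -> R) : approximable g -> approximable g' ->
  approximable (fun x => g x + k * g' x).
Proof.
move=> [e [M [he nM cv]]] [e' [M' [he' nM' cv']]].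
exists (fun n => e n ++ escale k (e' n)), (Num.max (Num.max M M') (M + `|k| * M')).
have E n : elementary_fun (e n ++ escale k (e' n)) =
    (fun x => elementary_fun (e n) x + k * elementary_fun (e' n) x).
  by apply/funext => x; exact: elementary_fun_cat.
split.
- by move=> n; exact: elementary_cat.
- by move=> n; rewrite E; exact: niceD.
- move=> x; under eq_fun do rewrite E.
  by apply: cvgD => //; apply: cvgMl_tmp.
Qed.

Lemma approximable_nice g : approximable g -> exists M, nice M g.
Proof.
move=> [e [M [he nM cv]]]; exists M; split.
- apply: (@measurable_fun_cvg _ R R setT (fun n => elementary_fun (e n)) g) => [n|x _]; last exact: cv.
  by case: (nM n).
- move=> x; apply: (ler_cvg_to (cvg_norm (cv x)) (cvg_cst M)).
  by apply: nearW => n; case: (nM n).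
- move=> x Mx; apply: (cvg_unique _ (cv x)) => //.
  have -> : (fun n => elementary_fun (e n) x) = (fun=> 0).
    by apply/funext => n; have [_ _ ->] := nM n.
  exact: cvg_cst.
Qed.

Lemma quadratic_discriminant (a b c : R) : 0 <= a -> 0 <= c ->
  (forall t, 0 <= a + 2 * t * b + t ^+ 2 * c) -> b ^+ 2 <= a * c.
Proof.
move=> a0 c0 h; have [cE|cE] := eqVneq c 0.
  have [->|b0] := eqVneq b 0; first by rewrite expr0n/= cE mulr0.
  have := h (- (a + 1) / (2 * b)); rewrite cE mulr0 addr0.
  rewrite (_ : 2 * _ * b = - (a + 1)); last by field.
  lra.
have c1 : 0 < c by rewrite lt_neqAle eq_sym cE.
have := h (- b / c); rewrite (_ : a + _ + _ = (a * c - b ^+ 2) / c); last by field.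
by rewrite pmulr_lge0 ?invr_gt0// subr_ge0.
Qed.

Lemma locint_sub (psi : R -> R) (A : set R) (u v : R) : locint psi -> measurable A ->
  A `<=` `[u, v]%classic -> mu.-integrable A (EFin \o psi).
Proof.
move=> lpsi mA Auv; apply: (@integrableS _ _ _ mu `[u, v]%classic) => //.
apply/(@mint_in R _ (measurableTypeR R) mu `[u, v]%classic psi) => //.
exact: locint_cut.
Qed.
End elementary_functions.

(** * The covariance of the generalized derivative *)

Section process.
Context {R : realType} d {T : measurableType d}.
Local Notation mu := (@lebesgue_measure R).
Variables (P : probability T R) (G : R -> T -> R) (S : R -> R).
Variable f : R -> R.
Let r := rho S.
Hypothesis hG : centered_gaussian_process P G.
Hypothesis hvar : increments_variance P G S.
Hypothesis Sev : forall x, S (- x) = S x.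
Hypothesis lr : locint r.
Hypothesis rev : forall x, r (- x) = r x.
Hypothesis ftc : forall u v, u <= v -> \int[mu]_(x in `]u, v]) r x = f v - f u.
Hypothesis cf : continuous f.
Hypothesis dS : forall x : R, is_derive x 1 (fun x => 2^-1 * S x) (f x).

(** The inner integral of [r (y - x)] is [f (y - a) - f (y - b)] by [ftc], and [f] is in turn the
    derivative of [S / 2]. The intervals may overlap, so the identity across 0 is needed. *)
Lemma form_itv a b c d' : a <= b -> c <= d' ->
  form r (\1_(`]a, b]%classic : set R)) (\1_(`]c, d']%classic : set R)) =
  2^-1 * (S (d' - a) - S (c - a) - S (d' - b) + S (c - b)).
Proof.
move=> ab cd.
set A := (\1_(`]a, b]%classic : set R) : R -> R); set B := (\1_(`]c, d']%classic : set R) : R -> R).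
pose M := Num.max (Num.max 1 (Num.max `|a| `|b|)) (Num.max 1 (Num.max `|c| `|d'|)).
have nA : nice M A by apply: nice_le (nice_itv a b); rewrite le_max lexx.
have nB : nice M B by apply: nice_le (nice_itv c d'); rewrite le_max lexx orbT.
have [mr _] := lr; have mA : measurable_fun [set: R] A by case: nA.
rewrite (form_iter lr nA nB).
have inner y : \int[mu]_x (r (y - x) * A x * B y) = B y * (f (y - a) - f (y - b)).
  have mh : measurable_fun [set: R] (fun z => \1_(`[y - b, y - a[%classic : set R) z * r z).
    by apply: measurable_funM => //; exact: measurable_indic.
  have ih : mu.-integrable `[y - b, y - a[%classic (EFin \o r).
    apply: (locint_sub (u := y - b) (v := y - a)) => // x /=.
    by rewrite !in_itv/= => /andP[h1 h2]; rewrite h1 ltW.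
  have iy : mu.-integrable [set: R] (EFin \o (fun x => \1_(`[y - b, y - a[%classic : set R) (y - x) * r (y - x))).
    apply: (@mint_reflect R y (fun z => \1_(`[y - b, y - a[%classic : set R) z * r z)) => //.
    by apply/(@mint_in R _ (measurableTypeR R) mu `[y - b, y - a[%classic r).
  have -> : \int[mu]_x (r (y - x) * A x * B y) =
     \int[mu]_x (B y * (\1_(`[y - b, y - a[%classic : set R) (y - x) * r (y - x))).
    apply: eq_Rintegral => x _; rewrite [RHS]mulrC; congr (_ * _); rewrite mulrC; congr (_ * _).
    by rewrite /A !indicE; congr (nat_of_bool _)%:R; apply/idP/idP; rewrite !inE/= !in_itv/= => /andP[? ?]; apply/andP; split; lra.
  rewrite RintegralZl//; congr (_ * _).
  rewrite (Rint_reflect y (h := fun z => \1_(`[y - b, y - a[%classic : set R) z * r z))//.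
  rewrite -Rint_in Rintegral_itv_bndo_bndc// -Rintegral_itv_obnd_cbnd; first by apply: ftc; lra.
  apply: (locint_sub (u := y - b) (v := y - a)) => // x /=.
  by rewrite !in_itv/= => /andP[h1 h2]; rewrite h2 ltW.
have -> : \int[mu]_y \int[mu]_x (r (y - x) * A x * B y) = \int[mu]_(y in `]c, d']) (f (y - a) - f (y - b)).
  by rewrite [RHS]Rint_in; apply: eq_Rintegral => y _; exact: inner.
move: cd; rewrite le_eqVlt => /orP[/eqP <-|cd].
  by rewrite set_itv_ge ?bnd_simp ?ltxx// Rintegral_set0; ring.
have cff : continuous (fun y => f (y - a) - f (y - b)).
  move=> y; apply: cvgB; (apply: (@continuous_comp _ _ _ (fun x => x - _) f); [apply: cvgB; [exact: cvg_id|exact: cvg_cst]|exact: cf]).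
have icd : mu.-integrable `[c, d']%classic (EFin \o (fun y => f (y - a) - f (y - b))).
  apply: continuous_compact_integrable; first exact: segment_compact.
  exact: continuous_subspaceT.
rewrite Rintegral_itv_obnd_cbnd; last first.
  apply: (integrableS _ _ _ icd) => // x /=.
  by rewrite !in_itv/= => /andP[h1 h2]; rewrite h2 ltW.
have dF t y : is_derive (y : R) 1 (fun y => 2^-1 * S (y - t)) (f (y - t)).
  have h2 : is_derive y 1 (fun x : R => x - t) 1.
    have -> : (fun x : R => x - t) = id + cst (- t) by [].
    by rewrite -[X in is_derive _ _ _ X]addr0; apply: is_deriveD.
  have := @is_derive1_comp R (fun x => 2^-1 * S x) (fun x => x - t) y (f (y - t)) 1 (dS _) h2.
  by rewrite mulr1.
have dF2 y : is_derive (y : R) 1 (fun y => 2^-1 * S (y - a) - 2^-1 * S (y - b)) (f (y - a) - f (y - b)).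
  exact: is_deriveB.
have cF : continuous (fun y => 2^-1 * S (y - a) - 2^-1 * S (y - b)).
  move=> y; apply: differentiable_continuous; apply/derivable1_diffP.
  exact: (ex_derive (is_derive := dF2 y)).
rewrite /Rintegral (@continuous_FTC2 _ _ (fun y => 2^-1 * S (y - a) - 2^-1 * S (y - b)))//.
- by rewrite /=; ring.
- exact: continuous_subspaceT.
- split.
  + by move=> y _; exact: (ex_derive (is_derive := dF2 y)).
  + by apply: cvg_at_right_filter; exact: cF.
  + by apply: cvg_at_left_filter; exact: cF.
- by move=> y _; rewrite derive1E; exact: (derive_val (is_derive := dF2 y)).
Qed.

Local Notation D := (elementary_derivative G).
Local Notation ef := elementary_fun.

Lemma elementary_derivative_cat k e1 e2 w : D (e1 ++ escale k e2) w = D e1 w + k * D e2 w.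
Proof.
rewrite /elementary_derivative big_cat/= big_map mulr_sumr; congr (_ + _).
by apply: eq_bigr => p _; rewrite mulrA.
Qed.

(** The process hypothesis concerns sums of values, not of increments; the combination is rewritten
    over the [2n] endpoints, with opposite signs at left ones. *)
Lemma gauss_elementary e : elementary e -> gauss P (D e).
Proof.
move=> he; pose n := size e; pose p0 : R * R * R := (0, 0, 0).
pose q i := nth p0 e i.
pose t (i : 'I_(n + n)) := match fintype.split i with inl j => (q j).2 | inr j => (q j).1.2 end.
pose c (i : 'I_(n + n)) := match fintype.split i with inl j => (q j).1.1 | inr j => - (q j).1.1 end.
have t0 i : 0 <= t i.
  rewrite /t; case: (fintype.split i) => j; have [h1 h2] := he _ (mem_nth p0 (ltn_ord j)) => //.
  exact: le_trans h1 h2.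
have [h _] := centered_gaussian_gauss (hG c t0).
have -> : D e = (fun w => \sum_(i < n + n) c i * G (t i) w) => //.
apply/funext => w; rewrite big_split_ord/= -big_split/=.
rewrite /elementary_derivative (big_nth p0) big_mkord; apply: eq_bigr => i _.
rewrite /t /c; have -> : fintype.split (lshift n i) = inl i by exact: (unsplitK (inl i)).
have -> : fintype.split (rshift n i) = inr i by exact: (unsplitK (inr i)).
by rewrite mulrBr mulNr.
Qed.

Lemma gauss2_elementary e e' : elementary e -> elementary e' -> gauss2 P (D e) (D e').
Proof.
move=> he he' a b.
have h := gauss_elementary (elementary_cat (k := b) (elementary_cat (e1 := [::]) (k := a) (fun _ => ltac:(by [])) he) he').
have -> : (fun w => a * D e w + b * D e' w) = D (([::] ++ escale a e) ++ escale b e') => //.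
apply/funext => w; rewrite !elementary_derivative_cat.
by rewrite (_ : D [::] w = 0) ?add0r// /elementary_derivative big_nil.
Qed.

Lemma sqint_elementary e : elementary e -> sqint P (D e).
Proof. by move=> he; apply: gauss_sqint; exact: gauss_elementary. Qed.

Let inc a b w := G b w - G a w.

Lemma sqint_increment a b : 0 <= a -> 0 <= b -> sqint P (inc a b) /\
  \int[P]_w (inc a b w ^+ 2) = S (b - a).
Proof.
move=> a0 b0; split.
  have [ab|/ltW ba] := leP a b.
    have -> : inc a b = D [:: (1, a, b)].
      by apply/funext => w; rewrite /elementary_derivative big_seq1 mul1r.
    by apply: sqint_elementary => p; rewrite inE => /eqP ->.
  have -> : inc a b = (fun w => - D [:: (1, b, a)] w).
    by apply/funext => w; rewrite /elementary_derivative big_seq1 mul1r /= /inc opprB.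
  by apply: sqintN; apply: sqint_elementary => p; rewrite inE => /eqP ->.
have [h _] := hvar b0 a0; rewrite /Rintegral.
by move: h; rewrite unlock => ->.
Qed.

(** Polarization: twice the product of the increments over [[a, b]] and [[c, d']] is the sum of
    squares of the increments over [[c, b]] and [[a, d']], minus those over [[d', b]] and
    [[c, a]]. *)
Lemma cov_increment a b c d' : 0 <= a -> a <= b -> 0 <= c -> c <= d' ->
  \int[P]_w (inc a b w * inc c d' w) =
  form r (\1_(`]a, b]%classic : set R)) (\1_(`]c, d']%classic : set R)).
Proof.
move=> a0 ab c0 cd; rewrite form_itv//.
have b0 := le_trans a0 ab; have d0 := le_trans c0 cd.
have mi x y : 0 <= x -> 0 <= y -> P.-integrable [set: T] (EFin \o (fun w => inc x y w ^+ 2)).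
  by move=> x0 y0; case: (sqint_increment x0 y0) => -[].
have v x y (x0 : 0 <= x) (y0 : 0 <= y) := (sqint_increment x0 y0).2.
have -> : \int[P]_w (inc a b w * inc c d' w) =
  \int[P]_w (2^-1 * ((inc c b w ^+ 2 + inc a d' w ^+ 2) - (inc d' b w ^+ 2 + inc c a w ^+ 2))).
  by apply: eq_Rintegral => w _; rewrite /inc; field.
rewrite RintegralZl//; last first.
  by apply: mintB; apply: mintD; exact: mi.
rewrite RintegralB//; [|by apply: mintD; exact: mi|by apply: mintD; exact: mi].
rewrite !RintegralD ?v//; [|exact: mi..].
have -> : S (b - c) = S (c - b) by rewrite -Sev opprB.
have -> : S (b - d') = S (d' - b) by rewrite -Sev opprB.
have -> : S (a - c) = S (c - a) by rewrite -Sev opprB.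
by ring.
Qed.

Let form0l g : form r (fun=> 0) g = 0.
Proof. by rewrite /form /Rintegral integral0_eq// => z _; rewrite mulr0 mul0r. Qed.

Lemma cov_elementary e e' : elementary e -> elementary e' ->
  \int[P]_w (D e w * D e' w) = form r (ef e) (ef e').
Proof.
have Dcons p e1 : D (p :: e1) = (fun w => D e1 w + p.1.1 * inc p.1.2 p.2 w).
  by apply/funext => w; rewrite /elementary_derivative big_cons addrC.
have Dnil : D [::] = (fun=> 0) by apply/funext => w; rewrite /elementary_derivative big_nil.
have fnil : ef [::] = (fun=> 0 : R) by apply/funext => w; rewrite /elementary_fun big_nil.
have fcons p e1 : ef (p :: e1) = (fun x => ef e1 x + p.1.1 * \1_(`]p.1.2, p.2]%classic : set R) x).
  by apply/funext => x; rewrite elementary_fun_cons addrC.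
have step p e1 e2 : elementary (p :: e1) -> elementary e2 ->
    \int[P]_w (D e1 w * D e2 w) = form r (ef e1) (ef e2) ->
    \int[P]_w (inc p.1.2 p.2 w * D e2 w) = form r (\1_(`]p.1.2, p.2]%classic : set R)) (ef e2) ->
    \int[P]_w (D (p :: e1) w * D e2 w) = form r (ef (p :: e1)) (ef e2).
  move=> he1 he2 E1 E2; have [[p0 p1] he1'] := elementary_cons he1.
  have si := (sqint_increment p0 (le_trans p0 p1)).1.
  rewrite Dcons fcons.
  have [M1 n1] := nice_elementary e1; have [M2 n2] := nice_elementary e2.
  have n3 := nice_itv p.1.2 p.2.
  pose M := Num.max (Num.max M1 M2) (Num.max 1 (Num.max `|p.1.2| `|p.2|)).
  rewrite (@formDl _ _ lr M); [|by apply: nice_le n1; rewrite !le_max lexx|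
    by apply: nice_le n3; rewrite /M le_max lexx orbT|by apply: nice_le n2; rewrite !le_max lexx orbT].
  rewrite -E1 -E2 -RintegralZl//; last by apply: sqintM => //; exact: sqint_elementary.
  rewrite -RintegralD//; first by apply: eq_Rintegral => w _; ring.
  - by apply: sqintM; exact: sqint_elementary.
  - by apply: mintZ; apply: sqintM => //; exact: sqint_elementary.
have nice_cat (e1 e2 : seq (R * R * R)) : exists M, nice M (ef e1) /\ nice M (ef e2).
  have [M1 n1] := nice_elementary e1; have [M2 n2] := nice_elementary e2.
  by exists (Num.max M1 M2); split; [apply: nice_le n1|apply: nice_le n2]; rewrite le_max lexx ?orbT.
move=> he he'; elim: e he => [|p e IH] he.
  by rewrite Dnil fnil form0l; under eq_Rintegral do rewrite mul0r; rewrite Rint_prob_cst.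
have [[p0 p1] he1] := elementary_cons he.
apply: (step) => //; first exact: IH.
(* [step] extends the first argument only; the second is reached by exchanging the two, using
   symmetry of [form]. *)
elim: e' he' {IH} => [|q e' IH] he'.
  rewrite Dnil fnil (@formC _ _ lr (Num.max 1 (Num.max `|p.1.2| `|p.2|)))//; [|exact: nice_itv|].
    by rewrite form0l; under eq_Rintegral do rewrite mulr0; rewrite Rint_prob_cst.
  by split=> [|x|x _]; [exact: measurable_cst|rewrite normr0 !le_max ler01|].
have [[q0 q1] he1'] := elementary_cons he'.
have E : \int[P]_w (D [:: (1, p.1.2, p.2)] w * D (q :: e') w) = form r (ef [:: (1, p.1.2, p.2)]) (ef (q :: e')).
  have hp : elementary [:: (1, p.1.2, p.2)] by move=> z; rewrite inE => /eqP ->.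
  have [M [n1 n2]] := nice_cat [:: (1, p.1.2, p.2)] (q :: e').
  rewrite (@formC _ _ lr M)//.
  have -> : \int[P]_w (D [:: (1, p.1.2, p.2)] w * D (q :: e') w) = \int[P]_w (D (q :: e') w * D [:: (1, p.1.2, p.2)] w).
    by apply: eq_Rintegral => w _; rewrite mulrC.
  have D1 : D [:: (1, p.1.2, p.2)] = inc p.1.2 p.2.
    by apply/funext => w; rewrite /elementary_derivative big_seq1 mul1r.
  have f1 : ef [:: (1, p.1.2, p.2)] = \1_(`]p.1.2, p.2]%classic : set R).
    by apply/funext => x; rewrite /elementary_fun big_seq1 mul1r.
  apply: (step) => //.
    rewrite D1 f1; have [M' [n1' n2']] := nice_cat [:: (1, p.1.2, p.2)] e'; rewrite f1 in n1'.
    rewrite (@formC _ _ lr M')// -IH//; by apply: eq_Rintegral => w _; rewrite mulrC.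
  by rewrite D1 f1; exact: cov_increment.
have D1 : D [:: (1, p.1.2, p.2)] = inc p.1.2 p.2.
  by apply/funext => w; rewrite /elementary_derivative big_seq1 mul1r.
have f1 : ef [:: (1, p.1.2, p.2)] = \1_(`]p.1.2, p.2]%classic : set R).
  by apply/funext => x; rewrite /elementary_fun big_seq1 mul1r.
by move: E; rewrite D1 f1.
Qed.

(** On elementary functions the form is a variance; the sign passes to the limit. *)
Lemma form_ge0 g : approximable g -> 0 <= form r g g.
Proof.
move=> [e [M [he nM cv]]].
apply: (ler_cvg_to (cvg_cst (0 : R)) (form_cvg lr nM nM cv cv)).
by apply: nearW => n; rewrite -cov_elementary//; exact: Rint_sqr_ge0.
Qed.

Lemma form_cauchy_schwarz g g' : approximable g -> approximable g' ->
  `|form r g g'| <= Num.sqrt (form r g g) * Num.sqrt (form r g' g').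
Proof.
move=> ag ag'; have [M1 n1] := approximable_nice ag; have [M2 n2] := approximable_nice ag'.
pose M := Num.max M1 M2.
have {}n1 : nice M g by apply: nice_le n1; rewrite le_max lexx.
have {}n2 : nice M g' by apply: nice_le n2; rewrite le_max lexx orbT.
rewrite -sqrtrM ?form_ge0// -sqrtr_sqr ler_wsqrtr//.
apply: quadratic_discriminant; [exact: form_ge0..|] => t.
have := form_ge0 (approximableD t ag ag').
have [M3 n3] := approximable_nice (approximableD t ag ag').
pose N := Num.max M M3.
have N1 : nice N g by apply: nice_le n1; rewrite le_max lexx.
have N2 : nice N g' by apply: nice_le n2; rewrite le_max lexx.
have N3 : nice N (fun x => g x + t * g' x) by apply: nice_le n3; rewrite le_max lexx orbT.
rewrite (formDl lr t N1 N2 N3) (formDr lr t N1 N2 N1) (formDr lr t N1 N2 N2).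
rewrite (formC lr rev N2 N1) => h; apply: le_trans h _.
by rewrite le_eqVlt; apply/orP; left; apply/eqP; ring.
Qed.

Local Notation hl := (`[(0 : R), +oo[%classic : set R).
(** Integrals over [[0, +oo[] become integrals over the line of a truncated function. The point 0 is
    left out because elementary functions vanish there; no integral is affected. *)
Definition half_open (g : R -> R) (x : R) : R := \1_(`]0, +oo[%classic : set R) x * g x.

Lemma half_open_elementary e (g : R -> R) : elementary e ->
  half_open (fun s => g s - ef e s) = (fun x => half_open g x + (-1) * ef e x).
Proof.
move=> he; apply/funext => x; rewrite /half_open indicE.
case: (boolP (x \in `]0, +oo[%classic)); first by rewrite !mul1r mulN1r.
rewrite notin_setE/= in_itv/= andbT => /negP; rewrite -leNgt => x0.
by rewrite elementary_fun_neg// !mul0r mulr0 addr0.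
Qed.

Lemma half_openT (g : R -> R) x : 0 < x -> half_open g x = g x.
Proof. by move=> x0; rewrite /half_open indicE mem_set ?mul1r//= in_itv/= x0. Qed.

Lemma half_open0 (g : R -> R) x : x <= 0 -> half_open g x = 0.
Proof.
move=> x0; rewrite /half_open indicE memNset ?mul0r//= in_itv/= andbT.
by apply/negP; rewrite -leNgt.
Qed.

Let Rint_half_line (F F' : R -> R) : measurable_fun [set: R] F' ->
  (forall x, 0 < x -> F x = F' x) -> (forall x, x <= 0 -> F' x = 0) ->
  \int[mu]_(x in hl) F x = \int[mu]_x F' x.
Proof.
move=> mF FF' F'0.
have mF' : measurable_fun (`]0, +oo[%classic : set R) F.
  apply: (eq_measurable_fun F'); last exact: measurable_funTS.
  by move=> x; rewrite inE/= in_itv/= andbT => x0; rewrite FF'.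
have -> : \int[mu]_(x in hl) F x = \int[mu]_(x in `]0, +oo[) F x.
  rewrite /Rintegral; congr fine; symmetry; apply: integral_itv_obnd_cbnd.
  exact/measurable_EFinP.
rewrite [LHS]Rint_in; apply: eq_Rintegral => x _.
have [x0|x0] := ltP 0 x; first by have := half_openT F x0; rewrite /half_open FF'.
by have := half_open0 F x0; rewrite /half_open F'0.
Qed.

Lemma rho_formE g M : nice M (half_open g) ->
  rho_form S g = form r (half_open g) (half_open g).
Proof.
move=> nM; have [mg _ _] := nM; have [mr _] := lr; rewrite (form_iter lr nM nM) /rho_form.
apply: Rint_half_line.
- have [h _] := Rint_fubini2 (form_mint lr nM nM).
  by have /measurable_EFinP := measurable_int _ h.
- move=> t t0; apply: Rint_half_line.
  + have mt : measurable_fun [set: R] (fun s : R => t - s).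
      by apply: measurable_funB; [exact: measurable_cst|exact: measurable_id].
    apply: measurable_funM; last exact: measurable_cst.
    by apply: measurable_funM; [exact: (measurableT_comp mr mt)|exact: mg].
  + by move=> s s0; rewrite !half_openT.
  + by move=> s s0; rewrite (half_open0 g s0) mulr0 mul0r.
- move=> t t0; rewrite /Rintegral integral0_eq// => s _.
  by rewrite (half_open0 g t0) mulr0.
Qed.

(** The covariances of the elementary approximations converge to that of [Y] and [Y']. The
    approximations of [g] and [g'] converge only in the seminorm of the form, so the limit of the
    form is obtained from its own Cauchy-Schwarz inequality. *)
Lemma gen_derivative_cov g g' Y Y' : approximable (half_open g) -> approximable (half_open g') ->
  is_gen_derivative P G S g Y -> is_gen_derivative P G S g' Y' ->
  gauss2 P Y Y' /\ \int[P]_w (Y w * Y' w) = form r (half_open g) (half_open g').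
Proof.
move=> ag ag' [_ /Lfun2P sY [e [he eg eY]]] [_ /Lfun2P sY' [e' [he' eg' eY']]].
have cvD e1 Z (he1 : forall n, elementary (e1 n)) : sqint P Z ->
    cvg_L2 P \oo (fun n => D (e1 n)) Z -> norm2 P (fun w => D (e1 n) w - Z w) @[n --> \oo] --> 0.
  move=> sZ /cvg_L2P; apply; apply: nearW => n; apply: sqintB => //; exact: sqint_elementary.
have nY := cvD _ _ he sY eY; have nY' := cvD _ _ he' sY' eY'.
split.
  by apply: (gauss2_lim _ sY sY' nY nY') => n; exact: gauss2_elementary.
have h1 : \int[P]_w (D (e n) w * D (e' n) w) @[n --> \oo] --> \int[P]_w (Y w * Y' w).
  by apply: Rint_mul_cvg => //; apply: nearW => n; exact: sqint_elementary.
pose q g := Num.sqrt (form r g g).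
pose u n x := half_open g x + (-1) * ef (e n) x.
pose u' n x := half_open g' x + (-1) * ef (e' n) x.
have au n : approximable (u n) by apply: approximableD => //; exact: approximable_elementary.
have au' n : approximable (u' n) by apply: approximableD => //; exact: approximable_elementary.
have qu n : Num.sqrt (rho_form S (fun s => g s - ef (e n) s)) = q (u n).
  have [M nM] := approximable_nice (au n).
  by rewrite (@rho_formE _ M) half_open_elementary.
have qu' n : Num.sqrt (rho_form S (fun s => g' s - ef (e' n) s)) = q (u' n).
  have [M nM] := approximable_nice (au' n).
  by rewrite (@rho_formE _ M) half_open_elementary.
have {}eg : q (u n) @[n --> \oo] --> 0 by move: eg; under eq_fun do rewrite qu.
have {}eg' : q (u' n) @[n --> \oo] --> 0 by move: eg'; under eq_fun do rewrite qu'.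
have q' n : q (ef (e' n)) = norm2 P (D (e' n)).
  by rewrite /q /norm2 -cov_elementary.
have qcv : q (ef (e' n)) @[n --> \oo] --> norm2 P Y'.
  under eq_fun do rewrite q'.
  by apply: norm2_cvg => //; apply: nearW => n; exact: sqint_elementary.
have bound n : `|form r (half_open g) (half_open g') - form r (ef (e n)) (ef (e' n))| <=
    q (half_open g) * q (u' n) + q (u n) * q (ef (e' n)).
  have ae := approximable_elementary (he n); have ae' := approximable_elementary (he' n).
  have [M1 n1] := approximable_nice ag; have [M2 n2] := approximable_nice ag'.
  have [M3 n3] := approximable_nice ae; have [M4 n4] := approximable_nice ae'.
  pose N := Num.max (Num.max M1 M2) (Num.max M3 M4).
  have {}n1 : nice N (half_open g) by apply: nice_le n1; rewrite !le_max lexx.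
  have {}n2 : nice N (half_open g') by apply: nice_le n2; rewrite !le_max lexx orbT.
  have {}n3 : nice N (ef (e n)) by apply: nice_le n3; rewrite !le_max lexx !orbT.
  have {}n4 : nice N (ef (e' n)) by apply: nice_le n4; rewrite !le_max lexx !orbT.
  have E1 : form r (half_open g) (u' n) = form r (half_open g) (half_open g') + (-1) * form r (half_open g) (ef (e' n)).
    exact: (formDr lr _ n2 n4 n1).
  have E2 : form r (u n) (ef (e' n)) = form r (half_open g) (ef (e' n)) + (-1) * form r (ef (e n)) (ef (e' n)).
    exact: (formDl lr _ n1 n3 n4).
  rewrite (_ : _ - _ = form r (half_open g) (u' n) + form r (u n) (ef (e' n))); last by rewrite E1 E2; ring.
  apply: le_trans (ler_normD _ _) _.
  by apply: lerD; exact: form_cauchy_schwarz.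
have bcv : q (half_open g) * q (u' n) + q (u n) * q (ef (e' n)) @[n --> \oo] --> q (half_open g) * 0 + 0 * norm2 P Y'.
  by apply: cvgD; apply: cvgM => //; exact: cvg_cst.
rewrite mulr0 mul0r addr0 in bcv.
apply: (cvg_unique _ h1) => //.
have -> : (fun n => \int[P]_w (D (e n) w * D (e' n) w)) = (fun n => form r (ef (e n)) (ef (e' n))).
  by apply/funext => n; rewrite cov_elementary.
rewrite /=; apply/cvgrPdist_le => eps eps0; near=> n.
apply: le_trans (bound n) _; apply: ltW.
by near: n; exact: (cvgr_lt (0 : R) bcv _ eps0).
Unshelve. all: by end_near.
Qed.
End process.

(** * Convergence of smoothed covariances *)

Section power_inequalities.
Context {R : realFieldType}.
Implicit Types a b c : R.

(** A power lies above its tangent at [c]. Integrated against a probability density with [c] the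
    mean, this is Jensen's inequality. *)
Lemma exprn_tangent a c k : 0 <= a -> 0 <= c ->
  c ^+ k.+1 + k.+1%:R * c ^+ k * (a - c) <= a ^+ k.+1.
Proof.
move=> a0 c0; elim: k => [|k IH]; first by rewrite expr0 !expr1 !mul1r; lra.
rewrite [a ^+ _]exprS; apply: le_trans (_ : a * (c ^+ k.+1 + k.+1%:R * c ^+ k * (a - c)) <= _).
  rewrite -subr_ge0.
  have -> : a * (c ^+ k.+1 + k.+1%:R * c ^+ k * (a - c)) -
      (c ^+ k.+2 + k.+2%:R * c ^+ k.+1 * (a - c)) = k.+1%:R * c ^+ k * (a - c) ^+ 2.
    by rewrite !exprS -[k.+2%:R]natr1; ring.
  by rewrite mulr_ge0 ?sqr_ge0// mulr_ge0// exprn_ge0.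
by rewrite ler_wpM2l.
Qed.

Lemma exprD_superadd a b k : 0 <= a -> 0 <= b -> a ^+ k.+1 + b ^+ k.+1 <= (a + b) ^+ k.+1.
Proof.
move=> a0 b0; elim: k => [|k IH]; first by rewrite !expr1.
rewrite [(a + b) ^+ _]exprS; apply: le_trans (_ : (a + b) * (a ^+ k.+1 + b ^+ k.+1) <= _).
  rewrite [a ^+ k.+2]exprS [b ^+ k.+2]exprS -subr_ge0.
  rewrite (_ : _ - _ = a * b ^+ k.+1 + b * a ^+ k.+1); last by ring.
  by rewrite addr_ge0// mulr_ge0// exprn_ge0.
by rewrite ler_wpM2l// addr_ge0.
Qed.

Lemma exprD_le a b k : 0 <= a -> 0 <= b -> (a + b) ^+ k <= 2 ^+ k * (a ^+ k + b ^+ k).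
Proof.
move=> a0 b0; have [ab|/ltW ba] := leP a b.
  apply: le_trans (_ : (2 * b) ^+ k <= _); first by apply: lerXn2r; rewrite ?nnegrE; lra.
  by rewrite exprMn ler_wpM2l ?exprn_ge0// lerDr exprn_ge0.
apply: le_trans (_ : (2 * a) ^+ k <= _); first by apply: lerXn2r; rewrite ?nnegrE; lra.
by rewrite exprMn ler_wpM2l ?exprn_ge0// lerDl exprn_ge0.
Qed.

(* Compares [|a - b|^k] with a difference of one function evaluated at [a] and
   [b], which reduces continuity of translations in [L^k] to [L^1]. *)
Lemma power_diff_le a b k :
  `|a - b| ^+ k.+1 <= 2 ^+ k.+1 * `|a * `|a| ^+ k - b * `|b| ^+ k|.
Proof.
have two1 (x : R) : 0 <= x -> x <= 2 ^+ k.+1 * x :> R.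
  by move=> x0; rewrite ler_peMl// exprn_ege1// ler1n.
have same (x y : R) : 0 <= x -> 0 <= y -> `|x - y| ^+ k.+1 <= 2 ^+ k.+1 * `|x * x ^+ k - y * y ^+ k|.
  move=> x0 y0; rewrite -!exprS; wlog yx : x y x0 y0 / y <= x.
    move=> h; have [|/ltW xy] := leP y x; first exact: h.
    by rewrite distrC [X in _ <= _ * X]distrC; exact: h.
  apply: le_trans (two1 _ (normr_ge0 _)).
  have s := @exprD_superadd (x - y) y k ltac:(lra) y0; rewrite subrK in s.
  rewrite ger0_norm; last lra.
  by apply: le_trans (ler_norm _); lra.
have opp (x y : R) : 0 <= x -> 0 <= y -> `|x + y| ^+ k.+1 <= 2 ^+ k.+1 * `|x * x ^+ k + y * y ^+ k|.
  move=> x0 y0; rewrite -!exprS !ger0_norm ?addr_ge0 ?exprn_ge0//.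
  exact: exprD_le.
have [a0|/ltW a0] := leP 0 a; have [b0|/ltW b0] := leP 0 b.
- by rewrite (ger0_norm a0) (ger0_norm b0); exact: same.
- rewrite (ger0_norm a0) (ler0_norm b0).
  have := @opp a (- b) a0 ltac:(lra).
  by rewrite mulNr.
- rewrite (ler0_norm a0) (ger0_norm b0).
  have := @opp (- a) b ltac:(lra) b0.
  rewrite mulNr -opprB normrN [b - a]addrC.
  by rewrite [X in _ -> _ <= _ * X]distrC [b * _ - _]addrC.
- rewrite (ler0_norm a0) (ler0_norm b0).
  have := @same (- a) (- b) ltac:(lra) ltac:(lra).
  by rewrite !mulNr -!opprD !normrN.
Qed.
End power_inequalities.

Section parametric_integrals.
Context {R : realType} d1 d2 {S : measurableType d1} {T : measurableType d2}.
Variable mT : {sigma_finite_measure set T -> \bar R}.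

(** No integrability is assumed: positive and negative parts are handled by Tonelli, and the
    difference of the two extended integrals is measurable. *)
Lemma measurable_Rint_section (F : S * T -> R) : measurable_fun [set: S * T] F ->
  measurable_fun [set: S] (fun x => \int[mT]_y F (x, y)).
Proof.
move=> mF; apply: measurableT_comp => //.
have mE : measurable_fun [set: S * T] (EFin \o F) by exact/measurable_EFinP.
have -> : (fun x => \int[mT]_y (F (x, y))%:E)%E =
   (fun x => \int[mT]_y (EFin \o F)^\+ (x, y) - \int[mT]_y (EFin \o F)^\- (x, y))%E.
  apply/funext => x; rewrite integralE; congr (_ - _)%E;
    by apply: eq_integral => y _; rewrite ?funeposE ?funenegE.
apply: emeasurable_funB.
- apply: (@measurable_fun_fubini_tonelli_F _ _ _ _ _ mT (EFin \o F)^\+%E) => //.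
  exact: measurable_funepos.
- apply: (@measurable_fun_fubini_tonelli_F _ _ _ _ _ mT (EFin \o F)^\-%E) => //.
  exact: measurable_funeneg.
Qed.
End parametric_integrals.

Section product_sigma_finite.
Context {R : realType} d1 d2 {S : measurableType d1} {T : measurableType d2}.
Variables (m1 : {sigma_finite_measure set S -> \bar R}) (m2 : {sigma_finite_measure set T -> \bar R}).

Let product_sigma_finite : sigma_finite setT (m1 \x m2)%E.
Proof.
have [/sigma_finiteP[F [FT Fnd Foo]] /sigma_finiteP[G [GT Gnd Goo]]] :=
  (sigma_finiteT m1, sigma_finiteT m2).
exists (fun n => F n `*` G n).
  apply/esym/seteqP; split=> // -[x y] _.
  have [i _ Fx] : (\bigcup_i F i) x by rewrite -FT.
  have [j _ Gy] : (\bigcup_i G i) y by rewrite -GT.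
  exists (maxn i j) => //; split => /=.
  - by have /subsetPset := Fnd _ _ (leq_maxl i j); apply.
  - by have /subsetPset := Gnd _ _ (leq_maxr i j); apply.
move=> n; have [mF Fn] := Foo n; have [mG Gn] := Goo n; split; first exact: measurableX.
by rewrite product_measure1E// lte_mul_pinfty// ge0_fin_numE.
Qed.

(** A name to which sigma-finiteness can be attached, so that a product measure may itself be a
    factor: the averaging below runs over pairs of pairs of reals. *)
Definition prod_measure := (m1 \x m2)%E.
HB.instance Definition _ := Measure.on prod_measure.
HB.instance Definition _ :=
  Measure_isSigmaFinite.Build _ _ _ prod_measure product_sigma_finite.
End product_sigma_finite.

(** * Averaging a kernel does not increase its weighted power integrals *)

Section young.
Context {R : realType} d1 d2 {S : measurableType d1} {T : measurableType d2}.
Variables (mS : {sigma_finite_measure set S -> \bar R}) (mT : {sigma_finite_measure set T -> \bar R}).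
Variables (W : S -> R) (w : T -> R) (K : S * T -> R) (k : nat) (B : R).
Hypotheses (mW : measurable_fun [set: S] W) (mw : measurable_fun [set: T] w)
  (mK : measurable_fun [set: S * T] K).
Hypotheses (W0 : forall z, 0 <= W z) (w0 : forall q, 0 <= w q).
Hypothesis iw : mT.-integrable [set: T] (EFin \o w).
Hypothesis w1 : \int[mT]_q w q = 1.
Hypothesis iK1 : forall z, mT.-integrable [set: T] (EFin \o (fun q => K (z, q) * w q)).
Hypothesis iK : forall z, mT.-integrable [set: T] (EFin \o (fun q => `|K (z, q)| ^+ k.+1 * w q)).
Hypothesis bK : forall q, w q != 0 ->
  mS.-integrable [set: S] (EFin \o (fun z => W z * `|K (z, q)| ^+ k.+1)) /\
  \int[mS]_z (W z * `|K (z, q)| ^+ k.+1) <= B.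

Let jensen z : `|\int[mT]_q (K (z, q) * w q)| ^+ k.+1 <= \int[mT]_q (`|K (z, q)| ^+ k.+1 * w q).
Proof.
pose c := \int[mT]_q (`|K (z, q)| * w q).
have iA : mT.-integrable [set: T] (EFin \o (fun q => `|K (z, q)| * w q)).
  have := integrable_norm (iK1 z); apply: eq_integrable => // q _ /=.
  by rewrite normrM (ger0_norm (w0 q)).
have c0 : 0 <= c by apply: Rintegral_ge0 => q _; rewrite mulr_ge0.
apply: le_trans (_ : c ^+ k.+1 <= _).
  apply: lerXn2r; rewrite ?nnegrE//.
  have := le_normr_Rintegral measurableT (iK1 z); move/le_trans; apply.
  by rewrite le_eqVlt; apply/orP; left; apply/eqP; apply: eq_Rintegral => q _; rewrite normrM (ger0_norm (w0 q)).
have E : c ^+ k.+1 = \int[mT]_q ((c ^+ k.+1 - k.+1%:R * c ^+ k * c) * w q + k.+1%:R * c ^+ k * (`|K (z, q)| * w q)).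
  rewrite RintegralD//; [|exact: mintZ..].
  by rewrite !RintegralZl// w1 -/c; ring.
rewrite E; apply: le_Rintegral => //.
  by apply: mintD; exact: mintZ.
move=> q _; have := exprn_tangent k (normr_ge0 (K (z, q))) c0.
move=> /(ler_wpM2r (w0 q)); apply: le_trans.
by rewrite le_eqVlt; apply/orP; left; apply/eqP; ring.
Qed.

(** Jensen in [q] for each [z], then an exchange of the integrals. The bound on [K] is needed only
    for those [q] that the density [w] charges. *)
Lemma young_bound :
  mS.-integrable [set: S] (EFin \o (fun z => W z * `|\int[mT]_q (K (z, q) * w q)| ^+ k.+1)) /\
  \int[mS]_z (W z * `|\int[mT]_q (K (z, q) * w q)| ^+ k.+1) <= B.
Proof.
pose H (z : S * T) := W z.1 * (`|K z| ^+ k.+1 * w z.2).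
have mH : measurable_fun [set: S * T] H.
  apply: measurable_funM; first exact: measurableT_comp mW measurable_fst.
  apply: measurable_funM; last exact: measurableT_comp mw measurable_snd.
  by apply: measurable_funX; exact: measurableT_comp.
pose H' (q : T * S) := H (q.2, q.1).
have mH' : measurable_fun [set: T * S] H'.
  by apply: measurableT_comp => //; apply/measurable_fun_pairP; split; [exact: measurable_snd|exact: measurable_fst].
have H0 z : 0 <= H z by rewrite /H !mulr_ge0// exprn_ge0.
have inner q : mS.-integrable [set: S] (EFin \o (fun z => H (z, q))) /\ \int[mS]_z H (z, q) <= B * w q.
  rewrite /H /=; have [wq|wq] := eqVneq (w q) 0.
    rewrite wq mulr0; have -> : (fun z => W z * (`|K (z, q)| ^+ k.+1 * 0)) = (fun=> 0).
      by apply/funext => z; rewrite !mulr0.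
    split; first exact: integrable0.
    by rewrite /Rintegral integral0_eq.
  have [i1 b1] := bK wq.
  have -> : (fun z => W z * (`|K (z, q)| ^+ k.+1 * w q)) = (fun z => w q * (W z * `|K (z, q)| ^+ k.+1)).
    by apply/funext => z; ring.
  split; first exact: mintZ.
  by rewrite RintegralZl// mulrC ler_wpM2r.
have mi : measurable_fun [set: T] (fun q => \int[mS]_z H (z, q)).
  exact: (@measurable_Rint_section _ _ _ _ _ mS _ mH').
have ii : mT.-integrable [set: T] (EFin \o (fun q => \int[mS]_z H (z, q))).
  apply: (le_integrableT mi _ (mintZ B iw)) => q.
  rewrite ger0_norm; last exact: Rintegral_ge0.
  exact: le_trans (inner q).2 (ler_norm _).
have iH' : (mT \x mS)%E.-integrable [set: T * S] (EFin \o H').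
  exact: (mint_prod mH' (fun q => H0 (q.2, q.1)) (fun q => (inner q).1) ii).
have [iz vz] := Rint_fubini2 iH'; have [_ vq] := Rint_fubini1 iH'.
have mJ : measurable_fun [set: S] (fun z => \int[mT]_q (K (z, q) * w q)).
  apply: (@measurable_Rint_section _ _ _ _ _ mT (fun z => K z * w z.2)); apply: measurable_funM => //.
  exact: measurableT_comp mw measurable_snd.
have le z : W z * `|\int[mT]_q (K (z, q) * w q)| ^+ k.+1 <= \int[mT]_q H' (q, z).
  rewrite /H' /H /= RintegralZl//; exact: ler_wpM2l.
have lhs0 z : 0 <= W z * `|\int[mT]_q (K (z, q) * w q)| ^+ k.+1.
  by rewrite mulr_ge0// exprn_ge0.
have iL : mS.-integrable [set: S] (EFin \o (fun z => W z * `|\int[mT]_q (K (z, q) * w q)| ^+ k.+1)).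
  apply: (le_integrableT _ _ iz).
    by apply: measurable_funM => //; apply: measurable_funX; exact: measurableT_comp.
  by move=> z; rewrite (ger0_norm (lhs0 z)); exact: le_trans (le z) (ler_norm _).
split=> //; apply: le_trans (_ : \int[mS]_z \int[mT]_q H' (q, z) <= _).
  exact: le_Rintegral.
rewrite vz -vq; apply: le_trans (_ : \int[mT]_q (B * w q) <= _).
  apply: le_Rintegral => //; first exact: mintZ.
  by move=> q _; exact: (inner q).2.
by rewrite RintegralZl// w1 mulr1.
Qed.
End young.

Section translation_continuity.
Context {R : realType}.
Local Notation mu := (@lebesgue_measure R).
Variable f : R -> R.
Hypothesis lf : locint f.
Variable L : R.
Hypothesis L0 : 0 <= L.
Let A : set R := `[- (L + 1), L + 1]%classic.
Let B : set R := `[- L, L]%classic.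
Let mf : measurable_fun [set: R] f. Proof. by case: lf. Qed.
Let mA : measurable A. Proof. exact: measurable_itv. Qed.
Let mB : measurable B. Proof. exact: measurable_itv. Qed.

Let approx (eps : R) : 0 < eps -> exists2 g : R -> R, continuous g &
  mu.-integrable [set: R] (EFin \o (fun z => \1_A z * `|f z - g z|)) /\
  \int[mu]_z (\1_A z * `|f z - g z|) <= eps.
Proof.
move=> eps0; have Aoo : (mu A < +oo)%E.
  have h : (lebesgue_measure (A : set R) < +oo)%E.
    by rewrite /A lebesgue_measure_itv/=; case: ifPn => _; rewrite -?EFinB ltry.
  exact: h.
have iA : mu.-integrable A (EFin \o f) by apply: (locint_sub (u := - (L + 1)) (v := L + 1)).
have [g [cg ig gf]] := @approximation_continuous_integrable R A f mA Aoo iA.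
have iD n : mu.-integrable A (EFin \o (fun z => `|f z - g n z|)).
  have i1 : mu.-integrable A (EFin \o (fun z => f z - g n z)).
    exact: (@integrableB _ (measurableTypeR R) R mu A mA (EFin \o f) (EFin \o g n) iA (ig n)).
  exact: (integrable_norm i1).
have h : fine (\int[mu]_(z in A) `|(f z - g n z)%:E|) @[n --> \oo] --> (0 : R) by exact: fine_cvg gf.
have [n _ hn] := cvgr_lt (0 : R) h _ eps0.
exists (g n) => //; split.
  by apply/(@mint_in R _ (measurableTypeR R) mu A (fun z => `|f z - g n z|)).
by rewrite -Rint_in; apply: ltW; exact: hn n (leqnn n).
Qed.

(** The function is approximated in $L^1$ by a continuous one on [[-(L+1), L+1]], which contains the
    translates of [[-L, L]] by at most 1. Two thirds of [eps] pay for the approximation, one third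
    for the continuous function. *)
Lemma translation_cvg (t : nat -> R) : (forall n, `|t n| <= 1) -> t n @[n --> \oo] --> 0 ->
  \int[mu]_z (\1_B z * `|f (z + t n) - f z|) @[n --> \oo] --> 0.
Proof.
move=> t1 tcv; apply/cvgrPdist_le => eps eps0.
have e3 : 0 < eps / 3 by rewrite divr_gt0.
have [g cg [ig gf]] := approx e3.
have mg : measurable_fun [set: R] g by apply: continuous_measurable_fun.
pose D z := \1_A z * `|f z - g z|.
have mD : measurable_fun [set: R] D.
  apply: measurable_funM; first exact: measurable_indic.
  by apply: measurableT_comp => //; exact: measurable_funB.
have mshift (h : R -> R) (s : R) : measurable_fun [set: R] h -> measurable_fun [set: R] (fun z : R => h (z + s)).
  by move=> mh; apply: measurableT_comp => //; exact: measurable_funD.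
pose I n := \int[mu]_z (\1_B z * `|g (z + t n) - g z|).
have [c1 _ gM] := @EVT_max R (fun x => `|g x|) (- (L + 1)) (L + 1) ltac:(have := L0; lra)
  ltac:(by apply: continuous_subspaceT => x; apply: cvg_norm; exact: cg).
pose M := `|g c1|.
have gb n z : z \in B -> `|g (z + t n) - g z| <= 2 * M.
  rewrite inE /B/= in_itv/= => /andP[z1 z2].
  have := t1 n; rewrite ler_norml => /andP[h1 h2].
  have e1 := gM (z + t n) ltac:(rewrite in_itv/=; apply/andP; split; lra).
  have e2 := gM z ltac:(rewrite in_itv/=; apply/andP; split; lra).
  by apply: le_trans (ler_normB _ _) _; rewrite /M; lra.
have mIn n : measurable_fun [set: R] (fun z => \1_B z * `|g (z + t n) - g z|).
  apply: measurable_funM; first exact: measurable_indic.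
  apply: measurableT_comp => //; apply: measurable_funB => //; exact: mshift.
have iI n : mu.-integrable [set: R] (EFin \o (fun z => \1_B z * `|g (z + t n) - g z|)).
  apply: (@mint_itv_bounded R (- L) L (2 * M) (fun z => `|g (z + t n) - g z|)).
    apply: measurableT_comp => //; apply: measurable_funB => //; exact: mshift.
  by move=> x xL; rewrite normr_id; apply: gb; rewrite inE /B/= in_itv/=.
have Icv : I n @[n --> \oo] --> 0.
  have -> : (0 : R) = \int[mu]_z (fun=> 0) z by rewrite /Rintegral integral0_eq.
  apply: (@Rint_dominated_line R (fun n z => \1_B z * `|g (z + t n) - g z|) (fun=> 0)
     (fun z => \1_B z * (2 * M)) mIn _ _ _ _).2.
  - exact: measurable_cst.
  - move=> z; rewrite -[X in _ --> X](mulr0 (\1_B z)); apply: cvgMl_tmp.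
    rewrite -[X in _ --> X](normr0 R) -[X in `|X|](subrr (g z)).
    apply: cvg_norm; apply: cvgB; last exact: cvg_cst.
    apply: (cvg_comp (fun n => z + t n) g); last exact: cg.
    have h : z + t n @[n --> \oo] --> z + 0 by apply: cvgD => //; exact: cvg_cst.
    by rewrite addr0 in h; exact: h.
  - apply: (@mint_itv_bounded R (- L) L (2 * M) (fun=> 2 * M)) => // x _.
    by rewrite ger0_norm// /M mulr_ge0.
  - move=> n z; rewrite normrM normr_indic normr_id indicE.
    case: (boolP (z \in B)) => zB; last by rewrite !mul0r.
    by rewrite !mul1r; exact: gb.
have bound n : \int[mu]_z (\1_B z * `|f (z + t n) - f z|) <= 2 * (eps / 3) + I n.
  have iDs : mu.-integrable [set: R] (EFin \o (fun z => D (z + t n))) by apply/mint_shift.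
  have iS : mu.-integrable [set: R] (EFin \o (fun z => D (z + t n) + D z + \1_B z * `|g (z + t n) - g z|)).
    by apply: (@mintD R _ (measurableTypeR R) mu) => //; exact: (@mintD R _ (measurableTypeR R) mu).
  have pw z : \1_B z * `|f (z + t n) - f z| <= D (z + t n) + D z + \1_B z * `|g (z + t n) - g z|.
    rewrite /D; case: (boolP (z \in B)) => zB.
      have := t1 n; rewrite ler_norml => /andP[h1 h2].
      move: (zB); rewrite inE /B/= in_itv/= => /andP[z1 z2].
      rewrite !indicE zB !mem_set /A/= ?in_itv/=; [|apply/andP; split; lra..].
      rewrite !mul1r.
      have -> : f (z + t n) - f z = (f (z + t n) - g (z + t n)) - (f z - g z) + (g (z + t n) - g z) by ring.
      apply: le_trans (ler_normD _ _) _; rewrite lerD2r; exact: ler_normB.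
    rewrite [\1_B z]indicE (negbTE zB) !mul0r addr0.
    by rewrite addr_ge0// mulr_ge0// indicE ler0n.
  have m1 : measurable_fun [set: R] (fun z => \1_B z * `|f (z + t n) - f z|).
    apply: measurable_funM; first exact: measurable_indic.
    apply: measurableT_comp => //; apply: measurable_funB => //; exact: mshift.
  apply: le_trans (_ : \int[mu]_z (D (z + t n) + D z + \1_B z * `|g (z + t n) - g z|) <= _).
    apply: le_Rintegral => //.
    apply: (@le_integrableT R _ (measurableTypeR R) mu _ _ m1 _ iS) => z.
    rewrite ger0_norm; last by rewrite mulr_ge0// indicE ler0n.
    exact: le_trans (pw z) (ler_norm _).
  rewrite RintegralD//; last exact: (@mintD R _ (measurableTypeR R) mu).
  rewrite RintegralD// (Rint_shift (t n) mD) -/(I n) lerD2r.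
  by move: gf; rewrite -/D; lra.
near=> n; rewrite sub0r normrN ger0_norm.
  apply: le_trans (bound n) _.
  have h3 : I n <= eps / 3 by apply: ltW; near: n; exact: (cvgr_lt (0 : R) Icv _ e3).
  lra.
by apply: Rintegral_ge0 => z _; rewrite mulr_ge0// indicE ler0n.
Unshelve. all: by end_near.
Qed.

Lemma translation_small (eps : R) : 0 < eps -> exists2 d : R, 0 < d & forall t, `|t| <= d ->
  \int[mu]_z (\1_B z * `|f (z + t) - f z|) <= eps.
Proof.
move=> eps0; apply: contrapT => H.
have H' n : exists t : R, `|t| <= n.+1%:R^-1 /\ eps < \int[mu]_z (\1_B z * `|f (z + t) - f z|).
  apply: contrapT => K; apply: H; exists n.+1%:R^-1; first by rewrite invr_gt0.
  move=> t tn; rewrite leNgt; apply/negP => h; apply: K; by exists t.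
have [t tP] := choice H'.
have t1 n : `|t n| <= 1.
  by apply: le_trans (tP n).1 _; rewrite invf_le1// ler1n.
have tcv : t n @[n --> \oo] --> 0.
  apply/norm_cvg0P; apply: (@squeeze_cvgr _ _ _ _ (fun=> 0) (fun n => n.+1%:R^-1)).
  - by near=> n; rewrite normr_ge0 (tP n).1.
  - exact: cvg_cst.
  - exact: cvg_harmonic.
have h := ler_cvg_to (cvg_cst eps) (translation_cvg t1 tcv).
have : eps <= 0 by apply: h; apply: nearW => n; rewrite ltW// (tP n).2.
by rewrite leNgt eps0.
Unshelve. all: by end_near.
Qed.
End translation_continuity.

(** * Covariances of smoothings on the half-line *)

Section kernels.
Context {R : realType}.
Local Notation mu := (@lebesgue_measure R).
Local Notation mu2 := ((@lebesgue_measure R \x @lebesgue_measure R)%E).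

Lemma locintB (f g : R -> R) : locint f -> locint g -> locint (fun x => f x - g x).
Proof.
move=> [mf lf] [mg lg]; split; first exact: measurable_funB.
move=> M; have mM : measurable (`[- M, M]%classic : set R) by [].
exact: (@integrableB _ (measurableTypeR R) R mu _ mM (EFin \o f) (EFin \o g) (lf M) (lg M)).
Qed.

Definition kernel (delta : R) (p : R -> R) := [/\ measurable_fun [set: R] p,
  exists A, forall x, p x <= A, forall x, 0 <= p x,
  forall x, delta < `|x| -> p x = 0 & \int[mu]_x p x = 1].

Let pos (x : R) : R := \1_(`]0, +oo[%classic : set R) x.

(** The value that [gen_derivative_cov] gives for the covariance of the smoothings of [G'] by [p] at
    [x] and by [p'] at [y]. *)
Definition kernel_cov (r p p' : R -> R) (x y : R) : R :=
  form r (half_open (fun s => p (s - x))) (half_open (fun s => p' (s - y))).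

Let mpos : measurable_fun [set: R] pos.
Proof. exact: measurable_indic. Qed.

Let mshift (h : R -> R) (s : R) : measurable_fun [set: R] h -> measurable_fun [set: R] (fun z : R => h (z + s)).
Proof. by move=> mh; apply: measurableT_comp => //; exact: measurable_funD. Qed.

Lemma kernel_nice delta p (x : R) : kernel delta p ->
  exists M, nice M (fun u => pos (u + x) * p u) /\ nice M (half_open (fun s => p (s - x))) /\ nice M p.
Proof.
move=> [mp [A pA] p0 psupp _].
have A0 : 0 <= A := le_trans (p0 0) (pA 0).
have pn y : `|p y| <= A by rewrite ger0_norm.
have pos1 y : `|pos y| <= 1 by rewrite /pos normr_indic indic_le1.
exists (Num.max A (`|delta| + `|x|)); split; [|split].
- split.
  + by apply: measurable_funM => //; exact: mshift.
  + move=> u; rewrite le_max normrM; apply/orP; left.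
    by apply: le_trans (pn u); rewrite ler_piMl.
  + move=> u; rewrite gt_max => /andP[_ h]; rewrite psupp ?mulr0//.
    have := ler_norm delta; have := normr_ge0 x; lra.
- split.
  + by apply: measurable_funM => //; exact: (mshift (- x)).
  + move=> u; rewrite le_max normrM; apply/orP; left.
    by apply: le_trans (pn (u - x)); rewrite ler_piMl.
  + move=> u; rewrite gt_max => /andP[_ h]; rewrite /half_open psupp ?mulr0//.
    have := ler_norm delta; have := ler_normD (u - x) x; rewrite subrK; lra.
- split => //.
  + by move=> u; rewrite le_max pn.
  + move=> u; rewrite gt_max => /andP[_ h]; rewrite psupp//.
    have := ler_norm delta; have := normr_ge0 x; lra.
Qed.

Section convergence.
Variable r : R -> R.
Hypothesis lr : locint r.
Let mr : measurable_fun [set: R] r. Proof. by case: lr. Qed.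

(** The shifts are moved from the kernels to [r]. Then [p q.1 * p' q.2] is a probability density
    independent of [(x, y)], as [young_bound] requires. *)
Lemma kernel_covE delta p p' x y : kernel delta p -> kernel delta p' ->
  kernel_cov r p p' x y =
  \int[mu2]_q (r (q.2 - q.1 + (y - x)) * (pos (q.1 + x) * p q.1) * (pos (q.2 + y) * p' q.2)).
Proof.
move=> kp kp'.
have [M1 [n1 [n1' _]]] := kernel_nice x kp; have [M2 [n2 [n2' _]]] := kernel_nice y kp'.
pose M := Num.max M1 M2.
have {}n1 : nice M (fun u => pos (u + x) * p u) by apply: nice_le n1; rewrite le_max lexx.
have {}n1' : nice M (half_open (fun s => p (s - x))) by apply: nice_le n1'; rewrite le_max lexx.
have {}n2 : nice M (fun u => pos (u + y) * p' u) by apply: nice_le n2; rewrite le_max lexx orbT.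
have {}n2' : nice M (half_open (fun s => p' (s - y))) by apply: nice_le n2'; rewrite le_max lexx orbT.
have lr' := locint_shift (y - x) lr.
rewrite -[RHS]/(form (fun s => r (s + (y - x))) (fun u => pos (u + x) * p u) (fun u => pos (u + y) * p' u)).
rewrite (form_iter lr' n1 n2) /kernel_cov (form_iter lr n1' n2').
have [i2 _] := Rint_fubini2 (form_mint lr n1' n2').
have m2 := (measurable_EFinP _ _).1 (measurable_int _ i2).
rewrite -(Rint_shift y m2); apply: eq_Rintegral => v _.
have m1 : measurable_fun [set: R] (fun s => r (v + y - s) * half_open (fun s => p (s - x)) s * half_open (fun s => p' (s - y)) (v + y)).
  apply: measurable_funM; last exact: measurable_cst.
  apply: measurable_funM; last by case: n1'.
  by apply: (measurableT_comp mr); apply: measurable_funB; [exact: measurable_cst|exact: measurable_id].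
rewrite /= -(Rint_shift x m1); apply: eq_Rintegral => u _.
rewrite /half_open -/(pos _) -/(pos _) !addrK; congr (r _ * _ * _); ring.
Qed.

Variables (a b : R) (k : nat).
Hypotheses (a0 : 0 <= a) (ab : a <= b).
Hypothesis lrk : locint (fun x => r x ^+ k.+1).
Let L := b - a.
Let I (x : R) : R := \1_(`[a, b]%classic : set R) x.
Let W (z : R * R) := I z.1 * I z.2.

Let I0 x : 0 <= I x. Proof. by rewrite /I indicE ler0n. Qed.
Let I1 x : I x <= 1. Proof. exact: indic_le1. Qed.
Let Iout x : ~~ (a <= x <= a + L) -> I x = 0.
Proof.
move=> h; rewrite /I indicE memNset//= in_itv/=; apply/negP.
by move: h; rewrite /L; apply: contra => /andP[? ?]; apply/andP; split; lra.
Qed.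
Let mI : measurable_fun [set: R] I. Proof. exact: measurable_indic. Qed.
Let L0 : 0 <= L. Proof. by rewrite /L subr_ge0. Qed.
Let mW : measurable_fun [set: R * R] W.
Proof.
by apply: measurable_funM; [exact: (measurableT_comp mI measurable_fst)|exact: (measurableT_comp mI measurable_snd)].
Qed.
Let W0 z : 0 <= W z. Proof. exact: mulr_ge0. Qed.

Let rk (x : R) : R := `|r x| ^+ k.+1.
Let lrk' : locint rk.
Proof.
have -> : rk = (fun x => `|r x ^+ k.+1|) by apply/funext => x; rewrite normrX.
exact: locint_norm.
Qed.
Let mrk : measurable_fun [set: R] rk. Proof. by case: lrk'. Qed.
Let rk0 x : 0 <= rk x. Proof. exact: exprn_ge0. Qed.

(** A signed power of [r]: by [power_diff_le] its translations in $L^1$ control those of [r] in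
    $L^(k+1)$, and it is locally integrable because [r^(k+1)] is. *)
Let psi (x : R) : R := r x * `|r x| ^+ k.
Let lpsi : locint psi.
Proof.
have mpsi : measurable_fun [set: R] psi.
  by apply: measurable_funM => //; apply: measurable_funX; exact: measurableT_comp.
split=> // M; have [_ /(_ M)] := lrk'; apply: le_integrable => //.
  by apply/measurable_EFinP; exact: measurable_funTS.
by move=> x _ /=; rewrite lee_fin /psi /rk normrM normrX normr_id -exprS (ger0_norm (exprn_ge0 _ (normr_ge0 _))).
Qed.

Let incr (t x : R) : R := `|r (x + t) - r x| ^+ k.+1.
Let incr_le t x : incr t x <= 2 ^+ k.+1 * (rk (x + t) + rk x).
Proof.
rewrite /incr /rk; apply: le_trans (_ : (`|r (x + t)| + `|r x|) ^+ k.+1 <= _).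
  by apply: lerXn2r; rewrite ?nnegrE ?addr_ge0//; exact: ler_normB.
exact: exprD_le.
Qed.
Let mincr t : measurable_fun [set: R] (incr t).
Proof.
apply: measurable_funX; apply: measurableT_comp => //; apply: measurable_funB => //.
exact: mshift.
Qed.
Let lincr t : locint (incr t).
Proof.
split=> // M; have [_ h1] := lrk'; have [_ h2] := locint_shift t lrk'.
apply/(@mint_in R _ (measurableTypeR R) mu `[- M, M]%classic (incr t)) => //.
have i1 := (@mint_in R _ (measurableTypeR R) mu `[- M, M]%classic _ (measurable_itv _)).1 (h1 M).
have i2 := (@mint_in R _ (measurableTypeR R) mu `[- M, M]%classic _ (measurable_itv _)).1 (h2 M).
have i3 := @mintZ R _ (measurableTypeR R) mu (2 ^+ k.+1) _ (@mintD R _ (measurableTypeR R) mu _ _ i2 i1).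
have m0 : measurable_fun [set: R] (fun x => \1_(`[- M, M]%classic : set R) x * incr t x).
  by apply: measurable_funM => //; exact: measurable_indic.
apply: (@le_integrableT R _ (measurableTypeR R) mu _ _ m0 _ i3).
move=> x; rewrite -mulrDr mulrCA !normrM ler_wpM2l// -normrM.
by apply: le_trans (ler_norm _); rewrite ger0_norm ?exprn_ge0.
Qed.

Let absint (g : R -> R) : R := \int[mu]_x (\1_(`[- L, L]%classic : set R) x * `|g x|).

Let strip (h : R -> R) : locint h -> (forall x, 0 <= h x) ->
  mu2.-integrable [set: R * R] (EFin \o (fun z => W z * h (z.2 - z.1))) /\
  \int[mu2]_z (W z * h (z.2 - z.1)) <= L * absint h.
Proof.
move=> lh h0.
have In x : `|I x| <= 1 by rewrite ger0_norm.
have [i v] := form_bound lh mI mI L0 In In Iout Iout.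
have E z : h (z.2 - z.1) * I z.1 * I z.2 = W z * h (z.2 - z.1) by rewrite /W; ring.
split; first by move: i; apply: eq_integrable => // z _ /=; rewrite E.
move: v; rewrite !mul1r; apply: le_trans; rewrite le_eqVlt; apply/orP; left; apply/eqP.
by apply: eq_Rintegral => z _; rewrite E ger0_norm// mulr_ge0.
Qed.

Let J (delta x : R) : R := I x * \1_(`[0, delta]%classic : set R) x.
Let mJ delta : measurable_fun [set: R] (J delta).
Proof. by apply: measurable_funM => //; exact: measurable_indic. Qed.
Let J0 delta x : 0 <= J delta x. Proof. by rewrite mulr_ge0// indicE ler0n. Qed.

(** The contribution of the points within [delta] of 0, whose kernel may stick out of the half-line;
    a strip of width [delta] yields a factor [delta]. *)
Let edge1 delta : 0 <= delta ->
  mu2.-integrable [set: R * R] (EFin \o (fun z => rk (z.2 - z.1) * J delta z.1 * I z.2)) /\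
  \int[mu2]_z (rk (z.2 - z.1) * J delta z.1 * I z.2) <= delta * absint rk.
Proof.
move=> d0; have [iD vD] := form_dominating lrk' 0 L d0; rewrite !add0r in iD vD.
have m1 : measurable_fun [set: R * R] (fun z => rk (z.2 - z.1) * J delta z.1 * I z.2).
  exact: measurable_form.
have F0 z : 0 <= rk (z.2 - z.1) * J delta z.1 * I z.2 by rewrite !mulr_ge0.
have le z : rk (z.2 - z.1) * J delta z.1 * I z.2 <=
   \1_(`[0, delta]%classic : set R) z.1 * (\1_(`[- L, L]%classic : set R) (z.2 - z.1) * `|rk (z.2 - z.1)|).
  have R0 : 0 <= \1_(`[0, delta]%classic : set R) z.1 * (\1_(`[- L, L]%classic : set R) (z.2 - z.1) * `|rk (z.2 - z.1)|).
    by rewrite mulr_ge0 ?mulr_ge0// indicE ler0n.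
  have [z1|/Iout z1] := boolP (a <= z.1 <= a + L); last by rewrite /J z1 mul0r mulr0 mul0r.
  have [z2|/Iout z2] := boolP (a <= z.2 <= a + L); last by rewrite z2 mulr0.
  rewrite [\1__ (z.2 - z.1)]indicE mem_set/= ?in_itv/=; last by apply/andP; split; lra.
  rewrite mul1r ger0_norm//.
  have -> : rk (z.2 - z.1) * J delta z.1 * I z.2 =
      (I z.1 * I z.2) * (\1_(`[0, delta]%classic : set R) z.1 * rk (z.2 - z.1)) by rewrite /J; ring.
  rewrite ler_piMl//; first by rewrite mulr_ge0// indicE ler0n.
  by rewrite mulr_ile1.
have iF : mu2.-integrable [set: R * R] (EFin \o (fun z => rk (z.2 - z.1) * J delta z.1 * I z.2)).
  apply: (@le_integrableT R _ _ mu2 _ _ m1 _ iD) => z.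
  by rewrite (ger0_norm (F0 z)); exact: le_trans (le z) (ler_norm _).
by split=> //; rewrite /absint -vD; apply: le_Rintegral.
Qed.

Hypothesis rev : forall x, r (- x) = r x.

Let niceI : nice (Num.max 1 (Num.max `|a| `|b|)) I.
Proof.
split=> //.
  by move=> x; rewrite ger0_norm// le_max I1.
move=> x; rewrite !gt_max => /andP[_ /andP[ax bx]]; apply: Iout.
apply/negP => /andP[h1 h2]; move: ax bx; rewrite /L in h2.
have hx : 0 <= x := le_trans a0 h1; have hb : 0 <= b := le_trans a0 ab.
by rewrite (ger0_norm hx) (ger0_norm hb); lra.
Qed.

Let niceJ delta : nice (Num.max 1 (Num.max `|a| `|b|)) (J delta).
Proof.
have [_ n1 n2] := niceI; split=> //.
  by move=> x; apply: le_trans (n1 x); rewrite /J normrM ler_piMr// normr_indic indic_le1.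
by move=> x /n2 h; rewrite /J h mul0r.
Qed.

Let edge2 delta : 0 <= delta ->
  mu2.-integrable [set: R * R] (EFin \o (fun z => rk (z.2 - z.1) * I z.1 * J delta z.2)) /\
  \int[mu2]_z (rk (z.2 - z.1) * I z.1 * J delta z.2) <= delta * absint rk.
Proof.
move=> d0; split; first exact: (form_mint lrk' niceI (niceJ delta)).
have ev x : rk (- x) = rk x by rewrite /rk rev.
rewrite -[X in X <= _]/(form rk I (J delta)) (formC lrk' ev niceI (niceJ delta)).
exact: (edge1 d0).2.
Qed.

(** For each offset [q] charged by the kernels, the integrand is either an increment of [r] by
    [q.2 - q.1], of size at most [2 delta], or supported in one of two edge strips. *)
Lemma kernel_cov_bound delta (t : R) p p' : 0 <= delta -> kernel delta p -> kernel delta p' ->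
  (forall s, `|s| <= 2 * delta -> absint (fun x => psi (x + s) - psi x) <= t) ->
  mu2.-integrable [set: R * R] (EFin \o (fun z =>
    W z * `|kernel_cov r p p' z.1 z.2 - r (z.2 - z.1)| ^+ k.+1)) /\
  \int[mu2]_z (W z * `|kernel_cov r p p' z.1 z.2 - r (z.2 - z.1)| ^+ k.+1) <=
  L * (2 ^+ k.+1 * t) + 2 * (delta * absint rk).
Proof.
move=> d0 kp kp' psit.
have [mp [A pA] p0 psupp p1] := kp; have [mp' [A' pA'] p0' psupp' p1'] := kp'.
pose w (q : R * R) := p q.1 * p' q.2.
(* Subtracting [r (y - x)] inside the average is possible because [w] has total mass 1; the factors
   [pos] record the truncation to the half-line. *)
pose K (zq : (R * R) * (R * R)) := r (zq.2.2 - zq.2.1 + (zq.1.2 - zq.1.1)) *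
  (pos (zq.2.1 + zq.1.1) * pos (zq.2.2 + zq.1.2)) - r (zq.1.2 - zq.1.1).
have m11 : measurable_fun [set: (R * R) * (R * R)] (fun zq => zq.1.1) := measurableT_comp measurable_fst measurable_fst.
have m12 : measurable_fun [set: (R * R) * (R * R)] (fun zq => zq.1.2) := measurableT_comp measurable_snd measurable_fst.
have m21 : measurable_fun [set: (R * R) * (R * R)] (fun zq => zq.2.1) := measurableT_comp measurable_fst measurable_snd.
have m22 : measurable_fun [set: (R * R) * (R * R)] (fun zq => zq.2.2) := measurableT_comp measurable_snd measurable_snd.
have mK : measurable_fun [set: (R * R) * (R * R)] K.
  apply: measurable_funB; last first.
    exact: (measurableT_comp mr (measurable_funB m12 m11)).
  apply: measurable_funM.
    exact: (measurableT_comp mr (measurable_funD (measurable_funB m22 m21) (measurable_funB m12 m11))).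
  apply: measurable_funM.
    exact: (measurableT_comp mpos (measurable_funD m21 m11)).
  exact: (measurableT_comp mpos (measurable_funD m22 m12)).
have mw : measurable_fun [set: R * R] w.
  by apply: measurable_funM; [exact: (measurableT_comp mp measurable_fst)|exact: (measurableT_comp mp' measurable_snd)].
have w0 q : 0 <= w q by rewrite mulr_ge0.
have [M1 [_ [_ np1]]] := kernel_nice 0 kp; have [M2 [_ [_ np2]]] := kernel_nice 0 kp'.
pose M := Num.max M1 M2.
have np : nice M p by apply: nice_le np1; rewrite le_max lexx.
have np' : nice M p' by apply: nice_le np2; rewrite le_max lexx orbT.
have lone : locint (fun=> 1 : R).
  split=> // N; apply/(@mint_in R _ (measurableTypeR R) mu `[- N, N]%classic (fun=> 1)) => //.
  by apply: (@mint_itv_bounded R (- N) N 1) => // x _; rewrite normr1.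
have wE q : 1 * p q.1 * p' q.2 = w q by rewrite mul1r.
have iw : mu2.-integrable [set: R * R] (EFin \o w).
  by have := form_mint lone np np'; apply: eq_integrable => // q _ /=; rewrite wE.
have ip : mu.-integrable [set: R] (EFin \o p).
  have [N nN] : exists N, forall x, N < `|x| -> p x = 0 by exists delta.
  have := @mint_itv_bounded R (- delta) delta A p mp (fun x _ => ltac:(by rewrite ger0_norm)).
  apply: eq_integrable => // x _ /=; congr EFin; rewrite indicE.
  case: (boolP (x \in `[- delta, delta]%classic)); rewrite ?mul1r// mul0r => xd.
  rewrite psupp// ltNge; apply: contra xd => xd; rewrite inE/= in_itv/=.
  by rewrite -ler_norml.
have w1 : \int[mu2]_q w q = 1.
  have -> : \int[mu2]_q w q = form (fun=> 1) p p' by apply: eq_Rintegral => q _; rewrite wE.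
  rewrite (form_iter lone np np') -[RHS]p1'; apply: eq_Rintegral => y _.
  have -> : (fun x => 1 * p x * p' y) = (fun x => p' y * p x) by apply/funext => x; rewrite mul1r mulrC.
  by rewrite RintegralZl// p1 mulr1.
have sh z : exists M, nice M (fun u => pos (u + z.1) * p u) /\ nice M (fun u => pos (u + z.2) * p' u).
  have [N1 [n1 _]] := kernel_nice z.1 kp; have [N2 [n2 _]] := kernel_nice z.2 kp'.
  by exists (Num.max N1 N2); split; [apply: nice_le n1|apply: nice_le n2]; rewrite le_max lexx ?orbT.
have iA (z : R * R) : mu2.-integrable [set: R * R] (EFin \o (fun q =>
    r (q.2 - q.1 + (z.2 - z.1)) * (pos (q.1 + z.1) * p q.1) * (pos (q.2 + z.2) * p' q.2))).
  by have [N [n1 n2]] := sh z; exact: (form_mint (locint_shift (z.2 - z.1) lr) n1 n2).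
have KE z q : K (z, q) * w q = r (q.2 - q.1 + (z.2 - z.1)) * (pos (q.1 + z.1) * p q.1) * (pos (q.2 + z.2) * p' q.2)
    - r (z.2 - z.1) * w q by rewrite /K /w /=; ring.
have iK1 z : mu2.-integrable [set: R * R] (EFin \o (fun q => K (z, q) * w q)).
  under eq_fun do rewrite /= KE.
  by apply: (mintB (iA z)); exact: mintZ.
have IK z : \int[mu2]_q (K (z, q) * w q) = kernel_cov r p p' z.1 z.2 - r (z.2 - z.1).
  under eq_Rintegral do rewrite KE.
  rewrite RintegralB//; last exact: mintZ.
  by rewrite RintegralZl// w1 mulr1 (kernel_covE z.1 z.2 kp kp').
have pos01 y : 0 <= pos y /\ pos y <= 1 by rewrite /pos indic_le1 indicE ler0n.
have iK z : mu2.-integrable [set: R * R] (EFin \o (fun q => `|K (z, q)| ^+ k.+1 * w q)).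
  have i1 := form_mint (locint_shift (z.2 - z.1) lrk') np np'.
  have i2 := mintZ (2 ^+ k.+1) (mintD i1 (mintZ (rk (z.2 - z.1)) iw)).
  have mKz : measurable_fun [set: R * R] (fun q => K (z, q)).
    by apply: measurableT_comp mK _; exact: measurable_pair1.
  apply: (le_integrableT _ _ i2).
    apply: measurable_funM => //; apply: measurable_funX; exact: measurableT_comp.
  move=> q; rewrite ger0_norm ?mulr_ge0// ?exprn_ge0//; apply: le_trans (ler_norm _).
  have -> : 2 ^+ k.+1 * (rk (q.2 - q.1 + (z.2 - z.1)) * p q.1 * p' q.2 + rk (z.2 - z.1) * w q) =
     2 ^+ k.+1 * (rk (q.2 - q.1 + (z.2 - z.1)) + rk (z.2 - z.1)) * w q by rewrite /w; ring.
  rewrite ler_wpM2r//; apply: le_trans (exprD_le _ (normr_ge0 _) (normr_ge0 _)).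
  apply: lerXn2r; rewrite ?nnegrE ?addr_ge0// /K /=.
  apply: le_trans (ler_normB _ _) _; rewrite lerD2r normrM ler_piMr// normrM.
  have [h1 h2] := pos01 (q.1 + z.1); have [h3 h4] := pos01 (q.2 + z.2).
  by rewrite !ger0_norm// mulr_ile1.
have bK q : w q != 0 ->
    mu2.-integrable [set: R * R] (EFin \o (fun z => W z * `|K (z, q)| ^+ k.+1)) /\
    \int[mu2]_z (W z * `|K (z, q)| ^+ k.+1) <= L * (2 ^+ k.+1 * t) + 2 * (delta * absint rk).
  move=> wq.
  have q1 : `|q.1| <= delta.
    by rewrite leNgt; apply/negP => h; move: wq; rewrite /w psupp// mul0r eqxx.
  have q2 : `|q.2| <= delta.
    by rewrite leNgt; apply/negP => h; move: wq; rewrite /w psupp'// mulr0 eqxx.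
  pose s := q.2 - q.1.
  have sd : `|s| <= 2 * delta by apply: le_trans (ler_normB _ _) _; lra.
  have incr0 x : 0 <= incr s x by exact: exprn_ge0.
  have [i1 v1] := strip (lincr s) incr0.
  have [i2 v2] := edge1 d0; have [i3 v3] := edge2 d0.
  have iS := mintD (mintD i1 i2) i3.
  have pw z : W z * `|K (z, q)| ^+ k.+1 <= W z * incr s (z.2 - z.1) +
      rk (z.2 - z.1) * J delta z.1 * I z.2 + rk (z.2 - z.1) * I z.1 * J delta z.2.
    have E1 : 0 <= W z * incr s (z.2 - z.1) by rewrite mulr_ge0.
    have E2 : 0 <= rk (z.2 - z.1) * J delta z.1 * I z.2 by rewrite !mulr_ge0.
    have E3 : 0 <= rk (z.2 - z.1) * I z.1 * J delta z.2 by rewrite !mulr_ge0.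
    have [z1|/Iout z1] := boolP (a <= z.1 <= a + L); last first.
      by rewrite {1}/W z1 !mul0r; lra.
    have [z2|/Iout z2] := boolP (a <= z.2 <= a + L); last first.
      by rewrite {1}/W z2 mulr0 !mul0r; lra.
    (* If the displaced point leaves the half-line, the first term of [K] is 0 and [|K|] is [|r|];
       but then [z.1] lies in [[0, delta]], since [a >= 0] and [|q.1| <= delta]. *)
    have [u1|u1] := ltP 0 (q.1 + z.1); last first.
      have -> : `|K (z, q)| ^+ k.+1 = rk (z.2 - z.1).
        rewrite /K /= {1}/pos indicE memNset/= ?in_itv/= ?andbT; last by apply/negP; rewrite -leNgt.
        by rewrite mul0r mulr0 sub0r normrN.
      have -> : W z * rk (z.2 - z.1) = rk (z.2 - z.1) * J delta z.1 * I z.2.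
        rewrite /J [\1__ z.1]indicE mem_set/=; first by rewrite /W; ring.
        rewrite in_itv/=; apply/andP; split; first by move/andP: z1 => [z1 _]; exact: le_trans a0 z1.
        by move: q1; rewrite ler_norml => /andP[? ?]; lra.
      lra.
    have [u2|u2] := ltP 0 (q.2 + z.2); last first.
      have -> : `|K (z, q)| ^+ k.+1 = rk (z.2 - z.1).
        rewrite /K /= [pos (q.2 + z.2)]indicE memNset/= ?in_itv/= ?andbT; last by apply/negP; rewrite -leNgt.
        by rewrite !mulr0 sub0r normrN.
      have -> : W z * rk (z.2 - z.1) = rk (z.2 - z.1) * I z.1 * J delta z.2.
        rewrite /J [\1__ z.2]indicE mem_set/=; first by rewrite /W; ring.
        rewrite in_itv/=; apply/andP; split; first by move/andP: z2 => [z2 _]; exact: le_trans a0 z2.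
        by move: q2; rewrite ler_norml => /andP[? ?]; lra.
      lra.
    have -> : `|K (z, q)| ^+ k.+1 = incr s (z.2 - z.1).
      rewrite /K /= /pos !indicE !mem_set/= ?in_itv/= ?u1 ?u2// !mulr1.
      by rewrite /incr /s [q.2 - q.1 + _]addrC.
    lra.
  have mS : measurable_fun [set: R * R] (fun z => W z * `|K (z, q)| ^+ k.+1).
    apply: measurable_funM => //; apply: measurable_funX; apply: measurableT_comp => //.
    by apply: measurableT_comp mK _; exact: measurable_pair2.
  have iF : mu2.-integrable [set: R * R] (EFin \o (fun z => W z * `|K (z, q)| ^+ k.+1)).
    apply: (@le_integrableT R _ _ mu2 _ _ mS _ iS) => z.
    by rewrite ger0_norm ?mulr_ge0// ?exprn_ge0//; exact: le_trans (pw z) (ler_norm _).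
  split=> //; apply: le_trans (le_Rintegral measurableT iF iS (fun z _ => pw z)) _.
  rewrite RintegralD//; last exact: mintD.
  rewrite RintegralD//.
  have v4 : absint (incr s) <= 2 ^+ k.+1 * t.
    have li := locint_norm (lincr s).
    have ld : locint (fun x => psi (x + s) - psi x).
      exact: (locintB (locint_shift s lpsi) lpsi).
    apply: le_trans (_ : 2 ^+ k.+1 * absint (fun x => psi (x + s) - psi x) <= _).
      have i5 := locint_cut (- L) L (locint_norm ld).
      rewrite /absint -RintegralZl//; apply: le_Rintegral => //.
      - exact: (locint_cut (- L) L li).
      - exact: (@mintZ R _ (measurableTypeR R) mu).
      - move=> x _; rewrite mulrCA ler_wpM2l ?indicE ?ler0n// (ger0_norm (incr0 _)).
        exact: power_diff_le.
    by rewrite ler_wpM2l ?exprn_ge0//; exact: psit.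
  have v5 : L * absint (incr s) <= L * (2 ^+ k.+1 * t) by rewrite ler_wpM2l.
  lra.
have [i v] := @young_bound _ _ _ _ _ (prod_measure mu mu) (prod_measure mu mu) W w K k _ mW mw mK W0 w0 iw w1 iK1 iK bK.
split.
  by move: i; apply: eq_integrable => // z _ /=; rewrite IK.
by move: v; under eq_Rintegral do rewrite IK.
Qed.

Lemma kernel_cov_cvg (eps : R) : 0 < eps -> exists2 d : R, 0 < d &
  forall delta p p', 0 <= delta -> delta <= d -> kernel delta p -> kernel delta p' ->
  mu2.-integrable [set: R * R] (EFin \o (fun z =>
    W z * `|kernel_cov r p p' z.1 z.2 - r (z.2 - z.1)| ^+ k.+1)) /\
  \int[mu2]_z (W z * `|kernel_cov r p p' z.1 z.2 - r (z.2 - z.1)| ^+ k.+1) <= eps.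
Proof.
move=> eps0.
have A0 : 0 <= absint rk by apply: Rintegral_ge0 => x _; rewrite mulr_ge0// indicE ler0n.
(* Half of [eps] goes to the translations and half to the two edge strips; the added 1's avoid
   division by 0, and [d1 / 2] below accounts for offsets up to [2 delta]. *)
have t0 : 0 < eps / 2 / ((L + 1) * 2 ^+ k.+1).
  by rewrite divr_gt0 ?divr_gt0// mulr_gt0 ?exprn_gt0// ltr_wpDl.
have [d1 d10 h1] := translation_small lpsi L0 t0.
pose d2 := eps / 4 / (absint rk + 1).
have d20 : 0 < d2 by rewrite !divr_gt0// ltr_wpDl.
exists (Num.min (d1 / 2) d2); first by rewrite lt_min d20 divr_gt0.
move=> delta p p' de0; rewrite le_min => /andP[de1 de2] kp kp'.
have [i v] := @kernel_cov_bound delta _ p p' de0 kp kp' (fun s hs => h1 s ltac:(lra)).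
split=> //; apply: le_trans v _.
have e1 : L * (2 ^+ k.+1 * (eps / 2 / ((L + 1) * 2 ^+ k.+1))) <= eps / 2.
  have -> : L * (2 ^+ k.+1 * (eps / 2 / ((L + 1) * 2 ^+ k.+1))) = L / (L + 1) * (eps / 2).
    have h1' : L + 1 != 0 by rewrite gt_eqF// ltr_wpDl.
    have h2' : 2 ^+ k.+1 != 0 :> R by rewrite expf_neq0.
    by field; rewrite h1' h2'.
  rewrite ler_piMl//; first by rewrite ltW// divr_gt0.
  by rewrite ler_pdivrMr ?ltr_wpDl//; lra.
have e2 : delta * absint rk <= eps / 4.
  apply: le_trans (_ : d2 * (absint rk + 1) <= _).
    by apply: ler_pM => //; lra.
  by rewrite /d2 divfK// gt_eqF// ltr_wpDl.
lra.
Qed.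
End convergence.
End kernels.

(** * Joint measurability and smoothings *)

Section step_functions.
Context {R : realType}.
Implicit Types (f : R -> R) (D u x : R) (N : nat).

Definition node D N (i : nat) : R := - D + i%:R * (2 * D / N%:R).

Lemma node_le D N i j : 0 <= D -> (i <= j)%N -> node D N i <= node D N j.
Proof.
move=> D0 ij; rewrite /node lerD2l ler_wpM2r ?ler_nat//.
by rewrite divr_ge0// mulr_ge0.
Qed.

Lemma nodeS D N i : node D N i.+1 - node D N i = 2 * D / N%:R.
Proof. by rewrite /node -natr1; ring. Qed.

Lemma node0 D N : node D N 0 = - D.
Proof. by rewrite /node mul0r addr0. Qed.

Lemma nodeN D N : (0 < N)%N -> node D N N = D.
Proof.
move=> N0; rewrite /node mulrCA divff ?mulr1; last by rewrite pnatr_eq0 -lt0n.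
by ring.
Qed.

Definition step D N f u : R :=
  \sum_(i < N) f (node D N i) * \1_(`]node D N i, node D N i.+1]%classic : set R) u.

Let indicE' (a b u : R) : a <= b ->
  \1_(`]a, b]%classic : set R) u = (a < u)%R%:R - (b < u)%R%:R :> R.
Proof.
move=> ab; rewrite indicE; case: (boolP (u \in _)); rewrite ?inE ?notin_setE/= in_itv/=.
  by move=> /andP[-> ub]; rewrite ltNge ub subr0.
move/negP; case: (ltP a u) => /= au.
  by rewrite -ltNge => ->; rewrite subrr.
by move=> _; rewrite ltNge (le_trans au ab) subrr.
Qed.

Lemma step1 D N u : 0 <= D -> (0 < N)%N ->
  \sum_(i < N) \1_(`]node D N i, node D N i.+1]%classic : set R) u =
  \1_(`]- D, D]%classic : set R) u :> R.
Proof.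
move=> D0 N0; under eq_bigr => i _ do rewrite indicE' ?node_le//.
rewrite indicE'; last lra.
rewrite -(big_mkord xpredT (fun i => (node D N i < u)%R%:R - (node D N i.+1 < u)%R%:R)).
rewrite -[LHS]opprK -sumrN; under eq_bigr do rewrite opprB.
by rewrite telescope_sumr// node0 nodeN// opprB.
Qed.

(** The half-open cells partition []-D, D]], so the error is [f (node) - f u] for the one cell
    containing [u], whose left node is within one mesh. *)
Lemma step_le D N f u (eps : R) : 0 <= D -> (0 < N)%N ->
  (forall t, `|t - u| <= 2 * D / N%:R -> `|f t - f u| <= eps) ->
  `|step D N f u - \1_(`]- D, D]%classic : set R) u * f u| <= eps.
Proof.
move=> D0 N0 h; have DN : 0 <= 2 * D / N%:R by rewrite divr_ge0// mulr_ge0.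
have eps0 : 0 <= eps by have := h u; rewrite !subrr !normr0; apply.
rewrite -(step1 u D0 N0) /step mulr_suml -sumrB.
apply: le_trans (ler_norm_sum _ _ _) _.
apply: le_trans (_ : \sum_(i < N) eps * \1_(`]node D N i, node D N i.+1]%classic : set R) u <= _).
  apply: ler_sum => i _; rewrite [\1_ _ _ * f u]mulrC -mulrBl normrM normr_indic indicE.
  case: (boolP (u \in _)) => ui; rewrite ?mulr0// !mulr1.
  apply: h; move: ui; rewrite inE/= in_itv/= => /andP[h1 h2].
  have := nodeS D N i; rewrite ler_norml => e; apply/andP; split; lra.
by rewrite -mulr_sumr step1// ler_piMr// indic_le1.
Qed.

(** Step approximation of [s -> f (s - x)]. Clipping the endpoints at 0 keeps every interval in the
    half-line, where [G] is defined, and performs the truncation of [half_open]. *)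
Definition kernel_steps D N f x : seq (R * R * R) :=
  [seq (f (node D N i), Num.max 0 (x + node D N i), Num.max 0 (x + node D N i.+1)) | i <- iota 0 N].

Lemma elementary_kernel_steps D N f x : 0 <= D -> elementary (kernel_steps D N f x).
Proof.
move=> D0 p /mapP[i _ ->] /=; split; first by rewrite le_max lexx.
by rewrite ge_max le_max lexx/= le_max lerD2l node_le// orbT.
Qed.

Lemma kernel_stepsE D N f x s : 0 <= D ->
  elementary_fun (kernel_steps D N f x) s = half_open (fun s => step D N f (s - x)) s.
Proof.
move=> D0; rewrite /elementary_fun big_map /half_open /step mulr_sumr.
rewrite -(big_mkord xpredT (fun i => \1_(`]0, +oo[%classic : set R) s *
   (f (node D N i) * \1_(`]node D N i, node D N i.+1]%classic : set R) (s - x)))).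
rewrite /index_iota subn0; apply: eq_bigr => i _ /=; rewrite mulrCA; congr (_ * _).
rewrite !indicE -natrM mulnb; congr (nat_of_bool _)%:R.
apply/idP/idP; rewrite ?inE/= !in_itv/=.
  rewrite gt_max le_max => /andP[/andP[s0 h1] h2]; rewrite !mem_set//= ?in_itv/= ?s0//.
  by move: h2; rewrite leNgt s0/= => h2; apply/andP; split; lra.
move=> /andP[]; rewrite !inE/= !in_itv/= ?andbT => s0 /andP[h1 h2].
rewrite gt_max s0 le_max; apply/andP; split; first by rewrite /=; lra.
by apply/orP; right; lra.
Qed.

Lemma step_cvg D f u : 0 <= D -> {for u, continuous f} -> (forall v, D < `|v| -> f v = 0) ->
  f (- D) = 0 -> step D n.+1 f u @[n --> \oo] --> f u.
Proof.
move=> D0 cf fD fD0; have E : \1_(`]- D, D]%classic : set R) u * f u = f u.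
  rewrite indicE; case: (boolP (u \in _)) => h; rewrite ?mul1r// mul0r.
  have [uD|uD] := ltP D `|u|; first by rewrite fD.
  move: h; rewrite notin_setE/= in_itv/= => /negP; move: uD; rewrite ler_norml => /andP[u1 u2].
  rewrite u2 andbT -leNgt => u3; have -> : u = - D by lra.
  by rewrite fD0.
apply/cvgrPdist_le => eps eps0.
have [d /= d0 hd] : exists2 d : R, 0 < d & forall t, `|u - t| < d -> `|f u - f t| <= eps.
  have /cvgrPdist_le /(_ _ eps0) [d d0 h] := cf; exists d => // t ut; exact: h.
have c : 2 * D / n.+1%:R @[n --> \oo] --> (0 : R).
  by rewrite -(mulr0 (2 * D)); apply: cvgMl_tmp; exact: cvg_harmonic.
near=> n; rewrite distrC; have := @step_le D n.+1 f u eps D0 isT; rewrite E; apply=> t tu.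
rewrite distrC; apply: hd; rewrite distrC; apply: le_lt_trans tu _.
by near: n; exact: (cvgr_lt (0 : R) c _ d0).
Unshelve. all: by end_near.
Qed.

Lemma approximable_continuous f delta x : 0 <= delta -> continuous f ->
  (forall v, delta < `|v| -> f v = 0) -> approximable (half_open (fun s => f (s - x))).
Proof.
(* The margin 1 makes [f] vanish at [- D], the one endpoint that the half-open cells miss. *)
move=> d0 cf fs; pose D := delta + 1.
have D0 : 0 <= D by rewrite /D; lra.
have fD v : D < `|v| -> f v = 0 by move=> h; apply: fs; rewrite /D in h; lra.
have fD0 : f (- D) = 0 by apply: fs; rewrite normrN ger0_norm// /D; lra.
have [c1 _ fM] := @EVT_max R (fun x => `|f x|) (- D) D ltac:(lra)
  ltac:(by apply: continuous_subspaceT => y; apply: cvg_norm; exact: cf).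
pose M := Num.max `|f c1| (D + `|x|).
have fb v : `|f v| <= `|f c1|.
  have [h|h] := ltP D `|v|; first by rewrite fD// normr0.
  by apply: fM; rewrite in_itv/= -ler_norml.
exists (fun n => kernel_steps D n.+1 f x), M; split.
- by move=> n; exact: elementary_kernel_steps.
- move=> n; have E := kernel_stepsE n.+1 f x _ D0; split.
  + by have [? []] := nice_elementary (kernel_steps D n.+1 f x).
  + move=> s; rewrite E /half_open normrM normr_indic.
    apply: le_trans (_ : `|step D n.+1 f (s - x)| <= _).
      by rewrite ler_piMl// indic_le1.
    apply: le_trans (ler_norm_sum _ _ _) _; rewrite /M le_max; apply/orP; left.
    apply: le_trans (_ : \sum_(i < n.+1) `|f c1| * \1_(`]node D n.+1 i, node D n.+1 i.+1]%classic : set R) (s - x) <= _).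
      by apply: ler_sum => i _; rewrite normrM normr_indic ler_wpM2r// indicE ler0n.
    by rewrite -mulr_sumr step1// ler_piMr// indic_le1.
  + move=> s; rewrite gt_max => /andP[_ h]; rewrite E /half_open /step big1 ?mulr0// => i _.
    rewrite indicE memNset ?mulr0//= in_itv/= => /andP[h1 h2].
    have n0 : - D <= node D n.+1 i by rewrite -(node0 D n.+1) node_le.
    have n1 : node D n.+1 i.+1 <= D by rewrite -[X in _ <= X](@nodeN D n.+1)// node_le.
    have := ler_normD (s - x) x; rewrite subrK.
    have : `|s - x| <= D by rewrite ler_norml; apply/andP; split; lra.
    lra.
- move=> s; under eq_fun do rewrite kernel_stepsE//.
  by rewrite /half_open; apply: cvgMl_tmp; apply: step_cvg => //; exact: cf.
Qed.
End step_functions.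

Section continuous_paths.
Context {R : realType} d {T : measurableType d}.
Variable G : R -> T -> R.
Hypothesis cG : continuous_paths G.
Hypothesis mG : forall x, 0 <= x -> measurable_fun [set: T] (G x).

(** Extending the paths to the left by their value at 0 gives functions continuous on the whole
    line, to which step approximation applies. *)
Let Gp x w := G (Num.max 0 x) w.

Let cGp w : continuous (fun x => Gp x w).
Proof.
move=> x; have /subspace_continuousP /(_ (Num.max 0 x)) h := @cG w.
have x0 : `[0, +oo[%classic (Num.max 0 x) by rewrite /= in_itv/= andbT le_max lexx.
have {}h := h x0; apply: (cvg_comp (fun y => Num.max 0 y) (G^~ w) _ h).
move=> A [e /= e0 hA]; exists e => //= y xy; apply: hA => /=; last first.
  by rewrite in_itv/= andbT le_max lexx.
apply: le_lt_trans xy; rewrite /Num.max.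
by do 2 case: ltP => ?; rewrite ?subrr ?normr0 ?normr_ge0// ?sub0r ?subr0 ?normrN;
  rewrite ler_norml; apply/andP; split; have := ler_norm (x - y); have := ler_norm (- (x - y)); rewrite ?normrN; lra.
Qed.

(** Each step approximation in time is a finite sum of products of a function of [x] and a function
    of [w]; by continuity of the paths they converge pointwise. *)
Lemma measurable_paths : measurable_fun [set: R * T] (fun z => G (Num.max 0 z.1) z.2).
Proof.
(* On [[-n, n]] with [(n+1)^2] cells, so that the interval exhausts the line while the mesh tends to
   0. *)
pose F n (z : R * T) : R := step n%:R (n.+1 * n.+1) (fun x => Gp x z.2) z.1.
have mF n : measurable_fun [set: R * T] (F n).
  apply: measurable_sum => i; apply: measurable_funM.
    have mg : measurable_fun [set: T] (Gp (node n%:R (n.+1 * n.+1) i)).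
      by apply: mG; rewrite le_max lexx.
    exact: (measurableT_comp mg measurable_snd).
  have mi : measurable_fun [set: R] (\1_(`]node n%:R (n.+1 * n.+1) i, node n%:R (n.+1 * n.+1) i.+1]%classic : set R) : R -> R).
    exact: measurable_indic.
  exact: (measurableT_comp mi measurable_fst).
apply: (@measurable_fun_cvg _ _ R setT F) => // -[x w] _ /=.
apply/cvgrPdist_le => eps eps0.
have [e /= e0 hd] : exists2 e : R, 0 < e & forall t, `|x - t| < e -> `|Gp x w - Gp t w| <= eps.
  have /cvgrPdist_le /(_ _ eps0) [e e0 h] := @cGp w x; exists e => // t ut; exact: h.
near=> n.
have xn : `|x| < n%:R by near: n; exact: nbhs_infty_gtr.
have nn : 2 * n%:R / (n.+1 * n.+1)%:R < e.
  apply: le_lt_trans (_ : 2 * n.+1%:R^-1 < _).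
    by rewrite natrM invfM mulrA ler_wpM2r// ler_pdivrMr// ler_wpM2l// ler_nat.
  near: n; have c : 2 * n.+1%:R^-1 @[n --> \oo] --> (0 : R).
    by rewrite -(mulr0 2); apply: cvgMl_tmp; exact: cvg_harmonic.
  exact: (cvgr_lt (0 : R) c _ e0).
have -> : G (Num.max 0 x) w = \1_(`]- n%:R, n%:R]%classic : set R) x * Gp x w.
  rewrite indicE mem_set ?mul1r//= in_itv/=.
  by move: xn; rewrite ltr_norml => /andP[h1 h2]; rewrite h1 ltW.
rewrite distrC; apply: step_le => // t tx.
by rewrite distrC; apply: hd; rewrite distrC; apply: le_lt_trans tx nn.
Unshelve. all: by end_near.
Qed.
End continuous_paths.

(** * Integrals of Wick powers *)

Section power_close.
Context {R : realFieldType}.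

Lemma power_sub_le (c s : R) k :
  `|c ^+ k.+1 - s ^+ k.+1| <= `|c - s| * (k.+1%:R * (`|s| + `|c - s|) ^+ k).
Proof.
rewrite subrXX normrM ler_wpM2l//; apply: le_trans (ler_norm_sum _ _ _) _.
apply: le_trans (_ : \sum_(i < k.+1) (`|s| + `|c - s|) ^+ k <= _); last first.
  by rewrite sumr_const card_ord mulr_natl.
apply: ler_sum => i _; rewrite normrM !normrX.
have cs : `|c| <= `|s| + `|c - s| by rewrite addrC -{1}(subrK s c); exact: ler_normD.
have ss : `|s| <= `|s| + `|c - s| by rewrite lerDl.
have -> : (`|s| + `|c - s|) ^+ k = (`|s| + `|c - s|) ^+ (k.+1.-1 - i) * (`|s| + `|c - s|) ^+ i.
  by rewrite -exprD /= subnK// -ltnS.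
by apply: ler_pM; rewrite ?exprn_ge0//; apply: lerXn2r; rewrite ?nnegrE ?addr_ge0.
Qed.

(** Turns convergence in $L^(k+1)$ into convergence of the integrals of the powers themselves. If
    [|c - s|] is small compared with [|s|] the first term suffices, otherwise [|s|] is a multiple of
    [|c - s|]. *)
Lemma power_close k (theta : R) : 0 < theta -> exists2 C : R, 0 <= C & forall c s : R,
  `|c ^+ k.+1 - s ^+ k.+1| <= theta * `|s| ^+ k.+1 + C * `|c - s| ^+ k.+1.
Proof.
move=> th0; pose A : R := k.+1%:R * 2 ^+ k.
have A0 : 0 < A by rewrite mulr_gt0// exprn_gt0.
pose t := Num.min 1 (theta / A).
have t0 : 0 < t by rewrite lt_min ltr01 divr_gt0.
have t1 : t <= 1 by rewrite ge_min lexx.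
have tA : t * A <= theta.
  by rewrite -ler_pdivlMr// ge_min lexx orbT.
exists (k.+1%:R * (t^-1 + 1) ^+ k); first by rewrite mulr_ge0// exprn_ge0// addr_ge0// invr_ge0 ltW.
move=> c s; apply: le_trans (power_sub_le c s k) _; set x := `|c - s|.
have x0 : 0 <= x by exact: normr_ge0.
have [xs|sx] := leP x (t * `|s|).
  apply: le_trans (_ : theta * `|s| ^+ k.+1 <= _); last first.
    by rewrite lerDl !mulr_ge0 ?exprn_ge0// addr_ge0// invr_ge0 ltW.
  apply: le_trans (_ : t * `|s| * (k.+1%:R * (2 * `|s|) ^+ k) <= _).
    apply: ler_pM => //; first by rewrite mulr_ge0// exprn_ge0// addr_ge0.
    rewrite ler_wpM2l//; apply: lerXn2r; rewrite ?nnegrE ?addr_ge0 ?mulr_ge0//.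
    have : t * `|s| <= `|s| by rewrite ler_piMl.
    lra.
  rewrite exprMn (_ : t * `|s| * _ = t * A * `|s| ^+ k.+1); last by rewrite /A exprS; ring.
  by rewrite ler_wpM2r// exprn_ge0.
apply: le_trans (_ : k.+1%:R * (t^-1 + 1) ^+ k * x ^+ k.+1 <= _); last first.
  by rewrite lerDr; apply: mulr_ge0; [exact: ltW|exact: exprn_ge0].
have sx' : `|s| <= t^-1 * x by rewrite ler_pdivlMl// ltW.
rewrite (_ : _ * x ^+ k.+1 = x * (k.+1%:R * ((t^-1 + 1) * x) ^+ k)); last by rewrite exprMn exprS; ring.
rewrite ler_wpM2l// ler_wpM2l//; apply: lerXn2r; rewrite ?nnegrE ?addr_ge0 ?mulr_ge0 ?addr_ge0 ?invr_ge0 ?(ltW t0)//.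
lra.
Qed.
End power_close.

Lemma measurable_comp2 (R : realType) d d' (T : measurableType d) (Z : measurableType d')
    (F : R -> T -> R) (g : Z -> R) (h : Z -> T) :
  measurable_fun [set: R * T] (fun z => F z.1 z.2) -> measurable_fun [set: Z] g ->
  measurable_fun [set: Z] h -> measurable_fun [set: Z] (fun z => F (g z) (h z)).
Proof. by move=> mF mg mh; exact: (measurableT_comp mF (measurable_fun_pair mg mh)). Qed.

Section wick_integrals.
Context {R : realType} d {T : measurableType d}.
Local Notation mu := (@lebesgue_measure R).
Local Notation mu2 := ((@lebesgue_measure R \x @lebesgue_measure R)%E).
Local Notation hl := (`[(0 : R), +oo[%classic : set R).
Variables (P : probability T R) (G : R -> T -> R) (S : R -> R).
Let r := rho S.
Hypothesis lr : locint r.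
Hypothesis rev : forall x, r (- x) = r x.
Hypothesis cov : forall g g' Y Y', approximable (half_open g) -> approximable (half_open g') ->
  is_gen_derivative P G S g Y -> is_gen_derivative P G S g' Y' ->
  gauss2 P Y Y' /\ \int[P]_w (Y w * Y' w) = form r (half_open g) (half_open g').
Variables (a b : R) (k : nat).
Hypotheses (a0 : 0 <= a) (ab : a <= b).
Hypothesis lrk : locint (fun x => r x ^+ k.+1).
Let I (x : R) : R := \1_(`[a, b]%classic : set R) x.
Let W (z : R * R) : R := I z.1 * I z.2.

(** What increment quotients and approximate identities have in common. Comparing any two instances
    at small scale identifies their limits. *)
Definition smoothing (delta : R) (p : R -> R) (U : R -> T -> R) :=
  [/\ measurable_fun (hl `*` [set: T]) (fun z : R * T => U z.1 z.2),
      forall x, 0 <= x -> is_gen_derivative P G S (fun s => p (s - x)) (U x),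
      forall x, 0 <= x -> approximable (half_open (fun s => p (s - x))) &
      kernel delta p].

Definition wick_integral (U : R -> T -> R) (w : T) : R :=
  \int[mu]_(x in hl) (wick_power P (U x) k.+1 w * \1_(`[a, b]%classic : set R) x).

Let Ioo : (mu (`[a, b]%classic : set R) < +oo)%E.
Proof.
have h : (lebesgue_measure (`[a, b]%classic : set R) < +oo)%E.
  by rewrite lebesgue_measure_itv/=; case: ifPn => _; rewrite -?EFinB ltry.
exact: h.
Qed.

Let mab : measurable (`[a, b]%classic : set (measurableTypeR R)).
Proof. exact: measurable_itv. Qed.

(** Lebesgue measure restricted to [[a, b]]: a finite measure, to which the results on random
    integrals apply. *)
Definition itv_measure : {finite_measure set (measurableTypeR R) -> \bar R} :=
  @mfrestr _ (measurableTypeR R) R `[a, b]%classic mu mab Ioo.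
Local Notation m := itv_measure.

Let m_density (A : set R) : measurable A -> m A = (\int[mu]_(x in A) (I x)%:E)%E.
Proof.
move=> mA; rewrite /I.
by rewrite (@integral_indic _ (measurableTypeR R) R mu A mA _ mab) setIC.
Qed.

Lemma Rint_itv_measure (F : R -> R) : measurable_fun [set: R] F ->
  \int[m]_x F x = \int[mu]_x (F x * \1_(`[a, b]%classic : set R) x).
Proof.
move=> mF; have I0 x : 0 <= I x by rewrite /I indicE ler0n.
have mI' : measurable_fun [set: measurableTypeR R] I by exact: measurable_indic.
exact: (@Rint_density R _ (measurableTypeR R) mu m I I0 mI' m_density F mF).
Qed.

Let mI : measurable_fun [set: R] I. Proof. exact: measurable_indic. Qed.
Let I01 x : I x = 0 \/ I x = 1.
Proof. by rewrite /I indicE; case: (_ \in _); [right|left]. Qed.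
Let Iab x : I x != 0 -> a <= x <= b.
Proof.
rewrite /I indicE; case: (boolP (x \in _)); rewrite ?eqxx// inE/= in_itv/=.
by move=> h _.
Qed.

(** Not uniform in [delta]: it serves only to bound the second moments in [x] for fixed kernels, so
    that the random integrals make sense. *)
Lemma kernel_cov_bounded delta p p' : kernel delta p -> kernel delta p' ->
  exists V, forall x y, 0 <= x <= b -> 0 <= y <= b -> `|kernel_cov r p p' x y| <= V.
Proof.
have nice_ho q : kernel delta q -> exists M, forall x, 0 <= x <= b -> nice M (half_open (fun s => q (s - x))).
  move=> [mq [A qA] q0 qs _].
  have A0 : 0 <= A := le_trans (q0 0) (qA 0).
  exists (Num.max A (`|delta| + b)) => x /andP[x0 xb]; split.
  + apply: measurable_funM; first exact: measurable_indic.
    by apply: (measurableT_comp mq); exact: measurable_funB.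
  + move=> u; rewrite le_max /half_open normrM normr_indic; apply/orP; left.
    rewrite (ger0_norm (q0 _)); apply: le_trans (qA (u - x)).
    by rewrite ler_piMl// indic_le1.
  + move=> u; rewrite gt_max => /andP[_ h]; rewrite /half_open qs ?mulr0//.
    have := ler_norm delta; have := ler_normD (u - x) x; rewrite subrK (ger0_norm x0); lra.
move=> /nice_ho[M1 h1] /nice_ho[M2 h2]; pose M := Num.max M1 M2.
exists (M * M * (2 * M * \int[mu]_x (\1_(`[- (2 * M), 2 * M]%classic : set R) x * `|r x|))) => x y hx hy.
have n1 : nice M (half_open (fun s => p (s - x))) by apply: nice_le (h1 x hx); rewrite le_max lexx.
have n2 : nice M (half_open (fun s => p' (s - y))) by apply: nice_le (h2 y hy); rewrite le_max lexx orbT.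
have M0 := nice_ge0 n1.
have out g : nice M g -> forall x, ~~ (- M <= x <= - M + 2 * M) -> g x = 0.
  move=> [_ _ g0] u h; apply: g0; move: h; apply: contraR; rewrite -leNgt ler_norml => /andP[? ?].
  by apply/andP; split; lra.
have [m1 b1 _] := n1; have [m2 b2 _] := n2.
have [i v] := form_bound lr m1 m2 (L := 2 * M) (u := - M) ltac:(by rewrite mulr_ge0) b1 b2 (out _ n1) (out _ n2).
apply: le_trans v; rewrite /kernel_cov /form; exact: le_normr_Rintegral.
Qed.

(** [U] is meaningful and measurable only for [x >= 0]; clipping the time and cutting to [[a, b]]
    gives a field jointly measurable on the whole line. *)
Let Ut (U : R -> T -> R) (x : R) (w : T) : R := I x * U (Num.max 0 x) w.

Let mmax : measurable_fun [set: R * T] (fun z : R * T => (Num.max 0 z.1, z.2)).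
Proof.
apply/measurable_fun_pairP; split; last exact: measurable_snd.
by apply: measurable_maxr; [exact: measurable_cst|exact: measurable_fst].
Qed.

Lemma measurable_truncated delta p U : smoothing delta p U ->
  measurable_fun [set: R * T] (fun z => Ut U z.1 z.2).
Proof.
move=> [mU _ _ _]; apply: measurable_funM; first exact: (measurableT_comp mI measurable_fst).
apply: (measurable_comp _ _ mU mmax).
- by apply: measurableX => //; exact: measurable_itv.
- by move=> _ [z _ <-] /=; split => //=; rewrite in_itv/= andbT le_max lexx.
Qed.

Lemma truncated_cov delta p p' U U' x y : smoothing delta p U -> smoothing delta p' U' ->
  gauss2 P (Ut U x) (Ut U' y) /\
  \int[P]_w (Ut U x w * Ut U' y w) = W (x, y) * kernel_cov r p p' x y.
Proof.
move=> [_ dU aU _] [_ dU' aU' _].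
have x0 : 0 <= Num.max 0 x by rewrite le_max lexx.
have y0 : 0 <= Num.max 0 y by rewrite le_max lexx.
have [g2 c] := cov (aU _ x0) (aU' _ y0) (dU _ x0) (dU' _ y0).
split.
  move=> u v; have := g2 (u * I x) (v * I y).
  by congr gauss; apply/funext => w; rewrite /Ut; ring.
rewrite /W /=; have [Ix|Ix] := eqVneq (I x) 0.
  rewrite Ix !mul0r; rewrite /Rintegral integral0_eq// => w _; by rewrite /Ut Ix !mul0r.
have [Iy|Iy] := eqVneq (I y) 0.
  rewrite Iy mulr0 mul0r; rewrite /Rintegral integral0_eq// => w _; by rewrite /Ut Iy !mul0r mulr0.
have /andP[ax xb] := Iab Ix; have /andP[ay yb] := Iab Iy.
have Ex : Num.max 0 x = x by apply/max_idPr; exact: le_trans a0 ax.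
have Ey : Num.max 0 y = y by apply/max_idPr; exact: le_trans a0 ay.
rewrite Ex Ey in c.
have I1 z : I z != 0 -> I z = 1 by case: (I01 z) => -> //; rewrite eqxx.
rewrite (I1 _ Ix) (I1 _ Iy) !mul1r /kernel_cov -c; apply: eq_Rintegral => w _.
by rewrite /Ut Ex Ey (I1 _ Ix) (I1 _ Iy) !mul1r.
Qed.

Lemma measurable_truncated_cov delta p p' U U' : smoothing delta p U -> smoothing delta p' U' ->
  measurable_fun [set: R * R] (fun z => W z * kernel_cov r p p' z.1 z.2).
Proof.
move=> sU sU'.
have -> : (fun z => W z * kernel_cov r p p' z.1 z.2) = (fun z => \int[P]_w (Ut U z.1 w * Ut U' z.2 w)).
  by apply/funext => -[x y]; have [_ ->] := truncated_cov x y sU sU'.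
apply: (@measurable_Rint_section _ _ _ _ _ P (fun z : (R * R) * T => Ut U z.1.1 z.2 * Ut U' z.1.2 z.2)).
apply: measurable_funM.
  exact: (measurable_comp2 (measurable_truncated sU) (measurableT_comp measurable_fst measurable_fst) measurable_snd).
exact: (measurable_comp2 (measurable_truncated sU') (measurableT_comp measurable_snd measurable_fst) measurable_snd).
Qed.

Let V U x := \int[P]_w (Ut U x w ^+ 2).
(** The Wick power as a polynomial in the field and its variance, a form in which joint
    measurability is visible. *)
Let HU U (z : R * T) : R := (he (V U z.1) k.+1).[Ut U z.1 z.2].

Let measurable_HU delta p U : smoothing delta p U -> measurable_fun [set: R * T] (HU U).
Proof.
move=> sU; have mU := measurable_truncated sU.
have mV : measurable_fun [set: R] (V U).
  apply: (@measurable_Rint_section _ _ _ _ _ P (fun z : R * T => Ut U z.1 z.2 ^+ 2)).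
  exact: measurable_funX.
have -> : HU U = (fun z => \sum_(j < k.+1./2.+1) (-1) ^+ j * 'C(k.+1, j.*2)%:R * (gmom j.*2 * V U z.1 ^+ j)
    * Ut U z.1 z.2 ^+ (k.+1 - j.*2)).
  by apply/funext => z; rewrite /HU horner_he.
apply: measurable_sum => j; apply: measurable_funM; last exact: measurable_funX.
apply: measurable_funM; first exact: measurable_cst.
apply: measurable_funM; first exact: measurable_cst.
by apply: measurable_funX; exact: (measurableT_comp mV measurable_fst).
Qed.

Let mHU delta p U : smoothing delta p U -> measurable_fun [set: measurableTypeR R * T] (HU U).
Proof. by move=> sU; exact: (measurable_HU sU). Qed.

Let cov_HU delta p p' U U' x y : smoothing delta p U -> smoothing delta p' U' ->
  \int[P]_w (HU U (x, w) * HU U' (y, w)) = (k.+1)`!%:R * (W (x, y) * kernel_cov r p p' x y ^+ k.+1).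
Proof.
move=> sU sU'; have [g2 c] := truncated_cov x y sU sU'.
rewrite /HU /V /= (he_gauss2 g2) eqxx mul1r c exprMn /W /=; congr (_ * (_ * _)).
by case: (I01 x) => ->; case: (I01 y) => ->; rewrite ?mulr0 ?mul0r ?mulr1 ?expr0n ?expr1n.
Qed.

Let sqint_HU delta p U x : smoothing delta p U -> sqint P (fun w => HU U (x, w)).
Proof.
move=> sU; have [g2 _] := truncated_cov x x sU sU; split.
  exact: (measurableT_comp (measurable_HU sU) (@measurable_pair1 _ _ _ _ x)).
have := gauss2_mint_poly g2 (he (V U x) k.+1) (he (V U x) k.+1).
by apply: eq_integrable => // w _ /=; rewrite /HU expr2.
Qed.

Let bound_HU delta p U : smoothing delta p U -> exists M, forall x, \int[P]_w (HU U (x, w) ^+ 2) <= M.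
Proof.
move=> sU; have [_ _ _ kp] := sU; have [B hB] := kernel_cov_bounded kp kp.
have B0 : 0 <= B by apply: le_trans (normr_ge0 _) (hB 0 0 _ _); rewrite lexx (le_trans a0 ab).
exists ((k.+1)`!%:R * B ^+ k.+1) => x.
under eq_Rintegral do rewrite expr2.
rewrite (cov_HU x x sU sU) ler_wpM2l//.
have [Ix|Ix] := eqVneq (I x) 0; first by rewrite /W /= Ix !mul0r exprn_ge0.
have /andP[ax xb] := Iab Ix.
have x0b : 0 <= x <= b by rewrite xb (le_trans a0 ax).
have Wx : W (x, x) = 1 by rewrite /W /=; case: (I01 x) Ix => ->; rewrite ?eqxx// mulr1.
rewrite Wx mul1r; apply: le_trans (ler_norm _) _; rewrite normrX.
by apply: lerXn2r; rewrite ?nnegrE//; exact: hB.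
Qed.

Lemma wick_integralE delta p U w : smoothing delta p U ->
  wick_integral U w = rint m (HU U) w.
Proof.
move=> sU; rewrite /rint Rint_itv_measure; last first.
  exact: (measurableT_comp (measurable_HU sU) (@measurable_pair2 _ _ _ _ w)).
rewrite /wick_integral Rint_in; apply: eq_Rintegral => x _.
rewrite -/(I x); have [Ix|Ix] := eqVneq (I x) 0; first by rewrite Ix !mulr0.
have /andP[ax xb] := Iab Ix; have x0 := le_trans a0 ax.
rewrite indicE mem_set/=; last by rewrite in_itv/= x0.
rewrite mul1r; congr (_ * _).
have Ut1 : Ut U x = U x.
  apply/funext => w'; rewrite /Ut; have -> : Num.max 0 x = x by exact/max_idPr.
  by case: (I01 x) Ix => ->; rewrite ?eqxx// mul1r.
have [g2 _] := truncated_cov x x sU sU; have gx := gauss2l g2; rewrite Ut1 in gx.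
by rewrite (wick_power_he _ _ gx) /HU /V /= Ut1.
Qed.

Let prod_HU delta p U : smoothing delta p U ->
  (m \x P)%E.-integrable [set: measurableTypeR R * T] (EFin \o (fun z => HU U z ^+ 2)).
Proof.
move=> sU; have [M hM] := bound_HU sU.
exact: (@integrable_sqr_prod R _ _ (measurableTypeR R) T m P (HU U) M (mHU sU) (fun x => sqint_HU x sU) hM).
Qed.

Lemma sqint_wick_integral delta p U : smoothing delta p U -> sqint P (wick_integral U).
Proof.
move=> sU; have -> : wick_integral U = rint m (HU U).
  by apply/funext => w; exact: wick_integralE sU.
exact: (@sqint_rint R _ _ (measurableTypeR R) T m P (HU U) (mHU sU) (prod_HU sU)).1.
Qed.

Let fact0 : (k.+1)`!%:R != 0 :> R.
Proof. by rewrite pnatr_eq0 -lt0n fact_gt0. Qed.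

Let unscale (c : R) (F : R -> R) : c != 0 -> m.-integrable [set: measurableTypeR R] (EFin \o (fun x => c * F x)) ->
  m.-integrable [set: measurableTypeR R] (EFin \o F).
Proof.
move=> c0 h; have := @mintZ R _ (measurableTypeR R) m c^-1 _ h.
by apply: eq_integrable => // x _ /=; rewrite mulKf.
Qed.

Definition wcov (p p' : R -> R) : R :=
  \int[m]_x \int[m]_y (W (x, y) * kernel_cov r p p' x y ^+ k.+1).

(** Fubini twice, with [E :X^k: :Y^k: = k! (E X Y)^k] for the inner expectation. *)
Lemma wick_integral_cov delta p p' U U' : smoothing delta p U -> smoothing delta p' U' ->
  \int[P]_w (wick_integral U' w * wick_integral U w) =
  (k.+1)`!%:R * wcov p p'.
Proof.
rewrite /wcov => sU sU'; have s' := sqint_wick_integral sU'.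
have E U1 p1 (s1 : smoothing delta p1 U1) : wick_integral U1 = rint m (HU U1).
  by apply/funext => w; exact: wick_integralE s1.
rewrite (E _ _ sU) (@Rint_rint_weight R _ _ (measurableTypeR R) T m P (HU U) (mHU sU) (prod_HU sU) _ s').2.
have inner x : \int[P]_w (wick_integral U' w * HU U (x, w)) =
    (k.+1)`!%:R * \int[m]_y (W (x, y) * kernel_cov r p p' x y ^+ k.+1).
  have -> : \int[P]_w (wick_integral U' w * HU U (x, w)) = \int[P]_w (HU U (x, w) * rint m (HU U') w).
    by apply: eq_Rintegral => w _; rewrite (E _ _ sU') mulrC.
  have [iy ->] := @Rint_rint_weight R _ _ (measurableTypeR R) T m P (HU U') (mHU sU') (prod_HU sU') _ (sqint_HU x sU).
  have E2 : (fun y => \int[P]_w (HU U (x, w) * HU U' (y, w))) =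
     (fun y => (k.+1)`!%:R * (W (x, y) * kernel_cov r p p' x y ^+ k.+1)).
    by apply/funext => y; rewrite (cov_HU x y sU sU').
  rewrite E2 in iy *; rewrite RintegralZl//.
  exact: (unscale fact0 iy).
have [ix _] := @Rint_rint_weight R _ _ (measurableTypeR R) T m P (HU U) (mHU sU) (prod_HU sU) _ s'.
under eq_Rintegral do rewrite inner.
have E3 : (fun x => \int[P]_w (wick_integral U' w * HU U (x, w))) =
    (fun x => (k.+1)`!%:R * \int[m]_y (W (x, y) * kernel_cov r p p' x y ^+ k.+1)) by apply/funext.
rewrite E3 in ix; rewrite RintegralZl//; exact: (unscale fact0 ix).
Qed.

Let WW z : W z = 0 \/ W z = 1.
Proof.
by rewrite /W; case: (I01 z.1) => ->; case: (I01 z.2) => ->; rewrite ?mulr0 ?mul0r ?mulr1; [left|left|left|right].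
Qed.

Lemma Rint_itv_measure2 (F : R * R -> R) : measurable_fun [set: R * R] F ->
  mu2.-integrable [set: R * R] (EFin \o (fun z => W z * F z)) ->
  \int[m]_x \int[m]_y (W (x, y) * F (x, y)) = \int[mu2]_z (W z * F z).
Proof.
move=> mF iF; have mWF := (measurable_EFinP _ _).1 (measurable_int _ iF).
have inner x : \int[m]_y (W (x, y) * F (x, y)) = \int[mu]_y (W (x, y) * F (x, y)).
  rewrite Rint_itv_measure; last exact: (measurableT_comp mWF (@measurable_pair1 _ _ _ _ x)).
  apply: eq_Rintegral => y _; rewrite -/(I y) /W /=.
  by case: (I01 y) => ->; rewrite ?mulr0 ?mul0r// !mulr1.
under eq_Rintegral do rewrite inner.
rewrite -(Rint_fubini1 iF).2 Rint_itv_measure; last first.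
  exact: (@measurable_Rint_section _ _ _ _ _ mu (fun z => W z * F z)).
apply: eq_Rintegral => x _; rewrite -/(I x).
case: (I01 x) => Ix; rewrite Ix ?mulr1// mulr0 /Rintegral integral0_eq// => y _.
by rewrite /W /= Ix !mul0r.
Qed.

Lemma integrable_truncated_rho : mu2.-integrable [set: R * R] (EFin \o (fun z => W z * r (z.2 - z.1) ^+ k.+1)).
Proof.
have n1 : nice (Num.max 1 (Num.max `|a| `|b|)) I.
  split=> //.
    by move=> x; rewrite /I normr_indic le_max indic_le1.
  move=> x; rewrite !gt_max => /andP[_ /andP[ax bx]].
  case: (I01 x) => // Ix; have /andP[h1 h2] : a <= x <= b by apply: Iab; rewrite Ix oner_eq0.
  have x0 : 0 <= x := le_trans a0 h1; have b0 : 0 <= b := le_trans a0 ab.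
  by move: bx; rewrite (ger0_norm x0) (ger0_norm b0); lra.
have := form_mint lrk n1 n1; apply: eq_integrable => // z _ /=; congr EFin.
by rewrite /W; ring.
Qed.

(** The limit does not depend on the kernels. [theta] makes the first term of [power_close] small
    against the integral of [|r|^(k+1)]; [kernel_cov_cvg] handles the second. *)
Lemma wick_cov_cvg (eps : R) : 0 < eps -> exists2 d0 : R, 0 < d0 &
  forall delta p p' U U', 0 <= delta -> delta <= d0 -> smoothing delta p U -> smoothing delta p' U' ->
  `|wcov p p' - \int[mu2]_z (W z * r (z.2 - z.1) ^+ k.+1)| <= eps.
Proof.
rewrite /wcov => eps0; pose Rk := \int[mu2]_z `|W z * r (z.2 - z.1) ^+ k.+1|.
have Rk0 : 0 <= Rk by apply: Rintegral_ge0.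
pose theta := eps / 2 / (Rk + 1).
have th0 : 0 < theta by rewrite !divr_gt0// ltr_wpDl.
have [C C0 hC] := power_close k th0.
have e0 : 0 < eps / 2 / (C + 1) by rewrite !divr_gt0// ltr_wpDl.
have [d0 d00 hd] := kernel_cov_cvg lr a0 ab lrk rev e0.
exists d0 => // delta p p' U U' de0 de1 sU sU'.
have [_ _ _ kp] := sU; have [_ _ _ kp'] := sU'.
have [i1 v1] := hd delta p p' de0 de1 kp kp'.
pose kc (z : R * R) := kernel_cov r p p' z.1 z.2.
have mkc := measurable_truncated_cov sU sU'.
(* Measurability of the covariance is known only after multiplication by [W], so powers are
   rewritten with [W] inside; [W] is 0 or 1. *)
have E z : W z * kc z ^+ k.+1 = (W z * kc z) ^+ k.+1.
  by case: (WW z) => ->; rewrite ?mul0r ?expr0n// !mul1r.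
have E' (x y : R) : W (x, y) * kernel_cov r p p' x y ^+ k.+1 = W (x, y) * (W (x, y) * kc (x, y)) ^+ k.+1.
  by case: (WW (x, y)) => ->; rewrite ?mul0r// !mul1r.
have pw z : `|W z * kc z ^+ k.+1 - W z * r (z.2 - z.1) ^+ k.+1| <=
    theta * `|W z * r (z.2 - z.1) ^+ k.+1| + C * (W z * `|kc z - r (z.2 - z.1)| ^+ k.+1).
  case: (WW z) => ->; rewrite ?mul0r ?subrr ?normr0 ?mulr0 ?addr0// !mul1r.
  by rewrite [`|r _ ^+ _|]normrX; exact: hC.
have mWk : measurable_fun [set: R * R] (fun z => W z * kc z ^+ k.+1).
  by under eq_fun do rewrite E; exact: measurable_funX.
have irho := integrable_truncated_rho.
have ia := integrable_norm irho.
have ib := mintD (mintZ theta ia) (mintZ C i1).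
have mr2 := (measurable_EFinP _ _).1 (measurable_int _ irho).
have idiff : mu2.-integrable [set: R * R] (EFin \o (fun z => W z * kc z ^+ k.+1 - W z * r (z.2 - z.1) ^+ k.+1)).
  apply: (@le_integrableT R _ _ mu2 _ _ _ _ ib); first exact: measurable_funB.
  by move=> z; apply: le_trans (pw z) (ler_norm _).
have iWk : mu2.-integrable [set: R * R] (EFin \o (fun z => W z * kc z ^+ k.+1)).
  by have := mintD idiff irho; apply: eq_integrable => // z _ /=; rewrite subrK.
have -> : \int[m]_x \int[m]_y (W (x, y) * kernel_cov r p p' x y ^+ k.+1) = \int[mu2]_z (W z * kc z ^+ k.+1).
  have E2 : (fun z => W z * (W z * kc z) ^+ k.+1) = (fun z => W z * kc z ^+ k.+1).
    by apply/funext => z; case: (WW z) => ->; rewrite ?mul0r// !mul1r.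
  under eq_Rintegral do under eq_Rintegral do rewrite E'.
  rewrite (Rint_itv_measure2 (F := fun z => (W z * kc z) ^+ k.+1)) ?E2//.
  exact: measurable_funX.
rewrite -RintegralB//; apply: le_trans (le_normr_Rintegral measurableT idiff) _.
apply: le_trans (le_Rintegral measurableT (integrable_norm idiff) ib (fun z _ => pw z)) _.
rewrite RintegralD//; [|exact: mintZ..].
rewrite !RintegralZl// -/Rk.
have h1 : theta * Rk <= eps / 2.
  apply: le_trans (_ : theta * (Rk + 1) <= _); first by rewrite ler_wpM2l ?(ltW th0)// lerDl.
  by rewrite /theta divfK// gt_eqF// ltr_wpDl.
have h2 : C * \int[mu2]_z (W z * `|kc z - r (z.2 - z.1)| ^+ k.+1) <= eps / 2.
  apply: le_trans (_ : C * (eps / 2 / (C + 1)) <= _); first by rewrite ler_wpM2l.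
  rewrite mulrCA ler_piMr ?divr_ge0 ?(ltW eps0)// ler_pdivrMr ?ltr_wpDl// mul1r.
  by rewrite lerDl.
lra.
Qed.

Lemma wick_integral_close (eps : R) : 0 < eps -> exists2 d0 : R, 0 < d0 &
  forall delta p p' U U', 0 <= delta -> delta <= d0 -> smoothing delta p U -> smoothing delta p' U' ->
  norm2 P (fun w => wick_integral U w - wick_integral U' w) <= eps.
Proof.
(* The squared distance is [(k+1)!] times [A - 2 B + D], where [A], [B] and [D] are within [e] of a
   common value; the errors add up to [4 e]. *)
move=> eps0; pose e := eps ^+ 2 / (4 * (k.+1)`!%:R).
have f0 : 0 < (k.+1)`!%:R :> R by rewrite ltr0n fact_gt0.
have e0 : 0 < e by rewrite divr_gt0 ?exprn_gt0// mulr_gt0.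
have [d0 d00 hd] := wick_cov_cvg e0; exists d0 => // delta p p' U U' de0 de1 sU sU'.
have s1 := sqint_wick_integral sU; have s2 := sqint_wick_integral sU'.
have hb := hd delta _ _ _ _ de0 de1.
rewrite -[X in _ <= X](ger0_norm (ltW eps0)) -sqrtr_sqr /norm2 ler_wsqrtr//.
have -> : \int[P]_w ((wick_integral U w - wick_integral U' w) ^+ 2) =
    \int[P]_w (wick_integral U w * wick_integral U w) +
    2 * - (\int[P]_w (wick_integral U' w * wick_integral U w)) +
    \int[P]_w (wick_integral U' w * wick_integral U' w).
  rewrite (Rint_sqrD s1 (sqintN s2)); congr (_ + 2 * _ + _).
  - rewrite -[RHS]mulN1r -RintegralZl//; last exact: sqintM.
    by apply: eq_Rintegral => w _; ring.
  - by apply: eq_Rintegral => w _; ring.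
rewrite (wick_integral_cov sU sU) (wick_integral_cov sU sU') (wick_integral_cov sU' sU').
have h1 := hb _ _ _ _ sU sU; have h2 := hb _ _ _ _ sU sU'; have h3 := hb _ _ _ _ sU' sU'.
move: h1 h2 h3; move: (wcov p p) (wcov p p') (wcov p' p') => A B D.
move: (\int[mu2]_z (W z * r (z.2 - z.1) ^+ k.+1)) => Q.
rewrite !ler_norml => /andP[h1 h1'] /andP[h2 h2'] /andP[h3 h3'].
have -> : (k.+1)`!%:R * A + 2 * - ((k.+1)`!%:R * B) + (k.+1)`!%:R * D = (k.+1)`!%:R * (A - 2 * B + D) by ring.
rewrite mulrC -ler_pdivlMr//.
have -> : eps ^+ 2 / (k.+1)`!%:R = 4 * e by rewrite /e; field; rewrite gt_eqF.
lra.
Qed.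
End wick_integrals.

(** * Existence of smoothed derivatives *)

Section smoothings.
Context {R : realType} d {T : measurableType d}.
Local Notation mu := (@lebesgue_measure R).
Local Notation hl := (`[(0 : R), +oo[%classic : set R).
Variables (P : probability T R) (G : R -> T -> R) (S : R -> R).
Variable f : R -> R.
Let r := rho S.
Hypothesis hG : centered_gaussian_process P G.
Hypothesis cG : continuous_paths G.
Hypothesis hvar : increments_variance P G S.
Hypothesis Sev : forall x, S (- x) = S x.
Hypothesis lr : locint r.
Hypothesis rev : forall x, r (- x) = r x.
Hypothesis ftc : forall u v, u <= v -> \int[mu]_(x in `]u, v]) r x = f v - f u.
Hypothesis cf : continuous f.
Hypothesis dS : forall x : R, is_derive x 1 (fun x => 2^-1 * S x) (f x).

Local Notation D := (elementary_derivative G).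
Local Notation ef := elementary_fun.

Let sqintD := sqint_elementary hG.
Let covD := cov_elementary hG hvar Sev lr rev ftc cf dS.

Let mG x : 0 <= x -> measurable_fun [set: T] (G x).
Proof.
move=> x0; have [m _] := hG (fun _ : 'I_1 => 1) (t := fun=> x) (fun=> x0).
by move: m; under eq_fun do rewrite big_ord1 mul1r.
Qed.

Let mpaths := measurable_paths cG mG.

Lemma measurable_paths_at (t : R) :
  measurable_fun [set: R * T] (fun z : R * T => G (Num.max 0 (z.1 + t)) z.2).
Proof.
have m1 : measurable_fun [set: R * T] (fun z : R * T => z.1 + t).
  by apply: measurable_funD; [exact: measurable_fst|exact: measurable_cst].
exact: (@measurable_comp2 R _ _ T _ (fun x w => G (Num.max 0 x) w) _ _ mpaths m1 measurable_snd).
Qed.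

Let maxE (x : R) : 0 <= x -> Num.max 0 x = x.
Proof. by move=> x0; apply/max_idPr. Qed.

Let rho_form0 (g : R -> R) : (forall s, g s = 0) -> rho_form S g = 0.
Proof.
move=> g0; rewrite /rho_form /Rintegral integral0_eq// => t _.
by rewrite integral0_eq// => s _; rewrite g0 mulr0 mul0r.
Qed.

Let cvg_L2_norm2 (X : nat -> T -> R) Y : (forall n, sqint P (X n)) -> sqint P Y ->
  norm2 P (fun w => X n w - Y w) @[n --> \oo] --> 0 -> cvg_L2 P \oo X Y.
Proof. by move=> sX sY h; apply/cvg_L2P => //; apply: nearW => n; exact: sqintB. Qed.

Definition increment_kernel (h s : R) : R := h^-1 * \1_(`]0, h]%classic : set R) s.

Definition increment_quotient (h x : R) (w : T) : R := (G (x + h) w - G x w) / h.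

(** The kernel is itself elementary, so a constant sequence approximates it exactly and its
    generalized derivative is the increment quotient. *)
Lemma smoothing_increment h : 0 < h ->
  smoothing P G S h (increment_kernel h) (increment_quotient h).
Proof.
move=> h0; have hi : 0 < h^-1 by rewrite invr_gt0.
pose e x : seq (R * R * R) := [:: (h^-1, x, x + h)].
have he x : 0 <= x -> elementary (e x).
  by move=> x0 p; rewrite inE => /eqP -> /=; split=> //; rewrite lerDl ltW.
have efE x s : ef (e x) s = increment_kernel h (s - x).
  rewrite /ef big_seq1 /increment_kernel /= !indicE; congr (_ * (nat_of_bool _)%:R).
  by apply/idP/idP; rewrite !inE/= !in_itv/= => /andP[? ?]; apply/andP; split; lra.
have DE x : D (e x) = increment_quotient h x.
  by apply/funext => w; rewrite /elementary_derivative big_seq1 /= mulrC.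
have mk : measurable_fun [set: R] (increment_kernel h).
  by apply: measurable_funM; [exact: measurable_cst|exact: measurable_indic].
have k0 s : 0 <= increment_kernel h s by rewrite mulr_ge0 ?indicE ?ler0n// ltW.
have k1 s : increment_kernel h s <= h^-1 by rewrite ler_piMr ?indic_le1// ltW.
split.
- apply: (eq_measurable_fun (fun z : R * T => (G (Num.max 0 (z.1 + h)) z.2 - G (Num.max 0 (z.1 + 0)) z.2) / h)).
    move=> z; rewrite inE/= => -[]; rewrite in_itv/= andbT => z0 _.
    by rewrite addr0 !maxE// addr_ge0// ltW.
  apply: measurable_funTS; apply: measurable_funM; last exact: measurable_cst.
  by apply: measurable_funB; exact: measurable_paths_at.
- move=> x x0; split.
  + split.
      apply: measurable_funTS; apply: (measurableT_comp mk).
      by apply: measurable_funB; [exact: measurable_id|exact: measurable_cst].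
    exists (Num.max h^-1 (x + h)) => s s0; split.
      by rewrite ger0_norm// le_max k1.
    rewrite gt_max => /andP[_ xs]; rewrite /increment_kernel indicE memNset ?mulr0//= in_itv/=.
    by move=> /andP[]; lra.
  + by apply/Lfun2P; rewrite -DE; exact: sqintD (he x x0).
  + exists (fun=> e x); split; first by move=> n; exact: he.
      have -> : (fun n : nat => Num.sqrt (rho_form S (fun s => increment_kernel h (s - x) - ef (e x) s))) = (fun=> 0).
        by apply/funext => n; rewrite rho_form0 ?sqrtr0// => s; rewrite efE subrr.
      exact: cvg_cst.
    apply: cvg_L2_norm2; [by move=> n; exact: sqintD (he x x0)|by rewrite -DE; exact: sqintD (he x x0)|].
    rewrite DE; have -> : norm2 P (fun w => increment_quotient h x w - increment_quotient h x w) = 0.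
      rewrite /norm2 /Rintegral integral0_eq ?sqrtr0// => w _.
      by rewrite subrr expr0n.
    exact: cvg_cst.
- move=> x x0; have -> : half_open (fun s => increment_kernel h (s - x)) = ef (e x).
    apply/funext => s; have [s0|s0] := ltP 0 s; first by rewrite half_openT// efE.
    by rewrite half_open0// elementary_fun_neg//; exact: he.
  exact: approximable_elementary (he x x0).
- split=> //; first by exists h^-1.
  + move=> x hx; rewrite /increment_kernel indicE memNset ?mulr0//= in_itv/= => /andP[x0 xh].
    by move: hx; rewrite ger0_norm ?ltNge ?xh// ltW.
  + have i1 := @mint_itv_bounded R 0 h 1 (fun=> 1) (measurable_cst _) (fun x _ => ltac:(by rewrite normr1)).
    have E1 : \int[mu]_x (\1_(`]0, h]%classic : set R) x * 1) = h.
      rewrite -Rint_in Rintegral_cst//.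
      have E := @lebesgue_measure_itv R `]0, h]%R.
      by move: E; rewrite /= lte_fin h0 => E; rewrite [X in _ * fine X]E /= subr0 mul1r.
    have i2 : mu.-integrable [set: R] (EFin \o (fun x => \1_(`]0, h]%classic : set R) x * 1)).
      apply: (@le_integrableT R _ (measurableTypeR R) mu _ _ _ _ i1).
        by apply: measurable_funM; [exact: measurable_indic|exact: measurable_cst].
      move=> x; rewrite !mulr1 !normr_indic !indicE.
      case: (boolP (x \in `]0, h]%classic)) => //; rewrite inE/= in_itv/= => /andP[x0 xh].
      by rewrite mem_set//= in_itv/= xh ltW.
    have -> : increment_kernel h = (fun x => h^-1 * (\1_(`]0, h]%classic : set R) x * 1)).
      by apply/funext => x; rewrite mulr1.
    by rewrite RintegralZl// E1 mulVf// gt_eqF.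
Qed.

Lemma smoothing_identity (g : R -> R -> R) (V : R -> R -> T -> R) delta :
  approximate_identity g -> is_smoothed_derivative P G S g V -> 0 < delta <= 1 ->
  smoothing P G S delta (g delta) (V delta).
Proof.
move=> hg hV hd; have [cg g0 gev gs g1] := hg delta hd; have [mV dV] := hV delta hd.
have /andP[d0 _] := hd.
split=> //.
  by move=> x x0; apply: (approximable_continuous x (ltW d0) cg).
split=> //; first exact: continuous_measurable_fun.
have [c1 _ gM] := @EVT_max R (g delta) (- delta) delta ltac:(lra) ltac:(exact: continuous_subspaceT).
exists (g delta c1) => x; have [h|h] := ltP delta `|x|; first by rewrite gs.
by apply: gM; rewrite in_itv/= -ler_norml.
Qed.

(** * A smoothed derivative built from a triangular kernel *)

Section triangular_kernel.
Variable delta : R.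
Hypothesis d0 : 0 < delta.

(** A Lipschitz profile: step approximations then have an explicit error, uniform in the center
    [x]. *)
Let bump (s : R) : R := Num.max 0 (delta - `|s|).
Let c : R := \int[mu]_s bump s.

Let bump0 s : 0 <= bump s. Proof. by rewrite /bump le_max lexx. Qed.
Let bump_lip s t : `|bump s - bump t| <= `|s - t|.
Proof.
have h := lerB_dist s t; have h' := lerB_dist t s; rewrite (distrC t s) in h'.
have n0 := normr_ge0 (s - t).
by rewrite /bump; do 2 case: (ltP 0) => ?; rewrite ler_norml; apply/andP; split; lra.
Qed.
Let cbump : continuous bump.
Proof.
move=> x; apply/cvgrPdist_le => e e0; exists e => //= t xt.
exact: le_trans (bump_lip _ _) (ltW xt).
Qed.
Let mbump : measurable_fun [set: R] bump. Proof. exact: continuous_measurable_fun. Qed.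
Let bump_supp s : delta < `|s| -> bump s = 0.
Proof. by move=> h; rewrite /bump; apply/max_idPl; lra. Qed.
Let ibump : mu.-integrable [set: R] (EFin \o bump).
Proof.
have := @mint_itv_bounded R (- delta) delta delta bump mbump (fun x _ => ltac:(
  rewrite ger0_norm// /bump ge_max (ltW d0)/=; have := normr_ge0 x; lra)).
apply: eq_integrable => // x _ /=; congr EFin; rewrite indicE.
case: (boolP (x \in `[- delta, delta]%classic)); rewrite ?mul1r// mul0r => xd.
rewrite bump_supp// ltNge; apply: contra xd => xd; rewrite inE/= in_itv/=.
by rewrite -ler_norml.
Qed.
Let c0 : 0 < c.
Proof.
have i1 := @mint_itv_bounded R (- (delta / 2)) (delta / 2) (delta / 2) (fun=> delta / 2) (measurable_cst _)
  (fun x _ => ltac:(have := d0 => d1; rewrite ger0_norm; lra)).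
apply: lt_le_trans (_ : \int[mu]_x (\1_(`[- (delta / 2), delta / 2]%classic : set R) x * (delta / 2)) <= _).
  rewrite -Rint_in Rintegral_cst//.
  have E := @lebesgue_measure_itv R `[- (delta / 2), delta / 2]%R.
  move: E; rewrite /= lte_fin ifT; last by have := d0; lra.
  move=> E; rewrite [X in _ * fine X]E /=.
  by have := d0 => d1; apply: mulr_gt0; lra.
apply: le_Rintegral => // x _; rewrite indicE; case: (boolP (x \in _)) => h; last by rewrite mul0r.
move: h; rewrite inE/= in_itv/= -ler_norml => h.
by rewrite mul1r /bump le_max; apply/orP; right; lra.
Qed.

Definition triangle (s : R) : R := c^-1 * bump s.

Lemma continuous_triangle : continuous triangle.
Proof. by move=> x; apply: cvgMl_tmp; exact: cbump. Qed.
Lemma triangle_ge0 s : 0 <= triangle s.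
Proof. by rewrite mulr_ge0// invr_ge0 ltW. Qed.
Lemma triangleN s : triangle (- s) = triangle s.
Proof. by rewrite /triangle /bump normrN. Qed.
Lemma triangle_supp s : delta < `|s| -> triangle s = 0.
Proof. by move=> h; rewrite /triangle bump_supp// mulr0. Qed.
Lemma triangle_int : \int[mu]_s triangle s = 1.
Proof. by rewrite /triangle RintegralZl// -/c mulVf// gt_eqF. Qed.
Lemma triangle_lip s t : `|triangle s - triangle t| <= c^-1 * `|s - t|.
Proof. by rewrite /triangle -mulrBr normrM gtr0_norm ?invr_gt0// ler_wpM2l// invr_ge0 ltW. Qed.

Let K : R := delta + 1.
Let K0 : 0 < K. Proof. by rewrite /K; have := d0; lra. Qed.
(** Bounds the form on functions of absolute value at most 1 supported in an interval of length
    [2 K], wherever that interval lies. *)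
Let M : R := 2 * K * \int[mu]_x (\1_(`[- (2 * K), 2 * K]%classic : set R) x * `|r x|).
Let M0 : 0 <= M.
Proof.
rewrite mulr_ge0// ?mulr_ge0 ?(ltW K0)//; apply: Rintegral_ge0 => x _.
by rewrite mulr_ge0// indicE ler0n.
Qed.
Let X : R := 2 * (c^-1 * (2 * K)) * Num.sqrt M.
(** Cell counts chosen for [A_fast]: the first factor absorbs the constant [X], the second makes the
    error halve at each stage, as [fast_cauchy] needs. *)
Let N (n : nat) : nat := ((Num.bound X).+1 * 2 ^ n)%N.
Let N0 n : (0 < N n)%N. Proof. by rewrite /N muln_gt0 expn_gt0. Qed.
Let A n : R := c^-1 * (2 * K / (N n)%:R).
Let A0 n : 0 <= A n.
Proof. by rewrite mulr_ge0 ?invr_ge0 ?(ltW c0)// divr_ge0// mulr_ge0// ltW. Qed.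
Let A_fast n : 2 * A n * Num.sqrt M <= 2^-1 ^+ n.
Proof.
have X0 : 0 <= X by rewrite !mulr_ge0 ?sqrtr_ge0 ?invr_ge0 ?(ltW c0) ?(ltW K0).
have hX : X <= (Num.bound X).+1%:R.
  by apply: ltW; apply: lt_le_trans (archi_boundP X0) _; rewrite ler_nat.
have b0 : 0 < (Num.bound X).+1%:R :> R by rewrite ltr0n.
have -> : 2 * A n * Num.sqrt M = X / (Num.bound X).+1%:R * 2^-1 ^+ n.
  rewrite /A /N /X natrM natrX exprVn; field.
  by rewrite !gt_eqF// exprn_gt0.
by rewrite ler_piMl ?exprn_ge0// ler_pdivrMr// mul1r.
Qed.

Let steps x n := kernel_steps K (N n) triangle x.
Let he x n : elementary (steps x n).
Proof. by apply: elementary_kernel_steps; exact: ltW. Qed.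

Let ho x : R -> R := half_open (fun s => triangle (s - x)).

Let step_close x n s : `|ho x s - ef (steps x n) s| <= A n.
Proof.
rewrite /ho (kernel_stepsE _ _ _ _ (ltW K0)) /half_open -mulrBr normrM normr_indic.
apply: le_trans (_ : `|triangle (s - x) - step K (N n) triangle (s - x)| <= _).
  by rewrite ler_piMl// indic_le1.
have E : \1_(`]- K, K]%classic : set R) (s - x) * triangle (s - x) = triangle (s - x).
  rewrite indicE; case: (boolP (s - x \in _)) => h; rewrite ?mul1r// mul0r.
  rewrite triangle_supp//; rewrite ltNge; apply: contra h; rewrite ler_norml => /andP[h1 h2].
  by rewrite inE/= in_itv/= /K; have := d0 => d1; apply/andP; split; lra.
rewrite distrC -[X in `|_ - X|]E; apply: step_le => //; first exact: ltW.
move=> t ht; apply: le_trans (triangle_lip _ _) _.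
by rewrite ler_wpM2l// invr_ge0 ltW.
Qed.

Let ho_supp x s : ~~ (x - K <= s <= x - K + 2 * K) -> ho x s = 0.
Proof.
move=> h; rewrite /ho /half_open triangle_supp ?mulr0// ltNge; apply: contra h; rewrite ler_norml => /andP[h1 h2].
by rewrite /K; have := d0 => d1; apply/andP; split; lra.
Qed.

Let steps_supp x n s : ~~ (x - K <= s <= x - K + 2 * K) -> ef (steps x n) s = 0.
Proof.
move=> h; rewrite (kernel_stepsE _ _ _ _ (ltW K0)) /half_open /step big1 ?mulr0// => i _.
rewrite indicE memNset ?mulr0//= in_itv/= => /andP[h1 h2].
have n0 : - K <= node K (N n) i by rewrite -(node0 K (N n)) node_le// ltW.
have n1 : node K (N n) i.+1 <= K by rewrite -[Y in _ <= Y](nodeN K (N0 n)) node_le// ltW.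
by move/negP: h; apply; apply/andP; split; lra.
Qed.

Let form_small x (u : R -> R) (B : R) : 0 <= B -> measurable_fun [set: R] u -> (forall s, `|u s| <= B) ->
  (forall s, ~~ (x - K <= s <= x - K + 2 * K) -> u s = 0) -> Num.sqrt (form r u u) <= B * Num.sqrt M.
Proof.
move=> B0 mu_ uB us; have [i v] := form_bound lr mu_ mu_ (L := 2 * K) ltac:(by rewrite mulr_ge0// ltW) uB uB us us.
rewrite -[B in B * _](ger0_norm B0) -sqrtr_sqr -sqrtrM ?sqr_ge0// ler_wsqrtr//.
apply: le_trans (ler_norm _) _; apply: le_trans (le_normr_Rintegral measurableT i) _.
by rewrite expr2; exact: v.
Qed.

Let approx_ho x : approximable (ho x).
Proof. exact: (approximable_continuous x (ltW d0) continuous_triangle triangle_supp). Qed.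

Let steps_fast x n : norm2 P (fun w => D (steps x n.+1) w - D (steps x n) w) <= 2^-1 ^+ n.
Proof.
pose e := steps x n.+1 ++ escale (-1) (steps x n).
have hee : elementary e by apply: elementary_cat; exact: he.
have -> : norm2 P (fun w => D (steps x n.+1) w - D (steps x n) w) = Num.sqrt (form r (ef e) (ef e)).
  rewrite -covD// /norm2; congr Num.sqrt; apply: eq_Rintegral => w _.
  by rewrite elementary_derivative_cat mulN1r expr2.
apply: le_trans (A_fast n); apply: (@form_small x); first by rewrite mulr_ge0.
- by have [? []] := nice_elementary e.
- move=> s; rewrite elementary_fun_cat mulN1r.
  have -> : ef (steps x n.+1) s - ef (steps x n) s = (ho x s - ef (steps x n) s) - (ho x s - ef (steps x n.+1) s) by ring.
  apply: le_trans (ler_normB _ _) _.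
  have AA : A n.+1 <= A n.
    rewrite /A ler_wpM2l ?invr_ge0 ?(ltW c0)// ler_wpM2l ?mulr_ge0 ?(ltW K0)//.
    rewrite lef_pV2 ?posrE ?ltr0n// ler_nat /N expnS mulnCA mulnA.
    by rewrite -mulnA leq_pmull.
  have h1 := step_close x n s; have h2 := step_close x n.+1 s; lra.
- by move=> s hs; rewrite elementary_fun_cat !steps_supp// mulr0 addr0.
Qed.

(** An upper limit of finite sums of increments of [G], at a rate independent of [x]. Being an
    explicit formula, it is one version for all [x] at once, which is what joint measurability
    requires. *)
Definition triangle_derivative (x : R) (w : T) : R := limfun (fun n w => D (steps x n) w) w.

Lemma triangle_derivative_lim x : sqint P (triangle_derivative x) /\
  forall n, norm2 P (fun w => D (steps x n) w - triangle_derivative x w) <= 2 * 2^-1 ^+ n.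
Proof. by apply: fast_cauchy; [move=> n; exact: sqintD (@he x n)|exact: steps_fast]. Qed.

Let pow_cvg (B : R) : B * 2^-1 ^+ n @[n --> \oo] --> 0.
Proof.
rewrite -(mulr0 B); apply: cvgMl_tmp; apply: cvg_expr.
by rewrite ger0_norm// invf_lt1// ltr1n.
Qed.

Lemma triangle_gen_derivative x : 0 <= x ->
  is_gen_derivative P G S (fun s => triangle (s - x)) (triangle_derivative x).
Proof.
move=> x0; have [sV hV] := triangle_derivative_lim x.
have mt : measurable_fun [set: R] triangle by apply: continuous_measurable_fun; exact: continuous_triangle.
split.
- split.
    apply: measurable_funTS; apply: (measurableT_comp mt).
    by apply: measurable_funB; [exact: measurable_id|exact: measurable_cst].
  exists (Num.max (c^-1 * delta) (x + delta)) => s s0; split.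
    rewrite ger0_norm ?triangle_ge0// le_max; apply/orP; left.
    rewrite /triangle ler_wpM2l ?invr_ge0 ?(ltW c0)// /bump ge_max (ltW d0)/=.
    by have := normr_ge0 (s - x); lra.
  rewrite gt_max => /andP[_ h]; apply: triangle_supp.
  by have := ler_norm (s - x); lra.
- exact/Lfun2P.
- exists (steps x); split; first exact: he.
  + have hb n : Num.sqrt (rho_form S (fun s => triangle (s - x) - ef (steps x n) s)) <= 2^-1 ^+ n.
      have au : approximable (fun s => ho x s + (-1) * ef (steps x n) s).
        by apply: approximableD => //; apply: approximable_elementary; exact: he.
      have [B nB] := approximable_nice au.
      have E := @half_open_elementary R (steps x n) (fun s => triangle (s - x)) (@he x n).
      rewrite (@rho_formE R S lr _ B) E//.
      apply: le_trans (_ : A n * Num.sqrt M <= _).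
        apply: (@form_small x) => //; first by case: nB.
        - by move=> s; rewrite mulN1r; exact: step_close.
        - by move=> s hs; rewrite -/(ho x s) (ho_supp hs) (steps_supp _ hs) mulr0 addr0.
      apply: le_trans (A_fast n); rewrite ler_wpM2r ?sqrtr_ge0//.
      by have := A0 n; lra.
    apply: (@squeeze_cvgr _ _ _ _ (fun=> 0) (fun n => 1 * 2^-1 ^+ n)).
    * by apply: nearW => n; rewrite mul1r sqrtr_ge0 hb.
    * exact: cvg_cst.
    * exact: pow_cvg.
  + apply: cvg_L2_norm2 => //; first by move=> n; exact: sqintD (@he x n).
    apply: (@squeeze_cvgr _ _ _ _ (fun=> 0) (fun n => 2 * 2^-1 ^+ n)).
    * by apply: nearW => n; rewrite hV sqrtr_ge0.
    * exact: cvg_cst.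
    * exact: pow_cvg.
Qed.

Lemma measurable_triangle_derivative :
  measurable_fun [set: R * T] (fun z : R * T => triangle_derivative z.1 z.2).
Proof.
apply: (measurable_limfun (X := fun n (z : R * T) => D (steps z.1 n) z.2)) => n.
have -> : (fun z : R * T => D (steps z.1 n) z.2) = (fun z => \sum_(i <- iota 0 (N n))
    triangle (node K (N n) i) * (G (Num.max 0 (z.1 + node K (N n) i.+1)) z.2 - G (Num.max 0 (z.1 + node K (N n) i)) z.2)).
  by apply/funext => z; rewrite /elementary_derivative big_map.
apply: measurable_sum => i; apply: measurable_funM; first exact: measurable_cst.
by apply: measurable_funB; exact: measurable_paths_at.
Qed.
End triangular_kernel.

(** Makes the condition in [is_wick_chaos] effective: a variable satisfying it is then a limit of
    actual integrals, hence almost surely unique. *)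
Lemma smoothed_derivative_exists : exists (g : R -> R -> R) (V : R -> R -> T -> R),
  approximate_identity g /\ is_smoothed_derivative P G S g V.
Proof.
exists triangle, triangle_derivative; split.
  move=> delta /andP[d0 _]; split.
  - exact: continuous_triangle.
  - by move=> s; exact: triangle_ge0.
  - by move=> s; exact: triangleN.
  - by move=> s; exact: triangle_supp.
  - exact: triangle_int.
move=> delta /andP[d0 _]; split.
  by apply: measurable_funTS; exact: measurable_triangle_derivative.
by move=> x x0; exact: triangle_gen_derivative.
Qed.
End smoothings.

(** * The Wick power chaos *)

Section wick_chaos_limit.
Context {R : realType} d {T : measurableType d}.
Local Notation mu := (@lebesgue_measure R).
Variables (P : probability T R) (G : R -> T -> R) (S : R -> R).
Let r := rho S.
Hypothesis hG : centered_gaussian_process P G.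
Hypothesis cG : continuous_paths G.
Hypothesis lr : locint r.
Hypothesis rev : forall x, r (- x) = r x.
Hypothesis cov : forall g g' Y Y', approximable (half_open g) -> approximable (half_open g') ->
  is_gen_derivative P G S g Y -> is_gen_derivative P G S g' Y' ->
  gauss2 P Y Y' /\ \int[P]_w (Y w * Y' w) = form r (half_open g) (half_open g').
Variables (a b : R) (k : nat).
Hypotheses (a0 : 0 <= a) (ab : a <= b).
Hypothesis lrk : locint (fun x => r x ^+ k.+1).

Local Notation WI := (wick_integral P a b k).
Local Notation smooth := (smoothing P G S).
Local Notation J := (fun h => WI (increment_quotient G h)).

Let sqintW (delta : R) p U : smooth delta p U -> sqint P (WI U) := @sqint_wick_integral R d T P G S lr cov a b k a0 ab delta p U.

Lemma smoothing_le delta delta' p U : delta <= delta' -> smooth delta p U -> smooth delta' p U.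
Proof.
move=> dd [mU dU aU [mp pA p0 ps p1]]; split=> //; split=> // x h.
exact: ps (le_lt_trans dd h).
Qed.

Let close (eps : R) : 0 < eps -> exists2 d0 : R, 0 < d0 &
  forall delta delta' p p' U U', 0 <= delta <= d0 -> 0 <= delta' <= d0 ->
    smooth delta p U -> smooth delta' p' U' -> norm2 P (fun w => WI U w - WI U' w) <= eps.
Proof.
move=> eps0; have [d0 d00 h] := wick_integral_close lr rev cov a0 ab lrk eps0.
exists d0 => // delta delta' p p' U U' /andP[de0 de1] /andP[de0' de1'] sU sU'.
apply: (h (Num.max delta delta') p p').
- by rewrite le_max de0.
- by rewrite ge_max de1.
- by apply: smoothing_le sU; rewrite le_max lexx.
- by apply: smoothing_le sU'; rewrite le_max lexx orbT.
Qed.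

Let half_pow (n : nat) : 0 < 2^-1 ^+ n :> R. Proof. by rewrite exprn_gt0. Qed.

(** A sequence of increment quotients at rapidly decreasing scales is fast Cauchy. Its limit
    attracts all smoothings, since any two of them at small scale are close. *)
Lemma wick_integral_limit : exists2 Z, sqint P Z & forall eps : R, 0 < eps -> exists2 d0 : R, 0 < d0 &
  forall delta p U, 0 <= delta <= d0 -> smooth delta p U -> norm2 P (fun w => WI U w - Z w) <= eps.
Proof.
have ex n : exists d0 : R, 0 < d0 /\
  forall delta delta' p p' U U', 0 <= delta <= d0 -> 0 <= delta' <= d0 ->
    smooth delta p U -> smooth delta' p' U' -> norm2 P (fun w => WI U w - WI U' w) <= 2^-1 ^+ n.
  by have [d0 d00 h] := close (half_pow n); exists d0.
have [d0 d0P] := choice ex.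
(* Below [d0 n] and below [d0 (n-1)]: then [h n] and [h (n+1)] both lie under the threshold [d0 n],
   and the difference is at most [2^-n]. *)
pose h n : R := Num.min n.+1%:R^-1 (Num.min (d0 n) (d0 n.-1)).
have h0 n : 0 < h n by rewrite !lt_min invr_gt0 ltr0n (d0P n).1 (d0P n.-1).1.
have hd n : 0 <= h n <= d0 n by rewrite (ltW (h0 n)) /h !ge_min lexx orbT.
have hd' n : 0 <= h n.+1 <= d0 n by rewrite (ltW (h0 _)) /h !ge_min /= lexx !orbT.
have sm n := smoothing_increment S hG cG (h0 n).
have sX n : sqint P (J (h n)) by exact: sqintW (sm n).
have fast n : norm2 P (fun w => J (h n.+1) w - J (h n) w) <= 2^-1 ^+ n.
  exact: ((d0P n).2 _ _ _ _ _ _ (hd' n) (hd n) (sm n.+1) (sm n)).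
have [sZ hZ] := fast_cauchy sX fast.
exists (limfun (fun n => J (h n))) => // eps eps0.
have e2 : 0 < eps / 2 by rewrite divr_gt0.
have [d1 d10 hd1] := close e2; exists d1 => // delta p U hdelta sU.
have c1 : 2 * 2^-1 ^+ n @[n --> \oo] --> (0 : R).
  rewrite -(mulr0 2); apply: cvgMl_tmp; apply: cvg_expr.
  by rewrite ger0_norm// invf_lt1// ltr1n.
have c2 : n.+1%:R^-1 @[n --> \oo] --> (0 : R) by exact: cvg_harmonic.
have [n [n1 n2]] : exists n, 2 * 2^-1 ^+ n <= eps / 2 /\ h n <= d1.
  have [n _ hn] : \forall n \near \oo, 2 * 2^-1 ^+ n < eps / 2 /\ n.+1%:R^-1 < d1.
    near=> n; split; near: n.
    - exact: (cvgr_lt (0 : R) c1 _ e2).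
    - exact: (cvgr_lt (0 : R) c2 _ d10).
  have [/ltW n1 n2] := hn n (leqnn n); exists n; split=> //.
  by rewrite /h ge_min (ltW n2).
apply: le_trans (norm2B (sqintW sU) (sX n) sZ) _.
have g1 := hd1 _ _ _ _ _ _ hdelta (_ : 0 <= h n <= d1) sU (sm n).
have {}g1 := g1 ltac:(by rewrite (ltW (h0 n)) n2).
have g2 := hZ n; lra.
Unshelve. all: by end_near.
Qed.

Let limit_chaos Z : sqint P Z -> (forall eps : R, 0 < eps -> exists2 d0 : R, 0 < d0 &
    forall delta p U, 0 <= delta <= d0 -> smooth delta p U -> norm2 P (fun w => WI U w - Z w) <= eps) ->
  is_wick_chaos P G S k.+1 \1_(`[a, b]%classic : set R) Z.
Proof.
move=> sZ hZ; split; first exact/Lfun2P.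
move=> g V hg hV.
have sm delta : 0 < delta <= 1 -> smooth delta (g delta) (V delta) by exact: smoothing_identity.
have near1 (e : R) : 0 < e -> \forall delta \near (0 : R)^'+, 0 < delta /\ delta < e.
  by move=> e0; near=> x; split; near: x; [exact: nbhs_right_gt|exact: nbhs_right_lt].
apply/(cvg_L2P (X := fun delta => WI (V delta))).
  have := near1 1 ltr01; apply: filterS => delta [de0 /ltW de1].
  by apply: sqintB => //; apply: sqintW (sm delta _); rewrite de0.
apply/cvgrPdist_le => eps eps0; have [d0 d00 hd] := hZ eps eps0.
have := near1 (Num.min 1 d0); rewrite lt_min ltr01 d00 => /(_ isT).
apply: filterS => delta [de0]; rewrite lt_min => /andP[/ltW de1 /ltW de2].
rewrite sub0r normrN ger0_norm ?sqrtr_ge0//; apply: (hd delta (g delta)).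
  by rewrite (ltW de0).
by apply: sm; rewrite de0.
Unshelve. all: by end_near.
Qed.

Hypothesis smoothed_ex : exists (g : R -> R -> R) (V : R -> R -> T -> R),
  approximate_identity g /\ is_smoothed_derivative P G S g V.

Lemma wick_chaos_limit : sqint P (wick_chaos P G S k.+1 \1_(`[a, b]%classic : set R)) /\
  forall eps : R, 0 < eps -> exists2 d0 : R, 0 < d0 & forall h, 0 < h <= d0 ->
    norm2 P (fun w => J h w - wick_chaos P G S k.+1 \1_(`[a, b]%classic : set R) w) <= eps.
Proof.
have [Z sZ hZ] := wick_integral_limit.
have chZ := limit_chaos sZ hZ.
set Y := wick_chaos _ _ _ _ _.
have chY : is_wick_chaos P G S k.+1 \1_(`[a, b]%classic : set R) Y.
  by rewrite /Y /wick_chaos; apply: (xgetPex (cst 0) (ex_intro _ Z chZ)).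
have sY : sqint P Y by case: chY => /Lfun2P.
split=> //.
have [g [V [hg hV]]] := smoothed_ex.
(* [Y] is whatever [xget] selected. It and [Z] are both limits along the same constructed smoothing,
   so they are at distance 0. *)
have ZY : norm2 P (fun w => Z w - Y w) = 0.
  have sm delta : 0 < delta <= 1 -> smooth delta (g delta) (V delta) by exact: smoothing_identity.
  have near1 (e : R) : 0 < e -> \forall delta \near (0 : R)^'+, 0 < delta /\ delta < e.
    by move=> e0; near=> x; split; near: x; [exact: nbhs_right_gt|exact: nbhs_right_lt].
  have lim A : sqint P A -> is_wick_chaos P G S k.+1 \1_(`[a, b]%classic : set R) A ->
      norm2 P (fun w => WI (V delta) w - A w) @[delta --> (0 : R)^'+] --> 0.
    move=> sA [_ /(_ g V hg hV)] /(cvg_L2P (X := fun delta => WI (V delta))); apply.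
    have := near1 1 ltr01; apply: filterS => delta [de0 /ltW de1].
    by apply: sqintB => //; apply: sqintW (sm delta _); rewrite de0.
  have l1 := lim _ sZ chZ; have l2 := lim _ sY chY.
  apply/eqP; rewrite eq_le sqrtr_ge0 andbT.
  have l3 : norm2 P (fun w => WI (V delta) w - Z w) + norm2 P (fun w => WI (V delta) w - Y w)
      @[delta --> (0 : R)^'+] --> (0 + 0 : R) by exact: cvgD.
  rewrite addr0 in l3.
  apply: (ler_cvg_to (cvg_cst (norm2 P (fun w => Z w - Y w))) l3).
  have := near1 1 ltr01; apply: filterS => delta [de0 /ltW de1].
  have sV : sqint P (WI (V delta)) by apply: sqintW (sm delta _); rewrite de0.
  by rewrite [X in _ <= X + _]norm2BC; exact: norm2B.
move=> eps eps0; have [d0 d00 hd] := hZ eps eps0; exists d0 => // h /andP[h0 hd0].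
have sm := smoothing_increment S hG cG h0.
apply: le_trans (norm2B (sqintW sm) sZ sY) _; rewrite ZY addr0.
by apply: (hd h (increment_kernel h)) => //; rewrite (ltW h0).
Unshelve. all: by end_near.
Qed.
End wick_chaos_limit.

(** * The remainder of the Hermite expansion *)

Section normalized_increments.
Context {R : realType} d {T : measurableType d}.
Local Notation mu := (@lebesgue_measure R).
Local Notation mu2 := ((@lebesgue_measure R \x @lebesgue_measure R)%E).
Local Notation nu := (normal_prob (0 : R) 1).
Variables (P : probability T R) (G : R -> T -> R) (S : R -> R).
Let r := rho S.
Hypothesis hG : centered_gaussian_process P G.
Hypothesis cG : continuous_paths G.
Hypothesis hvar : increments_variance P G S.
Hypothesis lr : locint r.
Hypothesis rev : forall x, r (- x) = r x.
Hypothesis cov : forall g g' Y Y', approximable (half_open g) -> approximable (half_open g') ->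
  is_gen_derivative P G S g Y -> is_gen_derivative P G S g' Y' ->
  gauss2 P Y Y' /\ \int[P]_w (Y w * Y' w) = form r (half_open g) (half_open g').
Variables (a b : R) (k : nat).
Hypotheses (a0 : 0 <= a) (ab : a <= b).
Hypothesis lrk : locint (fun x => r x ^+ k.+1).
Let I (x : R) : R := \1_(`[a, b]%classic : set R) x.
Let W (z : R * R) : R := I z.1 * I z.2.
Let m := itv_measure a b.
Let Ut h (x : R) (w : T) : R := I x * increment_quotient G h (Num.max 0 x) w.
Let kc h (z : R * R) := kernel_cov r (increment_kernel h) (increment_kernel h) z.1 z.2.

Let I01 x : I x = 0 \/ I x = 1.
Proof. by rewrite /I indicE; case: (_ \in _); [right|left]. Qed.
Let Iab x : I x = 1 -> a <= x <= b.
Proof.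
rewrite /I indicE; case: (boolP (x \in _)) => [|_ /eqP]; last by rewrite eq_sym oner_eq0.
by rewrite inE/= in_itv/=.
Qed.
Let mI : measurable_fun [set: R] I. Proof. exact: measurable_indic. Qed.

Definition increment_scale (h : R) : R := h / Num.sqrt (S h).

Local Notation sc := increment_scale.

(* The truncation in [x] makes the integrand jointly measurable on the whole line. *)
Definition normalized_field (h : R) (phi : R -> R) (z : R * T) : R :=
  \1_(`[a, b]%classic : set R) z.1 *
  phi (sc h * (\1_(`[a, b]%classic : set R) z.1 * increment_quotient G h (Num.max 0 z.1) z.2)).

Lemma normalized_fieldE h phi x w : 0 < h ->
  normalized_field h phi (x, w) = \1_(`[a, b]%classic : set R) x * phi ((G (x + h) w - G x w) / Num.sqrt (S h)).
Proof.
move=> h0; rewrite /normalized_field /= -/(I x); case: (I01 x) => Ix; first by rewrite Ix !mul0r.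
have /andP[ax _] := Iab Ix.
rewrite Ix !mul1r; congr phi; rewrite /increment_quotient (_ : Num.max 0 x = x); last exact/max_idPr/(le_trans a0).
by rewrite /sc mulrC mulf_div [X in _ / X]mulrC -mulf_div divff ?gt_eqF// mulr1.
Qed.

Section fixed_increment.
Variable h : R.
Hypotheses (h0 : 0 < h) (Sh0 : 0 < S h).
Let c := sc h.
Let sm : smoothing P G S h (increment_kernel h) (increment_quotient G h) := smoothing_increment S hG cG h0.

Let X (x : R) (w : T) : R := c * Ut h x w.

Let mX : measurable_fun [set: R * T] (fun z => X z.1 z.2).
Proof. by apply: measurable_funM; [exact: measurable_cst|exact: measurable_truncated sm]. Qed.

Lemma increment_scale_sqr : c ^+ 2 = h ^+ 2 / S h.
Proof. by rewrite /c /sc expr_div_n sqr_sqrtr// ltW. Qed.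

Let XE x : I x = 1 -> X x = (fun w => (Num.sqrt (S h))^-1 * (G (x + h) w - G x w)).
Proof.
move=> Ix; have /andP[ax _] := Iab Ix.
apply/funext => w; rewrite /X /Ut Ix mul1r /increment_quotient (_ : Num.max 0 x = x); last exact/max_idPr/(le_trans a0).
by rewrite /c /sc mulrC mulf_div [X in _ / X]mulrC -mulf_div divff ?gt_eqF// mulr1 mulrC.
Qed.

Let gX x y : gauss2 P (X x) (X y).
Proof.
have [g2 _] := truncated_cov cov b a0 x y sm sm.
by move=> u v; have := g2 (u * c) (v * c); congr gauss; apply/funext => w; rewrite /X /Ut /I; ring.
Qed.

Let covX x y : \int[P]_w (X x w * X y w) = c ^+ 2 * (W (x, y) * kc h (x, y)).
Proof.
have [g2 v] := truncated_cov cov b a0 x y sm sm.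
rewrite /W /I /kc /= -v -RintegralZl//.
  by apply: eq_Rintegral => w _; rewrite /X /Ut /I; ring.
by apply: sqintM; [exact: gauss_sqint (gauss2l g2)|exact: gauss_sqint (gauss2r g2)].
Qed.

Let X1 x : I x = 1 -> \int[P]_w (X x w ^+ 2) = 1.
Proof.
move=> Ix; have /andP[ax _] := Iab Ix; have x0 : 0 <= x := le_trans a0 ax.
have s0 : 0 < Num.sqrt (S h) by rewrite sqrtr_gt0.
have sX : sqint P (X x) := gauss_sqint (gauss2l (gX x x)).
have [v _] := @hvar (x + h) x ltac:(by rewrite addr_ge0// ltW) x0.
have v' : \int[P]_w ((G (x + h) w - G x w) ^+ 2) = S h.
  by move: v; rewrite unlock /Rintegral => ->; rewrite /= addrAC subrr add0r.
rewrite (_ : \int[P]_w (_ ^+ 2) = \int[P]_w ((G (x + h) w - G x w) ^+ 2) / S h); first by rewrite v' divff// gt_eqF.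
have -> : \int[P]_w ((G (x + h) w - G x w) ^+ 2) = \int[P]_w (S h * X x w ^+ 2).
  by apply: eq_Rintegral => w _; rewrite (XE Ix) exprMn exprVn sqr_sqrtr ?(ltW Sh0)// mulVKf// gt_eqF.
by rewrite RintegralZl//; [rewrite mulrC mulKf// gt_eqF|exact: sX.2].
Qed.

Let lX x : I x = 1 -> forall A : set R, measurable A -> P (X x @^-1` A) = nu A.
Proof.
move=> Ix; have /andP[ax _] := Iab Ix; have x0 : 0 <= x := le_trans a0 ax.
pose t (i : 'I_2) : R := if i == 0 then x + h else x.
pose e (i : 'I_2) : R := if i == 0 then (Num.sqrt (S h))^-1 else - (Num.sqrt (S h))^-1.
have t0 i : 0 <= t i by rewrite /t; case: ifP => _ //; rewrite addr_ge0// ltW.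
have cg : centered_gaussian P (X x).
  have := hG e t0; congr centered_gaussian; apply/funext => w.
  by rewrite (XE Ix) !big_ord_recl big_ord0 /e /t /=; ring.
exact: (centered_gaussian_gauss cg).2 (X1 Ix).
Qed.

(** Where [W] is 1 this is the correlation of two increments of unit variance. *)
Lemma kernel_cov_increment_le1 z : `|c ^+ 2 * (W z * kc h z)| <= 1.
Proof.
case: z => x y; have [Ix|Ix] := I01 x; first by rewrite /W /= Ix !mul0r mulr0 normr0.
have [Iy|Iy] := I01 y; first by rewrite /W /= Iy mulr0 mul0r mulr0 normr0.
by rewrite -covX; apply: (correlation_le1 (gX x y)); exact: X1.
Qed.

Section level.
Variable phi : R -> R.
Hypothesis sphi : sqint nu phi.
Let D := normalized_field h phi.
Let N := \int[nu]_x (phi x ^+ 2).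

Lemma measurable_normalized_field : measurable_fun [set: R * T] D.
Proof.
apply: measurable_funM; first exact: (measurableT_comp mI measurable_fst).
exact: (measurableT_comp sphi.1 mX).
Qed.

Let mD : measurable_fun [set: measurableTypeR R * T] D.
Proof. exact: measurable_normalized_field. Qed.

Let D0 x w : I x = 0 -> D (x, w) = 0.
Proof. by rewrite /D /normalized_field /= -/(I x) => ->; rewrite mul0r. Qed.
Let D1 x w : I x = 1 -> D (x, w) = phi (X x w).
Proof. by move=> Ix; rewrite /D /normalized_field /= -/(I x) {1}Ix mul1r. Qed.

Let mXx x : measurable_fun [set: T] (X x). Proof. by have [] := gauss2l (gX x x). Qed.

Let sD x : sqint P (fun w => D (x, w)).
Proof.
have [Ix|Ix] := I01 x.
  by rewrite (_ : (fun w => D (x, w)) = cst 0); [exact: sqint_cst|apply/funext => w; rewrite D0].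
rewrite (_ : (fun w => D (x, w)) = phi \o X x); last by apply/funext => w; rewrite D1.
by apply/(law_sqint (mXx x) (lX Ix)); [exact: sphi.1|].
Qed.

Let DN x : \int[P]_w (D (x, w) ^+ 2) <= N.
Proof.
have [Ix|Ix] := I01 x.
  under eq_Rintegral do rewrite D0// expr0n.
  by rewrite /Rintegral integral0_eq//; exact: Rint_sqr_ge0.
under eq_Rintegral do rewrite D1//.
rewrite (law_Rint (mXx x) (lX Ix) (f := fun u => phi u ^+ 2))//.
by apply: measurable_funX; exact: sphi.1.
Qed.

Lemma normalized_field_integrable :
  sqint P (rint m D) /\ {ae P, forall w, m.-integrable [set: measurableTypeR R] (EFin \o (fun x => D (x, w)))}.
Proof.
have iD := @integrable_sqr_prod R _ _ (measurableTypeR R) T m P D N mD sD DN.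
split; first exact: (@sqint_rint R _ _ (measurableTypeR R) T m P D mD iD).1.
have := @integrable_rint_weight R _ _ (measurableTypeR R) T m P D mD iD (cst 1) (sqint_cst _ _).
move=> /(@ae_integrable2 _ _ (measurableTypeR R) T R m P); apply: filterS => w.
by apply: eq_integrable => // x _ /=; rewrite mul1r.
Qed.

Variable K : nat.
Hypothesis phiK : forall j, (j < K)%N -> \int[nu]_x (phi x * (he 1 j).[x]) = 0.

Let B z := W z * `|c ^+ 2 * kc h z| ^+ K.

(** [pair_bound] is applied at each pair of times, with the covariance of the normalized increments
    written through [kernel_cov]. *)
Lemma normalized_field_le : mu2.-integrable [set: R * R] (EFin \o B) /\
  \int[P]_w (rint m D w ^+ 2) <= N * \int[mu2]_z B z.
Proof.
have [_ ->] := @Rint_rint2 R _ _ (measurableTypeR R) T m P D N mD sD DN.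
pose F (z : R * R) := \int[P]_w (D (z.1, w) * D (z.2, w)).
have mF : measurable_fun [set: R * R] F.
  apply: (@measurable_Rint_section _ _ _ _ _ P (fun z : (R * R) * T => D (z.1.1, z.2) * D (z.1.2, z.2))).
  have mD' : measurable_fun [set: R * T] (fun z => D (z.1, z.2)).
    exact: measurable_normalized_field.
  apply: measurable_funM.
    exact: (measurable_comp2 (F := fun x w => D (x, w)) mD' (measurableT_comp measurable_fst measurable_fst) measurable_snd).
  exact: (measurable_comp2 (F := fun x w => D (x, w)) mD' (measurableT_comp measurable_snd measurable_fst) measurable_snd).
have WF z : W z * F z = F z.
  case: z => x y; rewrite /W /F /=; have [Ix|Ix] := I01 x.
    by rewrite Ix !mul0r /Rintegral integral0_eq// => w _; rewrite D0// mul0r.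
  have [Iy|Iy] := I01 y; last by rewrite Ix Iy !mul1r.
  by rewrite Iy mulr0 mul0r /Rintegral integral0_eq// => w _; rewrite (D0 _ Iy) mulr0.
have WW z : W z = 0 \/ W z = 1 /\ (I z.1 = 1 /\ I z.2 = 1).
  by rewrite /W; case: (I01 z.1) => ->; case: (I01 z.2) => ->; rewrite ?mulr0 ?mul0r ?mulr1; [left|left|left|right].
(* [kc] by itself is not known to be measurable, so [W] is inserted inside the power. *)
have mB : measurable_fun [set: R * R] B.
  rewrite (_ : B = fun z => W z * `|c ^+ 2 * (W z * kc h z)| ^+ K); last first.
    by apply/funext => z; rewrite /B; case: (WW z) => [|[]] ->; rewrite ?mul0r// !mul1r.
  have mW : measurable_fun [set: R * R] W.
    by apply: measurable_funM; [exact: (measurableT_comp mI measurable_fst)|exact: (measurableT_comp mI measurable_snd)].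
  apply: measurable_funM => //; apply: measurable_funX; apply: measurableT_comp => //.
  apply: measurable_funM; first exact: measurable_cst.
  exact: (measurable_truncated_cov cov b a0 sm sm).
have B0 z : 0 <= B z.
  by rewrite /B; case: (WW z) => [|[]] ->; rewrite ?mul0r// mul1r exprn_ge0.
have iW : mu2.-integrable [set: R * R] (EFin \o W).
  have l1 : locint (fun _ : R => 1 : R).
    split; first exact: measurable_cst.
    move=> M; apply/mint_in => //.
    by apply: (@mint_itv_bounded R (- M) M 1 (cst 1) (measurable_cst _)) => x _; rewrite normr1.
  have n1 : nice (Num.max 1 b) I.
    split=> //; first by move=> x; rewrite /I normr_indic le_max indic_le1.
    move=> x; rewrite gt_max => /andP[_ bx]; case: (I01 x) => // /Iab/andP[ax xb].
    by move: bx; rewrite ger0_norm ?(le_trans a0 ax)//; lra.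
  by have := form_mint l1 n1 n1; apply: eq_integrable => // z _ /=; rewrite mul1r.
have iB : mu2.-integrable [set: R * R] (EFin \o B).
  apply: (@le_integrableT R _ _ mu2 _ _ mB _ iW) => z.
  rewrite ger0_norm ?B0//; have h1 := kernel_cov_increment_le1 z; move: h1; rewrite /B.
  case: (WW z) => [|[]] ->; rewrite ?mul0r// !mul1r normr1 => _ h1.
  by rewrite exprn_ile1.
split=> //.
have FB z : `|F z| <= N * B z.
  rewrite -WF /B; case: z => x y; case: (WW (x, y)) => [->|[-> [Ix Iy]]]; first by rewrite !mul0r mulr0 normr0.
  rewrite !mul1r mulrC /F /=.
  have -> : \int[P]_w (D (x, w) * D (y, w)) = \int[P]_w (phi (X x w) * phi (X y w)).
    by apply: eq_Rintegral => w _; rewrite !D1.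
  have := pair_bound (gX x y) (X1 Ix) (X1 Iy) (lX Ix) (lX Iy) sphi phiK.
  by rewrite covX /W /= Ix Iy !mul1r.
have iF : mu2.-integrable [set: R * R] (EFin \o F).
  apply: (@le_integrableT R _ _ mu2 _ _ mF _ (mintZ N iB)) => z.
  exact: le_trans (FB z) (ler_norm _).
have iWF : mu2.-integrable [set: R * R] (EFin \o (fun z => W z * F z)) by rewrite (_ : (fun z => _) = F)//; exact/funext.
have -> : \int[m]_x \int[m]_y \int[P]_w (D (x, w) * D (y, w)) = \int[mu2]_z F z.
  rewrite (_ : Rintegral mu2 _ _ = \int[mu2]_z (W z * F z)); last by apply: eq_Rintegral => z _; rewrite WF.
  rewrite -(@Rint_itv_measure2 R a b F mF iWF).
  by apply: eq_Rintegral => x _; apply: eq_Rintegral => y _; have := WF (x, y).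
rewrite -RintegralZl//; apply: le_trans (ler_norm _) _.
apply: le_trans (le_normr_Rintegral measurableT iF) _.
exact: (le_Rintegral measurableT (integrable_norm iF) (mintZ N iB) (fun z _ => FB z)).
Qed.
End level.

(** Scaling by [c] gives the quotient unit variance, so [he_scale] converts [he 1] of the normalized
    increment into [c^(k+1)] times the Wick power. Integrability in [x] is assumed at this [w], to
    pull the constant out. *)
Lemma wick_integral_normalized w :
  m.-integrable [set: measurableTypeR R] (EFin \o (fun x => normalized_field h (horner (he 1 k.+1)) (x, w))) ->
  rint m (normalized_field h (horner (he 1 k.+1))) w = c ^+ k.+1 * wick_integral P a b k (increment_quotient G h) w.
Proof.
have s1 : sqint nu (horner (he 1 k.+1)) := sqint_horner normal_expint (he 1 k.+1).
pose D := normalized_field h (horner (he 1 k.+1)); rewrite -/D => iD.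
have c0 : 0 < c by rewrite divr_gt0// sqrtr_gt0.
have cN : c ^+ k.+1 != 0 by rewrite expf_neq0// gt_eqF.
suff -> : wick_integral P a b k (increment_quotient G h) w = \int[m]_x (c ^- k.+1 * D (x, w)).
  by rewrite RintegralZl// mulrA mulfV// mul1r.
have mD : measurable_fun [set: R] (fun x => c ^- k.+1 * D (x, w)).
  apply: measurable_funM; first exact: measurable_cst.
  exact: (measurableT_comp (measurable_normalized_field s1) (@measurable_pair2 _ _ _ _ w)).
rewrite (@Rint_itv_measure R a b _ mD) /wick_integral Rint_in; apply: eq_Rintegral => x _.
rewrite -/(I x); have [Ix|Ix] := I01 x; first by rewrite Ix !mulr0.
have /andP[ax xb] := Iab Ix; have x0 := le_trans a0 ax.
rewrite indicE mem_set/=; last by rewrite in_itv/= x0.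
rewrite mul1r; congr (_ * _).
have U1 : Ut h x = increment_quotient G h x.
  by apply/funext => w'; rewrite /Ut Ix mul1r; have -> : Num.max 0 x = x by exact/max_idPr.
have [g2 _] := truncated_cov cov b a0 x x sm sm; have gx : gauss P (Ut h x) := gauss2l g2.
have cv : c ^+ 2 * \int[P]_w (Ut h x w ^+ 2) = 1.
  rewrite -(X1 Ix) -RintegralZl//; last exact: (gauss_sqint gx).2.
  by apply: eq_Rintegral => w' _; exact/esym/(exprMn 2 c (Ut h x w')).
rewrite -U1 (wick_power_he _ _ gx) /D /normalized_field /= -/(I x) {1}Ix mul1r.
have heE : he 1 k.+1 = he (c ^+ 2 * \int[P]_w (Ut h x w ^+ 2)) k.+1 by rewrite cv.
by rewrite heE he_scale mulrA mulVf// mul1r.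
Qed.
End fixed_increment.

(** [e |r|^(k+2)] would be the natural limit quantity but need not be integrable. Capping the last
    factor at 1 keeps it below [|r|^(k+1)], while it still tends to 0 with [e]. *)
Let rho_pow_weight (e : R) (z : R * R) : R :=
  W z * (`|r (z.2 - z.1)| ^+ k.+1 * Num.min 1 (2 * e * `|r (z.2 - z.1)|)).

Let WW z : W z = 0 \/ W z = 1.
Proof.
by rewrite /W; case: (I01 z.1) => ->; case: (I01 z.2) => ->; rewrite ?mulr0 ?mul0r ?mulr1; [left|left|left|right].
Qed.
Let W0 z : 0 <= W z. Proof. by case: (WW z) => ->. Qed.

Let irho := integrable_truncated_rho a0 ab lrk.

Let min01 (e x : R) : 0 <= e -> 0 <= x -> 0 <= Num.min 1 (2 * e * x) <= 1.
Proof. by move=> e0 x0; rewrite le_min ler01 ge_min lexx !mulr_ge0. Qed.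

Let weight_le e z : 0 <= e -> 0 <= rho_pow_weight e z <= `|W z * r (z.2 - z.1) ^+ k.+1|.
Proof.
move=> e0; have /andP[m0 m1] := min01 e0 (normr_ge0 (r (z.2 - z.1))).
have -> : `|W z * r (z.2 - z.1) ^+ k.+1| = W z * `|r (z.2 - z.1)| ^+ k.+1.
  by rewrite normrM (ger0_norm (W0 z)) normrX.
by rewrite /rho_pow_weight !mulr_ge0// ?exprn_ge0//= ler_wpM2l// ler_piMr// exprn_ge0.
Qed.

Let measurable_weight e : measurable_fun [set: R * R] (rho_pow_weight e).
Proof.
have mr : measurable_fun [set: R * R] (fun z : R * R => `|r (z.2 - z.1)|).
  apply: measurableT_comp => //; apply: (measurableT_comp lr.1).
  by apply: measurable_funB; [exact: measurable_snd|exact: measurable_fst].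
apply: measurable_funM.
  by apply: measurable_funM; [exact: (measurableT_comp mI measurable_fst)|exact: (measurableT_comp mI measurable_snd)].
apply: measurable_funM; first exact: measurable_funX.
apply: measurable_minr; first exact: measurable_cst.
by apply: measurable_funM => //; exact: measurable_cst.
Qed.

Let integrable_weight e : 0 <= e -> mu2.-integrable [set: R * R] (EFin \o rho_pow_weight e).
Proof.
move=> e0; apply: (@le_integrableT R _ _ mu2 _ _ (measurable_weight e) _ irho) => z.
by have /andP[w0 w1] := weight_le z e0; rewrite ger0_norm.
Qed.

Let weight_small (eps : R) : 0 < eps -> exists2 e0 : R, 0 < e0 & forall e, 0 <= e <= e0 ->
  \int[mu2]_z rho_pow_weight e z <= eps.
Proof.
move=> eps0.
have pos n : 0 <= n.+1%:R^-1 :> R by rewrite invr_ge0 ler0n.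
have harm : n.+1%:R^-1 @[n --> \oo] --> (0 : R) by exact: cvg_harmonic.
have A1 : \forall z \ae mu2, rho_pow_weight n.+1%:R^-1 z @[n --> \oo] --> (0 : R).
  apply: nearW => z; set x := `|r (z.2 - z.1)|.
  have up : W z * (x ^+ k.+1 * (2 * n.+1%:R^-1 * x)) @[n --> \oo] --> (0 : R).
    have E n : W z * (x ^+ k.+1 * (2 * n.+1%:R^-1 * x)) = (W z * x ^+ k.+1 * 2 * x) * n.+1%:R^-1 by ring.
    under eq_fun do rewrite E.
    by rewrite -(mulr0 (W z * x ^+ k.+1 * 2 * x)); exact: cvgMl_tmp.
  apply: (squeeze_cvgr _ (cvg_cst (0 : R)) up); apply: nearW => n.
  have /andP[-> _] := weight_le z (pos n); rewrite /rho_pow_weight -/x /=.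
  by rewrite ler_wpM2l// ler_wpM2l ?exprn_ge0 ?normr_ge0// ge_min lexx orbT.
have A2 n z : `|rho_pow_weight n.+1%:R^-1 z| <= `|W z * r (z.2 - z.1) ^+ k.+1|.
  by have /andP[w0 w1] := weight_le z (pos n); rewrite ger0_norm.
have [_] := @Rint_dominated R _ _ mu2 (fun n => rho_pow_weight n.+1%:R^-1) (cst 0)
  (fun z => `|W z * r (z.2 - z.1) ^+ k.+1|) (fun n => measurable_weight _) (measurable_cst _) A1 (integrable_norm irho) A2.
rewrite [X in _ --> X](_ : _ = 0); last by rewrite /Rintegral integral0_eq.
move=> c; have [n _ hn] := cvgr_lt (0 : R) c _ eps0.
exists n.+1%:R^-1; first by rewrite invr_gt0 ltr0n.
move=> e /andP[e0 e1]; apply: le_trans (ltW (hn n (leqnn n))).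
apply: (le_Rintegral measurableT (integrable_weight e0) (integrable_weight (pos n))) => z _.
rewrite /rho_pow_weight ler_wpM2l// ler_wpM2l ?exprn_ge0//.
by rewrite le_min ge_min lexx /= ge_min ler_wpM2r ?orbT// ler_wpM2l.
Qed.

(** One factor [|e c|] is held back. If [c] is within [|x|] of [x], that factor is at most
    [min(1, 2 e |x|)]; otherwise it is bounded by 1 and [|c| <= 2 |c - x|]. *)
Let pow_bound (e c x : R) : 0 <= e -> `|e * c| <= 1 ->
  `|e * c| ^+ k.+2 <= e ^+ k.+1 * 2 ^+ k.+1 * (`|x| ^+ k.+1 * Num.min 1 (2 * e * `|x|) + `|c - x| ^+ k.+1).
Proof.
move=> e0 ec1; have cx : `|c| <= `|x| + `|c - x| by rewrite addrC -{1}(subrK x c) ler_normD.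
have /andP[m0 m1] := min01 e0 (normr_ge0 x).
have E : `|e * c| ^+ k.+2 = e ^+ k.+1 * (`|c| ^+ k.+1 * `|e * c|).
  by rewrite exprSr normrM (ger0_norm e0) exprMn -mulrA.
rewrite E -mulrA ler_wpM2l ?exprn_ge0//.
have [le|lt] := leP `|c - x| `|x|.
  have c2 : `|c| <= 2 * `|x| by lra.
  apply: le_trans (_ : (2 * `|x|) ^+ k.+1 * Num.min 1 (2 * e * `|x|) <= _).
    apply: ler_pM; rewrite ?exprn_ge0//; first by apply: lerXn2r; rewrite ?nnegrE ?mulr_ge0.
    by rewrite le_min ec1 normrM (ger0_norm e0) -mulrA mulrCA ler_wpM2l.
  have -> y : (2 * `|x|) ^+ k.+1 * y = 2 ^+ k.+1 * (`|x| ^+ k.+1 * y) by rewrite exprMn mulrA.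
  by rewrite ler_wpM2l ?exprn_ge0// lerDl exprn_ge0.
have c2 : `|c| <= 2 * `|c - x| by lra.
apply: le_trans (_ : (2 * `|c - x|) ^+ k.+1 * 1 <= _).
  by apply: ler_pM; rewrite ?exprn_ge0//; apply: lerXn2r; rewrite ?nnegrE ?mulr_ge0.
by rewrite mulr1 exprMn ler_wpM2l ?exprn_ge0// lerDr mulr_ge0// exprn_ge0.
Qed.

(* Hermite orthogonality beyond rank [k.+1] bounds the covariance of [q] at two points by a power
   [k.+2] of the correlation, one more than the normalization consumes. *)
Lemma remainder_small (q : R -> R) : sqint nu q ->
  (forall j, (j < k.+2)%N -> \int[nu]_x (q x * (he 1 j).[x]) = 0) ->
  (forall e : R, 0 < e -> exists2 h0 : R, 0 < h0 & forall h, 0 < h <= h0 -> 0 < S h /\ h ^+ 2 / S h <= e) ->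
  forall eps : R, 0 < eps -> exists2 h0 : R, 0 < h0 & forall h, 0 < h <= h0 ->
    norm2 P (rint m (normalized_field h q)) <= eps * sc h ^+ k.+1.
Proof.
move=> sq q0 heps eps eps0; pose N := \int[nu]_x (q x ^+ 2).
have N0 : 0 <= N by exact: Rint_sqr_ge0.
(* Both parts of the bound receive [e1]; with the factors [2^(k+1)] and [N] the total is
   [(eps s)^2 N / (N + 1)], where [s] is the normalization. *)
pose e1 := eps ^+ 2 / (2 ^+ k.+2 * (N + 1)).
have N1 : 0 < N + 1 by rewrite ltr_wpDl.
have e10 : 0 < e1 by rewrite divr_gt0 ?exprn_gt0// mulr_gt0// exprn_gt0.
have [e0 e00 hw] := weight_small e10.
have [d0 d00 hd] := kernel_cov_cvg lr a0 ab lrk rev e10.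
have [h1 h10 hh] := heps _ e00.
exists (Num.min d0 h1); first by rewrite lt_min d00.
move=> h /andP[h0]; rewrite le_min => /andP[hd0 hh1].
have [Sh Se] := hh h ltac:(by rewrite h0).
have s0 : 0 < sc h by rewrite divr_gt0// sqrtr_gt0.
have sE := increment_scale_sqr Sh.
have e0' : 0 <= sc h ^+ 2 <= e0 by rewrite sqr_ge0 sE.
have /andP[ee _] := e0'.
have [iB vB] := normalized_field_le h0 Sh sq q0.
have sm := smoothing_increment S hG cG h0; have [_ _ _ kp] := sm.
have [iD vD] := hd h _ _ (ltW h0) hd0 kp kp.
have wb := hw _ e0'; have iw := integrable_weight ee.
pose Bd (z : R * R) := (sc h ^+ 2) ^+ k.+1 * 2 ^+ k.+1 *
  (rho_pow_weight (sc h ^+ 2) z + W z * `|kc h z - r (z.2 - z.1)| ^+ k.+1).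
have ibd : mu2.-integrable [set: R * R] (EFin \o Bd) by exact: mintZ (mintD iw iD).
have BB z : W z * `|sc h ^+ 2 * kc h z| ^+ k.+2 <= Bd z.
  have := kernel_cov_increment_le1 h0 Sh z; rewrite /Bd /rho_pow_weight -mulrDr.
  case: (WW z) => Wz; rewrite Wz; first by rewrite !mul0r !mulr0.
  by rewrite !mul1r; exact: pow_bound.
have key : \int[mu2]_z (W z * `|sc h ^+ 2 * kc h z| ^+ k.+2) <= (sc h ^+ 2) ^+ k.+1 * 2 ^+ k.+1 * (e1 + e1).
  apply: le_trans (le_Rintegral measurableT iB ibd (fun z _ => BB z)) _.
  rewrite /Bd RintegralZl//; last exact: mintD.
  apply: ler_wpM2l; first by rewrite mulr_ge0// exprn_ge0.
  by rewrite RintegralD//; exact: lerD.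
have T0 : 0 <= eps * sc h ^+ k.+1 by rewrite mulr_ge0 ?exprn_ge0 ?(ltW s0) ?(ltW eps0).
rewrite -[X in _ <= X](ger0_norm T0) -sqrtr_sqr /norm2 ler_wsqrtr//.
apply: le_trans vB _; apply: le_trans (ler_wpM2l N0 key) _.
have -> : (sc h ^+ 2) ^+ k.+1 = (sc h ^+ k.+1) ^+ 2 by rewrite -!exprM mulnC.
have e2 : 2 ^+ k.+2 = 2 * 2 ^+ k.+1 :> R := exprS _ _.
have p2 : 0 < 2 ^+ k.+1 :> R by rewrite exprn_gt0.
rewrite -/N /e1; move: e2 p2; move: (sc h ^+ k.+1) (2 ^+ k.+1) (2 ^+ k.+2) => s t u -> t0.
have -> : N * (s ^+ 2 * t * (eps ^+ 2 / (2 * t * (N + 1)) + eps ^+ 2 / (2 * t * (N + 1)))) =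
    (eps * s) ^+ 2 * (N / (N + 1)) by field; rewrite !gt_eqF.
by rewrite ler_piMr ?sqr_ge0// ler_pdivrMr// mul1r lerDl.
Qed.
End normalized_increments.

(** * The limit theorem *)

Section limit.
Context {R : realType} d {T : measurableType d}.
Local Notation mu := (@lebesgue_measure R).
Local Notation nu := (normal_prob (0 : R) 1).
Variables (P : probability T R) (G : R -> T -> R) (S : R -> R).
Let r := rho S.
Hypothesis hG : centered_gaussian_process P G.
Hypothesis cG : continuous_paths G.
Hypothesis hvar : increments_variance P G S.
Hypothesis lr : locint r.
Hypothesis rev : forall x, r (- x) = r x.
Hypothesis cov : forall g g' Y Y', approximable (half_open g) -> approximable (half_open g') ->
  is_gen_derivative P G S g Y -> is_gen_derivative P G S g' Y' ->
  gauss2 P Y Y' /\ \int[P]_w (Y w * Y' w) = form r (half_open g) (half_open g').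
Variables (a b : R) (k : nat).
Hypotheses (a0 : 0 <= a) (ab : a <= b).
Hypothesis lrk : locint (fun x => r x ^+ k.+1).
Hypothesis smoothed_ex : exists (g : R -> R -> R) (V : R -> R -> T -> R),
  approximate_identity g /\ is_smoothed_derivative P G S g V.
Hypothesis heps : forall e : R, 0 < e -> exists2 h0 : R, 0 < h0 &
  forall h, 0 < h <= h0 -> 0 < S h /\ h ^+ 2 / S h <= e.
Let m := itv_measure a b.
Local Notation I := (\1_(`[a, b]%classic : set R)).
Local Notation sc := (increment_scale S).
Local Notation J := (fun h => wick_integral P a b k (increment_quotient G h)).
Local Notation Z := (wick_chaos P G S k.+1 I).
Local Notation H1 := (horner (he 1 k.+1)).
Let sp (p : {poly R}) : sqint nu (horner p) := sqint_horner normal_expint p.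

Lemma norm2_ae_le (X Y : T -> R) : sqint P X -> sqint P Y ->
  (\forall w \ae P, X w = Y w) -> norm2 P X = norm2 P Y.
Proof.
move=> sX sY XY; congr Num.sqrt; rewrite /Rintegral; congr fine.
apply: ae_eq_integral => //.
- exact: measurable_int sX.2.
- exact: measurable_int sY.2.
- by apply: filterS XY => w /= -> _.
Qed.

Section fixed_increment.
Variables (h : R) (h0 : 0 < h) (Sh : 0 < S h).
Variables (f : R -> R) (sf : sqint nu f).
Local Notation D := (normalized_field G S a b h).

Let mD phi w : sqint nu phi -> measurable_fun [set: R] (fun x => D phi (x, w)).
Proof.
move=> s; exact: (measurableT_comp (measurable_normalized_field S hG cG a b h0 s) (@measurable_pair2 _ _ _ _ w)).
Qed.

Lemma Rint_normalized_increment w :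
  \int[mu]_(x in `[a, b]) f ((G (x + h) w - G x w) / Num.sqrt (S h)) = rint m (D f) w.
Proof.
rewrite /rint (@Rint_itv_measure R a b _ (mD w sf)) Rint_in; apply: eq_Rintegral => x _.
rewrite normalized_fieldE// indicE; case: (_ \in _); by rewrite ?mulr1 ?mul0r ?mulr0 ?mul1r.
Qed.

(** Linearity of the integral in [x], valid only for almost every [w]: the integrands are square
    integrable on the product space, so their sections are integrable almost surely. *)
Lemma rint_expansion (c0 c1 : R) : \forall w \ae P,
  rint m (D f) w = (b - a) * c0 + c1 * (sc h ^+ k.+1 * J h w)
    + rint m (D (fun x => f x - c0 - c1 * H1 x)) w.
Proof.
have sq : sqint nu (fun x => f x - c0 - c1 * H1 x).
  by apply: sqintB; [apply: sqintB => //; exact: sqint_cst|apply: sqintZ; exact: sp].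
have [_ i1] := normalized_field_integrable hG cG hvar cov b a0 h0 Sh (sp (he 1 k.+1)).
have [_ i2] := normalized_field_integrable hG cG hvar cov b a0 h0 Sh sq.
apply: filterS2 i1 i2 => w i1 i2.
have E x : D f (x, w) = c0 * I x + c1 * D H1 (x, w) + D (fun x => f x - c0 - c1 * H1 x) (x, w).
  by rewrite !normalized_fieldE//; ring.
have mI : measurable_fun [set: R] (I : R -> R) by exact: measurable_indic.
have iI : m.-integrable [set: measurableTypeR R] (EFin \o (I : R -> R)).
  apply: (@le_integrableT R _ (measurableTypeR R) m _ (cst 1)).
  - exact: mI.
  - by move=> x /=; rewrite normr_indic normr1 indic_le1.
  - exact: mint_cst.
have mab : measurable (`[a, b]%classic : set (measurableTypeR R)) by exact: measurable_itv.
have vI : \int[m]_x (I x : R) = b - a.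
  rewrite (@Rint_itv_measure R a b _ mI).
  rewrite (_ : \int[mu]_x _ = \int[mu]_(x in `[a, b]) cst 1 x); last first.
    rewrite [RHS]Rint_in; apply: eq_Rintegral => x _.
    by rewrite !indicE; case: (_ \in _); rewrite /= ?mulr1 ?mulr0.
  have := @Rintegral_cst _ (measurableTypeR R) R mu `[a, b]%classic mab 1.
  rewrite /= => ->; rewrite mul1r lebesgue_measure_itv/= lte_fin.
  by case: ifPn => //=; rewrite -leNgt => ba; rewrite (le_anti (introT andP (conj ab ba))) subrr.
rewrite -(wick_integral_normalized hG cG hvar cov a0 h0 Sh i1).
have -> : (b - a) * c0 = \int[m]_x (c0 * I x) by rewrite RintegralZl// vI mulrC.
have -> : c1 * rint (itv_measure a b) (D H1) w = \int[m]_x (c1 * D H1 (x, w)) by rewrite RintegralZl.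
rewrite /rint -RintegralD//; [|exact: mintZ..].
rewrite -RintegralD//; last by apply: mintD; exact: mintZ.
by apply: eq_Rintegral => x _; exact: E.
Qed.
End fixed_increment.

Variables (f : R -> R) (sf : sqint nu f) (c0 c1 : R).
Hypothesis f_orth : forall j, (j < k.+2)%N ->
  \int[nu]_x ((f x - c0 - c1 * H1 x) * (he 1 j).[x]) = 0.

Lemma normalized_integral_cvg : cvg_L2 P (0 : R)^'+
  (fun h w => (\int[mu]_(x in `[a, b]) f ((G (x + h) w - G x w) / Num.sqrt (S h)) - (b - a) * c0)
     / sc h ^+ k.+1)
  (fun w => c1 * Z w).
Proof.
pose q x := f x - c0 - c1 * H1 x.
have sq : sqint nu q by apply: sqintB; [apply: sqintB => //; exact: sqint_cst|apply: sqintZ; exact: sp].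
have [sZ hZ] := wick_chaos_limit hG cG lr rev cov a0 ab lrk smoothed_ex.
have near1 (e : R) : 0 < e -> \forall h \near (0 : R)^'+, 0 < h <= e.
  by move=> e0; near=> h; apply/andP; split; near: h; [exact: nbhs_right_gt|exact: nbhs_right_le].
pose A h w := (\int[mu]_(x in `[a, b]) f ((G (x + h) w - G x w) / Num.sqrt (S h)) - (b - a) * c0) / sc h ^+ k.+1.
have [h1 h10 hh1] := heps ltr01.
have sA h : 0 < h -> 0 < S h -> sqint P (A h).
  move=> h0 Sh; rewrite /A.
  have [s _] := normalized_field_integrable hG cG hvar cov b a0 h0 Sh sf.
  have := sqintZ (sc h ^+ k.+1)^-1 (sqintB s (sqint_cst P ((b - a) * c0))).
  by congr sqint; apply/funext => w; rewrite mulrC (Rint_normalized_increment h0 sf).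
apply/(cvg_L2P (X := A)).
  apply: filterS (near1 _ h10) => h /[dup]/andP[h0 _] /hh1[Sh _].
  by apply: sqintB; [exact: sA|exact: sqintZ].
apply/cvgrPdist_le => eps eps0.
have e1 : 0 < eps / 2 by rewrite divr_gt0.
have e2 : 0 < eps / 2 / (`|c1| + 1) by rewrite divr_gt0// ltr_wpDl.
have [d1 d10 hd1] := hZ _ e2.
have [d2 d20 hd2] := remainder_small hG cG hvar lr rev cov a0 ab lrk sq f_orth heps e1.
have := near1 (Num.min h1 (Num.min d1 d2)); rewrite !lt_min h10 d10 d20 => /(_ isT).
apply: filterS => h; rewrite !le_min => /andP[h0 /andP[hh /andP[hd hd']]].
have [Sh _] := hh1 h ltac:(by rewrite h0).
have {}hd1 := hd1 h ltac:(by rewrite h0); have {}hd2 := hd2 h ltac:(by rewrite h0).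
rewrite sub0r normrN ger0_norm ?sqrtr_ge0//.
have s0 : 0 < sc h ^+ k.+1 by rewrite exprn_gt0// divr_gt0// sqrtr_gt0.
have sJ : sqint P (J h) := sqint_wick_integral lr cov k a0 ab (smoothing_increment S hG cG h0).
have [sR _] := normalized_field_integrable hG cG hvar cov b a0 h0 Sh sq.
(* Almost surely the error is the convergence error of the Wick integrals, times [c1], plus the
   remainder divided by the normalization. *)
pose B w := c1 * (J h w - Z w) + (sc h ^+ k.+1)^-1 * rint m (normalized_field G S a b h q) w.
have sJZ := sqintB sJ sZ.
have sB : sqint P B by apply: sqintD; exact: sqintZ.
rewrite (norm2_ae_le (Y := B) _ sB); first last.
- apply: filterS (rint_expansion h0 Sh sf c0 c1) => w E.
  by rewrite /A /B (Rint_normalized_increment h0 sf) E -/q; field; rewrite gt_eqF.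
- by apply: sqintB; [exact: sA|exact: sqintZ].
apply: le_trans (norm2D (sqintZ _ sJZ) (sqintZ _ sR)) _.
rewrite !norm2Z//.
have b1 : `|c1| * norm2 P (fun w => J h w - Z w) <= eps / 2.
  apply: le_trans (ler_wpM2l (normr_ge0 c1) hd1) _.
  by rewrite mulrCA ler_piMr ?(ltW e1)// ler_pdivrMr ?ltr_wpDl// mul1r lerDl.
have b2 : `|(sc h ^+ k.+1)^-1| * norm2 P (rint m (normalized_field G S a b h q)) <= eps / 2.
  by rewrite gtr0_norm ?invr_gt0// ler_pdivrMl// mulrC.
lra.
Unshelve. all: by end_near.
Qed.
End limit.

Section hermite_coefficients.
Context {R : realType} d {T : measurableType d} (Q : probability T R).
Local Notation nu := (normal_prob (0 : R) 1).
Variables (H : nat -> {poly R}) (eta : T -> R) (f : R -> R).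
Hypotheses (hH : orthonormal_hermite H) (heta : standard_normal Q eta) (sf : sqint nu f).
Let sp (p : {poly R}) : sqint nu (horner p) := sqint_horner normal_expint p.
Local Notation coef := (hermite_coef Q eta H f).

Lemma expectation_normal : fine 'E_Q[f \o eta]%E = \int[nu]_x f x.
Proof.
by rewrite -(law_Rint heta.1 heta.2 sf.1) unlock /Rintegral.
Qed.

Lemma he_coef j : \int[nu]_x (f x * (he 1 j).[x]) = Num.sqrt j`!%:R * coef j.
Proof.
have s0 : Num.sqrt j`!%:R != 0 :> R by rewrite gt_eqF// sqrtr_gt0 ltr0n fact_gt0.
have mh : measurable_fun [set: R] (fun x => (H j).[x] * f x).
  by apply: measurable_funM; [exact: (sp (H j)).1|exact: sf.1].
have -> : coef j = \int[nu]_x ((H j).[x] * f x).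
  by rewrite -(law_Rint heta.1 heta.2 mh) /hermite_coef unlock.
rewrite -RintegralZl//; last exact: (sqintM (sp (H j)) sf).
apply: eq_Rintegral => x _; rewrite (orthonormal_hermiteE j hH) hornerZ.
by rewrite mulrA mulrA mulfV// mul1r mulrC.
Qed.

(** Degree 0 is cancelled by the mean, degree [k+1] by the leading coefficient, and the degrees
    between vanish by definition of the rank. The [Num.sqrt] comes from passing from orthonormal to
    monic polynomials. *)
Lemma hermite_rank_orthogonal k : hermite_rank Q eta H f k.+1 -> forall j, (j < k.+2)%N ->
  \int[nu]_x ((f x - fine 'E_Q[f \o eta]%E - coef k.+1 / Num.sqrt (k.+1)`!%:R * (he 1 k.+1).[x]) * (he 1 j).[x]) = 0.
Proof.
move=> [_ _ hk] j jk; rewrite expectation_normal; set c0 := \int[nu]_x f x; set c1 := coef k.+1 / _.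
have i1 := sqintM sf (sp (he 1 j)); have i2 := sqint_mint (sp (he 1 j)).
have i3 := normal_mint_poly (he 1 k.+1) (he 1 j).
have e0 (x : R) : (he 1 0).[x] = 1 by rewrite he0 hornerE.
have -> : \int[nu]_x ((f x - c0 - c1 * (he 1 k.+1).[x]) * (he 1 j).[x]) =
    \int[nu]_x (f x * (he 1 j).[x]) - c0 * \int[nu]_x (he 1 j).[x]
      - c1 * \int[nu]_x ((he 1 k.+1).[x] * (he 1 j).[x]).
  rewrite -RintegralZl// -RintegralZl// -RintegralB//; last exact: mintZ.
  rewrite -RintegralB//; [|by apply: mintB => //; exact: mintZ|exact: mintZ].
  by apply: eq_Rintegral => x _; ring.
have E0 : \int[nu]_x (he 1 j).[x] = (j == 0)%:R.
  rewrite (_ : (j == 0)%:R = (j == 0)%:R * j`!%:R :> R); last by case: j {jk i1 i2 i3} => [|j]; rewrite ?mul0r ?fact0 ?mulr1.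
  by rewrite -he_normal; apply: eq_Rintegral => x _; rewrite e0 mulr1.
rewrite E0 he_normal.
have [->|j0] := eqVneq j 0%N.
  rewrite mul0r mulr0 subr0 mulr1; apply/eqP; rewrite subr_eq0; apply/eqP.
  by apply: eq_Rintegral => x _; rewrite e0 mulr1.
rewrite mulr0 subr0 he_coef.
have [<-|jk1] := eqVneq k.+1 j.
  have f0 : 0 <= (k.+1)`!%:R :> R by rewrite ler0n.
  have s0 : Num.sqrt (k.+1)`!%:R != 0 :> R by rewrite gt_eqF// sqrtr_gt0 ltr0n fact_gt0.
  by rewrite mul1r /c1 -{3}(sqr_sqrtr f0) expr2 mulrA divfK// mulrC subrr.
rewrite mul0r mulr0 subr0 hk ?mulr0// lt0n j0 /=.
by move: jk; rewrite ltnS leq_eqVlt eq_sym (negbTE jk1).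
Qed.
End hermite_coefficients.

Section increment_variance.
Context {R : realType}.
Local Notation mu := (@lebesgue_measure R).
Variables (S : R -> R) (k : nat).
Hypothesis dS : forall s : R, s != 0 -> derivable S s 1 /\ derivable (derive1 S) s 1.
Let g : R -> R := derive1n 2 S.
Let mg : measurable_fun [set: R] g. Proof. exact: (measurable_derive2_off0 dS). Qed.

Hypothesis hloc : locally_integrable setT (fun s => g s ^+ k.+1).

Lemma locint_derive2_pow : locint (fun s => g s ^+ k.+1).
Proof.
have mgk : measurable_fun [set: R] (fun s => g s ^+ k.+1) by exact: measurable_funX.
split=> // M; have [_ _ h] := hloc; apply/integrableP; split.
  by apply/measurable_EFinP; exact: (@measurable_funS _ _ (measurableTypeR R) _ setT).
by apply: h => //; exact: segment_compact.
Qed.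

(** On bounded sets [|g| <= 1 + |g|^(k+1)], so local integrability of the power is enough. *)
Lemma locint_derive2 : locint g.
Proof.
split=> // M.
have lk := locint_cut (- M) M locint_derive2_pow.
have mM : measurable (`[- M, M]%classic : set (measurableTypeR R)) by exact: measurable_itv.
apply/(@mint_in R _ (measurableTypeR R) mu `[- M, M]%classic g) => //.
pose I := (\1_(`[- M, M]%classic : set R) : R -> R).
have mI : measurable_fun [set: R] I by exact: measurable_indic.
have i1 : mu.-integrable [set: R] (EFin \o I).
  have := @mint_itv_bounded R (- M) M 1 (cst 1) (measurable_cst _) _.
  move=> /(_ (fun x _ => _)).
  by rewrite /I; under eq_fun do rewrite /= mulr1; apply=> x; rewrite normr1.
have mIg : measurable_fun [set: R] (fun x => I x * g x) by exact: measurable_funM.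
apply: (@le_integrableT R _ _ mu _ _ mIg _ (mintD i1 (integrable_norm lk))) => x.
rewrite -/(I x); have I0 : 0 <= I x by rewrite /I indicE ler0n.
rewrite /= [X in _ <= X]ger0_norm ?addr_ge0// !normrM (ger0_norm I0) -[X in X + _]mulr1 -mulrDr ler_wpM2l// normrX.
have [g1|g1] := leP `|g x| 1; first by rewrite (le_trans g1)// lerDl exprn_ge0.
by rewrite -[leLHS]add0r lerD// exprS ler_peMr ?normr_ge0// exprn_ege1// ltW.
Qed.

Lemma locintZ (c : R) (psi : R -> R) : locint psi -> locint (fun x => c * psi x).
Proof.
move=> [m i]; split; first by apply: measurable_funM => //; exact: measurable_cst.
move=> M; have mM : measurable (`[- M, M]%classic : set (measurableTypeR R)) by exact: measurable_itv.
exact: (integrableZl mM c (i M)).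
Qed.

Lemma locint_rho : locint (rho S). Proof. exact: locintZ locint_derive2. Qed.

Lemma locint_rho_pow : locint (fun x => rho S x ^+ k.+1).
Proof.
rewrite (_ : (fun x => _) = (fun x => 2^-1 ^+ k.+1 * g x ^+ k.+1)); last by apply/funext => x; rewrite /rho exprMn.
exact: locintZ locint_derive2_pow.
Qed.

(** Positivity near 0 comes from regular variation at [lambda = 1]: the quotient [S h / S h] tends
    to 1, whereas it would be 0 wherever [S h = 0], division by 0 giving 0. *)
Lemma variance_scale beta : (forall h, 0 <= S h) -> regularly_varying0 beta S ->
  h ^+ 2 / S h @[h --> 0^'] --> (0 : R) ->
  forall e : R, 0 < e -> exists2 h0 : R, 0 < h0 & forall h, 0 < h <= h0 -> 0 < S h /\ h ^+ 2 / S h <= e.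
Proof.
move=> S0 /(_ 1 ltr01); rewrite powR1 => c1 /cvg_dnbhs_at_right c2 e e0.
have near2 : \forall h \near (0 : R)^'+, 0 < S (1 * h) / S h /\ h ^+ 2 / S h < e.
  near=> h; split; near: h; first exact: (cvgr_gt (1 : R) c1 _ ltr01).
  exact: (cvgr_lt (0 : R) c2 _ e0).
case: near2 => c c0 hc; exists (c / 2); first by rewrite divr_gt0.
move=> h /andP[h0 hc2]; have [] := hc h _ h0.
  by rewrite /ball_/= sub0r normrN gtr0_norm// (le_lt_trans hc2)// ltr_pdivrMr// ltr_pMr// ltr1n.
rewrite mul1r => q1 q2; split; last exact: ltW.
rewrite lt_neqAle S0 andbT; apply/eqP => Sh; by move: q1; rewrite -Sh mul0r ltxx.
Unshelve. all: by end_near.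
Qed.
End increment_variance.

Section variance_function.
Context {R : realType} d {T : measurableType d} (P : probability T R).
Variables (G : R -> T -> R) (S : R -> R).
Hypothesis hvar : increments_variance P G S.

Lemma increments_variance_norm t : S t = S `|t|.
Proof.
have [t0|t0] := leP 0 t; first by rewrite ger0_norm.
by have [_] := @hvar 0 (- t) (lexx 0) ltac:(by rewrite oppr_ge0 ltW); rewrite opprK add0r.
Qed.

Lemma increments_variance_even t : S (- t) = S t.
Proof. by rewrite [LHS]increments_variance_norm normrN -increments_variance_norm. Qed.

Lemma increments_variance_ge0 t : 0 <= S t.
Proof.
rewrite increments_variance_norm; have [] := @hvar `|t| 0 (normr_ge0 t) (lexx 0).
rewrite subr0 => E _; rewrite -lee_fin -E; apply: expectation_ge0 => w; exact: sqr_ge0.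
Qed.

Lemma increments_variance0 : S 0 = 0.
Proof.
have [] := @hvar 0 0 (lexx 0) (lexx 0); rewrite subrr => E _.
move: E; under eq_fun do rewrite subrr expr0n.
by rewrite expectation_cst => -[].
Qed.
End variance_function.

Theorem corollary1p1 (R : realType)
    (d : measure_display) (T : measurableType d) (P : probability T R)
    (d' : measure_display) (T' : measurableType d') (Q : probability T' R)
    (H : nat -> {poly R}) (eta : T' -> R) (f : R -> R) (k0 : nat)
    (G : R -> T -> R) (sigma2 : R -> R) (beta C : R)
    (hH : orthonormal_hermite H)
    (heta : standard_normal Q eta)
    (hf : f \in Lfun (normal_prob 0 1) 2%:E)
    (hk0 : hermite_rank Q eta H f k0)
    (hG : centered_gaussian_process P G)
    (hG0 : forall w, G 0 w = 0)
    (hGstat : stationary_increments P G)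
    (hGcont : continuous_paths G)
    (hsigma2 : increments_variance P G sigma2)
    (hsigma2_neq0 : exists h, sigma2 h != 0)
    (hbeta : 1 <= beta <= 2)
    (hi : regularly_varying0 beta sigma2)
    (hii1 : h ^+ 2 / sigma2 h @[h --> 0^'] --> (0 : R))
    (hii2 : sigma2 h / h @[h --> 0^'] --> (0 : R))
    (hiii : forall s h : R, 0 < s -> 0 < h -> h <= s / 8 ->
      `|sigma2 (s + h) + sigma2 (s - h) - 2 * sigma2 s| / h ^+ 2
        <= C * (sigma2 s / s ^+ 2))
    (hiv : forall s : R, s != 0 ->
      derivable sigma2 s 1 /\ derivable (derive1 sigma2) s 1)
    (hloc : locally_integrable setT (fun s => (derive1n 2 sigma2 s) ^+ k0))
    (hlo : (fun h : R => h : R^o)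
             =o_ ((0 : R)^'+) (fun h : R => (h ^+ 2 / sigma2 h) ^+ k0 : R^o))
    (a b : R) (ha : 0 <= a) (hab : a <= b) :
  let sigma h := Num.sqrt (sigma2 h) in
  cvg_L2 P (0 : R)^'+
    (fun h w =>
      ((\int[@lebesgue_measure R]_(x in `[a, b])
          f ((G (x + h) w - G x w) / sigma h))
       - (b - a) * fine 'E_Q[f \o eta]%E) / (h / sigma h) ^+ k0)
    (fun w => hermite_coef Q eta H f k0 / Num.sqrt (k0`!%:R)
              * wick_chaos P G sigma2 k0 \1_(`[a, b]) w).
Proof.
(* The rank is at least 1, so it is written [k+1], the form of the exponent in all the estimates. *)
move=> sigma; case: k0 hk0 hloc hlo => [[]//|k] hk hloc _.
have S0 := increments_variance0 hsigma2; have Sev := increments_variance_even hsigma2.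
have Sge0 := increments_variance_ge0 hsigma2.
have lr := locint_rho hiv hloc; have lrk := locint_rho_pow hiv hloc.
have ld := (locint_derive2 hiv hloc).2.
have rev x : rho sigma2 (- x) = rho sigma2 x.
  by rewrite /rho (derive2_even S0 Sev hiv hii2).
(* Half the first derivative, with the value 0 at 0: the antiderivative of [rho] on the whole
   line. *)
pose F x := 2^-1 * derive1 sigma2 x.
have dF (x : R) : is_derive x 1 (fun x => 2^-1 * sigma2 x) (F x).
  exact: (is_deriveZ 2^-1 (is_derive_all S0 hiv hii2 x)).
have cF : continuous F.
  have c := continuous_derive1 S0 Sev Sge0 hiv hii2 hiii ld.
  by move=> x; apply: cvgMl_tmp; exact: c.
have ftc (u v : R) : u <= v ->
    \int[@lebesgue_measure R]_(x in `]u, v]) rho sigma2 x = F v - F u.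
  move=> uv; rewrite /F -mulrBr -(derive1_ftc S0 Sev Sge0 hiv hii2 hiii ld uv).
  have mD : measurable (`]u, v]%classic : set (measurableTypeR R)) by exact: measurable_itv.
  have iD := locint_sub (locint_derive2 hiv hloc) mD (@subset_itv_oc_cc _ _ u v).
  exact: (RintegralZl (mu := @lebesgue_measure R) _ mD iD).
have cov := gen_derivative_cov hG hsigma2 Sev lr rev ftc cF dF.
have ex := smoothed_derivative_exists hG hGcont hsigma2 Sev lr rev ftc cF dF.
have heps := variance_scale Sge0 hi hii1.
have sf : sqint (normal_prob 0 1) f by exact/(Lfun2P (normal_prob 0 1)).
exact: (normalized_integral_cvg hG hGcont hsigma2 lr rev cov ha hab lrk ex heps sf
  (hermite_rank_orthogonal hH heta sf hk)).
Qed.
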